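(* Let $n\ge 2$. A real-valued function $F$ on a complex manifold $M$ of complex dimension $n$ is a Kähler potential of a Bochner--Kähler structure in a neighbourhood of a point $p\in M$ if and only if $$\begin{bmatrix} 0& z^* & \frac{\mathrm{i}}{2} \end{bmatrix} \,\mathrm{e}^{2\mathrm{i} AF}\begin{bmatrix} 1\\ z\\ 0 \end{bmatrix}=0$$ in some coordinates $z=(z_1,\ldots,z_n)$ centered at $p$, for some matrix $A\in \mathfrak{gl}_{n+2}(\mathbb{C})$ of the form $$A=\begin{bmatrix} 0& -2\mathrm{i} a^* & r\\0&\mathrm{i} X& a\\1&0&0 \end{bmatrix},$$ where (i) $X\in \mathfrak{gl}_{n}(\mathbb{R})$ is diagonal with entries ordered such that $X_{j,j}\geq X_{j+1,j+1}$, (ii) $a$ is a vector with non-negative real entries satisfying $a_{j+1}=0$ whenever $X_{j,j}=X_{j+1,j+1}$, and (iii) $r$ is a real number. Moreover, such a matrix $A$ is uniquely determined by the germ at $p$ of the Bochner--Kähler structure being represented.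
   Context: Here $^*$ denotes conjugate transpose, $z$ and $a$ are treated as column vectors of length $n$, $\mathrm{e}^{2\mathrm{i}AF}$ is the matrix exponential of the matrix $2\mathrm{i}F(z)A$, and the block sizes of rows and columns are $1,n,1$. The coordinates $z$ are local holomorphic coordinates on $M$. A function $F$ is a Kähler potential of a Kähler structure if the Kähler form is $\omega=\tfrac{\mathrm{i}}{2}\partial\bar\partial F$, so that the metric tensor is $G_{m\bar n}=\frac{\partial^2F}{\partial z_m\partial \bar z_n}$. The Riemann curvature of a Kähler manifold splits into a Ricci part and a traceless part, the Bochner curvature. A Bochner--Kähler structure is a Kähler structure with vanishing Bochner curvature.
   Formalization: F is taken smooth near p; the equation is required of F−h for some pluriharmonic h rather than of F itself, and the function satisfying the equation must vanish at p (also in the uniqueness clause), as potentials are unique only up to pluriharmonic terms and other branches can be negative definite. *)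

(* Defs.v *)
From HB Require Import structures.
From mathcomp Require Import all_boot all_order all_algebra.
From mathcomp Require Import complex.
From mathcomp Require Import all_classical all_reals all_analysis.

Set Implicit Arguments.
Unset Strict Implicit.
Unset Printing Implicit Defensive.

Import Order.TTheory GRing.Theory Num.Theory numFieldNormedType.Exports.

Local Open Scope classical_set_scope.
Local Open Scope ring_scope.

(* R[i], packaged so that it inherits the norm topology which the analysis
   library attaches to every numClosedFieldType. *)
Definition Cplx (R : realType) : numClosedFieldType := R[i].

Definition toC (R : realType) (x : R) : Cplx R := real_complex R x.

Definition conjT (R : realType) (m n : nat) (B : 'M[Cplx R]_(m, n)) :
    'M[Cplx R]_(n, m) :=
  map_mx Num.conj B^T.

Definition expmx (R : realType) (m : nat) (B : 'M[Cplx R]_m) : 'M[Cplx R]_m :=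
  limn (series (fun k : nat => (k`!%:R)^-1 *: B ^+ k)).

(** * Differential calculus on C^n *)

(* Complex-valued functions on C^n are differentiated along real lines
   t |-> z + t v, so these are derivatives for the underlying real structure;
   smoothness and the Wirtinger derivatives are built on them. *)
Definition rderivable (R : realType) (n : nat) (f : 'cV[Cplx R]_n -> Cplx R)
    (v z : 'cV[Cplx R]_n) : Prop :=
  derivable (fun t : R => complex.Re (f (z + toC t *: v))) 0 1 /\
  derivable (fun t : R => complex.Im (f (z + toC t *: v))) 0 1.

Definition rderive (R : realType) (n : nat) (f : 'cV[Cplx R]_n -> Cplx R)
    (v z : 'cV[Cplx R]_n) : Cplx R :=
  toC (derive1 (fun t : R => complex.Re (f (z + toC t *: v))) 0) +
  'i * toC (derive1 (fun t : R => complex.Im (f (z + toC t *: v))) 0).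

Fixpoint Ck (R : realType) (n k : nat) (U : set 'cV[Cplx R]_n)
    (f : 'cV[Cplx R]_n -> Cplx R) : Prop :=
  (forall z, U z -> {for z, continuous f}) /\
  match k with
  | 0%N => True
  | k'.+1 => forall v, (forall z, U z -> rderivable f v z) /\
                       Ck k' U (rderive f v)
  end.

(* Only used for open U. *)
Definition smooth_on (R : realType) (n : nat) (U : set 'cV[Cplx R]_n)
    (f : 'cV[Cplx R]_n -> Cplx R) : Prop :=
  forall k, Ck k U f.

Definition cbasis (R : realType) (n : nat) (k : 'I_n) : 'cV[Cplx R]_n :=
  delta_mx k 0.

(* d/dz_k = (d/dx_k - i d/dy_k) / 2 and d/dzbar_k = (d/dx_k + i d/dy_k) / 2. *)
Definition dz (R : realType) (n : nat) (k : 'I_n)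
    (f : 'cV[Cplx R]_n -> Cplx R) (z : 'cV[Cplx R]_n) : Cplx R :=
  2^-1 * (rderive f (cbasis R k) z - 'i * rderive f ('i *: cbasis R k) z).

Definition dzbar (R : realType) (n : nat) (k : 'I_n)
    (f : 'cV[Cplx R]_n -> Cplx R) (z : 'cV[Cplx R]_n) : Cplx R :=
  2^-1 * (rderive f (cbasis R k) z + 'i * rderive f ('i *: cbasis R k) z).

Definition holomorphic_on (R : realType) (n : nat) (U : set 'cV[Cplx R]_n)
    (f : 'cV[Cplx R]_n -> 'cV[Cplx R]_n) : Prop :=
  forall j : 'I_n,
    smooth_on U (fun z => f z j 0) /\
    forall (k : 'I_n) z, U z -> dzbar k (fun w => f w j 0) z = 0.

Definition jacobian (R : realType) (n : nat)
    (f : 'cV[Cplx R]_n -> 'cV[Cplx R]_n) (z : 'cV[Cplx R]_n) : 'M[Cplx R]_n :=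
  \matrix_(k, m) dz m (fun w => f w k 0) z.

Definition ddbar (R : realType) (n : nat) (f : 'cV[Cplx R]_n -> Cplx R)
    (z : 'cV[Cplx R]_n) : 'M[Cplx R]_n :=
  \matrix_(j, k) dz j (dzbar k f) z.

(** * Complex manifolds *)

Record chart (R : realType) (n : nat) (T : topologicalType) := Chart {
  cdom : set T ;
  cimg : set 'cV[Cplx R]_n ;
  cmap : T -> 'cV[Cplx R]_n ;
  cinv : 'cV[Cplx R]_n -> T ;
  cdom_open : open cdom ;
  cimg_open : open cimg ;
  cmap_img : forall q, cdom q -> cimg (cmap q) ;
  cinv_dom : forall z, cimg z -> cdom (cinv z) ;
  cmapK : forall q, cdom q -> cinv (cmap q) = q ;
  cinvK : forall z, cimg z -> cmap (cinv z) = z ;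
  cmap_continuous : forall q, cdom q -> {for q, continuous cmap} ;
  cinv_continuous : forall z, cimg z -> {for z, continuous cinv}
}.

(* The part of the image of the chart c that corresponds to U. *)
Definition in_chart (R : realType) (n : nat) (T : topologicalType)
    (U : set T) (c : chart R n T) : set 'cV[Cplx R]_n :=
  [set z | cimg c z /\ U (cinv c z)].

Definition transition (R : realType) (n : nat) (T : topologicalType)
    (c d : chart R n T) (z : 'cV[Cplx R]_n) : 'cV[Cplx R]_n :=
  cmap d (cinv c z).

Definition compatible (R : realType) (n : nat) (T : topologicalType)
    (c d : chart R n T) : Prop :=
  holomorphic_on (in_chart (cdom d) c) (transition c d) /\
  holomorphic_on (in_chart (cdom c) d) (transition d c).

Record complexManifold (R : realType) (n : nat) := ComplexManifold {
  cm_space :> topologicalType ;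
  cm_hausdorff : hausdorff_space cm_space ;
  cm_second_countable : @second_countable cm_space ;
  cm_atlas : set (chart R n cm_space) ;
  cm_cover : forall q : cm_space, exists2 c, cm_atlas c & cdom c q ;
  cm_compatible : forall c d, cm_atlas c -> cm_atlas d -> compatible c d
}.

(* Local holomorphic coordinates: members of the maximal atlas. *)
Definition holo_chart (R : realType) (n : nat) (M : complexManifold R n)
    (c : chart R n M) : Prop :=
  forall d, cm_atlas d -> compatible c d.

Definition in_coords (R : realType) (n : nat) (T : topologicalType)
    (c : chart R n T) (F : T -> R) (z : 'cV[Cplx R]_n) : Cplx R :=
  toC (F (cinv c z)).

Definition smooth_function (R : realType) (n : nat) (M : complexManifold R n)
    (U : set M) (F : M -> R) : Prop :=
  forall c, holo_chart c -> smooth_on (in_chart U c) (in_coords c F).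

Definition smooth_near (R : realType) (n : nat) (M : complexManifold R n)
    (p : M) (F : M -> R) : Prop :=
  exists2 U : set M, open_nbhs p U & smooth_function U F.

(* The indeterminacy of Kaehler potentials: two functions are potentials of the
   same metric exactly when they differ by a pluriharmonic function. *)
Definition pluriharmonic_near (R : realType) (n : nat)
    (M : complexManifold R n) (p : M) (h : M -> R) : Prop :=
  exists U : set M, [/\ open_nbhs p U, smooth_function U h &
    forall c, holo_chart c -> forall z, in_chart U c z ->
      ddbar (in_coords c h) z = 0].

(** * Bochner-Kaehler structures *)

(* A metric tensor is given by its matrix in every holomorphic chart:
   g c z j k is the coefficient G_{j kbar} at z in the coordinates c. *)
Definition metric_field (R : realType) (n : nat) (M : complexManifold R n) :=
  chart R n M -> 'cV[Cplx R]_n -> 'M[Cplx R]_n.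

(* The field [kahler_closed] says that the form (i/2) G_{j kbar} dz_j dzbar_k
   is closed; its (1,2)-part follows from the hermitian symmetry. *)
Record is_kahler (R : realType) (n : nat) (M : complexManifold R n)
    (U : set M) (g : metric_field M) : Prop := IsKahler {
  kahler_smooth : forall c, holo_chart c -> forall j k,
    smooth_on (in_chart U c) (fun z => g c z j k) ;
  kahler_herm : forall c, holo_chart c -> forall z, in_chart U c z ->
    conjT (g c z) = g c z ;
  kahler_pos : forall c, holo_chart c -> forall z, in_chart U c z ->
    forall v : 'cV[Cplx R]_n, v != 0 ->
      0 < (v^T *m g c z *m map_mx Num.conj v) 0 0 ;
  kahler_closed : forall c, holo_chart c -> forall z, in_chart U c z ->
    forall j k l, dz l (fun w => g c w j k) z = dz j (fun w => g c w l k) z ;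
  kahler_tensor : forall c d, holo_chart c -> holo_chart d ->
    forall z, in_chart (U `&` cdom d) c z ->
      g c z = (jacobian (transition c d) z)^T *m g d (transition c d z)
              *m map_mx Num.conj (jacobian (transition c d) z)
}.

Section Curvature.
Context (R : realType) (n : nat) (G : 'cV[Cplx R]_n -> 'M[Cplx R]_n).
Implicit Types (z : 'cV[Cplx R]_n) (i j k l : 'I_n).

(* The inverse metric G^{p qbar} is the (q, p) entry of the inverse matrix. *)
Definition inv_metric z (p q : 'I_n) : Cplx R := invmx (G z) q p.

(* R_{i jbar k lbar} *)
Definition riemann z i j k l : Cplx R :=
  - dz k (dzbar l (fun w => G w i j)) z +
  \sum_p \sum_q inv_metric z p q * dz k (fun w => G w i q) z
                                 * dzbar l (fun w => G w p j) z.

Definition ricci z k l : Cplx R :=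
  \sum_i \sum_j inv_metric z i j * riemann z i j k l.

Definition scalar_curvature z : Cplx R :=
  \sum_k \sum_l inv_metric z k l * ricci z k l.

(* The totally trace-free part of the curvature tensor. *)
Definition bochner z i j k l : Cplx R :=
  riemann z i j k l
  - (G z i j * ricci z k l + G z k j * ricci z i l
     + G z i l * ricci z k j + G z k l * ricci z i j) / n.+2%:R
  + scalar_curvature z * (G z i j * G z k l + G z i l * G z k j)
    / (n.+1%:R * n.+2%:R).

End Curvature.

Definition bochner_kahler (R : realType) (n : nat) (M : complexManifold R n)
    (U : set M) (g : metric_field M) : Prop :=
  is_kahler U g /\
  forall c, holo_chart c -> forall z, in_chart U c z ->
    forall i j k l, bochner (g c) z i j k l = 0.

Definition kahler_potential (R : realType) (n : nat) (M : complexManifold R n)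
    (U : set M) (g : metric_field M) (F : M -> R) : Prop :=
  smooth_function U F /\
  forall c, holo_chart c -> forall z, in_chart U c z ->
    g c z = ddbar (in_coords c F) z.

Definition bochner_kahler_potential_near (R : realType) (n : nat)
    (M : complexManifold R n) (p : M) (F : M -> R) : Prop :=
  exists (U : set M) (g : metric_field M),
    [/\ open_nbhs p U, bochner_kahler U g & kahler_potential U g F].

Definition same_germ (R : realType) (n : nat) (M : complexManifold R n)
    (p : M) (g1 g2 : metric_field M) : Prop :=
  exists2 U : set M, open_nbhs p U &
    forall c, holo_chart c -> forall z, in_chart U c z -> g1 c z = g2 c z.

(** * The normal form *)

Definition normal_mx (R : realType) (n : nat)
    (X : 'M[R]_n) (a : 'cV[R]_n) (r : R) : 'M[Cplx R]_(1 + (n + 1)) :=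
  let XC : 'M[Cplx R]_n := map_mx (@toC R) X in
  let aC : 'cV[Cplx R]_n := map_mx (@toC R) a in
  col_mx (row_mx 0 (row_mx (- (2 * 'i) *: conjT aC) (toC r)%:M))
 (col_mx (row_mx 0 (row_mx ('i *: XC)               aC))
         (row_mx 1 (row_mx 0                        0))).

Definition is_normal (R : realType) (n : nat)
    (A : 'M[Cplx R]_(1 + (n + 1))) : Prop :=
  exists (X : 'M[R]_n) (a : 'cV[R]_n) (r : R),
    [/\ is_diag_mx X /\
        (forall j k : 'I_n, k = j.+1 :> nat -> X k k <= X j j),
        forall j, 0 <= a j 0,
        forall j k : 'I_n, k = j.+1 :> nat -> X j j = X k k -> a k 0 = 0 &
        A = normal_mx X a r].

Definition normal_equation (R : realType) (n : nat)
    (A : 'M[Cplx R]_(1 + (n + 1))) (z : 'cV[Cplx R]_n) (t : R) : Prop :=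
  let u : 'rV[Cplx R]_(1 + (n + 1)) :=
    row_mx 0 (row_mx (conjT z) ('i / 2)%:M) in
  let v : 'cV[Cplx R]_(1 + (n + 1)) := col_mx 1 (col_mx z 0) in
  u *m expmx ((2 * 'i * toC t) *: A) *m v = 0.

(* The condition F p = 0 selects the branch of the equation through the origin:
   the equation may have further solutions at z = 0, through which it can
   define potentials of negative definite metrics. *)
Definition represents (R : realType) (n : nat) (M : complexManifold R n)
    (p : M) (A : 'M[Cplx R]_(1 + (n + 1))) (F : M -> R) : Prop :=
  F p = 0 /\
  exists c : chart R n M,
    [/\ holo_chart c, cdom c p, cmap c p = 0 &
        \forall q \near p, normal_equation A (cmap c q) (F q)].

(* Main.v *)
(* Work in the ring of germs at p of smooth functions with the derivations d/dz_k, d/dzbar_k.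

   If F solves the equation, put M = A^T, K = (exp (2iFM)) J, where J is the constant Hermitian
   matrix [Jmx], and phi = (1, z, 0), so that the equation reads
   phi K phi^* = 0.  Differentiating it twice gives the frame formed by phi, its covariant derivatives E and
   phi M, whose structure equations express the curvature through two tensors Q and q in the form
   [bochner_form]; its trace-free part vanishes.  At p the tensors Q, d q and the remaining coefficient c
   recover X, a and r up to a unitary change of coordinates, and they are determined by the curvature up to
   adding a constant to q; as q vanishes at p, this gives the uniqueness of A.

   Conversely, vanishing Bochner curvature and the Bianchi identities close up the same system for Q, q, c:
   it is a flat connection.  A parallel frame with suitable initial value conjugates its coefficient matrix
   to a constant matrix, which is M, and its first row phi is holomorphic with phi K phi^* = 0.  The implicit
   function theorem normalizes phi to (1, zeta, 0) at the expense of the pluriharmonic function h, and zeta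
   is the coordinate system. *)
From Pilot Require Import Defs.
From HB Require Import structures.
From mathcomp Require Import all_boot all_order all_algebra.
From mathcomp Require Import complex.
From mathcomp Require Import all_classical all_reals all_analysis.
From mathcomp Require Import ring lra.
Import Order.TTheory GRing.Theory Num.Theory numFieldNormedType.Exports.
Local Open Scope classical_set_scope.
Local Open Scope ring_scope.
Set Implicit Arguments. Unset Strict Implicit. Unset Printing Implicit Defensive.

(** * Norms and differential calculus on C^n *)

(** The zero in the lower right corner of A has a meaning of its own. In the frame phi, E, phi M the
    constant matrix M has the entries of [aa], whose last diagonal entry is a multiple of q. The
    curvature fixes q only up to a constant, because a multiple of the metric can be moved between Q
    and q; the corner entry pins this constant by q = 0 at p.

    The function h comes from a gauge freedom. M is skew for the Hermitian form J, so multiplying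
    phi by exp (g M) with g holomorphic replaces F by F - Im g and keeps the equation. One such g is
    exactly enough to remove the last entry of phi.

    Smoothness is defined by derivatives along real lines only. Fréchet differentiability, symmetry
    of second derivatives, parallel frames and the inverse function theorem are therefore obtained
    by elementary estimates, after which the curvature computations are polynomial identities in an
    abstract ring with derivations. *)

Section ComplexNorm.
Context {R : realType}.
Local Notation C := (Cplx R).
Implicit Types (x y : C) (a b : R).
(** The norm of [Cplx R] takes values in the complex field; this is its real-valued form, so that
    all estimates live in the ordered field [R]. *)
Definition cn x : R := @ComplexField.Normc.normc R x.
Definition rp x : R := complex.Re (x : R[i]).
Definition ip x : R := complex.Im (x : R[i]).
Lemma normE x : `|x| = toC (cn x). Proof. by []. Qed.
Lemma toC_is_zmod_morphism : zmod_morphism (@toC R).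
Proof. by move=> a b; rewrite /toC rmorphB. Qed.
HB.instance Definition _ := GRing.isZmodMorphism.Build R C (@toC R) toC_is_zmod_morphism.
Lemma toC_is_monoid_morphism : monoid_morphism (@toC R).
Proof. by split => [|a b]; rewrite /toC ?rmorph1 ?rmorphM. Qed.
HB.instance Definition _ := GRing.isMonoidMorphism.Build R C (@toC R) toC_is_monoid_morphism.
Lemma toCD a b : toC (a + b) = toC a + toC b. Proof. exact: raddfD. Qed.
Lemma toCB a b : toC (a - b) = toC a - toC b. Proof. exact: raddfB. Qed.
Lemma toCM a b : toC (a * b) = toC a * toC b. Proof. exact: rmorphM. Qed.
Lemma toC0 : toC 0 = 0 :> C. Proof. exact: raddf0. Qed.
Lemma toC1 : toC 1 = 1 :> C. Proof. exact: rmorph1. Qed.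
Lemma rp_is_zmod_morphism : zmod_morphism rp.
Proof. by case=> a b [c d]. Qed.
HB.instance Definition _ := GRing.isZmodMorphism.Build C R rp rp_is_zmod_morphism.
Lemma ip_is_zmod_morphism : zmod_morphism ip.
Proof. by case=> a b [c d]. Qed.
HB.instance Definition _ := GRing.isZmodMorphism.Build C R ip ip_is_zmod_morphism.
Lemma rpD x y : rp (x + y) = rp x + rp y. Proof. exact: raddfD. Qed.
Lemma ipD x y : ip (x + y) = ip x + ip y. Proof. exact: raddfD. Qed.
Lemma rpB x y : rp (x - y) = rp x - rp y. Proof. exact: raddfB. Qed.
Lemma ipB x y : ip (x - y) = ip x - ip y. Proof. exact: raddfB. Qed.
Lemma rp_toC a : rp (toC a) = a. Proof. by []. Qed.
Lemma ip_toC a : ip (toC a) = 0. Proof. by []. Qed.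
Lemma rpM x y : rp (x * y) = rp x * rp y - ip x * ip y.
Proof. by case: x y => [a b] [c d]. Qed.
Lemma ipM x y : ip (x * y) = rp x * ip y + ip x * rp y.
Proof. by case: x y => [a b] [c d]. Qed.
Lemma rp_i : rp 'i = 0. Proof. by []. Qed.
Lemma ip_i : ip 'i = 1. Proof. by []. Qed.
Lemma ip1 : ip 1 = 0. Proof. by []. Qed.
Lemma rp_conj x : rp (Num.conj x) = rp x. Proof. by case: x. Qed.
Lemma ip_conj x : ip (Num.conj x) = - ip x. Proof. by case: x. Qed.
Lemma rp_toCM a x : rp (toC a * x) = a * rp x.
Proof. by rewrite rpM rp_toC ip_toC mul0r subr0. Qed.
Lemma ip_toCM a x : ip (toC a * x) = a * ip x.
Proof. by rewrite ipM rp_toC ip_toC mul0r addr0. Qed.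
Lemma cplxP x y : rp x = rp y -> ip x = ip y -> x = y.
Proof. by case: x y => [a b] [c d] /= -> ->. Qed.
Lemma cplxE x : x = toC (rp x) + 'i * toC (ip x).
Proof.
by apply: cplxP; rewrite raddfD /= ?rpM ?ipM ?rp_i ?ip_i ?rp_toC ?ip_toC; ring.
Qed.
Lemma conj_toC a : Num.conj (toC a) = toC a.
Proof. by apply: cplxP; rewrite ?rp_conj ?ip_conj ?ip_toC ?oppr0. Qed.
Lemma leCE x y : (x <= y) = (ip y == ip x) && (rp x <= rp y).
Proof. by case: x y => [a b] [c d]. Qed.
Lemma ltCE x y : (x < y) = (ip y == ip x) && (rp x < rp y).
Proof. by case: x y => [a b] [c d]. Qed.
Lemma ler_toC a b : (toC a <= toC b) = (a <= b).
Proof. by rewrite leCE !ip_toC eqxx. Qed.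
Lemma ltr_toC a b : (toC a < toC b) = (a < b).
Proof. by rewrite ltCE !ip_toC eqxx. Qed.
Lemma posC_toC x : 0 < x -> x = toC (rp x).
Proof. by rewrite ltCE => /andP[/eqP h _]; apply: cplxP; rewrite ?ip_toC. Qed.
Lemma toC_inj : injective (@toC R).
Proof. by move=> a b /(congr1 rp). Qed.
Lemma cn_ge0 x : 0 <= cn x.
Proof. by rewrite -ler_toC rmorph0 -normE. Qed.
Lemma cn0 : cn 0 = 0. Proof. by apply: toC_inj; rewrite -normE normr0 rmorph0. Qed.
Lemma cnD x y : cn (x + y) <= cn x + cn y.
Proof. by rewrite -ler_toC rmorphD /= -!normE ler_normD. Qed.
Lemma cnM x y : cn (x * y) = cn x * cn y.
Proof. by apply: toC_inj; rewrite rmorphM /= -!normE normrM. Qed.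
Lemma cnN x : cn (- x) = cn x.
Proof. by apply: toC_inj; rewrite -!normE normrN. Qed.
Lemma cnB x y : cn (x - y) = cn (y - x).
Proof. by rewrite -cnN opprB. Qed.
Lemma cn_eq0 x : (cn x == 0) = (x == 0).
Proof. by rewrite -(inj_eq toC_inj) -normE rmorph0 normr_eq0. Qed.
Lemma cn_toC a : cn (toC a) = `|a|.
Proof. by rewrite /cn /= expr0n /= addr0 sqrtr_sqr. Qed.
Lemma cn_conj x : cn (Num.conj x) = cn x.
Proof. by apply: toC_inj; rewrite -!normE norm_conjC. Qed.
Lemma cn1 : cn 1 = 1.
Proof. by rewrite -(rmorph1 (@toC R)) cn_toC normr1. Qed.
Lemma cn_i : cn 'i = 1.
Proof. by rewrite /cn /= expr0n expr1n add0r sqrtr1. Qed.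
Lemma cnV x : cn x^-1 = (cn x)^-1.
Proof. exact: ComplexField.Normc.normcV. Qed.
Lemma rp_le x : `|rp x| <= cn x.
Proof.
case: x => a b; rewrite /cn /= -sqrtr_sqr ler_wsqrtr // lerDl sqr_ge0 //.
Qed.
Lemma ip_le x : `|ip x| <= cn x.
Proof.
case: x => a b; rewrite /cn /= -sqrtr_sqr ler_wsqrtr // lerDr sqr_ge0 //.
Qed.
Lemma cn_le x : cn x <= `|rp x| + `|ip x|.
Proof.
rewrite {1}(cplxE x) (le_trans (cnD _ _)) // cnM cn_i mul1r !cn_toC //.
Qed.
Lemma cn_sum (I : Type) (s : seq I) (P : pred I) (f : I -> C) :
  cn (\sum_(i <- s | P i) f i) <= \sum_(i <- s | P i) cn (f i).
Proof.
elim/big_ind2: _ => //; first by rewrite cn0.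
by move=> a b c d h1 h2; apply: (le_trans (cnD _ _)); apply: lerD.
Qed.
Lemma cnX x k : cn (x ^+ k) = cn x ^+ k.
Proof. by elim: k => [|k IH]; rewrite ?expr0 ?cn1 // !exprS cnM IH. Qed.
Lemma toC_sum (I : Type) (s : seq I) (P : pred I) (f : I -> R) :
  toC (\sum_(i <- s | P i) f i) = \sum_(i <- s | P i) toC (f i).
Proof. exact: rmorph_sum. Qed.
End ComplexNorm.
(** Used to distribute an error d over n coordinates; the divisor n+1 keeps the inequality strict
    and covers n = 0. *)
Lemma sum_cst_lt (R : realType) (n : nat) (d : R) : 0 < d -> \sum_(j < n) d / n.+1%:R < d.
Proof.
move=> d0; rewrite sumr_const card_ord -[X in X < _]mulr_natr -mulrA -[ltRHS]mulr1 ltr_pM2l //.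
by rewrite mulrC ltr_pdivrMr // mul1r ltr_nat.
Qed.
Lemma sqrCi1 (R : realType) : 'i * 'i = -1 :> Cplx R. Proof. by rewrite -expr2 sqrCi. Qed.
Section VectorNorm.
Context {R : realType} {n : nat}.
Local Notation C := (Cplx R).
Implicit Types (v w z : 'cV[C]_n).
(** The sum norm: it dominates every coordinate, and coordinate estimates simply add up. [nearvP]
    compares it with the entrywise balls of the matrix topology. *)
Definition vn v : R := \sum_j cn (v j 0).
Lemma vn_ge0 v : 0 <= vn v.
Proof. by apply: sumr_ge0 => j _; exact: cn_ge0. Qed.
Lemma vn0 : vn 0 = 0.
Proof. by rewrite /vn big1 // => j _; rewrite mxE cn0. Qed.
Lemma vnD v w : vn (v + w) <= vn v + vn w.
Proof. by rewrite /vn -big_split /= ler_sum // => j _; rewrite mxE cnD. Qed.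
Lemma vnZ (a : C) v : vn (a *: v) = cn a * vn v.
Proof. by rewrite /vn mulr_sumr; apply: eq_bigr => j _; rewrite mxE cnM. Qed.
Lemma vnN v : vn (- v) = vn v.
Proof. by rewrite /vn; apply: eq_bigr => j _; rewrite mxE cnN. Qed.
Lemma vnB v w : vn (v - w) = vn (w - v).
Proof. by rewrite -vnN opprB. Qed.
Lemma cn_vn v j : cn (v j 0) <= vn v.
Proof.
by rewrite /vn (bigD1 j) //= lerDl; apply: sumr_ge0 => i _; exact: cn_ge0.
Qed.
Lemma vn_eq0 v : vn v = 0 -> v = 0.
Proof.
move=> h; apply/matrixP => i j; rewrite ord1 mxE; apply/eqP; rewrite -cn_eq0.
by rewrite eq_le cn_ge0 andbT -h cn_vn.
Qed.
Lemma vn_sum (I : Type) (s : seq I) (P : pred I) (f : I -> 'cV[C]_n) :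
  vn (\sum_(i <- s | P i) f i) <= \sum_(i <- s | P i) vn (f i).
Proof.
elim/big_ind2: _ => //; first by rewrite vn0.
by move=> a b c d h1 h2; apply: (le_trans (vnD _ _)); apply: lerD.
Qed.
Lemma nearvP (z : 'cV[C]_n) (P : 'cV[C]_n -> Prop) :
  (\forall w \near z, P w) <-> (exists2 d : R, 0 < d & forall w, vn (w - z) < d -> P w).
Proof.
split.
  move=> /nbhs_ballP[e /= e0 h]; exists (rp e).
    by move: e0; rewrite ltCE => /andP[].
  move=> w wz; apply: h; split=> // i j; rewrite ord1 /ball /= -normrN opprB normE.
  rewrite (posC_toC e0) ltr_toC; apply: le_lt_trans wz.
  by have := cn_vn (w - z) i; rewrite !mxE.
move=> [d d0 h]; apply/nbhs_ballP; exists (toC (d / n.+1%:R)) => /=.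
  by rewrite -(rmorph0 (@toC R)) ltr_toC divr_gt0.
move=> w zw; apply: h.
apply: (@le_lt_trans _ _ (\sum_(j < n) (d / n.+1%:R))).
  apply: ler_sum => j _; rewrite !mxE -ler_toC ltW // -normE -normrN opprB.
  exact: (zw.2 j 0).
exact: sum_cst_lt.
Qed.
Lemma contP (z : 'cV[C]_n) (f : 'cV[C]_n -> C) :
  {for z, continuous f} <->
  (forall e : R, 0 < e -> \forall w \near z, cn (f w - f z) < e).
Proof.
rewrite /prop_for /continuous_at; split.
  move=> /cvgrPdist_lt h e e0.
  have e0' : 0 < toC e by rewrite -(rmorph0 (@toC R)) ltr_toC.
  have := h _ e0'; apply: filterS => w.
  by rewrite normE ltr_toC cnB.
move=> h; apply: (proj2 (@cvgrPdist_lt _ _ _ (nbhs z) _ f (f z))) => e e0.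
have e0' : 0 < rp e by move: e0; rewrite ltCE => /andP[].
have := h _ e0'; apply: filterS => w.
by rewrite normE (posC_toC e0) ltr_toC cnB.
Qed.
End VectorNorm.

Notation isder t f d := (is_derive (t : Real.sort _) (1 : Real.sort _) f d).

(** * Differentiation of complex-valued curves and the mean value inequality *)

Section RealDeriv.
Context {R : realType}.
Implicit Types (g : R -> R).
Lemma derive_shiftE g (t0 : R) (h : R) :
  h^-1 *: ((g \o shift t0) (h *: 1) - g t0) =
  h^-1 *: (((fun t => g (t + t0)) \o shift 0) (h *: 1) - (fun t => g (t + t0)) 0).
Proof. by rewrite /= addr0 add0r. Qed.
Lemma is_derive_shiftE g (t0 l : R) :
  isder t0 g l <-> isder 0 (fun t : R => g (t + t0)) l.
Proof.
have E : (fun h : R => h^-1 *: ((g \o shift t0) (h *: 1) - g t0)) =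
  (fun h : R => h^-1 *: (((fun t => g (t + t0)) \o shift 0) (h *: 1) - (fun t => g (t + t0)) 0)).
  by apply/funext => h; exact: derive_shiftE.
split=> [] [h1 h2]; (split; [move: h1 | move: h2]); rewrite /derivable /derive ?E //.
Qed.
(** The first-order remainder form, free of difference quotients and valid at t = 0 as well; all
    later estimates of derivatives go through it. *)
Lemma is_derive0P g (l : R) :
  isder 0 g l <->
  (forall e : R, 0 < e -> exists2 d : R, 0 < d & forall t : R, `|t| < d ->
     `|g t - g 0 - t * l| <= e * `|t|).
Proof.
have E t : t != 0 -> g t - g 0 - t * l = - (l - t^-1 * (g t - g 0)) * t.
  by move=> t0; rewrite mulNr mulrBl mulrAC mulVf // mul1r; ring.
split.
  move=> [h1 h2] e e0.
  have : (fun h : R => h^-1 *: ((g \o shift 0) (h *: 1) - g 0)) @ 0^' --> l.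
    by rewrite -h2; apply: h1.
  move=> /cvgrPdist_lt /(_ e e0); rewrite near_withinE => /nbhs_ballP[d /= d0 H].
  exists d => // t td.
  have [->|t0] := eqVneq t 0; first by rewrite mul0r subrr subr0 normr0 mulr0.
  have := H t; rewrite /ball /= sub0r normrN => /(_ td t0).
  rewrite addr0 [_ *: 1]mulr1 => /ltW h.
  by rewrite E // normrM normrN ler_wpM2r.
move=> H.
have cv : (fun h : R => h^-1 *: ((g \o shift 0) (h *: 1) - g 0)) @ 0^' --> l.
  apply/cvgrPdist_le => e e0; rewrite near_withinE; apply/nbhs_ballP.
  have [d d0 h] := H e e0; exists d => // t; rewrite /ball /= sub0r normrN => td t0.
  have := h t td; rewrite addr0 [_ *: 1]mulr1.
  by rewrite E // normrM normrN ler_pM2r // normr_gt0.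
split; first by apply/cvg_ex; exists l.
exact: cvg_lim.
Qed.
End RealDeriv.

Section Curves.
Context {R : realType}.
Local Notation C := (Cplx R).
Implicit Types (g h : R -> C) (d : C).
Definition cder g (t0 : R) d : Prop :=
  isder t0 (fun t : R => rp (g t)) (rp d) /\ isder t0 (fun t => ip (g t)) (ip d).
Lemma cder_eq g t0 d d' : cder g t0 d -> d = d' -> cder g t0 d'.
Proof. by move=> h <-. Qed.
Lemma cder_shift g t0 d : cder g t0 d <-> cder (fun t => g (t + t0)) 0 d.
Proof.
rewrite /cder (is_derive_shiftE (fun t : R => rp (g t))).
by rewrite (is_derive_shiftE (fun t => ip (g t))).
Qed.
Lemma cder0P g d : cder g 0 d <->
  (forall e : R, 0 < e -> exists2 b : R, 0 < b & forall t : R, `|t| < b ->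
     cn (g t - g 0 - toC t * d) <= e * `|t|).
Proof.
rewrite /cder !is_derive0P; split.
  move=> [h1 h2] e e0; have e2 : 0 < e / 2 by rewrite divr_gt0.
  have [b1 b10 H1] := h1 _ e2; have [b2 b20 H2] := h2 _ e2.
  exists (Num.min b1 b2); first by rewrite lt_min b10.
  move=> t; rewrite lt_min => /andP[tb1 tb2].
  apply: (le_trans (cn_le _)); rewrite [e]splitr mulrDl lerD //.
    by apply: le_trans (H1 t tb1); rewrite !raddfB /= rp_toCM.
  by apply: le_trans (H2 t tb2); rewrite !raddfB /= ip_toCM.
move=> H; split => e e0; have [b b0 h] := H e e0; exists b => // t tb;
  apply: le_trans (h t tb).
  by apply: le_trans (rp_le _); rewrite !raddfB /= rp_toCM.
by apply: le_trans (ip_le _); rewrite !raddfB /= ip_toCM.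
Qed.
Lemma cder_near g h t0 d :
  (\forall t \near t0, g t = h t) -> cder g t0 d -> cder h t0 d.
Proof.
move=> gh; have gh0 : g t0 = h t0 by apply: (nbhs_singleton gh).
rewrite cder_shift [X in _ -> X]cder_shift !cder0P => H e e0.
have [b b0 hb] := H e e0.
have : \forall t \near 0, g (t + t0) = h (t + t0).
  by move: gh => /nbhs0P; apply: filterS => t; rewrite addrC.
move=> /nbhs_ballP[c /= c0 hc].
exists (Num.min b c); first by rewrite lt_min b0.
move=> t; rewrite lt_min => /andP[tb tc].
rewrite -hc; last by rewrite /ball /= sub0r normrN.
by rewrite add0r -gh0; have := hb t tb; rewrite add0r.
Qed.
Lemma cderD g h t0 d e : cder g t0 d -> cder h t0 e ->
  cder (fun t => g t + h t) t0 (d + e).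
Proof.
move=> [g1 g2] [h1 h2]; split.
  rewrite raddfD; have -> : (fun t => rp (g t + h t)) = (fun t : R => rp (g t)) + (fun t => rp (h t)).
    by apply/funext => t; rewrite raddfD.
  exact: is_deriveD.
rewrite raddfD; have -> : (fun t => ip (g t + h t)) = (fun t => ip (g t)) + (fun t => ip (h t)).
  by apply/funext => t; rewrite raddfD.
exact: is_deriveD.
Qed.
Lemma cderM g h t0 d e : cder g t0 d -> cder h t0 e ->
  cder (fun t => g t * h t) t0 (d * h t0 + g t0 * e).
Proof.
move=> [g1 g2] [h1 h2]; split.
  have -> : (fun t => rp (g t * h t)) =
     ((fun t : R => rp (g t)) * (fun t => rp (h t))) - ((fun t => ip (g t)) * (fun t => ip (h t))).
    by apply/funext => t; rewrite rpM.
  have h3 := is_deriveB (is_deriveM g1 h1) (is_deriveM g2 h2).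
  apply: (is_derive_eq h3).
  by rewrite rpD !rpM /GRing.scale /=; ring.
have -> : (fun t => ip (g t * h t)) =
   ((fun t : R => rp (g t)) * (fun t => ip (h t))) + ((fun t => ip (g t)) * (fun t => rp (h t))).
  by apply/funext => t; rewrite ipM.
have h3 := is_deriveD (is_deriveM g1 h2) (is_deriveM g2 h1).
apply: (is_derive_eq h3).
by rewrite ipD !ipM /GRing.scale /=; ring.
Qed.
Lemma cder_cst (c : C) t0 : cder (fun=> c) t0 0.
Proof. by split; rewrite raddf0; exact: is_derive_cst. Qed.
Lemma cder_toC t0 : cder (fun t => toC t) t0 1.
Proof. by split; [exact: is_derive_id | exact: is_derive_cst]. Qed.
Lemma cder_conj g t0 d : cder g t0 d -> cder (fun t => Num.conj (g t)) t0 (Num.conj d).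
Proof.
move=> [h1 h2]; split.
  by rewrite rp_conj; have -> : (fun t => rp (Num.conj (g t))) = (fun t : R => rp (g t))
    by apply/funext => t; rewrite rp_conj.
rewrite ip_conj; have -> : (fun t => ip (Num.conj (g t))) = - (fun t => ip (g t)).
  by apply/funext => t; rewrite ip_conj.
exact: is_deriveN.
Qed.
Lemma cderZ (c : C) g t0 d : cder g t0 d -> cder (fun t => c * g t) t0 (c * d).
Proof.
move=> h; apply: (cder_eq (cderM (cder_cst c t0) h)); by rewrite mul0r add0r.
Qed.
Lemma cderN g t0 d : cder g t0 d -> cder (fun t => - g t) t0 (- d).
Proof.
move=> /(cderZ (-1)) h; rewrite mulN1r in h.
by have -> : (fun t => - g t) = (fun t => -1 * g t) by apply/funext => t; rewrite mulN1r.
Qed.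
Lemma cder_sum (I : finType) (g : I -> R -> C) t0 (d : I -> C) :
  (forall i, cder (g i) t0 (d i)) ->
  cder (fun t => \sum_i g i t) t0 (\sum_i d i).
Proof.
move=> h; elim: (index_enum I) => [|i s IH].
  have -> : (fun t => \sum_(i <- [::]) g i t) = (fun=> 0) by apply/funext => t; rewrite big_nil.
  by rewrite big_nil; exact: cder_cst.
have -> : (fun t => \sum_(j <- i :: s) g j t) = (fun t => g i t + \sum_(j <- s) g j t).
  by apply/funext => t; rewrite big_cons.
by rewrite big_cons; apply: cderD.
Qed.
Lemma cder_scale g (a : R) t0 d : cder g (a * t0) d ->
  cder (fun t => g (a * t)) t0 (toC a * d).
Proof.
have H : isder t0 (fun t : R => a * t) a.
  have h := is_deriveZ a (is_derive_id t0 (1 : R)).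
  by apply: (is_derive_eq h); rewrite /GRing.scale /= mulr1.
move=> [h1 h2]; split; rewrite ?rp_toCM ?ip_toCM.
  by have h := is_derive1_comp h1 H; apply: (is_derive_eq h); rewrite mulrC.
by have h := is_derive1_comp h2 H; apply: (is_derive_eq h); rewrite mulrC.
Qed.
Lemma cder_V g t0 d : cder g t0 d -> g t0 != 0 ->
  cder (fun t => (g t)^-1) t0 (- d / g t0 ^+ 2).
Proof.
move=> [h1 h2] g0.
pose q := (fun t : R => rp (g t)) ^+ 2 + (fun t => ip (g t)) ^+ 2 : R -> R.
have qE t : q t = rp (g t) ^+ 2 + ip (g t) ^+ 2 by [].
have q0 : q t0 != 0.
  rewrite qE; apply: contra g0; rewrite paddr_eq0 ?sqr_ge0 // !sqrf_eq0.
  by move=> /andP[/eqP e1 /eqP e2]; apply/eqP/cplxP; rewrite ?e1 ?e2 ?raddf0.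
have dq := is_deriveD (is_deriveX 2 h1) (is_deriveX 2 h2).
have dV := is_deriveV q0 dq.
have e0 t : (g t)^-1 = Complex (rp (g t) / q t) (- (ip (g t) / q t)).
  by rewrite qE; case: (g t).
have e1 : (fun t => rp (g t)^-1) = (fun t : R => rp (g t)) * (fun t => (q t)^-1).
  by apply/funext => t; rewrite e0.
have e2 : (fun t => ip (g t)^-1) = - ((fun t => ip (g t)) * (fun t => (q t)^-1)).
  by apply/funext => t; rewrite e0.
(* The quotient -(x + iy) / (a + ib)^2 split into real and imaginary parts, to be compared with the
   real quotient rule for each part of 1/g. *)
have key (a b x y : R) : a ^+ 2 + b ^+ 2 != 0 ->
  - (Complex x y : C) / (Complex a b : C) ^+ 2 =
  Complex ((x * (b^+2 - a^+2) - 2 * a * b * y) / (a^+2+b^+2)^+2)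
          ((y * (b^+2 - a^+2) + 2 * a * b * x) / (a^+2+b^+2)^+2) :> C.
  move=> ab.
  have ab0 : (Complex a b : C) ^+ 2 != 0.
    rewrite sqrf_eq0; apply: contra ab => /eqP[-> ->]; rewrite expr0n addr0 //.
  apply: (mulIf ab0); rewrite divfK //.
  by rewrite expr2; apply: cplxP; rewrite /rp /ip /=; field.
split.
  rewrite e1; apply: (is_derive_eq (is_deriveM h1 dV)); move: q0 d h1 h2 dq dV; rewrite qE.
  case: (g t0) => a b ab [x y] _ _ _ _; rewrite key // /rp /ip /GRing.scale /=.
  by rewrite /q /rp /ip /=; field.
rewrite e2; apply: (is_derive_eq (is_deriveN (is_deriveM h2 dV))); move: q0 d h1 h2 dq dV; rewrite qE.
case: (g t0) => a b ab [x y] _ _ _ _; rewrite key // /rp /ip /GRing.scale /=.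
by rewrite /q /rp /ip /=; field.
Qed.
Lemma real_mvt (f df : R -> R) (m M : R) :
  (forall t : R, 0 <= t <= 1 -> isder t f (df t)) ->
  (forall t : R, 0 <= t <= 1 -> `|df t - m| <= M) -> `|f 1 - f 0 - m| <= M.
Proof.
move=> h1 h2.
have [|||c] := @MVT R f df 0 1 => //.
- by move=> x; rewrite in_itv /= => /andP[/ltW x0 /ltW x1]; apply: h1; rewrite x0.
- apply: derivable_within_continuous => x; rewrite in_itv /= => hx.
  by have [] := h1 x hx.
rewrite in_itv /= => /andP[/ltW x0 /ltW x1]; rewrite subr0 mulr1 => ->.
by apply: h2; rewrite x0.
Qed.
(** The mean value theorem fails for complex values, so it is applied to both parts separately,
    which costs the factor 2. The free number [m] makes the same estimate bound the deviation from a
    linear approximation. *)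
Lemma cmvt g (dg : R -> C) (m : C) (M : R) :
  (forall t : R, 0 <= t <= 1 -> cder g t (dg t)) ->
  (forall t : R, 0 <= t <= 1 -> cn (dg t - m) <= M) -> cn (g 1 - g 0 - m) <= 2 * M.
Proof.
move=> h1 h2; apply: (le_trans (cn_le _)); rewrite !raddfB /= mulr2n mulrDl mul1r.
apply: lerD.
  apply: (@real_mvt (fun t : R => rp (g t)) (fun t => rp (dg t))) => t ht; first by have [] := h1 t ht.
  by rewrite -raddfB /=; apply: le_trans (rp_le _) (h2 t ht).
apply: (@real_mvt (fun t => ip (g t)) (fun t => ip (dg t))) => t ht; first by have [] := h1 t ht.
by rewrite -raddfB /=; apply: le_trans (ip_le _) (h2 t ht).
Qed.
End Curves.

(** * Directional derivatives and the chain rule *)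

Section Directional.
Context {R : realType} {n : nat}.
Local Notation C := (Cplx R).
Implicit Types (f g : 'cV[C]_n -> C) (v w z : 'cV[C]_n) (d : C).
(** One relation for [rderivable] together with the value of [rderive], so that the rules of
    calculus need no separate differentiability conditions. *)
Definition isd f v z d := cder (fun t : R => f (z + toC t *: v)) 0 d.
Lemma isd_rderivable f v z d : isd f v z d -> rderivable f v z.
Proof. move=> [[h1 _] [h2 _]]; split; [exact: h1|exact: h2]. Qed.
Lemma isd_rderive f v z d : isd f v z d -> rderive f v z = d.
Proof.
move=> [h1 h2]; rewrite /rderive [RHS]cplxE; congr (toC _ + 'i * toC _).
  by rewrite derive1E; case: h1.
by rewrite derive1E; case: h2.
Qed.
Lemma rderivable_isd f v z : rderivable f v z -> isd f v z (rderive f v z).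
Proof.
move=> [h1 h2].
have e1 : rp (rderive f v z) = 'D_1 (fun t : R => complex.Re (f (z + toC t *: v))) 0.
  by rewrite /rderive rpD rpM rp_i ip_i rp_toC !ip_toC !derive1E; ring.
have e2 : ip (rderive f v z) = 'D_1 (fun t : R => complex.Im (f (z + toC t *: v))) 0.
  by rewrite /rderive ipD ipM rp_i ip_i rp_toC !ip_toC !derive1E; ring.
by split; [rewrite e1; exact: (DeriveDef h1 erefl)|rewrite e2; exact: (DeriveDef h2 erefl)].
Qed.
Lemma near_line v z (P : 'cV[C]_n -> Prop) :
  (\forall w \near z, P w) -> \forall t \near (0 : R), P (z + toC t *: v).
Proof.
move=> /nearvP[d d0 h]; apply/nbhs_ballP; exists (d / (1 + vn v)) => /=.
  by rewrite divr_gt0 // ltr_pwDl // vn_ge0.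
move=> t; rewrite /ball /= sub0r normrN => td; apply: h.
rewrite addrC addKr vnZ cn_toC.
have p : 0 < 1 + vn v by rewrite ltr_pwDl // vn_ge0.
apply: (@le_lt_trans _ _ (`|t| * (1 + vn v))); first by rewrite ler_wpM2l // lerDr.
by rewrite -ltr_pdivlMr.
Qed.
Lemma isd_near f g v z d :
  (\forall w \near z, f w = g w) -> isd f v z d -> isd g v z d.
Proof. by move=> h; apply: cder_near; apply: (near_line v h). Qed.
Lemma isd_line f v z (t0 : R) d : isd f v (z + toC t0 *: v) d ->
  cder (fun t => f (z + toC t *: v)) t0 d.
Proof.
move=> h; apply: (proj2 (cder_shift _ _ _)).
have -> : (fun t => f (z + toC (t + t0) *: v)) = (fun t => f (z + toC t0 *: v + toC t *: v)).
  apply/funext => t; rewrite toCD scalerDl [toC t *: v + _]addrC addrA; reflexivity.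
exact: h.
Qed.
Lemma isdZ f v z (a : R) d : isd f v z d -> isd f (toC a *: v) z (toC a * d).
Proof.
rewrite /isd => h.
have -> : (fun t => f (z + toC t *: (toC a *: v))) =
  (fun t => (fun s => f (z + toC s *: v)) (a * t)).
  by apply/funext => t; rewrite scalerA -rmorphM /= mulrC.
apply: (@cder_scale R (fun s => f (z + toC s *: v)) a 0 d); rewrite mulr0; exact: h.
Qed.
(** Continuous derivatives in finitely many directions give a first-order expansion. By induction on
    the list, one direction is changed at a time; the new increment is controlled by [cmvt] and the
    continuity of that one derivative. *)
Lemma frechet_seq (I : eqType) (U : set 'cV[C]_n) f (ds : I -> 'cV[C]_n)
    (D : I -> 'cV[C]_n -> C) z (s : seq I) :
  (\forall w \near z, U w) ->
  (forall i w, U w -> isd f (ds i) w (D i w)) ->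
  (forall i, {for z, continuous (D i)}) ->
  forall e : R, 0 < e -> exists2 b : R, 0 < b & forall x : I -> R, (forall i, `|x i| < b) ->
    cn (f (z + \sum_(i <- s) toC (x i) *: ds i) - f z - \sum_(i <- s) toC (x i) * D i z)
    <= e * \sum_(i <- s) `|x i|.
Proof.
move=> nU hD cD; elim: s => [|i s IH] e e0.
  by exists 1 => // x _; rewrite !big_nil addr0 subrr subr0 cn0 mulr0.
have [b1 b10 h1] := IH e e0.
have e2 : 0 < e / 2 by rewrite divr_gt0.
have /nearvP[r r0 hr] : \forall w \near z, U w /\ cn (D i w - D i z) < e / 2.
  by apply: filterI => //; apply: ((contP _ _).1 (cD i)).
(* When every |x j| is at most r / B, all points of the broken path stay within r of z. *)
pose B := 1 + vn (ds i) + \sum_(j <- s) vn (ds j).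
have S0 : 0 <= \sum_(j <- s) vn (ds j) by apply: sumr_ge0 => j _; exact: vn_ge0.
have B0 : 0 < B by rewrite /B; have := vn_ge0 (ds i); lra.
exists (Num.min b1 (r / B)); first by rewrite lt_min b10 divr_gt0.
move=> x hx.
have hx1 j : `|x j| < b1 by move: (hx j); rewrite lt_min => /andP[].
have hx2 j : `|x j| <= r / B by move: (hx j); rewrite lt_min => /andP[_ /ltW].
rewrite !big_cons.
set S := \sum_(j <- s) toC (x j) *: ds j.
set T := \sum_(j <- s) toC (x j) * D j z.
set X := \sum_(j <- s) `|x j|.
have -> : f (z + (toC (x i) *: ds i + S)) - f z - (toC (x i) * D i z + T) =
  (f (z + S + toC 1 *: (toC (x i) *: ds i)) - f (z + S + toC 0 *: (toC (x i) *: ds i)) - toC (x i) * D i z) +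
  (f (z + S) - f z - T).
  by rewrite rmorph1 rmorph0 scale1r scale0r addr0 (addrC (_ *: _) S) addrA; ring.
apply: (le_trans (cnD _ _)); rewrite mulrDr lerD //; last by apply: h1.
pose g t := f (z + S + toC t *: (toC (x i) *: ds i)).
have inU t : 0 <= t <= 1 -> vn (z + S + toC t *: (toC (x i) *: ds i) - z) < r.
  move=> /andP[t0 t1].
  have -> : z + S + toC t *: (toC (x i) *: ds i) - z = S + toC t *: (toC (x i) *: ds i).
    by rewrite -[z + S + _]addrA [z + _]addrC addrK.
  apply: (le_lt_trans (vnD _ _)).
  apply: (@le_lt_trans _ _ (r / B * \sum_(j <- s) vn (ds j) + r / B * vn (ds i))).
    apply: lerD.
      apply: (le_trans (vn_sum _ _ _)); rewrite mulr_sumr; apply: ler_sum => j _.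
      by rewrite vnZ cn_toC ler_wpM2r ?vn_ge0.
    rewrite scalerA vnZ cnM !cn_toC ler_wpM2r ?vn_ge0 //.
    by rewrite ger0_norm // (le_trans _ (hx2 i)) // ler_piMl.
  rewrite -mulrDr mulrAC ltr_pdivrMr // ltr_pM2l // /B; lra.
have -> : e * `|x i| = 2 * (`|x i| * (e / 2)) by field.
apply: (@cmvt _ g (fun t => toC (x i) * D i (z + S + toC t *: (toC (x i) *: ds i)))).
  move=> t ht; apply: isd_line; apply: isdZ; apply: hD.
  by have [] := hr _ (inU t ht).
move=> t ht; rewrite -mulrBr cnM cn_toC ler_wpM2l // ltW //.
by have [] := hr _ (inU t ht).
Qed.
(** The basis of C^n over the reals: the flag [true] marks the vector i e_k. The coordinates in this
    basis are [rc]. *)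
Definition rb (k : 'I_n * bool) : 'cV[C]_n :=
  if k.2 then 'i *: cbasis R k.1 else cbasis R k.1.
Definition rc v (k : 'I_n * bool) : R := if k.2 then ip (v k.1 0) else rp (v k.1 0).
Lemma rcE v : v = \sum_k toC (rc v k) *: rb k.
Proof.

rewrite -(pair_bigA _ (fun i b => toC (rc v (i, b)) *: rb (i, b))) /=.
apply/matrixP => i j; rewrite ord1 [in RHS]summxE.
rewrite [in RHS](bigD1 i) //= [X in _ = _ + X]big1 => [|k ki].
  rewrite addr0 [in RHS]summxE big_bool /rb /rc /= !mxE !eqxx /= !mulr1.
  by rewrite [LHS]cplxE addrC mulrC.
rewrite summxE big_bool /rb /rc /= !mxE eq_sym (negPf ki) /= !mulr0.
by rewrite addr0.
Qed.
Lemma rc_le v k : `|rc v k| <= vn v.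
Proof.
apply: le_trans (cn_vn v k.1); rewrite /rc.
by case: k.2; [exact: ip_le|exact: rp_le].
Qed.
Lemma rcD v w k : rc (v + w) k = rc v k + rc w k.
Proof. by rewrite /rc mxE; case: k.2; rewrite ?ipD ?rpD. Qed.
Lemma rcZ (a : R) v k : rc (toC a *: v) k = a * rc v k.
Proof. by rewrite /rc mxE; case: k.2; rewrite ?ip_toCM ?rp_toCM. Qed.
Lemma rclin (D : 'I_n * bool -> C) v w (a b : R) :
  \sum_k toC (rc (toC a *: v + toC b *: w) k) * D k =
  toC a * (\sum_k toC (rc v k) * D k) + toC b * (\sum_k toC (rc w k) * D k).
Proof.
rewrite !mulr_sumr -big_split /=; apply: eq_bigr => k _.
by rewrite rcD !rcZ rmorphD !rmorphM /=; ring.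
Qed.
(** Chain rule along a curve: half of [e] is spent on the remainder of f from [frechet_seq], half on
    the remainder of the curve, which enters through the linear part of f. *)
Lemma cder_comp (U : set 'cV[C]_n) f (D : 'I_n * bool -> 'cV[C]_n -> C)
    (ga : R -> 'cV[C]_n) (dga : 'cV[C]_n) :
  (\forall w \near ga 0, U w) ->
  (forall k w, U w -> isd f (rb k) w (D k w)) ->
  (forall k, {for ga 0, continuous (D k)}) ->
  (forall j, cder (fun t => ga t j 0) 0 (dga j 0)) ->
  cder (fun t => f (ga t)) 0 (\sum_k toC (rc dga k) * D k (ga 0)).
Proof.
move=> nU hD cD hg; apply/cder0P => e e0.
pose K := \sum_k cn (D k (ga 0)).
have K0 : 0 <= K by apply: sumr_ge0 => k _; exact: cn_ge0.
have L0 := vn_ge0 dga.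
pose N : R := #|{: 'I_n * bool}|%:R.
have N0 : 0 <= N by rewrite ler0n.
pose e1 := e / 2 / (1 + N * (1 + vn dga)).
have NL : 0 <= N * (1 + vn dga) by rewrite mulr_ge0 // addr_ge0.
have e10 : 0 < e1 by rewrite !divr_gt0 // ltr_pwDl.
have [b b0 hb] := frechet_seq (index_enum _) nU hD cD e10.
have comp (c : R) : 0 < c -> exists2 r : R, 0 < r &
    forall t : R, `|t| < r -> vn (ga t - ga 0 - toC t *: dga) <= c * `|t|.
  move=> c0; pose c' := c / n.+1%:R.
  have c'0 : 0 < c' by rewrite divr_gt0.
  have hj j : exists r : R, 0 < r /\ forall t : R, `|t| < r ->
      cn (ga t j 0 - ga 0 j 0 - toC t * dga j 0) <= c' * `|t|.
    by have [r r0 h] := (cder0P _ _).1 (hg j) c' c'0; exists r.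
  have [r hr] := choice hj.
  exists (\big[Num.min/1]_j r j).
    by elim/big_ind: _ => // [x y x0 y0|j _]; rewrite ?lt_min ?x0 //; have [] := hr j.
  move=> t ht; apply: (@le_trans _ _ (\sum_(j < n) c' * `|t|)).
    apply: ler_sum => j _; rewrite !mxE; have [_ h] := hr j; apply: h.
    by apply: lt_le_trans ht _; rewrite (bigD1 j) //= ge_min lexx.
  rewrite sumr_const card_ord -[X in X <= _]mulr_natr mulrAC ler_wpM2r //.
  by rewrite /c' -mulrA ler_piMr ?(ltW c0) // mulrC ler_pdivrMr // mul1r ler_nat.
(* The bound 1 makes the increments of the curve at most (1 + |dga|) |t|; the second bound makes the
   curve's remainder contribute at most half of [e]. *)
pose c := Num.min 1 (e / 2 / (1 + K)).
have c0 : 0 < c by rewrite lt_min ltr01 !divr_gt0 // ltr_pwDl.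
have [r r0 hr] := comp c c0.
have LL : 0 < 1 + vn dga by rewrite ltr_pwDl.
exists (Num.min r (b / (1 + vn dga))); first by rewrite lt_min r0 divr_gt0.
move=> t; rewrite lt_min => /andP[tr tb].
have h1 := hr t tr.
pose x k := rc (ga t - ga 0) k.
have vle : vn (ga t - ga 0) <= (1 + vn dga) * `|t|.
  have -> : ga t - ga 0 = (ga t - ga 0 - toC t *: dga) + toC t *: dga by rewrite subrK.
  apply: (le_trans (vnD _ _)); rewrite vnZ cn_toC mulrDl mul1r [vn dga * _]mulrC lerD //.
  apply: (le_trans h1); rewrite ler_piMl //; first by rewrite ge_min lexx.
have hx k : `|x k| < b.
  apply: (le_lt_trans (rc_le _ _)); apply: (le_lt_trans vle).
  by rewrite mulrC -ltr_pdivlMr.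
have := hb x hx; rewrite -(rcE (ga t - ga 0)) (addrC (ga 0)) subrK => h2.
have -> : f (ga t) - f (ga 0) - toC t * (\sum_k toC (rc dga k) * D k (ga 0)) =
  (f (ga t) - f (ga 0) - \sum_k toC (x k) * D k (ga 0)) +
  \sum_k toC (rc (ga t - ga 0 - toC t *: dga) k) * D k (ga 0).
  have -> : ga t - ga 0 - toC t *: dga = toC 1 *: (ga t - ga 0) + toC (- t) *: dga.
    by rewrite rmorph1 scale1r rmorphN scaleNr.
  by rewrite rclin rmorph1 mul1r rmorphN /x; ring.
apply: (le_trans (cnD _ _)); rewrite [e]splitr mulrDl lerD //.
  apply: (le_trans h2); apply: (@le_trans _ _ (e1 * (N * ((1 + vn dga) * `|t|)))).
    rewrite ler_wpM2l ?(ltW e10) //.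
    apply: (@le_trans _ _ (\sum_(k : 'I_n * bool) (1 + vn dga) * `|t|)).
      by apply: ler_sum => k _; apply: le_trans (rc_le _ _) vle.
    by rewrite sumr_const -[X in X <= _]mulr_natr mulrC.

  rewrite !mulrA ler_wpM2r // -mulrA /e1 mulrAC ler_pdivrMr ?ltr_pwDl //.
  by apply: ler_wpM2l; [apply: ltW; rewrite divr_gt0|rewrite lerDr].
apply: (le_trans (cn_sum _ _ _)).
apply: (@le_trans _ _ (\sum_k (c * `|t|) * cn (D k (ga 0)))).
  apply: ler_sum => k _; rewrite cnM cn_toC ler_wpM2r ?cn_ge0 //.
  by apply: le_trans (rc_le _ _) h1.
rewrite -mulr_sumr -/K mulrAC ler_wpM2r //.
apply: (@le_trans _ _ (e / 2 / (1 + K) * K)).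
  by rewrite ler_wpM2r // ge_min lexx orbT.
rewrite mulrAC ler_pdivrMr ?ltr_pwDl //.
by apply: ler_wpM2l; [apply: ltW; rewrite divr_gt0|rewrite lerDr].
Qed.
End Directional.
Lemma big_truefalse (M : nmodType) (F : bool -> M) :
  \sum_(i <- [:: true; false]) F i = F true + F false.
Proof. by rewrite big_cons big_seq1. Qed.

(** * Closure properties of smooth functions and symmetry of second derivatives *)

Section SmoothClosure.
Context {R : realType} {n : nat}.
Local Notation C := (Cplx R).
Local Notation V := 'cV[C]_n.
Implicit Types (f g : V -> C) (v w z : V) (d : C) (U : set V).
Lemma Ck_cont k U f z : Ck k U f -> U z -> {for z, continuous f}.
Proof. by case: k => [|k] [h _] Uz; apply: h. Qed.
Lemma Ck_isd k U f v z : Ck k.+1 U f -> U z -> isd f v z (rderive f v z).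
Proof. by move=> [_ h] Uz; have [h1 _] := h v; apply: rderivable_isd; apply: h1. Qed.
Lemma Ck_rderive k U f v : Ck k.+1 U f -> Ck k U (rderive f v).
Proof. by move=> [_ h]; have [] := h v. Qed.
Lemma Ck_pred k U f : Ck k.+1 U f -> Ck k U f.
Proof.
elim: k f => [|k IH] f; first by move=> [h _].
by move=> [h1 h2]; split=> // v; have [h3 h4] := h2 v; split=> //; apply: IH.
Qed.
Lemma open_near U z : open U -> U z -> \forall w \near z, U w.
Proof. by move=> oU Uz; apply: open_nbhs_nbhs. Qed.
Lemma cont_near_eq f g z : (\forall w \near z, f w = g w) ->
  {for z, continuous f} -> {for z, continuous g}.
Proof.
move=> fg /contP h; apply/contP => e e0; have fgz := nbhs_singleton fg.
near do rewrite -(near fg) // -fgz.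
by have := h e e0.
Unshelve. all: by end_near. Qed.
Lemma isd_open_eq U f g v z d : open U -> U z -> (forall w, U w -> f w = g w) ->
  isd f v z d -> isd g v z d.
Proof.
by move=> oU Uz fg; apply: isd_near; apply: filterS (open_near oU Uz) => w; apply: fg.
Qed.
Lemma rderive_open_eq U f g v z : open U -> U z -> (forall w, U w -> f w = g w) ->
  rderivable f v z -> rderive f v z = rderive g v z.
Proof.
move=> oU Uz fg /rderivable_isd h.
by have /isd_rderive -> := isd_open_eq oU Uz fg h.
Qed.
Lemma Ck_ext k U f g : open U -> (forall z, U z -> f z = g z) -> Ck k U f -> Ck k U g.
Proof.
move=> oU; elim: k f g => [|k IH] f g fg [h1 h2]; split.
- move=> z Uz; apply: cont_near_eq (h1 z Uz).
  by apply: filterS (open_near oU Uz) => w; apply: fg.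
- by [].
- move=> z Uz; apply: cont_near_eq (h1 z Uz).
  by apply: filterS (open_near oU Uz) => w; apply: fg.
move=> v; have [h3 h4] := h2 v; split.
  move=> z Uz; apply: (@isd_rderivable _ _ _ _ _ (rderive f v z)).
  by apply: (isd_open_eq oU Uz fg); apply: rderivable_isd; apply: h3.
apply: IH h4 => z Uz; apply: (rderive_open_eq oU Uz fg); exact: h3.
Qed.
(** Off U the operator [rderive] has no controlled value, so a derivative found by a rule of
    calculus agrees with it on U only; openness of U makes this enough. *)
Lemma CkS k U f : open U -> (forall z, U z -> {for z, continuous f}) ->
  (forall v, exists g, (forall z, U z -> isd f v z (g z)) /\ Ck k U g) -> Ck k.+1 U f.
Proof.
move=> oU h1 h2; split=> // v; have [g [hg1 hg2]] := h2 v; split.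
  by move=> z Uz; apply: isd_rderivable (hg1 z Uz).
by apply: Ck_ext hg2 => // z Uz; rewrite (isd_rderive (hg1 z Uz)).
Qed.
Lemma Ck_sub k U U' f : U' `<=` U -> Ck k U f -> Ck k U' f.
Proof.
move=> sU; elim: k f => [|k IH] f [h1 h2]; split=> //; try by move=> z /sU; apply: h1.
move=> v; have [h3 h4] := h2 v; split; first by move=> z /sU; apply: h3.
exact: IH.
Qed.
Lemma isd_cst (c : C) v z : isd (fun=> c) v z 0.
Proof. exact: cder_cst. Qed.
Lemma isd_coord j v z : isd (fun w => w j 0) v z (v j 0).
Proof.
rewrite /isd.
have -> : (fun t => (z + toC t *: v) j 0) = (fun t => z j 0 + v j 0 * toC t).
  by apply/funext => t; rewrite !mxE mulrC.
apply: (cder_eq (cderD (cder_cst _ _) (cderZ (v j 0) (cder_toC _)))).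
by rewrite add0r mulr1.
Qed.
Lemma line0 v z : z + toC 0 *: v = z :> V.
Proof. by rewrite toC0 scale0r addr0. Qed.
Lemma isdD f g v z d e : isd f v z d -> isd g v z e -> isd (fun w => f w + g w) v z (d + e).
Proof. exact: cderD. Qed.
Lemma isdN f v z d : isd f v z d -> isd (fun w => - f w) v z (- d).
Proof. exact: cderN. Qed.
Lemma isdM f g v z d e : isd f v z d -> isd g v z e ->
  isd (fun w => f w * g w) v z (d * g z + f z * e).
Proof. by move=> h1 h2; have := cderM h1 h2; rewrite !line0. Qed.
Lemma isd_conj f v z d : isd f v z d -> isd (fun w => Num.conj (f w)) v z (Num.conj d).
Proof. exact: cder_conj. Qed.
Lemma isdV f v z d : isd f v z d -> f z != 0 ->
  isd (fun w => (f w)^-1) v z (- d / f z ^+ 2).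
Proof. by move=> h h0; have := cder_V h; rewrite !line0; apply. Qed.
Lemma isd_sum (I : finType) (f : I -> V -> C) v z (d : I -> C) :
  (forall i, isd (f i) v z (d i)) -> isd (fun w => \sum_i f i w) v z (\sum_i d i).
Proof. by move=> h; exact: (cder_sum h). Qed.
Lemma contD f g z : {for z, continuous f} -> {for z, continuous g} ->
  {for z, continuous (fun w => f w + g w)}.
Proof. move=> h1 h2; exact: (@cvgD _ _ _ (nbhs z) _ f g _ _ h1 h2). Qed.
Lemma contM f g z : {for z, continuous f} -> {for z, continuous g} ->
  {for z, continuous (fun w => f w * g w)}.
Proof. move=> h1 h2; exact: (@cvgM _ _ (nbhs z) _ f g _ _ h1 h2). Qed.
Lemma cont_cst (c : C) z : {for z, continuous (fun=> c : C)}.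
Proof. by apply/contP => e e0; apply/nearvP; exists 1 => // w _; rewrite subrr cn0. Qed.
Lemma contV f z : f z != 0 -> {for z, continuous f} -> {for z, continuous (fun w => (f w)^-1)}.
Proof. move=> h1 h2; exact: (@cvgV _ _ (nbhs z) _ f _ h1 h2). Qed.
Lemma cont_conj f z : {for z, continuous f} -> {for z, continuous (fun w => Num.conj (f w))}.
Proof.
move=> /contP h; apply/contP => e e0; apply: filterS (h e e0) => w.
by rewrite -rmorphB cn_conj.
Qed.
Lemma cont_coord j z : {for z, continuous (fun w : V => w j 0)}.
Proof.
apply/contP => e e0; apply/nearvP; exists e => // w; apply: le_lt_trans.
by have := cn_vn (w - z) j; rewrite !mxE.
Qed.
Lemma Ck_cst k U (c : C) : open U -> Ck k U (fun=> c).
Proof.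
move=> oU; elim: k c => [|k IH] c; first by split=> // z _; exact: cont_cst.
apply: CkS => // [z _|v]; first exact: cont_cst.
exists (fun=> 0); split=> // z _; exact: isd_cst.
Qed.
Lemma Ck_coord k U j : open U -> Ck k U (fun w => w j 0).
Proof.
move=> oU; case: k => [|k]; first by split=> // z _; exact: cont_coord.
apply: CkS => // [z _|v]; first exact: cont_coord.
exists (fun=> v j 0); split=> [z _|]; [exact: isd_coord|exact: Ck_cst].
Qed.
Lemma Ck_add k U f g : open U -> Ck k U f -> Ck k U g -> Ck k U (fun w => f w + g w).
Proof.
move=> oU; elim: k f g => [|k IH] f g hf hg.
  by split=> // z Uz; apply: contD; [apply: Ck_cont hf Uz|apply: Ck_cont hg Uz].
apply: CkS => // [z Uz|v]; first by apply: contD; [apply: Ck_cont hf Uz|apply: Ck_cont hg Uz].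
exists (fun z => rderive f v z + rderive g v z); split.
  by move=> z Uz; exact: (isdD (Ck_isd v hf Uz) (Ck_isd v hg Uz)).
by apply: IH; apply: Ck_rderive.
Qed.
Lemma Ck_mul k U f g : open U -> Ck k U f -> Ck k U g -> Ck k U (fun w => f w * g w).
Proof.
move=> oU; elim: k f g => [|k IH] f g hf hg.
  by split=> // z Uz; apply: contM; [apply: Ck_cont hf Uz|apply: Ck_cont hg Uz].
apply: CkS => // [z Uz|v]; first by apply: contM; [apply: Ck_cont hf Uz|apply: Ck_cont hg Uz].
exists (fun z => rderive f v z * g z + f z * rderive g v z); split.
  by move=> z Uz; exact: (isdM (Ck_isd v hf Uz) (Ck_isd v hg Uz)).
by apply: Ck_add => //; apply: IH; (try exact: Ck_rderive); exact: Ck_pred.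
Qed.
Lemma Ck_conj k U f : open U -> Ck k U f -> Ck k U (fun w => Num.conj (f w)).
Proof.
move=> oU; elim: k f => [|k IH] f hf.
  by split=> // z Uz; apply: cont_conj; apply: Ck_cont hf Uz.
apply: CkS => // [z Uz|v]; first by apply: cont_conj; apply: Ck_cont hf Uz.
exists (fun z => Num.conj (rderive f v z)); split.
  by move=> z Uz; exact: (isd_conj (Ck_isd v hf Uz)).
by apply: IH; apply: Ck_rderive.
Qed.
Lemma Ck_opp k U f : open U -> Ck k U f -> Ck k U (fun w => - f w).
Proof.
move=> oU h; have := Ck_mul oU (Ck_cst k (-1) oU) h.
by apply: Ck_ext => // z _; rewrite mulN1r.
Qed.
Lemma Ck_inv k U f : open U -> (forall z, U z -> f z != 0) -> Ck k U f ->
  Ck k U (fun w => (f w)^-1).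
Proof.
move=> oU f0; elim: k f f0 => [|k IH] f f0 hf.
  by split=> // z Uz; apply: contV; [apply: f0|apply: Ck_cont hf Uz].
apply: CkS => // [z Uz|v]; first by apply: contV; [apply: f0|apply: Ck_cont hf Uz].
exists (fun z => - (rderive f v z) * ((f z)^-1 * (f z)^-1)); split.
  move=> z Uz; rewrite -invfM -expr2; apply: isdV; last exact: f0.
  exact: (Ck_isd v hf Uz).
have hi : Ck k U (fun w => (f w)^-1) by apply: IH => //; exact: Ck_pred.
by apply: Ck_mul => //; [apply: Ck_opp => //; apply: Ck_rderive|apply: Ck_mul].
Qed.
Lemma Ck_sum k U (I : Type) (s : seq I) (P : pred I) (f : I -> V -> C) : open U ->
  (forall i, P i -> Ck k U (f i)) -> Ck k U (fun w => \sum_(i <- s | P i) f i w).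
Proof.
move=> oU h; elim: s => [|i s IH].
  by apply: Ck_ext (Ck_cst k 0 oU) => // z _; rewrite big_nil.
case Pi : (P i).
  by apply: Ck_ext (Ck_add oU (h i Pi) IH) => // z _; rewrite big_cons Pi.
by apply: Ck_ext IH => // z _; rewrite big_cons Pi.
Qed.
Lemma Ck_prod k U (I : Type) (s : seq I) (P : pred I) (f : I -> V -> C) : open U ->
  (forall i, P i -> Ck k U (f i)) -> Ck k U (fun w => \prod_(i <- s | P i) f i w).
Proof.
move=> oU h; elim: s => [|i s IH].
  by apply: Ck_ext (Ck_cst k 1 oU) => // z _; rewrite big_nil.
case Pi : (P i).
  by apply: Ck_ext (Ck_mul oU (h i Pi) IH) => // z _; rewrite big_cons Pi.
by apply: Ck_ext IH => // z _; rewrite big_cons Pi.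
Qed.
Lemma Ck_rp k U f : open U -> Ck k U f -> Ck k U (fun w => toC (rp (f w))).
Proof.
move=> oU h; apply: Ck_ext (Ck_mul oU (Ck_cst k 2^-1 oU) (Ck_add oU h (Ck_conj oU h))) => //.
move=> z _; rewrite {1 2}(cplxE (f z)) rmorphD rmorphM /= conjCi !conj_toC.
by field.
Qed.
Lemma Ck_ip k U f : open U -> Ck k U f -> Ck k U (fun w => toC (ip (f w))).
Proof.
move=> oU h; have h' := Ck_rp oU (Ck_mul oU (Ck_cst k (- 'i) oU) h).
apply: Ck_ext h' => // z _; by congr toC; rewrite rpM /rp /ip /=; case: (f z) => a b /=; ring.
Qed.
Lemma rderive_rc U f v z : open U -> Ck 1 U f -> U z ->
  rderive f v z = \sum_k toC (rc v k) * rderive f (rb k) z.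
Proof.
move=> oU hf Uz; apply: isd_rderive.
have Uz' : U (z + toC 0 *: v) by rewrite line0.
have h := @cder_comp R n U f (fun k w => rderive f (rb k) w)
  (fun t => z + toC t *: v) v (open_near oU Uz') _ _ _.
have := h _ _ _; rewrite line0; apply.
- by move=> k w Uw; apply: Ck_isd hf Uw.
- move=> k; exact: (Ck_cont (Ck_rderive _ hf) Uz).
- by move=> j; exact: isd_coord.
Qed.
Lemma Clairaut U f v w z : open U -> Ck 2 U f -> U z ->
  rderive (rderive f v) w z = rderive (rderive f w) v z.
Proof.
move=> oU hf Uz.
(* second differences, divided by s^2, converge to both sides *)
have key v' w' : forall e : R, 0 < e -> exists2 b : R, 0 < b &
    forall s : R, 0 < s < b ->
    cn (f (z + toC s *: v' + toC s *: w') - f (z + toC s *: v') - f (z + toC s *: w') + f z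
      - toC s * (toC s * rderive (rderive f v') w' z)) <= e * s * s.
  move=> e e0.
  pose ds (i : bool) := if i then v' else w'.
  have hfv := Ck_rderive v' hf.
  (* Two remainders of size e/8 times lengths of at most 2s and s add up to 3/8 e s, below the e/2 s
     left by the factor 2 of the mean value inequality. *)
  have e8 : 0 < e / 8 by rewrite divr_gt0.
  have [b1 b10 hb] := @frechet_seq R n _ U (rderive f v') ds
    (fun i x => rderive (rderive f v') (ds i) x) z [:: true; false] (open_near oU Uz)
    (fun i x Ux => Ck_isd _ hfv Ux)
    (fun i => Ck_cont (Ck_rderive _ hfv) Uz) _ e8.
  have /nearvP[b2 b20 hb2] := open_near oU Uz.
  pose B := 1 + vn v' + vn w'.
  have B0 : 0 < B by rewrite /B; have := vn_ge0 v'; have := vn_ge0 w'; lra.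
  exists (Num.min b1 (b2 / B)); first by rewrite lt_min b10 divr_gt0.
  move=> s /andP[s0]; rewrite lt_min => /andP[sb1 sb2].
  have inU (x y : R) : 0 <= x <= 1 -> 0 <= y <= 1 ->
      U (z + toC (x * s) *: v' + toC (y * s) *: w').
    move=> /andP[x0 x1] /andP[y0 y1]; apply: hb2.
    rewrite -[z + _ + _]addrA [z + (_ + _)]addrC addrK; apply: (le_lt_trans (vnD _ _)).
    rewrite !vnZ !cn_toC !normrM !ger0_norm //; try exact: ltW.
    apply: (@le_lt_trans _ _ (s * B)); last by rewrite -ltr_pdivlMr.
    rewrite /B !mulrDr mulr1.
    have h1 : x * s * vn v' <= s * vn v' by rewrite ler_wpM2r ?vn_ge0 // ler_piMl // ltW.
    have h2 : y * s * vn w' <= s * vn w' by rewrite ler_wpM2r ?vn_ge0 // ler_piMl // ltW.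
    lra.
  (* The second difference is the increment of g along the segment in direction v', so its size is
     governed by the expansion of [rderive f v'] to first order. *)
  pose g t := f (z + toC s *: w' + toC t *: (toC s *: v')) - f (z + toC t *: (toC s *: v')).
  pose dg t := toC s * rderive f v' (z + toC s *: w' + toC t *: (toC s *: v'))
               - toC s * rderive f v' (z + toC t *: (toC s *: v')).
  have -> : f (z + toC s *: v' + toC s *: w') - f (z + toC s *: v') - f (z + toC s *: w') + f z
     = g 1 - g 0.
    rewrite /g toC1 !scale1r toC0 !scale0r !addr0 -[z + _ + toC s *: v']addrA.
    by rewrite [toC s *: w' + _]addrC addrA; ring.
  have -> : e * s * s = 2 * (s * (e / 2 * s)) by field.
  apply: (@cmvt _ g dg) => t ht.
    rewrite /g /dg; apply: cderD; last apply: cderN.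
      apply: isd_line; apply: isdZ; apply: Ck_isd hf _.
      rewrite scalerA -toCM addrAC -[s in toC s *: w']mul1r; apply: inU => //.
      by rewrite ler01 lexx.
    apply: isd_line; apply: isdZ; apply: Ck_isd hf _.
    rewrite scalerA -toCM -[z + _]addr0 -(scale0r w') -toC0 -(mul0r s); apply: inU => //.
    by rewrite ler01 lexx.
  rewrite /dg -mulrBr -mulrBr cnM cn_toC gtr0_norm // ler_wpM2l ?(ltW s0) //.
  have ts : `|t * s| < b1.
    case/andP: ht => t0 t1; rewrite normrM ger0_norm // gtr0_norm //.
    by apply: le_lt_trans sb1; rewrite ler_piMl // ltW.
  have hb' (x y : R) : `|x| < b1 -> `|y| < b1 ->
      cn (rderive f v' (z + (toC x *: v' + toC y *: w')) - rderive f v' z -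
        (toC x * rderive (rderive f v') v' z + toC y * rderive (rderive f v') w' z))
      <= e / 8 * (`|x| + `|y|).
    move=> hx hy; have := hb (fun i => if i then x else y).
    by rewrite !big_truefalse; apply; case.
  have sn : `|s| = s by rewrite gtr0_norm.
  have tsn : `|t * s| <= s.
    by case/andP: ht => t0 t1; rewrite normrM ger0_norm // sn ler_piMl // ltW.
  have sb1' : `|s| < b1 by rewrite sn.
  have H1 := hb' _ _ ts sb1'; have := hb' _ 0 ts; rewrite normr0 => /(_ b10) H2.
  move: H1 H2.
  rewrite toC0 scale0r mul0r !addr0.
  set P0 := rderive f v' z; set T := toC (t * s) * _.
  rewrite !scalerA -!toCM [z + _ + toC (t * s) *: v']addrAC -[z + _ + toC s *: w']addrA.
  set A1 := rderive f v' (z + (_ + _)); set A2 := rderive f v' (z + _).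
  move=> H1 H2.
  have -> : A1 - A2 - toC s * rderive (rderive f v') w' z =
    (A1 - P0 - (T + toC s * rderive (rderive f v') w' z)) - (A2 - P0 - T) by ring.
  apply: (le_trans (cnD _ _)); rewrite cnN; apply: (le_trans (lerD H1 H2)).
  rewrite sn -mulrDr.
  have : e / 8 * (`|t * s| + s + `|t * s|) <= e / 8 * (s + s + s).
    by rewrite ler_wpM2l ?(ltW e8) // !lerD.
  move=> hh; apply: (le_trans hh).
  have es : 0 < e * s by rewrite mulr_gt0.
  have -> : e / 8 * (s + s + s) = 3/8 * (e * s) by field.
  have -> : e / 2 * s = 1/2 * (e * s) by field.
  by rewrite ler_wpM2r ?(ltW es) //; lra.
apply/eqP; rewrite -subr_eq0 -cn_eq0 eq_le cn_ge0 andbT; apply/ler_addgt0Pl => e e0.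
rewrite addr0.
have e2 : 0 < e / 2 by rewrite divr_gt0.
have [b1 b10 h1] := key v w _ e2; have [b2 b20 h2] := key w v _ e2.
pose s := Num.min b1 b2 / 2.
have m0 : 0 < Num.min b1 b2 by rewrite lt_min b10.
have s0 : 0 < s by rewrite divr_gt0.
have sm : s < Num.min b1 b2 by rewrite /s ltr_pdivrMr // ltr_pMr // ltr1n.
move: (sm); rewrite lt_min => /andP[s1 s2].
have := h1 s; rewrite s0 s1 => /(_ isT) {}h1.
have := h2 s; rewrite s0 s2 => /(_ isT) {}h2.
move: h1 h2; generalize (rderive (rderive f v) w z) (rderive (rderive f w) v z) => a b.
rewrite [z + _ + toC s *: v]addrAC.
set x := f (_ + _ + _); set y := f (z + _); set y' := f (z + _); set q := f z => h1 h2.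
have h3 : cn (toC s * (toC s * (a - b))) <= e * s * s.
  have -> : toC s * (toC s * (a - b)) =
    (x - y' - y + q - toC s * (toC s * b)) - (x - y - y' + q - toC s * (toC s * a)) by ring.
  apply: (le_trans (cnD _ _)); rewrite cnN; apply: (le_trans (lerD h2 h1)).
  have -> : e / 2 * s * s + e / 2 * s * s = e * s * s by field.
  exact: lexx.
move: h3; rewrite !cnM cn_toC gtr0_norm // mulrA [s * s * _]mulrC -mulrA ler_pM2r //.
exact: mulr_gt0.
Qed.
End SmoothClosure.
Lemma conj_cplxE (R : realType) (x : Cplx R) :
  Num.conj x = toC (rp x) - 'i * toC (ip x).
Proof.
by apply: cplxP; rewrite ?rpB ?ipB ?rpM ?ipM ?rp_i ?ip_i ?rp_toC ?ip_toC ?rp_conj ?ip_conj; ring.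
Qed.

Section Composition.
Context {R : realType} {n m : nat}.
Local Notation C := (Cplx R).
Lemma cont_comp (f : 'cV[C]_m -> C) (psi : 'cV[C]_n -> 'cV[C]_m) z :
  (forall j, {for z, continuous (fun w => psi w j 0)}) -> {for psi z, continuous f} ->
  {for z, continuous (fun w => f (psi w))}.
Proof.
move=> h /contP hf; apply/contP => e e0.
have /nearvP[d d0 hd] := hf e e0.
have dm : 0 < d / m.+1%:R by rewrite divr_gt0.
have hj j : exists r : R, 0 < r /\ forall w, vn (w - z) < r -> cn (psi w j 0 - psi z j 0) < d / m.+1%:R.
  have /contP /(_ _ dm) /nearvP[r r0 hr] := h j.
  by exists r.
have [r hr] := choice hj.
apply/nearvP; exists (\big[Num.min/1]_j r j).
  by elim/big_ind: _ => // [x y x0 y0|j _]; rewrite ?lt_min ?x0 //; have [] := hr j.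
move=> w hw; apply: hd; apply: (@le_lt_trans _ _ (\sum_(j < m) (d / m.+1%:R))).
  apply: ler_sum => j _; rewrite !mxE ltW //; have [_] := hr j; apply.
  by apply: lt_le_trans hw _; rewrite (bigD1 j) //= ge_min lexx.
exact: sum_cst_lt.
Qed.
Lemma isd_comp (W : set 'cV[C]_m) (f : 'cV[C]_m -> C) (psi : 'cV[C]_n -> 'cV[C]_m)
    (v z : 'cV[C]_n) (d : 'cV[C]_m) :
  open W -> W (psi z) -> Ck 1 W f -> (forall j, isd (fun w => psi w j 0) v z (d j 0)) ->
  isd (fun w => f (psi w)) v z (\sum_k toC (rc d k) * rderive f (rb k) (psi z)).
Proof.
move=> oW Wz hf hd.
have Wz' : W (psi (z + toC 0 *: v)) by rewrite line0.
have h := @cder_comp R m W f (fun k w => rderive f (rb k) w)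
  (fun t => psi (z + toC t *: v)) d (open_near oW Wz') _ _ _.
have := h _ _ _; rewrite line0; apply.
- by move=> k w Uw; apply: Ck_isd hf Uw.
- move=> k; exact: (Ck_cont (Ck_rderive _ hf) Wz).
- by move=> j; exact: hd.
Qed.
Lemma Ck_comp k (U : set 'cV[C]_n) (W : set 'cV[C]_m) (f : 'cV[C]_m -> C)
    (psi : 'cV[C]_n -> 'cV[C]_m) : open U -> open W -> (forall z, U z -> W (psi z)) ->
  (forall j, Ck k U (fun w => psi w j 0)) -> Ck k W f -> Ck k U (fun w => f (psi w)).
Proof.
move=> oU oW UW; elim: k f => [|k IH] f hpsi hf.
  split=> // z Uz; apply: cont_comp; last by apply: Ck_cont hf (UW z Uz).
  by move=> j; apply: Ck_cont (hpsi j) Uz.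
apply: CkS => // [z Uz|v].
  apply: cont_comp; last by apply: Ck_cont hf (UW z Uz).
  by move=> j; apply: Ck_cont (hpsi j) Uz.
have hf1 : Ck 1 W f.
  by elim: (k) hf => // j IHj hj; apply: IHj; apply: Ck_pred.
exists (fun z => \sum_k toC (rc (\col_j rderive (fun w => psi w j 0) v z) k) *
   rderive f (rb k) (psi z)); split.
  move=> z Uz; apply: (isd_comp oW (UW z Uz) hf1) => j; rewrite mxE.
  exact: Ck_isd (hpsi j) Uz.
apply: Ck_sum => // -[j b] _; apply: Ck_mul => //.
  rewrite /rc /=; case: b.
    apply: Ck_ext (Ck_ip oU (Ck_rderive v (hpsi j))) => // z _; by rewrite mxE.
  by apply: Ck_ext (Ck_rp oU (Ck_rderive v (hpsi j))) => // z _; rewrite mxE.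
apply: IH; first by move=> i; apply: Ck_pred.
exact: Ck_rderive.
Qed.
End Composition.

Section Wirtinger.
Context {R : realType} {n : nat}.
Local Notation C := (Cplx R).
Local Notation V := 'cV[C]_n.
Implicit Types (f g : V -> C) (v w z : V) (U : set V).
Lemma rderive_dz U f v z : open U -> Ck 1 U f -> U z ->
  rderive f v z = \sum_j (v j 0 * dz j f z + Num.conj (v j 0) * dzbar j f z).
Proof.
move=> oU hf Uz; rewrite (rderive_rc v oU hf Uz).
rewrite -(pair_bigA _ (fun i b => toC (rc v (i, b)) * rderive f (rb (i, b)) z)) /=.
apply: eq_bigr => j _; rewrite big_bool /rc /rb /= /dz /dzbar.
rewrite conj_cplxE [in RHS](cplxE (v j 0)) rpD ipD !rpM !ipM rp_i ip_i !rp_toC !ip_toC !mul0r !mul1r !subr0 !addr0 !add0r.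
set a := toC (rp _); set b := toC (ip _); set x := rderive _ _ _; set y := rderive _ _ _.
have i2 : ('i : C) ^+ 2 = -1 by rewrite sqrCi.
have -> : (a + 'i * b) * (2^-1 * (y - 'i * x)) + (a - 'i * b) * (2^-1 * (y + 'i * x)) =
  a * y - 'i ^+ 2 * b * x by field.
by rewrite i2; ring.
Qed.
Lemma rderive_ext U f g v z : open U -> U z -> (forall w, U w -> f w = g w) -> Ck 1 U f ->
  rderive f v z = rderive g v z.
Proof. by move=> oU Uz fg hf; apply: (rderive_open_eq oU Uz fg); apply: isd_rderivable (Ck_isd v hf Uz). Qed.
Lemma dz_ext U f g k z : open U -> U z -> (forall w, U w -> f w = g w) -> Ck 1 U f ->
  dz k f z = dz k g z.
Proof. by move=> oU Uz fg hf; rewrite /dz !(rderive_ext _ oU Uz fg hf). Qed.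
Lemma dzbar_ext U f g k z : open U -> U z -> (forall w, U w -> f w = g w) -> Ck 1 U f ->
  dzbar k f z = dzbar k g z.
Proof. by move=> oU Uz fg hf; rewrite /dzbar !(rderive_ext _ oU Uz fg hf). Qed.
End Wirtinger.

(** * Germs of smooth functions and derivations *)

Section GermType.
Context {R : realType} {n : nat} (p : 'cV[Cplx R]_n).
Local Notation C := (Cplx R).
Local Notation V := 'cV[C]_n.
Implicit Types (f g h : V -> C) (z v : V) (U : set V).
Definition smn f : Prop := exists2 U, open_nbhs p U & smooth_on U f.
Definition neq f g : Prop := \forall z \near p, f z = g z.
Lemma nearI (P Q : V -> Prop) : (\forall z \near p, P z) -> (\forall z \near p, Q z) ->
  \forall z \near p, P z /\ Q z.
Proof. exact: filterI. Qed.
Lemma nearS (P Q : V -> Prop) : (forall z, P z -> Q z) -> (\forall z \near p, P z) ->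
  \forall z \near p, Q z.
Proof. exact: filterS. Qed.
Lemma neq_refl f : neq f f.
Proof. by apply/nearvP; exists 1. Qed.
Lemma neq_sym f g : neq f g -> neq g f.
Proof. by apply: filterS => z ->. Qed.
Lemma neq_trans f g h : neq f g -> neq g h -> neq f h.
Proof. by apply: filterS2 => z -> ->. Qed.
Lemma neq_p f g : neq f g -> f p = g p.
Proof. exact: nbhs_singleton. Qed.
Lemma near_open (P : V -> Prop) : (\forall z \near p, P z) ->
  exists2 U, open_nbhs p U & forall z, U z -> P z.
Proof.
move=> h; exists (interior P); last by move=> z; exact: interior_subset.
by split; [exact: open_interior|exact: h].
Qed.
Lemma smn_neq f g : neq f g -> smn f -> smn g.
Proof.
move=> /near_open[W [oW Wp] hW] [U [oU Up] hU].
exists (U `&` W); first by split; [exact: openI|split].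
have oI := openI oU oW.
move=> k; apply: (@Ck_ext _ _ _ _ f) => //; first by move=> z [_ /hW].
by apply: Ck_sub (hU k) => z [].
Qed.
Lemma smn2 f g : smn f -> smn g ->
  exists U, [/\ open U, U p, smooth_on U f & smooth_on U g].
Proof.
move=> [U [oU Up] hU] [W [oW Wp] hW]; exists (U `&` W); split=> //.
- exact: openI.
- by move=> k; apply: Ck_sub (hU k) => z [].
- by move=> k; apply: Ck_sub (hW k) => z [].
Qed.
Lemma smn_cst (c : C) : smn (fun=> c).
Proof. by exists setT; [split; [exact: openT|]|move=> k; apply: Ck_cst; exact: openT]. Qed.
Lemma smn_add f g : smn f -> smn g -> smn (fun w => f w + g w).
Proof.
move=> hf hg; have [U [oU Up h1 h2]] := smn2 hf hg.
by exists U => // k; apply: Ck_add.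
Qed.
Lemma smn_mul f g : smn f -> smn g -> smn (fun w => f w * g w).
Proof.
move=> hf hg; have [U [oU Up h1 h2]] := smn2 hf hg.
by exists U => // k; apply: Ck_mul.
Qed.
Lemma smn_opp f : smn f -> smn (fun w => - f w).
Proof. by move=> [U [oU Up] h1]; exists U => // k; apply: Ck_opp. Qed.
Lemma smn_conj f : smn f -> smn (fun w => Num.conj (f w)).
Proof. by move=> [U [oU Up] h1]; exists U => // k; apply: Ck_conj. Qed.
Lemma smn_cont f : smn f -> {for p, continuous f}.
Proof. by move=> [U [oU Up] h1]; apply: (Ck_cont (h1 0%N)). Qed.
Lemma cont_neq0 f z : {for z, continuous f} -> f z != 0 -> \forall w \near z, f w != 0.
Proof.
move=> /contP h f0; have c0 : 0 < cn (f z) by rewrite lt_def cn_eq0 f0 cn_ge0.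
apply: filterS (h _ c0) => w; apply: contraTneq => ->.
by rewrite sub0r cnN ltxx.
Qed.
Lemma smn_inv f : smn f -> f p != 0 -> smn (fun w => (f w)^-1).
Proof.
move=> hf f0; have /near_open[W [oW Wp] hW] := cont_neq0 (smn_cont hf) f0.
have [U [oU Up] hU] := hf.
exists (U `&` W); first by split; [exact: openI|split].
have oI := openI oU oW.
move=> k; apply: Ck_inv => //; first by move=> z [_ /hW].
by apply: Ck_sub (hU k) => z [].
Qed.
Lemma smn_rderive f v : smn f -> smn (rderive f v).
Proof. by move=> [U [oU Up] h1]; exists U => // k; apply: Ck_rderive. Qed.
Local Ltac smn_closed := repeat first [exact: smn_rderive|exact: smn_cst|apply: smn_mul|apply: smn_add|apply: smn_opp].
Lemma smn_dz f k : smn f -> smn (dz k f). Proof. by move=> hf; smn_closed. Qed.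
Lemma smn_dzbar f k : smn f -> smn (dzbar k f). Proof. by move=> hf; smn_closed. Qed.
Lemma smn_isd f v : smn f -> \forall z \near p, isd f v z (rderive f v z).
Proof.
move=> [U [oU Up] h1]; apply: filterS (open_near oU Up) => z Uz.
exact: Ck_isd (h1 1%N) Uz.
Qed.
Lemma near_near (P : V -> Prop) : (\forall z \near p, P z) ->
  \forall z \near p, \forall w \near z, P w.
Proof.
move=> /near_open[U [oU Up] h]; apply: filterS (open_near oU Up) => z Uz.
by apply: filterS (open_near oU Uz).
Qed.
Lemma neq_rderive f g v : smn f -> neq f g -> neq (rderive f v) (rderive g v).
Proof.
move=> hf /near_near fg; apply: filterS2 fg (smn_isd v hf) => z fg hz.
by rewrite (isd_rderive (isd_near fg hz)).
Qed.
Lemma neq_dz f g k : smn f -> neq f g -> neq (dz k f) (dz k g).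
Proof.
move=> hf fg; apply: filterS2 (neq_rderive (cbasis R k) hf fg) (neq_rderive ('i *: cbasis R k) hf fg) => z.
by rewrite /dz => -> ->.
Qed.
Lemma neq_dzbar f g k : smn f -> neq f g -> neq (dzbar k f) (dzbar k g).
Proof.
move=> hf fg; apply: filterS2 (neq_rderive (cbasis R k) hf fg) (neq_rderive ('i *: cbasis R k) hf fg) => z.
by rewrite /dzbar => -> ->.
Qed.
(** A representative chosen once per class of functions equal near p. Germs are the smooth functions
    that equal their own representative, so equality of germs is Leibniz equality and no quotient
    type is needed. *)
Definition gcanon f : V -> C := xget (fun=> 0) [set g | neq f g].
Lemma gcanonP f : neq f (gcanon f).
Proof. by rewrite /gcanon; case: xgetP => [g _ //|/(_ f)]; have := neq_refl f. Qed.
Lemma gcanon_eq f g : neq f g -> gcanon f = gcanon g.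
Proof.
move=> fg; rewrite /gcanon; congr xget; apply/seteqP; split=> h /=.
  exact: neq_trans (neq_sym fg).
exact: neq_trans fg.
Qed.

Record germ := Germ { gfun :> V -> C; gfunP : smn gfun /\ gfun = gcanon gfun }.
HB.instance Definition _ := gen_eqMixin germ.
HB.instance Definition _ := gen_choiceMixin germ.
Lemma gm_exists f : exists x : germ, smn f -> neq x f.
Proof.
have [h|nh] := pselect (smn f).
  exists (@Germ (gcanon f) (conj (smn_neq (gcanonP f) h) (gcanon_eq (gcanonP f)))) => _.
  by apply: neq_sym; exact: gcanonP.
by exists (@Germ (gcanon (fun=> 0))
  (conj (smn_neq (gcanonP (fun=> 0)) (smn_cst 0)) (gcanon_eq (gcanonP (fun=> 0))))).
Qed.
End GermType.
(** The germ of f when f is smooth near p, an arbitrary germ otherwise. The operations are locked to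
    keep conversion away from the chosen representatives. *)
HB.lock Definition gm (R : realType) (n : nat) (p : 'cV[Cplx R]_n)
  (f : 'cV[Cplx R]_n -> Cplx R) : germ p := projT1 (cid (gm_exists p f)).
HB.lock Definition gadd (R : realType) (n : nat) (p : 'cV[Cplx R]_n) (x y : germ p) :=
  gm p (fun z => x z + y z).
HB.lock Definition gopp (R : realType) (n : nat) (p : 'cV[Cplx R]_n) (x : germ p) :=
  gm p (fun z => - x z).
HB.lock Definition gmul (R : realType) (n : nat) (p : 'cV[Cplx R]_n) (x y : germ p) :=
  gm p (fun z => x z * y z).
HB.lock Definition gcst (R : realType) (n : nat) (p : 'cV[Cplx R]_n) (c : Cplx R) :=
  gm p (fun=> c).
HB.lock Definition gconj (R : realType) (n : nat) (p : 'cV[Cplx R]_n) (x : germ p) :=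
  gm p (fun z => Num.conj (x z)).
HB.lock Definition gdel (R : realType) (n : nat) (p : 'cV[Cplx R]_n) k (x : germ p) :=
  gm p (dz k x).
HB.lock Definition gdelb (R : realType) (n : nat) (p : 'cV[Cplx R]_n) k (x : germ p) :=
  gm p (dzbar k x).
HB.lock Definition gder (R : realType) (n : nat) (p : 'cV[Cplx R]_n)
  (v : 'cV[Cplx R]_n) (x : germ p) := gm p (rderive x v).

Arguments gm {R n} p f.
Arguments gadd {R n p} x y.
Arguments gopp {R n p} x.
Arguments gmul {R n p} x y.
Arguments gcst {R n} p c.
Arguments gconj {R n p} x.
Arguments gdel {R n p} k x.
Arguments gdelb {R n p} k x.
Arguments gder {R n p} v x.

Section Germs.
Context {R : realType} {n : nat} {p : 'cV[Cplx R]_n}.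
Local Notation C := (Cplx R).
Local Notation V := 'cV[C]_n.
Local Notation germ := (germ p).
Local Notation neq := (neq p).
Local Notation smn := (smn p).
Local Notation gm := (gm p).
Local Notation gcst := (gcst p).
Implicit Types (f g h : V -> C) (z v : V) (U : set V) (x y : germ).
Lemma gm_near f : smn f -> neq (gm f) f.
Proof. by rewrite unlock; case: cid. Qed.
Lemma germP (x y : germ) : neq x y -> x = y.
Proof.
case: x y => [f [hf ef]] [g [hg eg]] /= fg.
have E : f = g by rewrite ef eg; apply: gcanon_eq.
rewrite -E in hg eg *; congr Germ; exact: Prop_irrelevance.
Qed.
Lemma germ_sm (x : germ) : smn x. Proof. by case: x => f []. Qed.
(** A germ is a unit exactly when it does not vanish at p. On the other germs the inverse is the
    identity, as the unit ring structure demands. *)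
Definition ginv x := if x p != 0 then gm (fun z => (x z)^-1) else x.
Lemma gaddE x y : neq (gadd x y) (fun z => x z + y z).
Proof. by rewrite unlock; apply: gm_near; apply: smn_add; exact: germ_sm. Qed.
Lemma goppE x : neq (gopp x) (fun z => - x z).
Proof. by rewrite unlock; apply: gm_near; apply: smn_opp; exact: germ_sm. Qed.
Lemma gmulE x y : neq (gmul x y) (fun z => x z * y z).
Proof. by rewrite unlock; apply: gm_near; apply: smn_mul; exact: germ_sm. Qed.
Lemma gcstE c : neq (gcst c) (fun=> c).
Proof. by rewrite unlock; apply: gm_near; exact: smn_cst. Qed.
Lemma gconjE x : neq (gconj x) (fun z => Num.conj (x z)).
Proof. by rewrite unlock; apply: gm_near; apply: smn_conj; exact: germ_sm. Qed.
Lemma gdelE k x : neq (gdel k x) (dz k x).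
Proof. by rewrite unlock; apply: gm_near; apply: smn_dz; exact: germ_sm. Qed.
Lemma gdelbE k x : neq (gdelb k x) (dzbar k x).
Proof. by rewrite unlock; apply: gm_near; apply: smn_dzbar; exact: germ_sm. Qed.
Lemma gderE v x : neq (gder v x) (rderive x v).
Proof. by rewrite unlock; apply: gm_near; apply: smn_rderive; exact: germ_sm. Qed.
Lemma gaddA : associative (@gadd R n p).
Proof.
move=> x y z; apply: germP.
apply: nearS (nearI (nearI (gaddE x (gadd y z)) (gaddE y z)) (nearI (gaddE (gadd x y) z) (gaddE x y))) => w /= [[-> ->] [-> ->]]; by rewrite addrA.
Qed.
Lemma gaddC : commutative (@gadd R n p).
Proof.
move=> x y; apply: germP.
apply: nearS (nearI (gaddE x y) (gaddE y x)) => w /= [-> ->]; by rewrite addrC.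
Qed.
Lemma gadd0 : left_id (gcst 0) gadd.
Proof.
move=> x; apply: germP.
apply: nearS (nearI (gaddE (gcst 0) x) (gcstE 0)) => w /= [-> ->]; by rewrite add0r.
Qed.
Lemma gaddN : left_inverse (gcst 0) gopp gadd.
Proof.
move=> x; apply: germP.
apply: nearS (nearI (nearI (gaddE (gopp x) x) (goppE x)) (gcstE 0)) => w /= [[-> ->] ->]; by rewrite addNr.
Qed.
HB.instance Definition _ := GRing.isZmodule.Build germ gaddA gaddC gadd0 gaddN.
Lemma gmulA : associative (@gmul R n p).
Proof.
move=> x y z; apply: germP.
apply: nearS (nearI (nearI (gmulE x (gmul y z)) (gmulE y z)) (nearI (gmulE (gmul x y) z) (gmulE x y))) => w /= [[-> ->] [-> ->]]; by rewrite mulrA.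
Qed.
Lemma gmulC : commutative (@gmul R n p).
Proof.
move=> x y; apply: germP.
apply: nearS (nearI (gmulE x y) (gmulE y x)) => w /= [-> ->]; by rewrite mulrC.
Qed.
Lemma gmul1 : left_id (gcst 1) gmul.
Proof.
move=> x; apply: germP.
apply: nearS (nearI (gmulE (gcst 1) x) (gcstE 1)) => w /= [-> ->]; by rewrite mul1r.
Qed.
Lemma gmulD : left_distributive (@gmul R n p) gadd.
Proof.
move=> x y z; apply: germP.
apply: nearS (nearI (nearI (gmulE (gadd x y) z) (gaddE x y))
  (nearI (gaddE (gmul x z) (gmul y z)) (nearI (gmulE x z) (gmulE y z)))) => w /= [[-> ->] [-> [-> ->]]]; by rewrite mulrDl.
Qed.
Lemma gone0 : gcst 1 != gcst 0.
Proof.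
apply/eqP => e; have := neq_p (gcstE 1); rewrite e (neq_p (gcstE 0)) => /eqP.
by rewrite eq_sym oner_eq0.
Qed.
HB.instance Definition _ := GRing.Zmodule_isComNzRing.Build germ gmulA gmulC gmul1 gmulD gone0.
Definition gunit : pred germ := fun x => x p != 0.
Lemma gmulV : {in gunit, left_inverse 1 ginv *%R}.
Proof.
move=> x; rewrite unfold_in => x0; apply: germP; rewrite /ginv x0.
have h1 := gm_near (smn_inv (germ_sm x) x0).
have h2 := gmulE (gm (fun z => (x z)^-1)) x.
have h3 := cont_neq0 (smn_cont (germ_sm x)) x0.
apply: nearS (nearI (nearI h1 h2) (nearI h3 (gcstE 1))) => w /= [[e1 ->] [h ->]]; by rewrite e1 mulVf.
Qed.
Lemma gunitP (x y : germ) : y * x = 1 -> gunit x.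
Proof.
move=> e; rewrite /gunit; apply/eqP => x0.
have := neq_p (gmulE y x); rewrite -[gmul y x]/(y * x) e (neq_p (gcstE 1)) x0 mulr0.
by move/eqP; rewrite oner_eq0.
Qed.
Lemma ginv0 : {in [predC gunit], ginv =1 id}.
Proof. by move=> x; rewrite inE /= unfold_in /gunit /ginv negbK => /eqP ->; rewrite eqxx. Qed.
HB.instance Definition _ := GRing.ComNzRing_hasMulInverse.Build germ gmulV gunitP ginv0.
Lemma gderD v x y : gder v (x + y) = gder v x + gder v y.
Proof.
apply: germP; have [U [oU Up h1 h2]] := smn2 (germ_sm x) (germ_sm y).
have h := neq_trans (gderE v (x + y)) (neq_rderive v (germ_sm (gadd x y)) (gaddE x y)).
apply: nearS (nearI (nearI h (gaddE (gder v x) (gder v y)))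
  (nearI (open_near oU Up) (nearI (gderE v x) (gderE v y)))) => w [[-> ->] [Uw [-> ->]]].
exact: (isd_rderive (isdD (Ck_isd v (h1 1%N) Uw) (Ck_isd v (h2 1%N) Uw))).
Qed.
Lemma gderM v x y : gder v (x * y) = gder v x * y + x * gder v y.
Proof.
apply: germP; have [U [oU Up h1 h2]] := smn2 (germ_sm x) (germ_sm y).
have h := neq_trans (gderE v (x * y)) (neq_rderive v (germ_sm (gmul x y)) (gmulE x y)).
apply: nearS (nearI (nearI h (gaddE (gder v x * y) (x * gder v y)))
  (nearI (nearI (gmulE (gder v x) y) (gmulE x (gder v y)))
  (nearI (open_near oU Up) (nearI (gderE v x) (gderE v y))))) => w
  [[-> ->] [[-> ->] [Uw [-> ->]]]].
exact: (isd_rderive (isdM (Ck_isd v (h1 1%N) Uw) (Ck_isd v (h2 1%N) Uw))).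
Qed.
Lemma gder_cst v c : gder v (gcst c) = 0.
Proof.
apply: germP; have h := neq_trans (gderE v (gcst c)) (neq_rderive v (germ_sm _) (gcstE c)).
apply: nearS (nearI h (gcstE 0)) => w [-> ->].
exact: isd_rderive (isd_cst _ _ _).
Qed.
Lemma gderC v w x : gder v (gder w x) = gder w (gder v x).
Proof.
apply: germP; have [U [oU Up] hU] := germ_sm x.
have h a b := neq_trans (gderE a (gder b x)) (neq_rderive a (germ_sm _) (gderE b x)).
apply: nearS (nearI (nearI (h v w) (h w v)) (open_near oU Up)) => z [[-> ->] Uz].
exact: Clairaut oU (hU 2%N) Uz.
Qed.
Lemma gder_conj v x : gder v (gconj x) = gconj (gder v x).
Proof.
apply: germP; have [U [oU Up] hU] := germ_sm x.
have h := neq_trans (gderE v (gconj x)) (neq_rderive v (germ_sm _) (gconjE x)).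
apply: nearS (nearI (nearI h (gconjE (gder v x))) (nearI (gderE v x) (open_near oU Up))) => z
  [[-> ->] [-> Uz]].
exact: isd_rderive (isd_conj (Ck_isd v (hU 1%N) Uz)).
Qed.
Lemma gcst_is_zmod_morphism : zmod_morphism gcst.
Proof.
move=> a b; apply: germP.
apply: nearS (nearI (nearI (gcstE (a - b)) (gaddE (gcst a) (- gcst b)))
  (nearI (goppE (gcst b)) (nearI (gcstE a) (gcstE b)))) => z [[-> ->] [-> [-> ->]]].
by [].
Qed.
HB.instance Definition _ := GRing.isZmodMorphism.Build C germ gcst gcst_is_zmod_morphism.
Lemma gcst_is_monoid_morphism : monoid_morphism gcst.
Proof.
split=> // a b; apply: germP.
by apply: nearS (nearI (nearI (gcstE (a * b)) (gmulE (gcst a) (gcst b)))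
  (nearI (gcstE a) (gcstE b))) => z [[-> ->] [-> ->]].
Qed.
HB.instance Definition _ := GRing.isMonoidMorphism.Build C germ gcst gcst_is_monoid_morphism.
Lemma gconj_is_zmod_morphism : zmod_morphism (@gconj R n p).
Proof.
move=> a b; apply: germP.
apply: nearS (nearI (nearI (gconjE (a - b)) (gaddE a (- b)))
  (nearI (nearI (gaddE (gconj a) (- gconj b)) (nearI (goppE b) (goppE (gconj b))))
  (nearI (gconjE a) (gconjE b)))) => z [[-> ->] [[-> [-> ->]] [-> ->]]].
by rewrite rmorphB.
Qed.
HB.instance Definition _ := GRing.isZmodMorphism.Build germ germ (@gconj R n p) gconj_is_zmod_morphism.
Lemma gconj_is_monoid_morphism : monoid_morphism (@gconj R n p).
Proof.
split.
  by apply: germP; apply: nearS (nearI (gconjE 1) (gcstE 1)) => z [-> ->]; rewrite rmorph1.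
move=> a b; apply: germP.
by apply: nearS (nearI (nearI (gconjE (a * b)) (gmulE a b))
  (nearI (gmulE (gconj a) (gconj b)) (nearI (gconjE a) (gconjE b)))) => z [[-> ->] [-> [-> ->]]];
  rewrite rmorphM.
Qed.
HB.instance Definition _ := GRing.isMonoidMorphism.Build germ germ (@gconj R n p) gconj_is_monoid_morphism.
Lemma gconjK : involutive (@gconj R n p).
Proof.
move=> x; apply: germP.
by apply: nearS (nearI (gconjE (gconj x)) (gconjE x)) => z [-> ->]; rewrite conjCK.
Qed.
Lemma gconj_cst c : gconj (gcst c) = gcst (Num.conj c).
Proof.
by apply: germP; apply: nearS (nearI (gconjE (gcst c)) (nearI (gcstE c) (gcstE (Num.conj c))))
  => z [-> [-> ->]].
Qed.
Lemma gdel_gder k x :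
  gdel k x = gcst 2^-1 * (gder (cbasis R k) x - gcst 'i * gder ('i *: cbasis R k) x).
Proof.
apply: germP; set a := gder _ x; set b := gder _ x.
apply: nearS (nearI (nearI (gdelE k x) (nearI (gmulE (gcst 2^-1) (a - gcst 'i * b)) (gcstE 2^-1)))
 (nearI (nearI (gaddE a (- (gcst 'i * b))) (goppE (gcst 'i * b)))
 (nearI (gmulE (gcst 'i) b) (nearI (gcstE 'i) (nearI (gderE (cbasis R k) x) (gderE ('i *: cbasis R k) x)))))) => z
 [[-> [-> ->]] [[-> ->] [-> [-> [-> ->]]]]].
by [].
Qed.
Lemma gdelb_gder k x :
  gdelb k x = gcst 2^-1 * (gder (cbasis R k) x + gcst 'i * gder ('i *: cbasis R k) x).
Proof.
apply: germP; set a := gder _ x; set b := gder _ x.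
apply: nearS (nearI (nearI (gdelbE k x) (nearI (gmulE (gcst 2^-1) (a + gcst 'i * b)) (gcstE 2^-1)))
 (nearI (gaddE a (gcst 'i * b))
 (nearI (gmulE (gcst 'i) b) (nearI (gcstE 'i) (nearI (gderE (cbasis R k) x) (gderE ('i *: cbasis R k) x)))))) => z
 [[-> [-> ->]] [-> [-> [-> [-> ->]]]]].
by [].
Qed.
(** This is what allows d/dzbar to be a derived notion in the abstract rings below. *)
Lemma gdelb_conj k x : gdelb k x = gconj (gdel k (gconj x)).
Proof.
rewrite gdelb_gder gdel_gder.
have gM (a b : germ) : gconj (a * b) = gconj a * gconj b by exact: (rmorphM (@gconj R n p)).
have gB (a b : germ) : gconj (a - b) = gconj a - gconj b by exact: (raddfB (@gconj R n p)).
rewrite gM gB gM !gconj_cst !gder_conj !gconjK conjCi.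
have e : (2^-1 : C) = toC 2^-1 by rewrite /toC fmorphV rmorph_nat.
have -> : Num.conj (2^-1 : C) = 2^-1 by rewrite e conj_toC.
by rewrite (rmorphN gcst) mulNr opprK.
Qed.
Lemma gdel_is_zmod_morphism k : zmod_morphism (@gdel R n p k).
Proof.
move=> x y; rewrite !gdel_gder.
have gderB v : gder v (x - y) = gder v x - gder v y.
  by apply/eqP; rewrite -[x]/(x) eq_sym subr_eq -gderD subrK.
by rewrite !gderB; ring.
Qed.
HB.instance Definition _ k := GRing.isZmodMorphism.Build germ germ (@gdel R n p k) (gdel_is_zmod_morphism k).
Lemma gdelM k x y : gdel k (x * y) = gdel k x * y + x * gdel k y.
Proof. by rewrite !gdel_gder !gderM; ring. Qed.
Lemma gdel_cst k c : gdel k (gcst c) = 0.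
Proof. by rewrite gdel_gder !gder_cst; ring. Qed.
Lemma gder_cstM v c x : gder v (gcst c * x) = gcst c * gder v x.
Proof. by rewrite gderM gder_cst mul0r add0r. Qed.
Lemma gderN v x : gder v (- x) = - gder v x.
Proof. by rewrite -mulN1r -(rmorphN1 gcst) gder_cstM rmorphN1 mulN1r. Qed.
Lemma gder_gdel v k x : gder v (gdel k x) = gdel k (gder v x).
Proof. by rewrite !gdel_gder gder_cstM gderD gderN gder_cstM !(gderC v). Qed.
Lemma gdelC j k x : gdel j (gdel k x) = gdel k (gdel j x).
Proof.
rewrite (gdel_gder j (gdel k x)) !gder_gdel (gdel_gder j x).
by rewrite gdelM gdel_cst mul0r add0r raddfB /= gdelM gdel_cst mul0r add0r.
Qed.
Lemma gdel_delb j k x : gdel j (gdelb k x) = gdelb k (gdel j x).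
Proof.
rewrite (gdelb_gder k (gdel j x)) !gder_gdel (gdelb_gder k x).
by rewrite gdelM gdel_cst mul0r add0r raddfD /= gdelM gdel_cst mul0r add0r.
Qed.
Definition gev (x : germ) : C := x p.
Lemma gev_is_zmod_morphism : zmod_morphism gev.
Proof.
move=> x y; rewrite /gev.
have := neq_p (gaddE x (- y)); rewrite (neq_p (goppE y)); exact.
Qed.
HB.instance Definition _ := GRing.isZmodMorphism.Build germ C gev gev_is_zmod_morphism.
Lemma gev_is_monoid_morphism : monoid_morphism gev.
Proof. by split; [exact: (neq_p (gcstE 1))|move=> x y; exact: (neq_p (gmulE x y))]. Qed.
HB.instance Definition _ := GRing.isMonoidMorphism.Build germ C gev gev_is_monoid_morphism.
Lemma gev_cst c : gev (gcst c) = c. Proof. exact: (neq_p (gcstE c)). Qed.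
Lemma gev_conj x : gev (gconj x) = Num.conj (gev x). Proof. exact: (neq_p (gconjE x)). Qed.
Lemma gunitE x : (x \is a GRing.unit) = (gev x != 0).
Proof. by []. Qed.
End Germs.

(* Commutative rings with commuting derivations d/dz_k and a conjugation; the
   derivations d/dzbar_k are the conjugates of the d/dz_k. *)
Record dring (R : realType) (n : nat) := DRing {
  dA :> comUnitRingType;
  dscal : {rmorphism Cplx R -> dA};
  dcj : {rmorphism dA -> dA};
  ddel : 'I_n -> {additive dA -> dA};
  dcjK : involutive dcj;
  dcj_scal : forall c, dcj (dscal c) = dscal (Num.conj c);
  ddelM : forall k x y, ddel k (x * y) = ddel k x * y + x * ddel k y;
  ddel_scal : forall k c, ddel k (dscal c) = 0;
  ddelC : forall j k x, ddel j (ddel k x) = ddel k (ddel j x);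
  ddel_delb : forall j k x,
    ddel j (dcj (ddel k (dcj x))) = dcj (ddel k (dcj (ddel j x)))
}.
Lemma gdel_delb' (R : realType) (n : nat) (p : 'cV[Cplx R]_n) j k (x : germ p) :
  gdel j (gconj (gdel k (gconj x))) = gconj (gdel k (gconj (gdel j x))).
Proof. by rewrite -!gdelb_conj gdel_delb. Qed.
Definition germ_dring (R : realType) (n : nat) (p : 'cV[Cplx R]_n) : dring R n :=
  @DRing R n (germ p) (gcst p) (@gconj R n p) (@gdel R n p)
    (@gconjK R n p) (@gconj_cst R n p) (@gdelM R n p) (@gdel_cst R n p) (@gdelC R n p)
    (@gdel_delb' R n p).

(** * Matrices over a ring with derivations and conjugation *)

Section MatrixDerivations.
Context {R : realType} {n : nat} {A : dring R n}.
Implicit Types (x y : A) (j k l : 'I_n).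
Definition del k x : A := ddel A k x.
Definition cj x : A := dcj A x.
Definition delb k x : A := cj (del k (cj x)).
Definition cs (c : Cplx R) : A := dscal A c.
Lemma delD k x y : del k (x + y) = del k x + del k y. Proof. exact: raddfD. Qed.
Lemma delN k x : del k (- x) = - del k x. Proof. exact: raddfN. Qed.
Lemma delB k x y : del k (x - y) = del k x - del k y. Proof. exact: raddfB. Qed.
Lemma del0 k : del k 0 = 0. Proof. exact: raddf0. Qed.
Lemma delM k x y : del k (x * y) = del k x * y + x * del k y. Proof. exact: ddelM. Qed.
Lemma del_sum k (I : Type) (s : seq I) (P : pred I) (f : I -> A) :
  del k (\sum_(i <- s | P i) f i) = \sum_(i <- s | P i) del k (f i).
Proof. exact: raddf_sum. Qed.
Lemma del_cs k c : del k (cs c) = 0. Proof. exact: ddel_scal. Qed.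
Lemma cjD x y : cj (x + y) = cj x + cj y. Proof. exact: raddfD. Qed.
Lemma cjN x : cj (- x) = - cj x. Proof. exact: raddfN. Qed.
Lemma cjB x y : cj (x - y) = cj x - cj y. Proof. exact: raddfB. Qed.
Lemma cjM x y : cj (x * y) = cj x * cj y. Proof. exact: rmorphM. Qed.
Lemma cj0 : cj 0 = 0. Proof. exact: raddf0. Qed.
Lemma cj1 : cj 1 = 1. Proof. exact: rmorph1. Qed.
Lemma cjK x : cj (cj x) = x. Proof. exact: dcjK. Qed.
Lemma cj_cs c : cj (cs c) = cs (Num.conj c). Proof. exact: dcj_scal. Qed.
Lemma cj_sum (I : Type) (s : seq I) (P : pred I) (f : I -> A) :
  cj (\sum_(i <- s | P i) f i) = \sum_(i <- s | P i) cj (f i).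
Proof. exact: raddf_sum. Qed.
Lemma cj_nat (m : nat) : cj m%:R = m%:R. Proof. exact: rmorph_nat. Qed.
Lemma csM a b : cs (a * b) = cs a * cs b. Proof. exact: rmorphM. Qed.
Lemma csN a : cs (- a) = - cs a. Proof. exact: rmorphN. Qed.
Lemma cs1 : cs 1 = 1. Proof. exact: rmorph1. Qed.
Lemma cs_nat (m : nat) : cs m%:R = m%:R. Proof. exact: rmorph_nat. Qed.
Lemma del1 k : del k 1 = 0. Proof. by rewrite -cs1 del_cs. Qed.
Lemma del_nat k m : del k m%:R = 0. Proof. by rewrite -cs_nat del_cs. Qed.
Lemma delbD k x y : delb k (x + y) = delb k x + delb k y.
Proof. by rewrite /delb cjD delD cjD. Qed.
Lemma delbN k x : delb k (- x) = - delb k x.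
Proof. by rewrite /delb cjN delN cjN. Qed.
Lemma delbB k x y : delb k (x - y) = delb k x - delb k y.
Proof. by rewrite delbD delbN. Qed.
Lemma delb0 k : delb k 0 = 0. Proof. by rewrite /delb cj0 del0 cj0. Qed.
Lemma delbM k x y : delb k (x * y) = delb k x * y + x * delb k y.
Proof. by rewrite /delb cjM delM cjD !cjM !cjK. Qed.
Lemma delb_sum k (I : Type) (s : seq I) (P : pred I) (f : I -> A) :
  delb k (\sum_(i <- s | P i) f i) = \sum_(i <- s | P i) delb k (f i).
Proof. by rewrite /delb cj_sum del_sum cj_sum. Qed.
Lemma delb_cs k c : delb k (cs c) = 0. Proof. by rewrite /delb cj_cs del_cs cj0. Qed.
Lemma delb_nat k m : delb k m%:R = 0. Proof. by rewrite -cs_nat delb_cs. Qed.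
Lemma delC j k x : del j (del k x) = del k (del j x). Proof. exact: ddelC. Qed.
Lemma del_delb j k x : del j (delb k x) = delb k (del j x). Proof. exact: ddel_delb. Qed.
Lemma del_cj k x : del k (cj x) = cj (delb k x). Proof. by rewrite /delb cjK. Qed.
Lemma delb_cj k x : delb k (cj x) = cj (del k x). Proof. by rewrite /delb cjK. Qed.
Lemma delb_real k x : cj x = x -> delb k x = cj (del k x).
Proof. by rewrite /delb => ->. Qed.
Lemma nat_unit m : (m.+1%:R : A) \is a GRing.unit.
Proof.
apply/unitrP; exists (cs m.+1%:R^-1); rewrite -cs_nat -!csM.
by rewrite mulVf ?pnatr_eq0 // divff ?pnatr_eq0 // cs1.
Qed.
Lemma nat_cancel m x y : m.+1%:R * x = m.+1%:R * y -> x = y.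
Proof. exact: (mulrI (nat_unit m)). Qed.

Section Mx.
Variables (a b c : nat).
Implicit Types (M : 'M[A]_(a, b)) (N : 'M[A]_(b, c)).
Definition D k (M : 'M[A]_(a, b)) := map_mx (del k) M.
Definition Db k (M : 'M[A]_(a, b)) := map_mx (delb k) M.
Definition star (M : 'M[A]_(a, b)) : 'M[A]_(b, a) := map_mx cj M^T.
End Mx.

Section MxTheory.
Variables (a b c : nat).
Implicit Types (M : 'M[A]_(a, b)) (N : 'M[A]_(b, c)).
Lemma addE M M' (i : 'I_a) (j : 'I_b) : (M + M') i j = M i j + M' i j. Proof. by rewrite mxE. Qed.
Lemma oppE M (i : 'I_a) (j : 'I_b) : (- M) i j = - M i j. Proof. by rewrite mxE. Qed.
Lemma scaleE x M (i : 'I_a) (j : 'I_b) : (x *: M) i j = x * M i j. Proof. by rewrite mxE. Qed.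
Lemma DE k M (i : 'I_a) (j : 'I_b) : D k M i j = del k (M i j). Proof. by rewrite mxE. Qed.
Lemma DbE k M (i : 'I_a) (j : 'I_b) : Db k M i j = delb k (M i j). Proof. by rewrite mxE. Qed.
Lemma starE M (i : 'I_b) (j : 'I_a) : star M i j = cj (M j i). Proof. by rewrite !mxE. Qed.
Lemma D_add k M M' : D k (M + M') = D k M + D k M'.
Proof. by apply/matrixP => i j; rewrite !mxE delD. Qed.
Lemma D_opp k M : D k (- M) = - D k M.
Proof. by apply/matrixP => i j; rewrite !mxE delN. Qed.
Lemma D_scale k x M : D k (x *: M) = del k x *: M + x *: D k M.
Proof. by apply/matrixP => i j; rewrite !mxE delM. Qed.
Lemma D_zero k : D k (0 : 'M[A]_(a, b)) = 0.
Proof. by apply/matrixP => i j; rewrite !mxE del0. Qed.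
Lemma Db_add k M M' : Db k (M + M') = Db k M + Db k M'.
Proof. by apply/matrixP => i j; rewrite !mxE delbD. Qed.
Lemma Db_opp k M : Db k (- M) = - Db k M.
Proof. by apply/matrixP => i j; rewrite !mxE delbN. Qed.
Lemma Db_scale k x M : Db k (x *: M) = delb k x *: M + x *: Db k M.
Proof. by apply/matrixP => i j; rewrite !mxE delbM. Qed.
Lemma Db_zero k : Db k (0 : 'M[A]_(a, b)) = 0.
Proof. by apply/matrixP => i j; rewrite !mxE delb0. Qed.
Lemma D_mul k M N : D k (M *m N) = D k M *m N + M *m D k N.
Proof.
apply/matrixP => i j; rewrite !mxE del_sum -big_split /=; apply: eq_bigr => h _.
by rewrite delM !mxE.
Qed.
Lemma Db_mul k M N : Db k (M *m N) = Db k M *m N + M *m Db k N.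
Proof.
apply/matrixP => i j; rewrite !mxE delb_sum -big_split /=; apply: eq_bigr => h _.
by rewrite delbM !mxE.
Qed.
Lemma star_add M M' : star (M + M') = star M + star M'.
Proof. by apply/matrixP => i j; rewrite !mxE cjD. Qed.
Lemma star_opp M : star (- M) = - star M.
Proof. by apply/matrixP => i j; rewrite !mxE cjN. Qed.
Lemma star_scale x M : star (x *: M) = cj x *: star M.
Proof. by apply/matrixP => i j; rewrite !mxE cjM. Qed.
Lemma star_mul M N : star (M *m N) = star N *m star M.
Proof.
apply/matrixP => i j; rewrite !mxE cj_sum; apply: eq_bigr => h _.
by rewrite cjM !mxE mulrC.
Qed.
Lemma star0 : star (0 : 'M[A]_(a, b)) = 0.
Proof. by apply/matrixP => i j; rewrite !mxE cj0. Qed.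
Lemma D_star k M : D k (star M) = star (Db k M).
Proof. by apply/matrixP => i j; rewrite !mxE del_cj. Qed.
Lemma Db_star k M : Db k (star M) = star (D k M).
Proof. by apply/matrixP => i j; rewrite !mxE delb_cj. Qed.
Lemma D_comm j k M : D j (D k M) = D k (D j M).
Proof. by apply/matrixP => i h; rewrite !mxE delC. Qed.
Lemma D_Db j k M : D j (Db k M) = Db k (D j M).
Proof. by apply/matrixP => i h; rewrite !mxE del_delb. Qed.
End MxTheory.
Lemma starK (a b : nat) (M : 'M[A]_(a, b)) : star (star M) = M.
Proof. by apply/matrixP => i j; rewrite !mxE cjK. Qed.
Lemma star1 (a : nat) : star (1%:M : 'M[A]_a) = 1%:M.
Proof. by apply/matrixP => i j; rewrite !mxE eq_sym cj_nat. Qed.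
Lemma D_1 k (a : nat) : D k (1%:M : 'M[A]_a) = 0.
Proof. by apply/matrixP => i j; rewrite !mxE del_nat. Qed.
Lemma Db_1 k (a : nat) : Db k (1%:M : 'M[A]_a) = 0.
Proof. by apply/matrixP => i j; rewrite !mxE delb_nat. Qed.
Lemma D_tr k (a : nat) (M : 'M[A]_a) : del k (\tr M) = \tr (D k M).
Proof. by rewrite /mxtrace del_sum; apply: eq_bigr => i _; rewrite mxE. Qed.
Lemma Db_tr k (a : nat) (M : 'M[A]_a) : delb k (\tr M) = \tr (Db k M).
Proof. by rewrite /mxtrace delb_sum; apply: eq_bigr => i _; rewrite mxE. Qed.
Lemma inv_rule (a : nat) (M N P Q : 'M[A]_a) : M *m N = 1%:M -> P *m N + M *m Q = 0 -> Q = - (N *m P *m N).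
Proof.
move=> MN; have NM := mulmx1C MN; move=> /(congr1 (mulmx N)).
rewrite mulmxDr [N *m (M *m _)]mulmxA NM mul1mx mulmx0 mulmxA => /eqP.
by rewrite addrC addr_eq0 => /eqP.
Qed.
Lemma D_inv k (a : nat) (M N : 'M[A]_a) : M *m N = 1%:M -> D k N = - (N *m D k M *m N).
Proof. by move=> MN; apply: (inv_rule MN); rewrite -D_mul MN D_1. Qed.
Lemma Db_inv k (a : nat) (M N : 'M[A]_a) : M *m N = 1%:M -> Db k N = - (N *m Db k M *m N).
Proof. by move=> MN; apply: (inv_rule MN); rewrite -Db_mul MN Db_1. Qed.
Lemma sum_delta (a : nat) (f : 'I_a -> A) m : \sum_k (k == m)%:R * f k = f m.
Proof.
rewrite (bigD1 m) //= eqxx mul1r big1 ?addr0 // => k /negPf ->; by rewrite mul0r.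
Qed.
Lemma sum_delta' (a : nat) (f : 'I_a -> A) m : \sum_k f k * (k == m)%:R = f m.
Proof. by rewrite -[RHS](sum_delta f); apply: eq_bigr => k _; rewrite mulrC. Qed.
End MatrixDerivations.

Arguments star {R n A a b} M.
Arguments D {R n A a b} k M.
Arguments Db {R n A a b} k M.

(** * Christoffel symbols and curvature of a Kähler metric *)

Section Kaehler.
Context {R : realType} {n : nat} {A : dring R n}.
Implicit Types (j k l i m : 'I_n).
Local Notation del := (@del R n A).
Local Notation delb := (@delb R n A).
Variables (G Gi : 'M[A]_n).
Hypothesis GGi : G *m Gi = 1%:M.
Hypothesis Gstar : star G = G.
Hypothesis Gsym : forall k i l, del k (G i l) = del i (G k l).
(** The connection matrix of the metric: the entry (i, m) is the Christoffel symbol with lower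
    indices k, i and upper index m. *)
Definition Gam k : 'M[A]_n := locked (D k G *m Gi).
Lemma GamE k : Gam k = D k G *m Gi. Proof. by rewrite /Gam -lock. Qed.
(** The curvature with one index raised: lowering m in [Om k l i m] with [G] gives the tensor
    [riemann] (see [Rm_Om]). *)
Definition Om k l : 'M[A]_n := - Db l (Gam k).
Lemma GiG : Gi *m G = 1%:M. Proof. exact: mulmx1C. Qed.
Lemma Gistar : star Gi = Gi.
Proof.
have h : star Gi *m G = 1%:M by rewrite -{1}Gstar -star_mul GGi star1.
by rewrite -[LHS]mulmx1 -GGi mulmxA h mul1mx.
Qed.
Lemma DG k : D k G = Gam k *m G.
Proof. by rewrite GamE -mulmxA GiG mulmx1. Qed.
Lemma DbG l : Db l G = G *m star (Gam l).
Proof. by rewrite -{1}Gstar Db_star DG star_mul Gstar. Qed.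
Lemma DGi k : D k Gi = - (Gi *m Gam k).
Proof. by rewrite (D_inv k GGi) GamE mulmxA. Qed.
Lemma Gam_sym k i m : Gam k i m = Gam i k m.
Proof. by rewrite !GamE !mxE; apply: eq_bigr => l _; rewrite !mxE Gsym. Qed.
Lemma GamM_sym (a : nat) k i (M : 'M[A]_(n, a)) (m : 'I_a) : (Gam k *m M) i m = (Gam i *m M) k m.
Proof. by rewrite !mxE; apply: eq_bigr => l _; rewrite Gam_sym. Qed.
(** Both sides equal [D j (D k G) *m Gi]: the (2,0)-part of the curvature vanishes. *)
Lemma Gam_flat j k : D j (Gam k) + Gam k *m Gam j = D k (Gam j) + Gam j *m Gam k.
Proof.
suff h a b : D a (Gam b) + Gam b *m Gam a = D a (D b G) *m Gi by rewrite !h D_comm.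
rewrite {1}GamE D_mul DGi mulmxN -addrA mulmxA -GamE.
by rewrite addNr addr0.
Qed.
Lemma trGam_sym j k : del j (\tr (Gam k)) = del k (\tr (Gam j)).
Proof.
have := congr1 (fun M => \tr M) (Gam_flat j k); rewrite !D_tr !linearD /=.
by rewrite [X in _ + X = _]mxtrace_mulC => /addIr.
Qed.
(** The second Bianchi identity, obtained by applying d/dzbar_l to [Gam_flat]. *)
Lemma Bianchi j k l : D j (Om k l) + Om k l *m Gam j + Gam k *m Om j l =
  D k (Om j l) + Om j l *m Gam k + Gam j *m Om k l.
Proof.
have := congr1 (Db l) (Gam_flat j k).
rewrite !Db_add (Db_mul l (Gam k) (Gam j)) (Db_mul l (Gam j) (Gam k)) -!D_Db /Om.
rewrite !D_opp !mulNmx !mulmxN => /(congr1 -%R); rewrite !opprD !addrA.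
by [].
Qed.

(** * Consequences of the Bianchi identities for a curvature of Bochner form *)

Section BochnerFlat.
Variables (Q : 'M[A]_n) (q : A).
Hypothesis n2 : (2 <= n)%N.
Hypothesis Qstar : star Q = Q.
Hypothesis qreal : cj q = q.
Variables (S : 'M[A]_n) (N : 'I_n -> 'M[A]_n).
Hypothesis defS : S = Q *m Gi.
Hypothesis DQ_N : forall k, D k Q = N k + Gam k *m Q.
(** The curvature-like tensor built from the metric, a Hermitian tensor Q and a scalar q, where S is
    Q with an index raised. Adding mu G to Q and subtracting mu/2 from q changes nothing. Such a
    change adds -(n+2) mu to tr S + 4(n+1) q, so the hypothesis [H1] restricts mu to quantities
    killed by the derivations. *)
Definition bochner_form (Q' S' : 'M[A]_n) (q' : A) k l i m : A :=
  Q' k l * (i == m)%:R + Q' i l * (m == k)%:R + G i l * S' k m + G k l * S' i m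
  + 4 * q' * (G k l * (i == m)%:R + G i l * (m == k)%:R).
Hypothesis H0 : forall k l i m, Om k l i m = bochner_form Q S q k l i m.
Hypothesis H1 : forall k, del k (\tr S) + 4 * (n%:R + 1) * del k q = 0.
Lemma SG : S *m G = Q. Proof. by rewrite defS -mulmxA GiG mulmx1. Qed.
Lemma Sstar : star S = Gi *m Q. Proof. by rewrite defS star_mul Qstar Gistar. Qed.
Lemma SQ_sym : star (S *m Q) = S *m Q.
Proof. by rewrite star_mul Sstar Qstar defS !mulmxA. Qed.
Lemma outerE (a b : nat) (u : 'cV[A]_a) (v : 'rV[A]_b) (i : 'I_a) (j : 'I_b) : (u *m v) i j = u i 0 * v 0 j.
Proof. by rewrite mxE big_ord1. Qed.
Lemma OmE k l : Om k l = Q k l *: 1%:M + col l Q *m delta_mx 0 k + col l G *m row k S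
  + G k l *: S + (4 * q) *: (G k l *: 1%:M + col l G *m delta_mx 0 k).
Proof.
apply/matrixP => i m; rewrite H0 /bochner_form !(addE, scaleE, outerE) !mxE.
by rewrite eqxx /=; ring.
Qed.
Lemma OmMr k l (a : nat) (M : 'M[A]_(n, a)) i (m : 'I_a) : (Om k l *m M) i m =
  Q k l * M i m + Q i l * M k m + G i l * (S *m M) k m + G k l * (S *m M) i m
  + 4 * q * (G k l * M i m + G i l * M k m).
Proof.
rewrite OmE !mulmxDl -!scalemxAl mulmxDl -!scalemxAl -!mulmxA -!rowE -row_mul !mul1mx.
by rewrite !(addE, scaleE, outerE) ![row _ _ _ _]mxE ![col _ _ _ _]mxE; ring.
Qed.
Lemma OmMl k l (a : nat) (M : 'M[A]_(a, n)) (i : 'I_a) m : (M *m Om k l) i m =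
  Q k l * M i m + (M *m Q) i l * (m == k)%:R + (M *m G) i l * S k m + G k l * (M *m S) i m
  + 4 * q * (G k l * M i m + (M *m G) i l * (m == k)%:R).
Proof.
have cM (X : 'M[A]_n) : M *m col l X = col l (M *m X) by rewrite !colE mulmxA.
rewrite OmE !mulmxDr -!scalemxAr mulmxDr -!scalemxAr !mulmxA !cM !mulmx1.
rewrite !(addE, scaleE, outerE) ![row _ _ _ _]mxE ![col _ _ _ _]mxE.
by rewrite ![delta_mx _ _ _ _]mxE eqxx /=; ring.
Qed.
(** The trace is the Ricci tensor; the coefficient of [G] is the quantity whose derivatives vanish
    by [H1]. *)
Lemma trOm k l : \tr (Om k l) = (n%:R + 2) * Q k l + (\tr S + 4 * (n%:R + 1) * q) * G k l.
Proof.
rewrite OmE !mxtraceD !mxtraceZ mxtraceD mxtraceZ mxtrace1.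
have tr1 (X : 'M[A]_n) : \tr (col l X *m delta_mx 0 k) = X k l.
  by rewrite mxtrace_mulC trace_mx11 -rowE !mxE.
rewrite !tr1 [X in _ + X + _ + _]mxtrace_mulC trace_mx11.
have -> : (row k S *m col l G) 0 0 = Q k l.
  by rewrite -SG !mxE; apply: eq_bigr => j _; rewrite !mxE.
by ring.
Qed.
(** The Ricci form is closed, since [trGam_sym] survives d/dzbar_l. In [trOm] the coefficient of [G]
    has derivative zero and [G] itself is closed, so n+2 times the claim remains. *)
Lemma delQ_sym j k l : del j (Q k l) = del k (Q j l).
Proof.
have h : del j (\tr (Om k l)) = del k (\tr (Om j l)).
  have E a b : del a (\tr (Om b l)) = - delb l (del a (\tr (Gam b))).
    rewrite /Om linearN /= delN; congr (- _).
    by rewrite -Db_tr del_delb.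
  by rewrite !E trGam_sym.
move: h; rewrite !trOm !(delM, delD, del_nat, del1).
have H1' c : del c (\tr S) = - (4 * (n%:R + 1) * del c q) by apply/eqP; rewrite -addr_eq0 H1.
rewrite !H1' (Gsym j k l) => h.
have n0 : n.+2%:R = n%:R + 2 :> A by rewrite -addn2 natrD.
apply: (@nat_cancel _ _ _ n.+1); rewrite n0; apply/eqP; rewrite -subr_eq0.
move/eqP: h; rewrite -subr_eq0 => /eqP h; rewrite -[X in _ == X]h; apply/eqP; ring.
Qed.
(** [N k] is the covariant derivative of Q in direction k; the symmetric Christoffel symbols drop
    out of [delQ_sym]. *)
Lemma N_sym k m l : N k m l = N m k l.
Proof.
have E a b : N a b l = del a (Q b l) - (Gam a *m Q) b l.
  by rewrite -DE DQ_N addE addrK.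
by rewrite !E (delQ_sym k m l) (GamM_sym k m).
Qed.
Lemma DS_N k : D k S = N k *m Gi + Gam k *m S - S *m Gam k.
Proof.
rewrite defS D_mul DQ_N DGi mulmxDl mulmxN !mulmxA.
by [].
Qed.
Lemma NGi_sym k m l : (N k *m Gi) m l = (N m *m Gi) k l.
Proof. by rewrite !mxE; apply: eq_bigr => j _; rewrite N_sym. Qed.
(** In [Bianchi] with the curvature of Bochner form all Christoffel terms cancel by symmetry, and
    only the covariant derivatives of Q and q are left. *)
Lemma Bianchi_entry j k l i m :
  N j i l * (m == k)%:R + G k l * (N j *m Gi) i m
    + 4 * del j q * (G k l * (i == m)%:R + G i l * (m == k)%:R) =
  N k i l * (m == j)%:R + G j l * (N k *m Gi) i m
    + 4 * del k q * (G j l * (i == m)%:R + G i l * (m == j)%:R).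
Proof.
have dQ a x y : del a (Q x y) = N a x y + (Gam a *m Q) x y.
  by rewrite -DE DQ_N addE.
have dG a x y : del a (G x y) = (Gam a *m G) x y by rewrite -DE DG.
have dS a x y : del a (S x y) = (N a *m Gi) x y + (Gam a *m S) x y - (S *m Gam a) x y.
  by rewrite -DE DS_N !(addE, oppE).
have dOm a b : del a (Om b l i m) =
  (N a b l + (Gam a *m Q) b l) * (i == m)%:R + (N a i l + (Gam a *m Q) i l) * (m == b)%:R
  + (Gam a *m G) i l * S b m
  + G i l * ((N a *m Gi) b m + (Gam a *m S) b m - (S *m Gam a) b m)
  + (Gam a *m G) b l * S i m
  + G b l * ((N a *m Gi) i m + (Gam a *m S) i m - (S *m Gam a) i m)
  + 4 * del a q * (G b l * (i == m)%:R + G i l * (m == b)%:R)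
  + 4 * q * ((Gam a *m G) b l * (i == m)%:R + (Gam a *m G) i l * (m == b)%:R).
  rewrite H0 /bochner_form !(delD, delM, del_nat) !dQ !dG !dS; ring.
have B := congr1 (fun M : 'M[A]_n => M i m) (Bianchi j k l).
move: B; rewrite !addE !DE !dOm !OmMr !OmMl.
rewrite (N_sym k j l) (GamM_sym k j Q l) (NGi_sym k j m) (GamM_sym k j S m).
rewrite (GamM_sym k j G l) (Gam_sym k j m).
set a1 := (S *m Gam j) k m; set a2 := (S *m Gam k) j m.
move=> B; apply/eqP; rewrite -subr_eq0; apply/eqP.
move/eqP: B; rewrite -subr_eq0 => /eqP B; rewrite -[RHS]B.
ring.
Qed.
Lemma trN i : \sum_k (N k *m Gi) i k = - (4 * (n%:R + 1) * del i q).
Proof.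
have : del i (\tr S) = \sum_k (N k *m Gi) i k.
  rewrite D_tr DS_N !mxtraceD [\tr (- _)]raddfN /= [X in _ + X - _]mxtrace_mulC addrK.
  by apply: eq_bigr => k _; rewrite NGi_sym.
by move=> <-; apply/eqP; rewrite -addr_eq0 H1.
Qed.

(* Contracting the second Bianchi identity. *)
Lemma N_form j i l : N j i l = - (4 * (del j q * G i l + del i q * G j l)).
Proof.
have : \sum_k (N j i l * (k == k)%:R + G k l * (N j *m Gi) i k
    + 4 * del j q * (G k l * (i == k)%:R + G i l * (k == k)%:R)) =
  \sum_k (N k i l * (k == j)%:R + G j l * (N k *m Gi) i k
    + 4 * del k q * (G j l * (i == k)%:R + G i l * (k == j)%:R)).
  by apply: eq_bigr => k _; exact: Bianchi_entry.
rewrite !big_split /=.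
have e1 : \sum_(k < n) N j i l * (k == k)%:R = n%:R * N j i l.
  under eq_bigr => k _ do rewrite eqxx mulr1.
  by rewrite sumr_const card_ord mulr_natl.
have e2 : \sum_(k < n) G k l * (N j *m Gi) i k = N j i l.
  have -> : N j i l = (N j *m Gi *m G) i l by rewrite -mulmxA GiG mulmx1.
  by rewrite [RHS]mxE; apply: eq_bigr => k _; rewrite mulrC.
have e3 : \sum_(k < n) 4 * del j q * (G k l * (i == k)%:R + G i l * (k == k)%:R) =
    4 * del j q * (G i l + n%:R * G i l).
  rewrite -mulr_sumr big_split /=; congr (_ * (_ + _)).
    by under eq_bigr => k _ do rewrite eq_sym; rewrite sum_delta'.
  under eq_bigr => k _ do rewrite eqxx mulr1.
  by rewrite sumr_const card_ord mulr_natl.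
have e4 : \sum_(k < n) N k i l * (k == j)%:R = N j i l by rewrite sum_delta'.
have e5 : \sum_(k < n) G j l * (N k *m Gi) i k = G j l * - (4 * (n%:R + 1) * del i q).
  by rewrite -mulr_sumr trN.
have e6 : \sum_(k < n) 4 * del k q * (G j l * (i == k)%:R + G i l * (k == j)%:R) =
   4 * del i q * G j l + 4 * del j q * G i l.
  under eq_bigr => k _ do rewrite mulrDr !mulrA.
  rewrite big_split /= sum_delta'; congr (_ + _).
  by under eq_bigr => k _ do rewrite [i == k]eq_sym; rewrite sum_delta'.
rewrite e1 e2 e3 e4 e5 e6 => h2.
have [m nm] : exists m : nat, n = m.+1 by exists n.-1; rewrite prednK // (ltn_trans _ n2).
have n0 : m.+1%:R = n%:R :> A := congr1 (fun x : nat => x%:R) (esym nm).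
apply: (@nat_cancel _ _ _ m); rewrite n0.
move/eqP: h2; rewrite -subr_eq0 => /eqP h2.
apply/eqP; rewrite -subr_eq0 -[X in _ == X]h2; apply/eqP; ring.
Qed.
Definition dq : 'cV[A]_n := \col_i del i q.
Definition Zq : 'M[A]_n := \matrix_(i, l) delb l (del i q).
Lemma dqE i : dq i 0 = del i q. Proof. by rewrite mxE. Qed.
Lemma NE j : N j = (- 4%:R) *: (del j q *: G + dq *m row j G).
Proof.
apply/matrixP => i l; rewrite N_form !(addE, scaleE, outerE) dqE [row _ _ _ _]mxE; ring.
Qed.
Lemma delQE k i l : del k (Q i l) = (Gam k *m Q) i l - 4 * (del k q * G i l + del i q * G k l).
Proof. by rewrite -DE DQ_N addE N_form addrC. Qed.
(** Contraction with column k of [Gi]: two different rows of an invertible matrix are independent.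
    Applying it takes two distinct indices, and here n >= 2 enters. *)
Lemma G_cancel (x : 'I_n -> A) (y z : A) (j k : 'I_n) : j != k ->
  (forall l, y * G k l = z * G j l) -> y = 0.
Proof.
move=> jk h; have : \sum_l (y * G k l) * Gi l k = \sum_l (z * G j l) * Gi l k.
  by apply: eq_bigr => l _; rewrite h.
have e (u : A) a : \sum_l (u * G a l) * Gi l k = u * (G *m Gi) a k.
  by rewrite mxE mulr_sumr; apply: eq_bigr => l _; rewrite mulrA.
by rewrite !e GGi !mxE eqxx (negPf jk) mulr1 mulr0.
Qed.
Lemma delb_q l : delb l q = cj (del l q).
Proof. exact: delb_real. Qed.
(** The (2,0)-part of the covariant Hessian of q vanishes. Commuting [del j] and [del k] on Q
    cancels the terms in Q by [Gam_flat] and leaves one Hessian entry times row k of G equal to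
    another one times row j. *)
Lemma D_dq j : D j dq = Gam j *m dq.
Proof.
suff h i k : j != k -> del j (del i q) = (Gam j *m dq) i 0.
  apply/matrixP => i o; rewrite ord1 DE dqE.
  have [k jk] : exists k, j != k.
    have [m nm] : exists m : nat, n = m.+2 by exists n.-2; case: (n) n2 => [|[|]].
    exists (cast_ord (esym nm) (if cast_ord nm j == ord0 then ord_max else ord0)).
    apply/eqP => /(congr1 (cast_ord nm)); rewrite cast_ordKV.
    case: (cast_ord nm j =P ord0) => [->|h1 h2]; first by move/(congr1 val).
  exact: h1 h2.
  exact: h jk.
move=> jk; apply/eqP; rewrite -subr_eq0; apply/eqP.
apply: (@G_cancel (fun=> 0) _ (del k (del i q) - (Gam k *m dq) i 0) j k jk) => l.
have E a b : del a (del b (Q i l)) =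
   ((D a (Gam b) + Gam b *m Gam a) *m Q) i l
   - 4 * (del a q * (Gam b *m G) i l + (Gam b *m dq) i 0 * G a l)
   - 4 * (del a (del b q) * G i l + del b q * (Gam a *m G) i l
      + del a (del i q) * G b l + del i q * (Gam a *m G) b l).
  rewrite delQE delB -DE D_mul DQ_N NE mulmxDr -scalemxAr mulmxDr -scalemxAr !mulmxA.
  rewrite mulmxDl !(addE, scaleE, outerE) [row _ _ _ _]mxE.
  rewrite !(delM, delD, del_nat) -![del a (G _ _)]DE !DG.
  ring.
have := delC j k (Q i l); rewrite !E (Gam_flat j k) (delC k j q) (GamM_sym k j).
move/eqP; rewrite -subr_eq0 => /eqP h.
apply: (@nat_cancel _ _ _ 3); apply/eqP; rewrite -subr_eq0 -oppr_eq0 -[X in _ == X]h.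
by apply/eqP; ring.
Qed.
Lemma Db_Q l i m : delb l (Q i m) = (Q *m star (Gam l)) i m
  - 4 * (delb l q * G i m + delb m q * G i l).
Proof.
have -> : delb l (Q i m) = cj (del l (Q m i)) by rewrite -DE -starE -Db_star Qstar DbE.
rewrite delQE cjB cjM cj_nat cjD !cjM -!delb_q.
have -> : cj (G m i) = G i m by rewrite -starE Gstar.
have -> : cj (G l i) = G i l by rewrite -starE Gstar.
by rewrite -starE star_mul Qstar.
Qed.
Lemma delbE_G l i m : delb l (G i m) = (G *m star (Gam l)) i m.
Proof. by rewrite -DbE DbG. Qed.
Lemma QOm_star k l i m : (Q *m star (Om l k)) i m =
  Q k l * Q i m + Q k m * Q i l + G k m * (S *m Q) i l + G k l * (S *m Q) i m
  + 4 * q * (G k l * Q i m + G k m * Q i l).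
Proof.
have -> : Q *m star (Om l k) = star (Om l k *m Q) by rewrite star_mul Qstar.
rewrite starE OmMr !(cjD, cjM, cj_nat) qreal.
have eQ a b : cj (Q a b) = Q b a by rewrite -starE Qstar.
have eG a b : cj (G a b) = G b a by rewrite -starE Gstar.
have eS a b : cj ((S *m Q) a b) = (S *m Q) b a by rewrite -starE SQ_sym.
by rewrite !eQ !eG !eS.
Qed.
(** The mixed derivatives of Q commute. With the curvature inserted this says that the tensor S Q +
    4 q Q - 4 [Zq] is proportional to the metric. *)
Lemma W_rank1 i l k m :
  G i l * ((S *m Q) k m + 4 * q * Q k m - 4 * Zq k m) =
  G k m * ((S *m Q) i l + 4 * q * Q i l - 4 * Zq i l).
Proof.
have h1 : del k (delb l (Q i m)) =
  ((Gam k *m Q *m star (Gam l)) i m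
    - 4 * (del k q * (G *m star (Gam l)) i m + del i q * (G *m star (Gam l)) k m))
  - (Q *m star (Om l k)) i m
  - 4 * (del k (delb l q) * G i m + delb l q * (Gam k *m G) i m
      + del k (delb m q) * G i l + delb m q * (Gam k *m G) i l).
  rewrite Db_Q delB -DE D_mul DQ_N NE D_star.
  have -> : Db k (Gam l) = - Om l k by rewrite /Om opprK.
  rewrite star_opp mulmxN mulmxDl -scalemxAl mulmxDl -scalemxAl -!mulmxA -row_mul.
  rewrite !(addE, scaleE, oppE, outerE) dqE [row _ _ _ _]mxE.
  rewrite !(delM, delD, del_nat) -![del k (G _ _)]DE !DG !mulmxA.
  ring.
have h2 : delb l (del k (Q i m)) =
  - (Om k l *m Q) i m + (Gam k *m Q *m star (Gam l)) i m
  - 4 * (delb l q * (Gam k *m G) i m + (Gam k *m G) i l * delb m q)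
  - 4 * (delb l (del k q) * G i m + del k q * (G *m star (Gam l)) i m
     + delb l (del i q) * G k m + del i q * (G *m star (Gam l)) k m).
  rewrite delQE delbB -DbE Db_mul.
  have -> : Db l (Gam k) = - Om k l by rewrite /Om opprK.
  have -> : Db l Q = Q *m star (Gam l) - 4%:R *: (delb l q *: G + col l G *m (\row_m delb m q)).
    apply/matrixP => x y; rewrite DbE Db_Q !(addE, scaleE, oppE, outerE).
    by rewrite [col _ _ _ _]mxE [(\row__ _) _ _]mxE; ring.
  rewrite mulmxDr mulmxN -scalemxAr mulmxDr -scalemxAr !mulmxA !mulNmx.
  have -> : Gam k *m col l G = col l (Gam k *m G) by rewrite !colE mulmxA.
  rewrite !(addE, scaleE, oppE, outerE) [col _ _ _ _]mxE [(\row__ _) _ _]mxE.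
  rewrite !(delbM, delbD, delb_nat) !delbE_G; ring.
have := del_delb k l (Q i m); rewrite h1 h2 QOm_star OmMr.
have ZE a b : Zq a b = delb b (del a q) by rewrite mxE.
rewrite !ZE !del_delb => /eqP; rewrite -subr_eq0 => /eqP h.
apply/eqP; rewrite -subr_eq0 -[X in _ == X]h; apply/eqP; ring.
Qed.
Lemma cancel_G (x : A) i : (forall l, x * G i l = 0) -> x = 0.
Proof.
move=> h; have : \sum_l (x * G i l) * Gi l i = 0 by apply: big1 => l _; rewrite h mul0r.
have -> : \sum_l (x * G i l) * Gi l i = x * (G *m Gi) i i.
  by rewrite mxE mulr_sumr; apply: eq_bigr => l _; rewrite mulrA.
by rewrite GGi mxE eqxx mulr1.
Qed.
(** Contracting [W_rank1] gives n W = tr (W Gi) G, and c is minus a quarter of the factor of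
    proportionality. It is real because all other terms of the equation are Hermitian. *)
Lemma scalar_c : exists c : A, cj c = c /\
  4%:R *: Zq = S *m Q + (4 * q) *: Q + (4 * c) *: G.
Proof.
have [n' nn] : exists m : nat, n = m.+1 by exists n.-1; rewrite prednK // (ltn_trans _ n2).
pose W := S *m Q + (4 * q) *: Q - 4%:R *: Zq.
have WE i l k m : G i l * W k m = G k m * W i l.
  by rewrite /W !(addE, oppE, scaleE); exact: W_rank1.
have nW : n%:R *: W = \tr (W *m Gi) *: G.
  apply/matrixP => k m; rewrite !scaleE.
  have : \sum_i \sum_l (G i l * W k m) * Gi l i = \sum_i \sum_l (G k m * W i l) * Gi l i.
    by apply: eq_bigr => i _; apply: eq_bigr => l _; rewrite WE.
  have -> : \sum_i \sum_l (G i l * W k m) * Gi l i = n%:R * W k m.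
    transitivity (\sum_(i < n) (G *m Gi) i i * W k m).
      by apply: eq_bigr => i _; rewrite [in RHS]mxE [in RHS]mulr_suml; apply: eq_bigr => l _; rewrite mulrAC.
    by rewrite GGi -mulr_suml -/(\tr _) mxtrace1.
  move=> ->; rewrite /mxtrace mulr_suml; apply: eq_bigr => i _.
  by rewrite mxE mulr_suml; apply: eq_bigr => l _; ring.
pose c := - (cs (4 * n%:R)^-1 * \tr (W *m Gi)) : A.
have c4 : (4 * n%:R) * (cs (4 * n%:R)^-1) = 1 :> A.
  have -> : 4 * n%:R = cs (4 * n%:R) :> A by rewrite csM !cs_nat.
  by rewrite -csM divff ?cs1 // mulf_neq0 ?pnatr_eq0 // nn.
have hc : 4%:R *: Zq = S *m Q + (4 * q) *: Q + (4 * c) *: G.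
  have -> : (4 * c) *: G = - W.
    have -> : - W = - ((4 * n%:R) * (cs (4 * n%:R)^-1)) *: W by rewrite c4 scaleN1r.
    have -> : - (4 * n%:R * cs (4 * n%:R)^-1) = - (4 * cs (4 * n%:R)^-1) * n%:R :> A by ring.
    rewrite -[RHS]scalerA nW scalerA /c; congr (_ *: _); ring.
  by rewrite /W opprB addrCA subrr addr0.
exists c; split=> //.
have Zs : star Zq = Zq.
  apply/matrixP => a b; rewrite starE !mxE -del_cj -delb_q.
  exact: del_delb.
have := congr1 (@star R n A n n) hc; rewrite !(star_add, star_scale) SQ_sym Qstar Gstar Zs !cjM !cj_nat qreal hc.
move/addrI/matrixP => h; apply/eqP; rewrite -subr_eq0; apply/eqP.
have i0 : 'I_n by rewrite nn; exact: ord0.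
apply: (@cancel_G _ i0) => l; apply: (@nat_cancel _ _ _ 3).
have := h i0 l; rewrite !scaleE => /eqP; rewrite -subr_eq0 => /eqP h'.
apply/eqP; rewrite -subr_eq0 -oppr_eq0 -[X in _ == X]h'; apply/eqP; ring.
Qed.
(** Differentiating the equation of c produces a third derivative of q, which the curvature
    expresses by first derivatives again. With this the system for Q, q, dq and c is closed. *)
Lemma del_c (c : A) : 4%:R *: Zq = S *m Q + (4 * q) *: Q + (4 * c) *: G ->
  forall j, del j c = - (S *m dq) j 0.
Proof.
move=> hc j; apply/eqP; rewrite -addr_eq0; apply/eqP; apply: (@cancel_G _ j) => l.
have := congr1 (fun M : 'M[A]_n => D j M j l) hc.
rewrite !D_add D_scale del_nat scale0r add0r !D_scale D_mul.
have -> : D j Zq = \matrix_(i, l) (- (Om j l *m dq) i 0) + Gam j *m Zq.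
  apply/matrixP => a b; rewrite DE !mxE del_delb.
  have -> : del j (del a q) = (Gam j *m dq) a 0 by rewrite -D_dq DE dqE.
  have Zc : Db b dq = col b Zq by apply/matrixP => x y; rewrite !mxE.
  rewrite -DbE Db_mul Zc addE.
  have -> : Db b (Gam j) = - Om j b by rewrite /Om opprK.
  by rewrite mulNmx oppE !mxE; congr (_ + _); apply: eq_bigr => x _; rewrite !mxE.
rewrite scalerDr scalemxAr hc !mulmxDr -!scalemxAr.
rewrite DS_N DQ_N DG NE !mulmxDl !mulmxDr -!scalemxAl -!scalemxAr !mulmxDl !mulmxDr.
rewrite -!scalemxAl -!scalemxAr GGi !mulmxA.
have rG : row j G *m Gi = delta_mx 0 j by rewrite -row_mul GGi row1.
have e1 : dq *m row j G *m Gi *m Q = dq *m row j Q.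
  by rewrite -(mulmxA dq) rG -(mulmxA dq) -rowE.
rewrite e1 SG mulNmx mul1mx !(delM, del_nat) !(addE, scaleE, oppE, outerE).
rewrite [(\matrix_(_, _) _) _ _]mxE OmMr ![row _ _ _ _]mxE !dqE.
move/eqP; rewrite -subr_eq0 => /eqP h; apply: (@nat_cancel _ _ _ 3).
apply/eqP; rewrite -subr_eq0 -oppr_eq0 -[X in _ == X]h; apply/eqP; ring.
Qed.

End BochnerFlat.
End Kaehler.

(** * Structure equations of a solution *)

Section Structure.
Context {R : realType} {n : nat} {A : dring R n}.
Implicit Types (j k l : 'I_n).
Local Notation del := (@del R n A).
Local Notation delb := (@delb R n A).
Local Notation N := (1 + (n + 1))%N.
Local Notation row_t := 'rV[A]_N.
Implicit Types (x y : row_t).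
(** The number -2i; the exponential in the equation is exp (- [wi] F M). *)
Definition wi : A := cs (- (2 * 'i)).
Lemma wi2 : wi * wi = - 4%:R.
Proof.
rewrite /wi -csM mulrNN.
have -> : (2 * 'i) * (2 * 'i) = - 4%:R :> Cplx R.
  by rewrite mulrACA sqrCi1; ring.
by rewrite csN cs_nat.
Qed.
Lemma cj_wi : cj wi = - wi.
Proof.
rewrite /wi cj_cs -csN; congr cs.
rewrite rmorphN rmorphM /= conjCi; congr (- _).
by rewrite conjC_nat mulrN.
Qed.
Lemma del_wi k : del k wi = 0. Proof. exact: del_cs. Qed.
Lemma delb_wi k : delb k wi = 0. Proof. exact: delb_cs. Qed.
Lemma wi_unit : wi \is a GRing.unit.
Proof.
apply/unitrP; exists (- cs 4%:R^-1 * wi).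
have h : cs 4%:R^-1 * 4%:R = 1 :> A.
  by rewrite -cs_nat -csM mulVf ?cs1 // pnatr_eq0.
split; last rewrite mulrC; by rewrite -mulrA wi2 mulrNN h.
Qed.
Variables (F : A) (M K : 'M[A]_N).
Hypothesis Freal : cj F = F.
Hypothesis DM : forall k, D k M = 0.
Hypothesis DbM : forall k, Db k M = 0.
Hypothesis DK : forall k, D k K = (- wi * del k F) *: (M *m K).
Hypothesis Kstar : star K = K.
Hypothesis KM : K *m star M = - (M *m K).
(** The (1,0)-part of the Chern connection of the Hermitian form [bf] on trivial bundles of rows:
    the correction term absorbs the derivative of K, as [del_bf] shows, and the (0,1)-part is the
    plain [Db]. *)
Definition Tw k (y : row_t) : row_t := D k y - (wi * del k F) *: (y *m M).
Definition bf (y x : row_t) : A := (y *m K *m star x) 0 0.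
Lemma bfDl y y' x : bf (y + y') x = bf y x + bf y' x.
Proof. by rewrite /bf !mulmxDl addE. Qed.
Lemma bfZl (c : A) y x : bf (c *: y) x = c * bf y x.
Proof. by rewrite /bf -!scalemxAl scaleE. Qed.
Lemma bfNl y x : bf (- y) x = - bf y x.
Proof. by rewrite -scaleN1r bfZl mulN1r. Qed.
Lemma bf_cj y x : cj (bf y x) = bf x y.
Proof. by rewrite /bf -starE star_mul star_mul starK Kstar mulmxA. Qed.
Lemma bfDr y x x' : bf y (x + x') = bf y x + bf y x'.
Proof. by rewrite /bf star_add mulmxDr addE. Qed.
Lemma bfZr (c : A) y x : bf y (c *: x) = cj c * bf y x.
Proof. by rewrite /bf star_scale -scalemxAr scaleE. Qed.
Lemma bfNr y x : bf y (- x) = - bf y x.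
Proof. by rewrite -[LHS]bf_cj bfNl cjN bf_cj. Qed.
Lemma bf_suml (I : Type) (s : seq I) (P : pred I) (f : I -> row_t) x :
  bf (\sum_(i <- s | P i) f i) x = \sum_(i <- s | P i) bf (f i) x.
Proof.
elim/big_rec2: _ => [|i a b _ <-]; first by rewrite /bf !mul0mx mxE.
by rewrite bfDl.
Qed.
Lemma bf0r y : bf y 0 = 0.
Proof. by rewrite -(scale0r (0 : row_t)) bfZr cj0 mul0r. Qed.
Lemma bfM y x : bf (y *m M) x = - bf y (x *m M).
Proof.
rewrite /bf star_mul -!mulmxA [K *m (_ *m _)]mulmxA KM mulNmx mulmxN oppE opprK.
by rewrite !mulmxA.
Qed.
Lemma DbK l : Db l K = (- wi * delb l F) *: (M *m K).
Proof.
rewrite -{1}Kstar Db_star DK star_scale star_mul Kstar KM.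
rewrite cjM cjN cj_wi opprK (delb_real _ Freal) scalerN -scaleNr.
by rewrite mulNr.
Qed.
Lemma del_bf k y x : del k (bf y x) = bf (Tw k y) x + bf y (Db k x).
Proof.
rewrite /bf -DE !D_mul DK D_star -scalemxAr !mulmxDl -scalemxAl.
by rewrite /Tw !mulNmx -!scalemxAl mulNr scaleNr !mulmxA !addE.
Qed.
Lemma delb_bf l y x : delb l (bf y x) = bf (Db l y) x + bf y (Tw l x).
Proof.
by rewrite -[bf y x]bf_cj delb_cj del_bf cjD !bf_cj addrC.
Qed.
(** The commutator is the curvature of this connection: the mixed Hessian of F times M. This is how
    the metric enters. *)
Lemma Db_Tw l k y : Db l (Tw k y) = Tw k (Db l y) - (wi * del k (delb l F)) *: (y *m M).
Proof.
rewrite /Tw Db_add Db_opp Db_scale Db_mul DbM mulmx0 addr0 -D_Db delbM delb_wi mul0r add0r.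
by rewrite -del_delb opprD addrCA addrC -!addrA; congr (_ + _); rewrite addrC.
Qed.
Lemma Tw_M k y : Tw k (y *m M) = Tw k y *m M.
Proof. by rewrite /Tw D_mul DM mulmx0 addr0 mulmxDl mulNmx scalemxAl. Qed.
Lemma Tw_D k y y' : Tw k (y + y') = Tw k y + Tw k y'.
Proof. by rewrite /Tw D_add mulmxDl scalerDr opprD addrACA. Qed.
Lemma Tw_Z k (c : A) y : Tw k (c *: y) = del k c *: y + c *: Tw k y.
Proof.
by rewrite /Tw D_scale -scalemxAl scalerBr -addrA !scalerA [c * _]mulrC.
Qed.
Lemma Tw_sum k (I : Type) (s : seq I) (P : pred I) (f : I -> row_t) :
  Tw k (\sum_(i <- s | P i) f i) = \sum_(i <- s | P i) Tw k (f i).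
Proof.
elim/big_rec2: _ => [|i a b _ <-]; last by rewrite Tw_D.
by rewrite /Tw D_zero mul0mx scaler0 subr0.
Qed.
Lemma Db_sum l (I : Type) (s : seq I) (P : pred I) (f : I -> row_t) :
  Db l (\sum_(i <- s | P i) f i) = \sum_(i <- s | P i) Db l (f i).
Proof. by elim/big_rec2: _ => [|i a b _ <-]; rewrite ?Db_zero ?Db_add. Qed.
Variables (G Gi : 'M[A]_n).
Hypothesis GE : forall k l, G k l = del k (delb l F).
Hypothesis GGi : G *m Gi = 1%:M.
Lemma hess_star : star G = G.
Proof.
apply/matrixP => k l; by rewrite starE !GE -delb_cj (delb_real k Freal) cjK del_delb.
Qed.
Lemma hess_sym k i l : del k (G i l) = del i (G k l).
Proof. by rewrite !GE delC. Qed.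
Variable phi : row_t.
Hypothesis Dbphi : forall l, Db l phi = 0.
Hypothesis null : bf phi phi = 0.
Variables (be : row_t) (u : A) (ga : 'I_n -> A) (E : 'I_n -> row_t) (Q : 'M[A]_n) (q : A).
Hypothesis defbe : be = phi *m M.
Hypothesis defu : u = bf be phi.
Hypothesis u_unit : u \is a GRing.unit.
Hypothesis gaE : forall k, del k u = ga k * u.
Hypothesis TwE : forall k, Tw k phi = E k + ga k *: phi.
Hypothesis QE : forall k l, Q k l = delb l (ga k).
Hypothesis bebe : bf be be = wi * u * q.
Lemma EK k : E k = Tw k phi - ga k *: phi.
Proof. by rewrite TwE addrK. Qed.
Lemma Dbbe l : Db l be = 0.
Proof. by rewrite defbe Db_mul Dbphi DbM mul0mx mulmx0 addr0. Qed.
Lemma Twphi k : bf (Tw k phi) phi = 0.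
Proof. by have := del_bf k phi phi; rewrite null del0 Dbphi bf0r addr0 => <-. Qed.
Lemma Ephi k : bf (E k) phi = 0.
Proof. by rewrite EK bfDl bfNl bfZl Twphi null mulr0 subr0. Qed.
Lemma phiE k : bf phi (E k) = 0.
Proof. by rewrite -bf_cj Ephi cj0. Qed.
Lemma phibe : bf phi be = - u.
Proof. by rewrite defu defbe bfM opprK. Qed.
Lemma u_cj : cj u = - u.
Proof. by rewrite {1}defu bf_cj phibe. Qed.
Lemma Twbe k : bf (Tw k phi) be = - del k u.
Proof. by rewrite defu del_bf Dbphi bf0r addr0 defbe Tw_M bfM opprK. Qed.
(** The reason for subtracting [ga k] times phi from the twisted derivative of phi: as [ga] is the
    logarithmic derivative of u, the vector E k becomes orthogonal to phi M, being orthogonal to phi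
    already. *)
Lemma Ebe k : bf (E k) be = 0.
Proof. by rewrite EK bfDl bfNl bfZl Twbe phibe gaE; ring. Qed.
Lemma beE k : bf be (E k) = 0.
Proof. by rewrite -bf_cj Ebe cj0. Qed.
(** Differentiating the vanishing pairing of [Tw k phi] with phi in zbar_l brings in the curvature
    of [Tw], hence the metric. *)
Lemma EE k l : bf (E k) (E l) = wi * u * G k l.
Proof.
have -> : bf (E k) (E l) = bf (Tw k phi) (Tw l phi).
  rewrite [E k]EK bfDl bfNl bfZl phiE mulr0 subr0 EK bfDr bfNr bfZr Twphi mulr0 subr0 //.
have := delb_bf l (Tw k phi) phi; rewrite Twphi delb0 Db_Tw Dbphi.
have -> : Tw k 0 = 0 by rewrite /Tw D_zero mul0mx scaler0 subr0.
rewrite sub0r bfNl bfZl -defbe -defu -GE => /esym/eqP; rewrite addrC subr_eq0 => /eqP ->; ring.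
Qed.
Lemma Db_E l k : Db l (E k) = - ((wi * G k l) *: be) - Q k l *: phi.
Proof.
rewrite EK Db_add Db_opp Db_Tw Db_scale Dbphi scaler0 addr0 -GE.
have -> : Tw k 0 = 0 by rewrite /Tw D_zero mul0mx scaler0 subr0.
by rewrite sub0r QE defbe.
Qed.
(** As u is purely imaginary, [cj (ga l)] is the antiholomorphic logarithmic derivative of u; the
    claim is that the mixed second derivatives of log u commute. *)
Lemma Qstar : star Q = Q.
Proof.
apply/matrixP => k l; rewrite starE !QE -del_cj.
have e : cj (ga l) * u = delb l u.
  apply: oppr_inj; rewrite -mulrN -u_cj -cjM -gaE -delb_cj u_cj.
  by rewrite delbN.
have h1 : del k (cj (ga l)) * u + cj (ga l) * del k u = del k (delb l u).
  by rewrite -delM e.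
have h2 : delb l (ga k) * u + ga k * delb l u = delb l (del k u).
  by rewrite -delbM -gaE.
apply: (mulIr u_unit).
have -> : del k (cj (ga l)) * u = del k (delb l u) - cj (ga l) * del k u by rewrite -h1 addrK.
have -> : delb l (ga k) * u = delb l (del k u) - ga k * delb l u by rewrite -h2 addrK.
rewrite del_delb gaE -e; ring.
Qed.
Lemma wu_unit : wi * u \is a GRing.unit.
Proof. by rewrite unitrM wi_unit. Qed.
Lemma qreal : cj q = q.
Proof.
apply: (mulrI wu_unit); rewrite -bebe -[RHS]bf_cj bebe !cjM cj_wi u_cj; ring.
Qed.
(** The Gram matrix of the n+2 vectors phi, E, phi M is invertible, so these vectors are a basis and
    the form is nondegenerate. *)
Lemma complete (x : row_t) : bf x phi = 0 -> bf x be = 0 -> (forall k, bf x (E k) = 0) -> x = 0.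
Proof.
move=> h1 h2 h3.
pose EM : 'M[A]_(n, N) := \matrix_(k, j) E k 0 j.
have rE k : row k EM = E k by apply/rowP => j; rewrite !mxE.
pose Fr : 'M[A]_N := col_mx phi (col_mx EM be).
(* The blocks of the explicit inverse of the Gram matrix, whose nonzero entries are -u, wi u G, u
   and wi u q. *)
pose I1 : 'M[A]_(1, N) := row_mx ((wi * q / u)%:M) (row_mx 0 (u^-1)%:M).
pose I2 : 'M[A]_(n, N) := row_mx 0 (row_mx ((wi * u)^-1 *: Gi) 0).
pose I3 : 'M[A]_(1, N) := row_mx (- u^-1)%:M (row_mx 0 0).
pose Iv : 'M[A]_N := col_mx I1 (col_mx I2 I3).
have BM (a b : nat) (Y : 'M[A]_(a, N)) (X : 'M[A]_(b, N)) (i : 'I_a) (j : 'I_b) :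
    (Y *m K *m star X) i j = bf (row i Y) (row j X).
  rewrite /bf -row_mul [LHS]mxE [RHS]mxE; apply: eq_bigr => h _.
  by rewrite !starE [row i _ _ _]mxE [row j _ _ _]mxE.
have gram : Fr *m K *m star Fr *m Iv = 1%:M.
  have sF : star Fr = row_mx (star phi) (row_mx (star EM) (star be)).
    rewrite /star /Fr !tr_col_mx !map_row_mx //.
  have e1 : phi *m K *m star phi = (0 : 'M[A]_1).
    by apply/matrixP => i j; rewrite !ord1 [RHS]mxE -null.
  have e2 : phi *m K *m star EM = 0.
    by apply/matrixP => i j; rewrite BM rE ord1 row_id phiE mxE.
  have e3 : phi *m K *m star be = (- u)%:M.
    by apply/matrixP => i j; rewrite !ord1 -phibe [RHS]mxE eqxx.
  have e4 : EM *m K *m star phi = 0.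
    by apply/matrixP => i j; rewrite BM rE ord1 row_id Ephi mxE.
  have e5 : EM *m K *m star EM = (wi * u) *: G.
    by apply/matrixP => i j; rewrite BM !rE EE scaleE.
  have e6 : EM *m K *m star be = 0.
    by apply/matrixP => i j; rewrite BM rE ord1 row_id Ebe mxE.
  have e7 : be *m K *m star phi = u%:M.
    by apply/matrixP => i j; rewrite !ord1 [RHS]mxE eqxx.
  have e8 : be *m K *m star EM = 0.
    by apply/matrixP => i j; rewrite BM rE ord1 row_id beE mxE.
  have e9 : be *m K *m star be = (wi * u * q)%:M.
    by apply/matrixP => i j; rewrite !ord1 -bebe [RHS]mxE eqxx.
  rewrite sF !mul_col_mx !mul_mx_row e1 e2 e3 e4 e5 e6 e7 e8 e9.
  rewrite /Iv !mul_row_col !mul0mx !add0r !addr0.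
  rewrite /I1 /I2 /I3 !mul_mx_row !mulmx0.
  rewrite -!scalar_mxM -scalemxAl -scalemxAr scalerA GGi divrr ?wu_unit // scale1r.
  rewrite !add_row_mx !addr0 mulrNN divrr //.
  have -> : (u * (wi * q / u))%:M + (wi * u * q * - u^-1)%:M = 0 :> 'M[A]_(1, 1).
    have -> : u * (wi * q / u) = (wi * q) * (u / u) by ring.
    have -> : wi * u * q * - u^-1 = - ((wi * q) * (u / u)) by ring.
    by apply/matrixP => i j; rewrite !ord1 addE ![_%:M _ _]mxE [RHS]mxE eqxx /= !mulr1n subrr.
  have e (a b : nat) (y : A) : (y%:M : 'M[A]_(a + b)) = col_mx (row_mx y%:M 0) (row_mx 0 y%:M).
    by rewrite scalar_mx_block.
  rewrite [RHS]e; congr col_mx; first by rewrite row_mx0.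
  by rewrite -[LHS]block_mxEv block_mxEh col_mx0 e.
have h : x *m (K *m star Fr) = 0.
  have sF : star Fr = row_mx (star phi) (row_mx (star EM) (star be)).
    rewrite /star /Fr !tr_col_mx !map_row_mx //.
  rewrite mulmxA sF !mul_mx_row.
  have -> : x *m K *m star phi = 0 by apply/matrixP => i j; rewrite !ord1 [RHS]mxE -h1.
  have -> : x *m K *m star be = 0 by apply/matrixP => i j; rewrite !ord1 [RHS]mxE -h2.
  have -> : x *m K *m star EM = 0.
    by apply/matrixP => i j; rewrite BM rE ord1 row_id h3 mxE.
  by rewrite !row_mx0.
have g2 : (K *m star Fr) *m (Iv *m Fr) = 1%:M.
  by rewrite mulmxA; apply: mulmx1C; rewrite -gram -!mulmxA.
by rewrite -[x]mulmx1 -g2 mulmxA h mul0mx.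
Qed.
(** The row with coordinates a, v, b in the frame phi, E, phi M. By [lin_inj] and [lin_eq] every
    identity between rows becomes one between coordinates. *)
Definition lin (a : A) (v : 'I_n -> A) (b : A) : row_t :=
  a *: phi + (\sum_k v k *: E k) + b *: be.
Lemma lin_phi a v b : bf (lin a v b) phi = b * u.
Proof.
rewrite /lin !bfDl !bfZl null mulr0 add0r bf_suml big1 ?add0r ?defu // => k _.
by rewrite bfZl Ephi mulr0.
Qed.
Lemma lin_E a v b m : bf (lin a v b) (E m) = wi * u * \sum_k v k * G k m.
Proof.
rewrite /lin !bfDl !bfZl phiE beE !mulr0 add0r addr0 bf_suml mulr_sumr.
by apply: eq_bigr => k _; rewrite bfZl EE; ring.
Qed.
Lemma lin_be a v b : bf (lin a v b) be = - a * u + b * (wi * u * q).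
Proof.
rewrite /lin !bfDl !bfZl phibe bebe bf_suml big1 => [|k _]; last by rewrite bfZl Ebe mulr0.
by ring.
Qed.
Lemma contractG (v : 'I_n -> A) l : \sum_m (\sum_k v k * G k m) * Gi m l = v l.
Proof.
under eq_bigr => m _ do rewrite mulr_suml.
rewrite exchange_big /=.
transitivity (\sum_k v k * (G *m Gi) k l).
  by apply: eq_bigr => k _; rewrite mxE mulr_sumr; apply: eq_bigr => m _; rewrite mulrA.
by rewrite GGi; under eq_bigr => k _ do rewrite mxE; rewrite sum_delta'.
Qed.
Lemma lin_inj a v b a' v' b' : lin a v b = lin a' v' b' ->
  [/\ a = a', (forall k, v k = v' k) & b = b'].
Proof.
move=> h; have eb : b = b'.
  by apply: (mulIr u_unit); rewrite -!(lin_phi a v) h lin_phi (lin_phi a v).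
have ev k : v k = v' k.
  rewrite -(contractG v k) -(contractG v' k); apply: eq_bigr => m _; congr (_ * _).
  by apply: (mulrI wu_unit); rewrite -(lin_E a v b m) h lin_E.
split=> //; apply: (mulIr u_unit); apply: oppr_inj.
have := congr1 (fun y => bf y be) h; rewrite !lin_be -eb => /addIr.
by rewrite !mulNr.
Qed.
Lemma lin_eq (y : row_t) a v b : bf y phi = b * u ->
  (forall m, bf y (E m) = wi * u * \sum_k v k * G k m) ->
  bf y be = - a * u + b * (wi * u * q) -> y = lin a v b.
Proof.
move=> h1 h2 h3; apply/eqP; rewrite -subr_eq0; apply/eqP; apply: complete => [||k].
- by rewrite bfDl bfNl h1 lin_phi subrr.
- by rewrite bfDl bfNl h3 lin_be subrr.
- by rewrite bfDl bfNl h2 lin_E subrr.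
Qed.
Lemma lin_add a v b a' v' b' :
  lin a v b + lin a' v' b' = lin (a + a') (fun k => v k + v' k) (b + b').
Proof.
rewrite /lin !scalerDl; under [in RHS]eq_bigr => k _ do rewrite scalerDl.
rewrite big_split /=.
by rewrite addrACA; congr (_ + _); rewrite addrACA.
Qed.
Lemma lin_scale c a v b : c *: lin a v b = lin (c * a) (fun k => c * v k) (c * b).
Proof.
rewrite /lin !scalerDr !scalerA scaler_sumr.
by under eq_bigr => k _ do rewrite scalerA.
Qed.
Lemma lin_sum (I : finType) (a : I -> A) (v : I -> 'I_n -> A) (b : I -> A) :
  \sum_i lin (a i) (v i) (b i) = lin (\sum_i a i) (fun k => \sum_i v i k) (\sum_i b i).
Proof.
rewrite /lin !big_split /= -!scaler_suml; congr (_ + _ + _).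
rewrite exchange_big /=; apply: eq_bigr => k _; by rewrite -scaler_suml.
Qed.
Lemma E_lin m : E m = lin 0 (fun k => (k == m)%:R) 0.
Proof.
rewrite /lin !scale0r add0r addr0 (bigD1 m) //= eqxx scale1r big1 ?addr0 // => k /negPf ->.
by rewrite scale0r.
Qed.
Lemma phi_scale (x : A) : x *: phi = lin x (fun=> 0) 0.
Proof. by rewrite /lin scale0r addr0 big1 ?addr0 // => k _; rewrite scale0r. Qed.
Lemma be_scale (x : A) : x *: be = lin 0 (fun=> 0) x.
Proof. by rewrite /lin scale0r add0r big1 ?add0r // => k _; rewrite scale0r. Qed.
Lemma del_G k i l : del k (G i l) = (Gam G Gi k *m G) i l.
Proof. by rewrite -DE (DG GGi). Qed.
(** The pairings with the frame are known from the Gram matrix. The result is the connection of the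
    metric, tensored with the line connection [ga], without components along phi and phi M. *)
Lemma Tw_E k l : Tw k (E l) = lin 0 (fun m => ga k * (m == l)%:R + Gam G Gi k l m) 0.
Proof.
have dbe m : bf (E l) (Db k (E m)) = 0.
  rewrite Db_E bfDr !bfNr !bfZr Ebe Ephi !mulr0; ring.
apply: lin_eq => [|m|].
- have := del_bf k (E l) phi; rewrite Ephi del0 Dbphi bf0r addr0 => <-; ring.
- have := del_bf k (E l) (E m); rewrite dbe addr0 => <-.
  rewrite EE !delM del_wi gaE del_G [in LHS]mxE.
  have -> : \sum_k0 (ga k * (k0 == l)%:R + Gam G Gi k l k0) * G k0 m =
     ga k * G l m + \sum_j Gam G Gi k l j * G j m.
    rewrite -[G l m](sum_delta (fun j => G j m)) mulr_sumr -big_split /=.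
    by apply: eq_bigr => j _; ring.
  ring.
- have := del_bf k (E l) be; rewrite Ebe del0 Dbbe bf0r addr0 => <-; ring.
Qed.
Variables (s : 'M[A]_n) (al : 'I_n -> A) (bv : 'I_n -> A) (c : A).
Hypothesis hs : forall k m, bf (E k *m M) (E m) = wi * u * (s *m G) k m.
Hypothesis hal : forall k, bf (E k *m M) be = - al k * u.
Hypothesis hb : forall m, bf (be *m M) (E m) = wi * u * \sum_p bv p * G p m.
Hypothesis hc : bf (be *m M) be = - c * u - wi * q * (wi * u * q).
(** Together with [be_M]: the numbers s, al, bv, c are the coefficients of M in the frame. *)
Lemma E_M k : E k *m M = lin (al k) (s k) 0.
Proof.
apply: lin_eq => [|m|].
- by rewrite bfM -defbe Ebe; ring.
- by rewrite hs mxE.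
- by rewrite hal; ring.
Qed.
Lemma be_M : be *m M = lin c bv (- (wi * q)).
Proof.
apply: lin_eq => [|m|].
- by rewrite bfM -defbe bebe; ring.
- by rewrite hb.
- by rewrite hc; ring.
Qed.
Lemma Db_E' l k : Db l (E k) = lin (- Q k l) (fun=> 0) (- (wi * G k l)).
Proof.
rewrite Db_E /lin big1 => [|j _]; last by rewrite scale0r.
by rewrite addr0 !scaleNr addrC.
Qed.
Lemma Tw_phi' k : Tw k phi = lin (ga k) (fun m => (m == k)%:R) 0.
Proof. by rewrite TwE [E k]E_lin phi_scale lin_add; congr lin; [ring|apply/funext => m; ring|ring]. Qed.
(** Since M is constant, the derivative of E k times M can also be found by differentiating [E_M].
    Comparing the coefficients of phi M and of phi with [Db_E'] yields [Q_form] and [delb_al]. *)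
Lemma Db_EM l k : (Db l (E k)) *m M = lin (delb l (al k) - \sum_m s k m * Q m l)
  (fun m => delb l (s k m)) (- (wi * \sum_m s k m * G m l)).
Proof.
have := congr1 (Db l) (E_M k); rewrite Db_mul DbM mulmx0 addr0 => ->.
rewrite /lin scale0r addr0 Db_add Db_scale Dbphi scaler0 addr0 Db_sum.
have -> : delb l (al k) *: phi = lin (delb l (al k)) (fun=> 0) 0.
  exact: phi_scale.
have -> : \sum_i Db l (s k i *: E i) =
  \sum_i lin (- (s k i * Q i l)) (fun m => delb l (s k i) * (m == i)%:R) (- (wi * (s k i * G i l))).
  apply: eq_bigr => i _; rewrite Db_scale Db_E' [E i]E_lin !lin_scale lin_add.
  by congr lin; [ring|apply/funext => m; ring|ring].
rewrite lin_sum lin_add; congr lin.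
- by rewrite sumrN.
- apply/funext => m; rewrite add0r -[RHS](sum_delta (fun i => delb l (s k i))).
  by apply: eq_bigr => i _; rewrite mulrC eq_sym.
- by rewrite add0r sumrN mulr_sumr.
Qed.
Lemma Q_form k l : Q k l = wi * (s *m G) k l - 4 * q * G k l.
Proof.
have := Db_EM l k; rewrite Db_E' /lin mulmxDl -[X in X = _]/(_ + _).
rewrite -!/(lin _ _ _) mulmxDl mulmx_suml -!scalemxAl -defbe be_M.
rewrite big1 => [|j _]; last by rewrite scale0r mul0mx.
rewrite addr0 be_scale !lin_scale lin_add => /lin_inj[_ _].
move=> h; have e1 : - (wi * G k l) * - (wi * q) = (wi * wi) * q * G k l by ring.
have e2 : (s *m G) k l = \sum_m s k m * G m l by rewrite mxE.
rewrite e1 wi2 -e2 in h.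
move/eqP: h; rewrite -subr_eq0 => /eqP h.
by apply/eqP; rewrite -subr_eq0 -oppr_eq0 -[X in _ == X]h; apply/eqP; ring.
Qed.
Lemma delb_al k l : delb l (al k) = \sum_m s k m * Q m l - wi * G k l * c.
Proof.
have := Db_EM l k; rewrite Db_E' /lin mulmxDl -!/(lin _ _ _) mulmxDl mulmx_suml -!scalemxAl -defbe be_M.
rewrite big1 => [|j _]; last by rewrite scale0r mul0mx.
rewrite addr0 be_scale !lin_scale lin_add => /lin_inj[h _ _].
move/eqP: h; rewrite -subr_eq0 => /eqP h.
by apply/eqP; rewrite -subr_eq0 -oppr_eq0 -[X in _ == X]h; apply/eqP; ring.
Qed.
Lemma Tw_lin k a v b : Tw k (lin a v b) =
  lin (del k a + a * ga k + b * ga k * 0 + b * al k)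
   (fun m => a * (m == k)%:R + del k (v m) + v m * ga k + \sum_i v i * Gam G Gi k i m + b * s k m)
   (del k b + b * ga k).
Proof.
rewrite /lin !Tw_D Tw_Z Tw_phi' Tw_sum Tw_Z.
have -> : Tw k be = lin (al k) (fun m => s k m) (ga k).
  rewrite defbe Tw_M TwE mulmxDl E_M -scalemxAl -defbe be_scale lin_add.
  by congr lin; [ring|apply/funext => m; ring|ring].
have -> : \sum_i Tw k (v i *: E i) =
  \sum_i lin 0 (fun m => del k (v i) * (m == i)%:R + v i * ga k * (m == i)%:R + v i * Gam G Gi k i m) 0.
  apply: eq_bigr => i _; rewrite Tw_Z Tw_E [E i]E_lin !lin_scale lin_add.
  by congr lin; [ring|apply/funext => m; ring|ring].
rewrite lin_sum phi_scale be_scale !lin_scale !lin_add; congr lin.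
- by rewrite big1 //; ring.
- apply/funext => m; rewrite !big_split /=.
  have -> : \sum_i del k (v i) * (m == i)%:R = del k (v m).
    rewrite -[RHS](sum_delta' (fun i => del k (v i))); apply: eq_bigr => i _; by rewrite eq_sym.
  have -> : \sum_i v i * ga k * (m == i)%:R = v m * ga k.
    rewrite -[RHS](sum_delta' (fun i => v i * ga k)); apply: eq_bigr => i _; by rewrite eq_sym.
  ring.
- by rewrite big1 //; ring.
Qed.
(** The twisted derivative commutes with the constant M. Comparing the E-coefficients and taking the
    trace removes the Christoffel symbols. *)
Lemma tr_s k : del k (\tr s) = - al k.
Proof.
have h l m : al l * (m == k)%:R + del k (s l m) + s l m * ga k + \sum_i s l i * Gam G Gi k i m =
   \sum_i (ga k * (i == l)%:R + Gam G Gi k l i) * s i m.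
  have := Tw_M k (E l); rewrite E_M Tw_lin Tw_E {2}/lin !scale0r add0r addr0 mulmx_suml.
  have -> : \sum_i ((ga k * (i == l)%:R + Gam G Gi k l i) *: E i) *m M =
    \sum_i lin ((ga k * (i == l)%:R + Gam G Gi k l i) * al i)
      (fun m => (ga k * (i == l)%:R + Gam G Gi k l i) * s i m) 0.
    by apply: eq_bigr => i _; rewrite -scalemxAl E_M lin_scale mulr0.
  rewrite lin_sum => /lin_inj[_ hh _]; have := hh m; rewrite mul0r addr0; exact.
have : \sum_l (al l * (l == k)%:R + del k (s l l) + s l l * ga k + \sum_i s l i * Gam G Gi k i l) =
  \sum_l (ga k * s l l + \sum_i Gam G Gi k l i * s i l).
  apply: eq_bigr => l _; rewrite h.
  rewrite -[s l l in RHS](sum_delta (fun i => s i l)) mulr_sumr -big_split /=.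
  by apply: eq_bigr => i _; ring.
rewrite !big_split /= sum_delta' -del_sum -mulr_suml -mulr_sumr -/(\tr s).
have -> : \sum_l \sum_i s l i * Gam G Gi k i l = \tr (s *m Gam G Gi k).
  by apply: eq_bigr => l _; rewrite mxE.
have -> : \sum_l \sum_i Gam G Gi k l i * s i l = \tr (Gam G Gi k *m s).
  by apply: eq_bigr => l _; rewrite mxE.
rewrite mxtrace_mulC => /addIr.
rewrite mulrC => /eqP; rewrite -[X in _ == X]add0r => /eqP /addIr /eqP.
by rewrite addrC addr_eq0 => /eqP.
Qed.
Lemma del_q k : wi * del k q = - al k.
Proof.
have h : bf (Tw k be) be = - al k * u + ga k * (wi * u * q).
  by rewrite defbe Tw_M TwE mulmxDl -scalemxAl -defbe bfDl hal bfZl bebe.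
have := del_bf k be be; rewrite Dbbe bf0r addr0 h bebe !delM del_wi gaE mul0r add0r => h2.
apply: (mulIr u_unit); move/eqP: h2; rewrite -subr_eq0 => /eqP h2.
by apply/eqP; rewrite -subr_eq0 -[X in _ == X]h2; apply/eqP; ring.
Qed.
Lemma QGi : Q *m Gi = wi *: s - (4 * q)%:M.
Proof.
have -> : Q = wi *: (s *m G) - (4 * q) *: G.
  by apply/matrixP => i j; rewrite Q_form !(addE, oppE, scaleE).
by rewrite mulmxBl -!scalemxAl -mulmxA GGi mulmx1 scalemx1.
Qed.
Lemma trQ k : del k (\tr (Q *m Gi)) + 4 * (n%:R + 1) * del k q = 0.
Proof.
rewrite QGi.
rewrite mxtraceD [\tr (- _)]raddfN /= mxtraceZ mxtrace_scalar delB delM del_wi mul0r add0r.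
rewrite tr_s -del_q.
have -> : wi * (wi * del k q) = (wi * wi) * del k q by ring.
rewrite wi2 -(mulr_natr (4 * q) n) !delM !del_nat; ring.
Qed.
(** [Db l (Tw k (E i))] is computed in two ways, by the curvature of [Tw] and by differentiating
    [Tw_E]. The E-components of the results give the curvature of the metric. *)
Lemma Om_form k l i m : Om G Gi k l i m = bochner_form G Q (Q *m Gi) q k l i m.
Proof.
have S_form a b : (Q *m Gi) a b = wi * s a b - 4 * q * (a == b)%:R.
  have e : ((4 * q)%:M : 'M[A]_n) a b = 4 * q * (a == b)%:R by rewrite mxE mulr_natr.
  by rewrite QGi !(addE, oppE, scaleE) e.
have h1 : Db l (Tw k (E i)) = lin (- del k (Q i l) - Q i l * ga k - wi * G i l * al k - wi * G k l * al i)
  (fun m => - Q i l * (m == k)%:R - wi * G i l * s k m - wi * G k l * s i m)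
  (- (wi * del k (G i l)) - wi * G i l * ga k).
  rewrite Db_Tw Db_E' Tw_lin -GE E_M -scaleNr lin_scale lin_add; congr lin.
  - by rewrite delN; ring.
  - apply/funext => m'; rewrite del0 big1 => [|j _]; last by rewrite mul0r.
    by ring.
  - by rewrite delN delM del_wi; ring.
have : Db l (Tw k (E i)) = lin (\sum_j (ga k * (j == i)%:R + Gam G Gi k i j) * - Q j l)
  (fun m => Q k l * (m == i)%:R + delb l (Gam G Gi k i m))
  (\sum_j (ga k * (j == i)%:R + Gam G Gi k i j) * - (wi * G j l)).
  rewrite Tw_E /lin !scale0r add0r addr0 Db_sum.
  have -> : \sum_j Db l ((ga k * (j == i)%:R + Gam G Gi k i j) *: E j) =
    \sum_j lin ((ga k * (j == i)%:R + Gam G Gi k i j) * - Q j l)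
     (fun m => (Q k l * (j == i)%:R + delb l (Gam G Gi k i j)) * (m == j)%:R)
     ((ga k * (j == i)%:R + Gam G Gi k i j) * - (wi * G j l)).
    apply: eq_bigr => j _; rewrite Db_scale Db_E' [E j]E_lin !lin_scale lin_add.
    rewrite delbD delbM -QE delb_nat.
    by congr lin; [ring|apply/funext => m'; ring|ring].
  rewrite lin_sum; congr lin; apply/funext => m'.
  rewrite -[RHS](sum_delta' (fun j => Q k l * (j == i)%:R + delb l (Gam G Gi k i j))).
  by apply: eq_bigr => j _; rewrite [m' == j]eq_sym.
rewrite h1 => /lin_inj[_ /(_ m) h _].
rewrite /bochner_form !S_form /Om oppE DbE.
have -> : delb l (Gam G Gi k i m) =
  - Q i l * (m == k)%:R - wi * G i l * s k m - wi * G k l * s i m - Q k l * (m == i)%:R.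
  by rewrite h [_ + delb _ _]addrC addrK.
rewrite [i == m]eq_sym [k == m]eq_sym; ring.
Qed.
End Structure.

(** * The flat connection of a Bochner-flat metric *)

Section Block3.
Context {T : Type} {n : nat}.
Definition block3 (a : 'M[T]_1) (b : 'rV[T]_n) (c : 'M[T]_1)
  (d : 'cV[T]_n) (e : 'M[T]_n) (f : 'cV[T]_n)
  (g : 'M[T]_1) (h : 'rV[T]_n) (i : 'M[T]_1) : 'M[T]_(1 + (n + 1)) :=
  col_mx (row_mx a (row_mx b c)) (col_mx (row_mx d (row_mx e f)) (row_mx g (row_mx h i))).
Lemma block3_eq a b c d e f g h i a' b' c' d' e' f' g' h' i' :
  a = a' -> b = b' -> c = c' -> d = d' -> e = e' -> f = f' -> g = g' -> h = h' -> i = i' ->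
  block3 a b c d e f g h i = block3 a' b' c' d' e' f' g' h' i'.
Proof. by move=> -> -> -> -> -> -> -> -> ->. Qed.
Lemma block3_map (T' : Type) (F : T -> T') a b c d e f g h i :
  map_mx F (block3 a b c d e f g h i) =
  @col_mx T' 1 (n + 1) (1 + (n + 1)) (row_mx (map_mx F a) (row_mx (map_mx F b) (map_mx F c)))
   (col_mx (row_mx (map_mx F d) (row_mx (map_mx F e) (map_mx F f)))
           (row_mx (map_mx F g) (row_mx (map_mx F h) (map_mx F i)))).
Proof. by rewrite /block3 !(map_col_mx, map_row_mx). Qed.
Lemma block3_tr a b c d e f g h i : (block3 a b c d e f g h i)^T =
  col_mx (row_mx a^T (row_mx d^T g^T)) (col_mx (row_mx b^T (row_mx e^T h^T)) (row_mx c^T (row_mx f^T i^T))).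
Proof.
rewrite /block3 !(tr_col_mx, tr_row_mx).
have E (m1 m2 n1 n2 : nat) (x1 : 'M[T]_(m1, n1)) (x2 : 'M[T]_(m2, n1)) (y1 : 'M[T]_(m1, n2)) (y2 : 'M[T]_(m2, n2)) :
    row_mx (col_mx x1 x2) (col_mx y1 y2) = col_mx (row_mx x1 y1) (row_mx x2 y2).
  by rewrite -block_mxEh block_mxEv.
by rewrite !E.
Qed.
End Block3.

Section Block3Ring.
Context {T : nzRingType} {n : nat}.
Implicit Types (a c g i : 'M[T]_1) (b h : 'rV[T]_n) (d f : 'cV[T]_n) (e : 'M[T]_n).
Lemma block3_add a b c d e f g h i a' b' c' d' e' f' g' h' i' :
  block3 a b c d e f g h i + block3 a' b' c' d' e' f' g' h' i' =
  block3 (a + a') (b + b') (c + c') (d + d') (e + e') (f + f') (g + g') (h + h') (i + i').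
Proof. by rewrite /block3 !(add_col_mx, add_row_mx). Qed.
Lemma block3_opp a b c d e f g h i :
  - block3 a b c d e f g h i = block3 (- a) (- b) (- c) (- d) (- e) (- f) (- g) (- h) (- i).
Proof. by rewrite /block3 !(opp_col_mx, opp_row_mx). Qed.
Lemma block3_scale x a b c d e f g h i : x *: block3 a b c d e f g h i =
  block3 (x *: a) (x *: b) (x *: c) (x *: d) (x *: e) (x *: f) (x *: g) (x *: h) (x *: i).
Proof. by rewrite /block3 !(scale_col_mx, scale_row_mx). Qed.
Lemma block3_scalar (x : T) : (x%:M : 'M[T]_(1 + (n + 1))) = block3 x%:M 0 0 0 x%:M 0 0 0 x%:M.
Proof.
rewrite /block3 [LHS]scalar_mx_block /block_mx [in RHS]row_mx0; congr col_mx.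
by rewrite -[RHS]block_mxEv [RHS]block_mxEh col_mx0 [in LHS]scalar_mx_block.
Qed.
Lemma block3_mul a b c d e f g h i a' b' c' d' e' f' g' h' i' :
  block3 a b c d e f g h i *m block3 a' b' c' d' e' f' g' h' i' =
  block3 (a *m a' + (b *m d' + c *m g')) (a *m b' + (b *m e' + c *m h')) (a *m c' + (b *m f' + c *m i'))
   (d *m a' + (e *m d' + f *m g')) (d *m b' + (e *m e' + f *m h')) (d *m c' + (e *m f' + f *m i'))
   (g *m a' + (h *m d' + i *m g')) (g *m b' + (h *m e' + i *m h')) (g *m c' + (h *m f' + i *m i')).
Proof.
rewrite /block3 !mul_col_mx !mul_row_col !mul_mx_row !add_row_mx.
by [].
Qed.
End Block3Ring.

Section Block3Derivations.
Context {R : realType} {n : nat} {A : dring R n}.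
Implicit Types (a c g i : 'M[A]_1) (b h : 'rV[A]_n) (d f : 'cV[A]_n) (e : 'M[A]_n).
Lemma D_block3 k a b c d e f g h i : D k (block3 a b c d e f g h i) =
  block3 (D k a) (D k b) (D k c) (D k d) (D k e) (D k f) (D k g) (D k h) (D k i).
Proof. exact: block3_map. Qed.
Lemma Db_block3 k a b c d e f g h i : Db k (block3 a b c d e f g h i) =
  block3 (Db k a) (Db k b) (Db k c) (Db k d) (Db k e) (Db k f) (Db k g) (Db k h) (Db k i).
Proof. exact: block3_map. Qed.
Lemma star_block3 a b c d e f g h i : star (block3 a b c d e f g h i) =
  block3 (star a) (star d) (star g) (star b) (star e) (star h) (star c) (star f) (star i).
Proof. rewrite /star block3_tr; exact: block3_map. Qed.
Lemma D_scalar k (x : A) (m : nat) : D k (x%:M : 'M[A]_m) = (del k x)%:M.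
Proof. by apply/matrixP => u v; rewrite !mxE; case: (u == v); rewrite ?mulr1n // !mulr0n del0. Qed.
Lemma Db_scalar k (x : A) (m : nat) : Db k (x%:M : 'M[A]_m) = (delb k x)%:M.
Proof. by apply/matrixP => u v; rewrite !mxE; case: (u == v); rewrite ?mulr1n // !mulr0n delb0. Qed.
Lemma star_scalar (x : A) (m : nat) : star (x%:M : 'M[A]_m) = (cj x)%:M.
Proof. by apply/matrixP => u v; rewrite !mxE eq_sym; case: (u == v); rewrite ?mulr1n // !mulr0n cj0. Qed.
Lemma D_delta k (r s : nat) u v : D k (delta_mx u v : 'M[A]_(r, s)) = 0.
Proof. by apply/matrixP => x y; rewrite !mxE del_nat. Qed.
Lemma Db_delta k (r s : nat) u v : Db k (delta_mx u v : 'M[A]_(r, s)) = 0.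
Proof. by apply/matrixP => x y; rewrite !mxE delb_nat. Qed.
Lemma D_col k (r s : nat) l (M : 'M[A]_(r, s)) : D k (col l M) = col l (D k M).
Proof. exact: map_col. Qed.
Lemma Db_col k (r s : nat) l (M : 'M[A]_(r, s)) : Db k (col l M) = col l (Db k M).
Proof. exact: map_col. Qed.
Lemma star_col (r s : nat) l (M : 'M[A]_(r, s)) : star (col l M) = row l (star M).
Proof. by apply/matrixP => x y; rewrite !mxE. Qed.
End Block3Derivations.

(** * A flat connection with a parallel endomorphism and a parallel Hermitian form *)

Section Connection.
Context {R : realType} {n m : nat} {A : dring R n}.
Implicit Types (j k l : 'I_n).
Local Notation del := (@del R n A).
Local Notation delb := (@delb R n A).
Local Notation wi := (@wi R n A).
Variables (F : A) (th thb : 'I_n -> 'M[A]_m) (aa H : 'M[A]_m) (gam : 'I_n -> A) (G Q : 'M[A]_n).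
Hypothesis D_aa : forall k, D k aa = th k *m aa - aa *m th k.
Hypothesis Db_aa : forall k, Db k aa = thb k *m aa - aa *m thb k.
Hypothesis th_flat : forall j k, D j (th k) + th k *m th j = D k (th j) + th j *m th k.
Hypothesis gam_sym : forall j k, del j (gam k) = del k (gam j).
Hypothesis GE : forall k l, G k l = del k (delb l F).
Hypothesis delb_gam : forall k l, delb l (gam k) = Q k l.
Hypothesis th_thb : forall k l, Db l (th k) + (Q k l)%:M + (wi * G k l) *: aa + th k *m thb l =
  D k (thb l) + thb l *m th k.
Variable Th : 'I_n -> 'M[A]_m.
Hypothesis ThE : forall k, Th k = th k + (gam k)%:M + (wi * del k F) *: aa.

(* u H transported by the frame EE solves the equation of the one-parameter group generated by MM. *)
Variables (u : A) (EE Ei MM XX : 'M[A]_m).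
Hypothesis D_H : forall k, D k H = th k *m H + H *m star (thb k).
Hypothesis star_H : star H = - H.
Hypothesis aa_H : star (aa *m H) = aa *m H.
Hypothesis du : forall k, del k u = gam k * u.
Hypothesis cju : cj u = - u.
Hypothesis DE' : forall k, D k EE = Th k *m EE.
Hypothesis DbE' : forall k, Db k EE = thb k *m EE.
Hypothesis EEi : EE *m Ei = 1%:M.
Hypothesis MME : MM = Ei *m aa *m EE.
Hypothesis XXE : XX = Ei *m (u *: H) *m star Ei.
(** The endomorphism [aa] is parallel, and [gam] and the derivatives of F are closed, so the two
    correction terms in [Th] keep the (2,0)-curvature zero. *)
Lemma Th_flat j k : D j (Th k) + Th k *m Th j = D k (Th j) + Th j *m Th k.
Proof.
have h a b : D a (Th b) + Th b *m Th a =
  (D a (th b) + th b *m th a) + (del a (gam b))%:M + (wi * del a (del b F)) *: aa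
  + (gam b *: th a + gam a *: th b) + (gam b * gam a)%:M
  + (wi * del a F * gam b + wi * del b F * gam a) *: aa
  + (wi * del b F) *: (th a *m aa) + (wi * del a F) *: (th b *m aa)
  + (wi * del b F * (wi * del a F)) *: (aa *m aa).
  rewrite !ThE !D_add D_scale D_scalar delM del_wi mul0r add0r D_aa.
  rewrite !mulmxDl !mulmxDr !mul_mx_scalar !mul_scalar_mx -!scalemxAl -!scalemxAr.
  apply/matrixP => i o; rewrite !(addE, oppE, scaleE) ![_%:M _ _]mxE.
  by case: (i == o); rewrite ?mulr1n ?mulr0n; ring.
rewrite !h th_flat gam_sym (delC j k F) (mulrC (gam k)).
rewrite (addrC (gam k *: _)) (addrC (_ * gam k)) (mulrC (wi * del k F) (wi * _)).
by congr (_ + _); exact: addrAC.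
Qed.
(** By [th_thb] the curvature of the uncorrected pair is the sum of a scalar Q and a multiple of
    [aa]; the zbar-derivatives of the two correction terms supply exactly these. *)
Lemma Th_thb_flat k l : Db l (Th k) + Th k *m thb l = D k (thb l) + thb l *m Th k.
Proof.
have e : Db l (Th k) + Th k *m thb l =
  (Db l (th k) + (Q k l)%:M + (wi * G k l) *: aa + th k *m thb l) + gam k *: thb l + (wi * del k F) *: (thb l *m aa).
  rewrite !ThE !Db_add Db_scale Db_scalar delb_gam delbM delb_wi mul0r add0r -del_delb -GE Db_aa.
  rewrite !mulmxDl mul_scalar_mx -scalemxAl.
  by apply/matrixP => i o; rewrite !(addE, oppE, scaleE); ring.
rewrite e th_thb !ThE !mulmxDr mul_mx_scalar -scalemxAr.
by apply/matrixP => i o; rewrite !(addE, oppE, scaleE); ring.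
Qed.
Lemma DEi k : D k Ei = - (Ei *m Th k).
Proof. by rewrite (D_inv k EEi) DE' !mulmxA -(mulmxA (_ *m _)) EEi mulmx1. Qed.
Lemma DbEi k : Db k Ei = - (Ei *m thb k).
Proof. by rewrite (Db_inv k EEi) DbE' !mulmxA -(mulmxA (_ *m _)) EEi mulmx1. Qed.
(** A parallel endomorphism has constant matrix in a parallel frame; the corrections in [Th] commute
    with [aa]. *)
Lemma D_MM k : D k MM = 0.
Proof.
have h : D k aa = Th k *m aa - aa *m Th k.
  rewrite D_aa !ThE !mulmxDl !mulmxDr mul_mx_scalar mul_scalar_mx -scalemxAl -scalemxAr.
  by apply/matrixP => i o; rewrite !(addE, oppE, scaleE); ring.
rewrite MME !D_mul DEi DE' h mulNmx mulmxBr !mulmxDl mulNmx mulNmx !mulmxA.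
by rewrite addrA addNr add0r addNr.
Qed.
Lemma Db_MM k : Db k MM = 0.
Proof.
rewrite MME !Db_mul DbEi DbE' Db_aa mulNmx mulmxBr !mulmxDl mulNmx mulNmx !mulmxA.
by rewrite addrA addNr add0r addNr.
Qed.
Lemma star_XX : star XX = XX.
Proof. by rewrite XXE !star_mul starK star_scale star_H cju scalerN scaleNr opprK mulmxA. Qed.
(** In a parallel frame the connection terms of [D_H] cancel and [gam] is absorbed by u; only the
    term of [Th] with the derivative of F is left, and it is the differential equation of the
    exponential. *)
Lemma D_XX k : D k XX = (- wi * del k F) *: (MM *m XX).
Proof.
have hH : D k (u *: H) = u *: (Th k *m H + H *m star (thb k) - (wi * del k F) *: (aa *m H)).
  rewrite D_scale du D_H ThE !mulmxDl mul_scalar_mx -scalemxAl.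
  by apply/matrixP => i o; rewrite !(addE, oppE, scaleE); ring.
have -> : MM *m XX = Ei *m (u *: (aa *m H)) *m star Ei.
  by rewrite MME XXE !mulmxA -(mulmxA _ EE) EEi mulmx1 -!scalemxAr -!mulmxA.
rewrite XXE !D_mul DEi hH D_star DbEi star_opp star_mul.
rewrite mulmxDl !mulNmx mulmxN -!scalemxAr -!scalemxAl !mulmxA.
rewrite mulmxBr !mulmxDr mulmxBl mulmxDl -!scalemxAr -scalemxAl !mulmxA.
by apply/matrixP => i o; rewrite !(addE, oppE, scaleE); ring.
Qed.
Lemma XX_MM : XX *m star MM = - (MM *m XX).
Proof.
have h : H *m star aa = - (aa *m H).
  by rewrite -aa_H star_mul star_H mulNmx opprK.
rewrite XXE MME !star_mul.
have -> : Ei *m (u *: H) *m star Ei *m (star EE *m (star aa *m star Ei)) =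
   Ei *m (u *: (H *m star aa)) *m star Ei.
  rewrite !mulmxA -(mulmxA _ (star Ei) (star EE)) -star_mul EEi star1 mulmx1.
  by rewrite -!scalemxAr -!scalemxAl !mulmxA.
rewrite h !mulmxA -(mulmxA (Ei *m aa) EE Ei) EEi mulmx1.
by rewrite scalerN mulmxN mulNmx -!scalemxAr !mulmxA.
Qed.
End Connection.

(** * The connection matrices of a Bochner-flat metric and their flatness *)

Section Flatness.
Context {R : realType} {n : nat} {A : dring R n}.
Implicit Types (j k l i m : 'I_n).
Local Notation del := (@del R n A).
Local Notation delb := (@delb R n A).
Local Notation wi := (@wi R n A).
Variables (F : A) (G Gi Q : 'M[A]_n) (q c : A) (y : Cplx R).
Hypothesis n2 : (2 <= n)%N.
Hypothesis Freal : cj F = F.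
Hypothesis GE : forall k l, G k l = del k (delb l F).
Hypothesis GGi : G *m Gi = 1%:M.
Hypothesis Qstar : star Q = Q.
Hypothesis qreal : cj q = q.
Hypothesis creal : cj c = c.
Hypothesis omQ : forall k l i m, Om G Gi k l i m = bochner_form G Q (Q *m Gi) q k l i m.
Hypothesis trSq : \tr (Q *m Gi) + 4 * (n%:R + 1) * q = cs y.
Hypothesis hc : 4%:R *: Zq q = (Q *m Gi) *m Q + (4 * q) *: Q + (4 * c) *: G.

Local Notation S := (Q *m Gi).
Local Notation Gam := (Gam G Gi).
Local Notation dq := (dq q).
Let Gstar : star G = G := hess_star Freal GE.
Let Gsym : forall k i l, del k (G i l) = del i (G k l) := hess_sym GE.
Lemma H1 k : del k (\tr S) + 4 * (n%:R + 1) * del k q = 0.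
Proof.
have := congr1 (del k) trSq; rewrite del_cs delD [del k (_ * q)]delM (_ : del k (4 * (n%:R + 1)) = 0) => [<-|]; first by ring.
by rewrite -(natrD _ n 1) -natrM del_nat.
Qed.
Definition N k : 'M[A]_n := D k Q - Gam k *m Q.
Lemma DQ_N k : D k Q = N k + Gam k *m Q. Proof. by rewrite /N subrK. Qed.
Definition ca : 'cV[A]_n := locked (- wi *: dq).
Lemma caE : ca = - wi *: dq. Proof. by rewrite /ca -lock. Qed.
Definition hq : A := cs ('i / 2).
Lemma wiE : wi = - 4 * hq.
Proof.
rewrite /hq /wi -cs_nat mulNr -csM -csN; congr cs; field.
by [].
Qed.
Lemma hq2 : 4 * (hq * hq) = -1.
Proof.
rewrite /hq -cs_nat -!csM.
have -> : 4 * ('i / 2 * ('i / 2)) = -1 :> Cplx R by rewrite mulrACA sqrCi1; field.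
by rewrite csN cs1.
Qed.
Lemma del_hq k : del k hq = 0. Proof. exact: del_cs. Qed.
Lemma delb_hq k : delb k hq = 0. Proof. exact: delb_cs. Qed.
Definition csm : 'M[A]_n := locked (hq *: (S + (4 * q)%:M)).
Lemma csmE : csm = hq *: (S + (4 * q)%:M). Proof. by rewrite /csm -lock. Qed.
Definition cb : 'rV[A]_n := locked (- (star dq *m Gi)).
Lemma cbE : cb = - (star dq *m Gi). Proof. by rewrite /cb -lock. Qed.
Definition cd : A := locked (- wi * q).
Lemma cdE : cd = - wi * q. Proof. by rewrite /cd -lock. Qed.
(** The would-be logarithmic derivative of u: by [trOm] the zbar-derivative of the trace is -((n+2)
    Q + y G), so adding y times the derivative of F and dividing by -(n+2) makes the zbar-derivative
    equal to Q (see [delb_gam]). *)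
Definition gam k : A := - cs (n.+2%:R)^-1 * (\tr (Gam k) + cs y * del k F).
Definition ek k : 'rV[A]_n := delta_mx 0 k.
(** The coefficients of [Tw_phi'], [Tw_E] and the twisted derivative of phi M in the frame, with the
    common summand [ga] taken out. Likewise [thb] contains those of [Db_E]. *)
Definition th k := block3 0 (ek k) 0 0 (Gam k) 0 (ca k 0)%:M (ek k *m csm) 0.
Definition thb l := block3 0 0 0 (- col l Q) 0 (- wi *: col l G) 0 0 0.
(** The matrix of M in the frame phi, E, phi M as found for solutions in [E_M] and [be_M]: al =
    [ca], s = [csm], bv = [cb], each expressed by Q, q, c. The first row says that phi is sent to
    phi M. *)
Definition aa := block3 0 0 1%:M ca csm 0 c%:M cb cd%:M.
Definition Th k := th k + (gam k)%:M + (wi * del k F) *: aa.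
Lemma D_dq' k : D k dq = Gam k *m dq.
Proof. exact: (@D_dq R n A G Gi GGi Gsym Q q n2 S N erefl DQ_N omQ H1 k). Qed.
Lemma delQE' k i l : del k (Q i l) = (Gam k *m Q) i l - 4 * (del k q * G i l + del i q * G k l).
Proof. exact: (@delQE R n A G Gi GGi Gsym Q q n2 S N erefl DQ_N omQ H1). Qed.
Lemma DQE k : D k Q = Gam k *m Q - 4%:R *: (del k q *: G + dq *m row k G).
Proof.
apply/matrixP => i l; rewrite DE delQE' !(addE, oppE, scaleE, outerE) dqE.
by rewrite [row _ _ _ _]mxE.
Qed.
Lemma DS k : D k S = Gam k *m S - S *m Gam k - 4%:R *: ((del k q)%:M + dq *m ek k).
Proof.
rewrite D_mul DQE (DGi GGi) mulmxN !mulmxBl -scalemxAl mulmxDl -scalemxAl GGi scalemx1.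
by rewrite -(mulmxA dq) -row_mul GGi row1 !mulmxA addrAC.
Qed.
Lemma Dca k : D k ca = Gam k *m ca.
Proof. by rewrite caE D_scale delN del_wi oppr0 scale0r add0r D_dq' scalemxAr. Qed.
Lemma ca0E i : ca i 0 = 4 * hq * del i q.
Proof. by rewrite caE scaleE dqE wiE; ring. Qed.
Lemma Dcsm k : D k csm = Gam k *m csm - csm *m Gam k - ca *m ek k.
Proof.
rewrite csmE D_scale del_hq scale0r add0r.
rewrite D_add DS D_scalar delM del_nat mul0r add0r -scalemxAr -scalemxAl mulmxDr mulmxDl.
rewrite mul_mx_scalar mul_scalar_mx caE -scalemxAl wiE.
apply/matrixP => i m; rewrite !(addE, oppE, scaleE) ![_%:M _ _]mxE !(mulrnAr, mulr_natl).
by case: (i == m); rewrite ?mulr1n ?mulr0n; ring.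
Qed.
Lemma csm2 : 4%:R *: (csm *m csm) = - (S *m S + (8 * q) *: S + (16 * (q * q))%:M).
Proof.
rewrite csmE -scalemxAl -scalemxAr !scalerA -(mulrA 4) hq2 scaleN1r; congr (- _).
rewrite mulmxDl !mulmxDr mul_mx_scalar mul_scalar_mx -scalar_mxM.
rewrite -!addrA; congr (_ + _); rewrite addrA -scalerDl; congr (_ *: _ + _%:M); ring.
Qed.
(** The equation of c rewritten as a quadratic relation for [csm]; it gives the derivative of
    [cb]. *)
Lemma ZGi : Zq q *m Gi = c%:M - csm *m csm + cd *: csm.
Proof.
have h := congr1 (mulmx^~ Gi) hc; rewrite /= !mulmxDl -!scalemxAl -(mulmxA S) GGi scalemx1 in h.
have h4 := csm2; apply/matrixP => i j; apply: (@nat_cancel _ _ _ 3).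
have := congr1 (fun M : 'M[A]_n => M i j) h4; have := congr1 (fun M : 'M[A]_n => M i j) h.
set x2 := (csm *m csm) i j; rewrite cdE wiE !(addE, oppE, scaleE) ![_%:M _ _]mxE -/x2 csmE !(addE, scaleE) ![_%:M _ _]mxE.
case: (i == j); rewrite ?mulr1n ?mulr0n => hz hx.
  have -> : 4 * (c - x2 + - (- 4 * hq) * q * (hq * (S i j + 4 * q))) =
    4 * c - (4 * x2) + 4 * (4 * (hq * hq)) * q * (S i j + 4 * q) by ring.
  rewrite hz hx hq2; ring.
have -> : 4 * (0 - x2 + - (- 4 * hq) * q * (hq * (S i j + 0))) =
    - (4 * x2) + 4 * (4 * (hq * hq)) * q * (S i j) by ring.
by rewrite hz hx hq2; ring.
Qed.
Lemma D_dqs k : D k (star dq) = row k (Zq q).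
Proof.
rewrite D_star; apply/matrixP => i j; rewrite ord1 starE DbE dqE [RHS]mxE [Zq q k j]mxE.
by rewrite -del_cj -delb_real // del_delb.
Qed.
Lemma Dcb k : D k cb = - (cb *m Gam k) - c *: ek k + ek k *m csm *m csm - cd *: (ek k *m csm).
Proof.
rewrite cbE D_opp D_mul D_dqs (DGi GGi) mulmxN -[row k _ *m Gi]row_mul ZGi.
rewrite rowE !mulmxDr mulmxN mul_mx_scalar -scalemxAr !mulmxA mulNmx !opprD !opprK.
rewrite -/(ek k) addrC -!addrA; congr (_ + (_ + _)).
Qed.
Lemma Dcd k : del k cd = ca k 0.
Proof. by rewrite cdE delM delN del_wi oppr0 mul0r add0r caE scaleE dqE. Qed.
Lemma Dcc k : del k c = (csm *m ca) k 0 - cd * ca k 0.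
Proof.
rewrite (@del_c R n A G Gi GGi Gsym Q q n2 S N erefl DQ_N omQ H1 c hc k).
rewrite csmE caE -scalemxAl -scalemxAr mulmxDl mul_scalar_mx cdE wiE !(addE, scaleE) dqE.
set x := (S *m dq) k 0.
have -> : hq * (- (- 4 * hq) * (x + 4 * q * del k q)) - - (- 4 * hq) * q * (- (- 4 * hq) * del k q) =
  (4 * (hq * hq)) * (x + 4 * q * del k q) - 4 * (4 * (hq * hq)) * q * del k q by ring.
by rewrite hq2; ring.
Qed.
Lemma row_scal k (M : 'M[A]_(n, 1)) : ek k *m M = (M k 0)%:M.
Proof. by apply/matrixP => i j; rewrite !ord1 -rowE !mxE. Qed.
Lemma scal_ek k l (M : 'M[A]_n) : ek k *m col l M = (M k l)%:M.
Proof. by rewrite row_scal mxE. Qed.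
Lemma D_aa k : D k aa = th k *m aa - aa *m th k.
Proof.
rewrite /aa /th D_block3 !block3_mul block3_opp block3_add.
rewrite !(mul0mx, mulmx0, mul1mx, mulmx1, add0r, addr0, oppr0, D_zero, D_scalar, D_1).
rewrite Dca Dcsm Dcb Dcd Dcc !row_scal !mul_scalar_mx.
apply: block3_eq => //.
- by rewrite subrr.
- by rewrite subrr.
- by rewrite opprD addrA [RHS]addrAC.
- by rewrite -mulmxA row_scal scale_scalar_mx raddfB.
- by apply/matrixP => i j; rewrite !(addE, oppE); ring.
Qed.
Lemma Db_dq l : Db l dq = col l (Zq q).
Proof. by apply/matrixP => i j; rewrite !mxE. Qed.
Lemma Db_dqs l : Db l (star dq) = star dq *m star (Gam l).
Proof. by rewrite Db_star D_dq' star_mul. Qed.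
Lemma DbGi l : Db l Gi = - (star (Gam l) *m Gi).
Proof. by rewrite -{1}(Gistar GGi Gstar) Db_star (DGi GGi) star_opp star_mul (Gistar GGi Gstar). Qed.
Lemma DbQE l : Db l Q = Q *m star (Gam l) - 4%:R *: (delb l q *: G + col l G *m star dq).
Proof.
apply/matrixP => i m; rewrite DbE (@Db_Q R n A G Gi GGi Gstar Gsym Q q n2 Qstar qreal S N erefl DQ_N omQ H1 l i m).
by rewrite !(addE, oppE, scaleE, outerE) starE dqE -delb_real // [col _ _ _ _]mxE; ring.
Qed.
Lemma DbS l : Db l S = - (4%:R *: ((delb l q)%:M - col l G *m cb)).
Proof.
rewrite Db_mul DbQE DbGi mulmxN mulmxBl -scalemxAl mulmxDl -scalemxAl GGi scalemx1 cbE.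
by rewrite -!mulmxA mulmxN opprK addrAC subrr add0r.
Qed.
Lemma Dbcsm l : Db l csm = - wi *: (col l G *m cb).
Proof.
rewrite csmE Db_scale delb_hq scale0r add0r Db_add DbS Db_scalar delbM delb_nat mul0r add0r wiE.
apply/matrixP => i m; rewrite !(addE, oppE, scaleE) ![_%:M _ _]mxE.
by case: (i == m); rewrite ?mulr1n ?mulr0n; ring.
Qed.
Lemma Dbca l : Db l ca = csm *m col l Q - (wi * c) *: col l G.
Proof.
rewrite caE csmE Db_scale delbN delb_wi oppr0 scale0r add0r Db_dq wiE.
have h := congr1 (col l) hc.
have -> : - (- 4 * hq) *: col l (Zq q) = hq *: (4%:R *: col l (Zq q)).
  by rewrite scalerA; congr (_ *: _); ring.
have -> : 4%:R *: col l (Zq q) = col l (4%:R *: Zq q) by apply/matrixP => i j; rewrite !mxE.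
rewrite h -scalemxAl mulmxDl mul_scalar_mx {h}.
have -> : S *m col l Q = col l (S *m Q) by rewrite !colE mulmxA.
have cE (M : 'M[A]_n) (i : 'I_n) (j : 'I_1) : col l M i j = M i l by rewrite mxE.
by apply/matrixP => i j; rewrite !(addE, oppE, scaleE) !cE !(addE, oppE, scaleE); ring.
Qed.
Lemma Dbcb l : Db l cb = 0.
Proof.
by rewrite cbE Db_opp Db_mul Db_dqs DbGi mulmxN !mulmxA subrr oppr0.
Qed.
Lemma cbG l : cb *m col l G = (- delb l q)%:M.
Proof.
rewrite cbE mulNmx colE mulmxA -(mulmxA (star dq)) (GiG GGi) mulmx1 -colE.
by apply/matrixP => i j; rewrite !ord1 oppE [col _ _ _ _]mxE starE dqE -delb_real // [RHS]mxE eqxx.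
Qed.
Lemma Dbcd l : delb l cd = - wi * delb l q.
Proof. by rewrite cdE delbM delbN delb_wi oppr0 mul0r add0r. Qed.
Lemma Sstar' : star S = Gi *m Q.
Proof. by rewrite star_mul Qstar (Gistar GGi Gstar). Qed.
Lemma Dbcc l : (delb l c)%:M = cb *m col l Q.
Proof.
have h : del l c = - (S *m dq) l 0 := @del_c R n A G Gi GGi Gsym Q q n2 S N erefl DQ_N omQ H1 c hc l.
rewrite (delb_real l creal) h cjN -starE star_mul Sstar' cbE mulNmx mulmxA.
by apply/matrixP => i j; rewrite !ord1 !mxE eqxx mulr1n; congr (- _); apply: eq_bigr => k _; rewrite !mxE.
Qed.
Lemma QG : Q = wi *: (csm *m G) - (4 * q) *: G.
Proof.
rewrite csmE -scalemxAl mulmxDl mul_scalar_mx -mulmxA (GiG GGi) mulmx1 scalerA wiE.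
have -> : - 4 * hq * hq = - (4 * (hq * hq)) by ring.
by rewrite hq2 opprK scale1r addrK.
Qed.
Lemma colQG l : col l Q = wi *: (csm *m col l G) - (4 * q) *: col l G.
Proof.
rewrite {1}QG; have -> : csm *m col l G = col l (csm *m G) by rewrite !colE mulmxA.
by apply/matrixP => i j; rewrite !mxE.
Qed.
Lemma Db_aa l : Db l aa = thb l *m aa - aa *m thb l.
Proof.
rewrite /aa /thb Db_block3 !block3_mul block3_opp block3_add.
rewrite !(mul0mx, mulmx0, mul1mx, mulmx1, add0r, addr0, oppr0, Db_zero, Db_scalar, Db_1).
rewrite Dbca Dbcsm Dbcb Dbcd Dbcc !mul_mx_scalar.
rewrite !(mulNmx, mulmxN) -!scalemxAl -!scalemxAr cbG.
apply: block3_eq => //.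
- by rewrite opprK addrC !scaleNr scalerN scalerA [c * _]mulrC.
- rewrite colQG !scaleNr !scalerN !opprK opprD opprK cdE scalerA.
  have -> : - wi * q * wi = - (wi * wi) * q by ring.
  rewrite wi2; apply/matrixP => i j; rewrite !(addE, oppE, scaleE) [LHS]mxE; ring.
- by rewrite opprK.
- by apply/matrixP => i j; rewrite !(addE, oppE, scaleE) ![_%:M _ _]mxE ?mxE !ord1 eqxx ?mulr1n /=; ring.
Qed.
Lemma n2_unit : cs (n.+2%:R)^-1 * (n%:R + 2) = 1 :> A.
Proof.
have -> : n%:R + 2 = cs n.+2%:R :> A by rewrite cs_nat -[in RHS]addn2 natrD.
by rewrite -csM mulVf ?cs1 // pnatr_eq0.
Qed.
Lemma delb_gam k l : delb l (gam k) = Q k l.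
Proof.
rewrite /gam delbM delbN delb_cs oppr0 mul0r add0r delbD delbM delb_cs mul0r add0r -del_delb -GE.
have -> : delb l (\tr (Gam k)) = - ((n%:R + 2) * Q k l + cs y * G k l).
  rewrite Db_tr; have -> : Db l (Gam k) = - Om G Gi k l by rewrite /Om opprK.
  rewrite raddfN /= (trOm GGi erefl omQ) trSq //.
have e : - cs n.+2%:R^-1 * (- ((n%:R + 2) * Q k l + cs y * G k l) + cs y * G k l) =
  (cs n.+2%:R^-1 * (n%:R + 2)) * Q k l by ring.
by rewrite e n2_unit mul1r.
Qed.
Lemma del_gam_sym j k : del j (gam k) = del k (gam j).
Proof.
have e a b : del a (gam b) = - cs n.+2%:R^-1 * (del a (\tr (Gam b)) + cs y * del a (del b F)).
  by rewrite /gam delM delN del_cs oppr0 mul0r add0r delD delM del_cs mul0r add0r.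
by rewrite !e (trGam_sym GGi j k) (delC j k).
Qed.
(** The middle block is [Gam_flat]; the other blocks agree because the lower indices of the
    Christoffel symbols commute. *)
Lemma th_flat j k : D j (th k) + th k *m th j = D k (th j) + th j *m th k.
Proof.
have h a b : D a (th b) + th b *m th a =
   block3 0 (ek b *m Gam a) 0 0 (D a (Gam b) + Gam b *m Gam a) 0
     (ek b *m (Gam a *m ca))
     (ek b *m (Gam a *m csm)) 0.
  rewrite /th D_block3 block3_mul block3_add D_mul D_delta.
  rewrite !(mul0mx, mulmx0, mul1mx, mulmx1, add0r, addr0, oppr0, D_zero, D_scalar).
  apply: block3_eq => //.
    by rewrite row_scal -DE Dca.
  rewrite Dcsm mul_scalar_mx !mulmxBr !mulmxA row_scal mul_scalar_mx.
  by apply/matrixP => i m; rewrite !(addE, oppE, scaleE); ring.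
rewrite !h (Gam_flat GGi j k); apply: block3_eq => //.
- by apply/matrixP => i m; rewrite !ord1 -!rowE !mxE (Gam_sym Gi Gsym).
- by apply/matrixP => i m; rewrite -!rowE ![row _ _ _ _]mxE (GamM_sym Gi Gsym).
- by apply/matrixP => i m; rewrite -!rowE ![row _ _ _ _]mxE (GamM_sym Gi Gsym).
Qed.
Lemma wihq : wi * hq = 1.
Proof. by rewrite wiE mulNr mulNr -mulrA hq2 opprK. Qed.
Lemma OmE' k l : - Om G Gi k l = - ((Q k l)%:M + col l Q *m ek k + wi *: (col l G *m (ek k *m csm)) + (wi * G k l) *: csm).
Proof.
rewrite (OmE omQ) csmE.
have hh x : wi * x * hq = x.
  rewrite wiE; have -> : - 4 * hq * x * hq = - (4 * (hq * hq)) * x by ring.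
  by rewrite hq2 opprK mul1r.
rewrite -!scalemxAr !scalerA hh (_ : wi * hq = 1); last by rewrite -[RHS](hh 1) mulr1.
rewrite scale1r mulmxDr mulmxDr mul_mx_scalar -scalemxAr /ek -(rowE k S) scalemx1.
by congr (- _); apply/matrixP => i m; rewrite !(addE, oppE, scaleE) ![_%:M _ _]mxE; case: (i == m); rewrite ?mulr1n ?mulr0n; ring.
Qed.
(** The middle block is the Bochner form of the curvature; the other blocks are the derivatives of
    G, Q, [csm] and [ca] established above. *)
Lemma th_thb k l : Db l (th k) + (Q k l)%:M + (wi * G k l) *: aa + th k *m thb l =
  D k (thb l) + thb l *m th k.
Proof.
rewrite [(Q k l)%:M]block3_scalar /th /thb /aa D_block3 Db_block3 block3_scale !block3_mul !block3_add.
rewrite !(mul0mx, mulmx0, mul1mx, mulmx1, add0r, addr0, oppr0, D_zero, Db_zero, Db_scalar, D_scalar, scaler0, Db_delta).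
rewrite D_opp !D_col D_scale delN del_wi oppr0 scale0r add0r D_col (DG GGi) DQE Db_mul Db_delta mul0mx add0r Dbcsm.
rewrite !(mulNmx, mulmxN) -!scalemxAr -!scalemxAl !scal_ek.
have cE (M : 'M[A]_n) (i : 'I_n) (j : 'I_1) : col l M i j = M i l by rewrite mxE.
have gE (M : 'M[A]_n) : M *m col l Q = col l (M *m Q) by rewrite !colE mulmxA.
have gG (M : 'M[A]_n) : M *m col l G = col l (M *m G) by rewrite !colE mulmxA.
have sE (x : A) : (x%:M : 'M[A]_1) 0 0 = x by rewrite mxE.
have rE (M : 'M[A]_n) (i : 'I_n) (j : 'I_1) : row k M j i = M k i by rewrite mxE.
apply: block3_eq => //.
- by rewrite subrr.
- by apply/matrixP => i m; rewrite !ord1 !(addE, scaleE, sE) [RHS]mxE; ring.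
- apply/matrixP => i m; rewrite ord1 gE !(addE, oppE, scaleE, cE, outerE, sE, rE) ca0E (ca0E k) dqE.
  have -> : wi * G k l * (4 * hq * del i q) = (wi * hq) * (4 * G k l * del i q) by ring.
  have -> : - wi * (G i l * (4 * hq * del k q)) = - (wi * hq) * (4 * G i l * del k q) by ring.
  by rewrite wihq; ring.
- have -> : Db l (Gam k) = - Om G Gi k l by rewrite /Om opprK.
  rewrite OmE'; apply/matrixP => i m; rewrite !(addE, oppE, scaleE, outerE, cE); ring.
- by rewrite gG. 
- have -> : ((delb l (ca k 0))%:M : 'M[A]_1) = ((csm *m col l Q) k 0 - (wi * c) * G k l)%:M.
    by rewrite -DbE Dbca addE oppE scaleE cE.
  apply/matrixP => i m; rewrite !ord1 -mulmxA row_scal !(addE, oppE, scaleE, sE) [RHS]mxE; ring.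
- rewrite mulmxA scal_ek mul_scalar_mx scalerA.
  by apply/matrixP => i m; rewrite !(addE, oppE, scaleE) [RHS]mxE; ring.
- rewrite -mulmxA row_scal cdE; have h := QG.
  have -> : (Q k l)%:M = (wi * (csm *m col l G) k 0 - 4 * q * G k l)%:M :> 'M[A]_1.
    by rewrite gG cE {1}QG !(addE, oppE, scaleE).
  apply/matrixP => i m; rewrite !ord1 !(addE, oppE, scaleE, sE) [RHS]mxE; set x := (_ *m _) k 0.
  have -> : wi * x - 4 * q * G k l + wi * G k l * (- wi * q) + - wi * x = - (4 + wi * wi) * (q * G k l) by ring.
  by rewrite wi2; ring.
Qed.
Lemma thb_flat j l : Db j (thb l) + thb l *m thb j = Db l (thb j) + thb j *m thb l.
Proof.
have h a b : thb a *m thb b = 0.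
  rewrite /thb block3_mul !(mul0mx, mulmx0, addr0).
  by rewrite -(scale0r (block3 0 0 0 0 0 0 0 0 0)) block3_scale !scaler0.
rewrite !h !addr0 /thb !Db_block3 !(Db_zero, Db_opp, Db_scale, delbN, delb_wi, oppr0, scale0r, add0r, Db_col).
have dG a b i : delb a (G i b) = delb b (G i a).
  by rewrite -Gstar ![star G _ _]mxE !mxE !delb_cj Gsym.
have dQ a b i : delb a (Q i b) = delb b (Q i a).
  by rewrite -Qstar !starE !delb_cj (@delQ_sym R n A G Gi GGi Gsym Q q S erefl omQ H1).
apply: block3_eq => //; apply/matrixP => i m; rewrite !(oppE, scaleE) ![col _ _ _ _]mxE !DbE.
  by rewrite dQ.
by rewrite dG.
Qed.
Lemma Th_flat' j k : D j (Th k) + Th k *m Th j = D k (Th j) + Th j *m Th k.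
Proof. exact: (Th_flat D_aa th_flat del_gam_sym (fun=> erefl)). Qed.
Lemma Th_thb_flat' k l : Db l (Th k) + Th k *m thb l = D k (thb l) + thb l *m Th k.
Proof. exact: (Th_thb_flat Db_aa GE delb_gam th_thb (fun=> erefl)). Qed.
(** The Gram matrix of the frame phi, E, phi M divided by u. Its upper left zero will become the
    equation for phi. *)
Definition gH := block3 0 0 (-1)%:M 0 (wi *: G) 0 1%:M 0 (wi * q)%:M.
Lemma star_gH : star gH = - gH.
Proof.
rewrite /gH star_block3 block3_opp !(star_scalar, star_scale, star0, oppr0, Gstar, cjM, cj_wi, qreal, cjN, cj1).
by apply: block3_eq; rewrite ?raddfN //= ?opprK ?mulNr ?raddfN ?scaleNr //.
Qed.
Lemma D_gH k : D k gH = th k *m gH + gH *m star (thb k).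
Proof.
rewrite /gH /th /thb D_block3 star_block3 !block3_mul block3_add.
rewrite !(mul0mx, mulmx0, mul1mx, mulmx1, add0r, addr0, oppr0, D_zero, D_scalar, star0, D_1).
rewrite delN del1 oppr0 raddf0 D_scale del_wi scale0r add0r (DG GGi) delM del_wi mul0r add0r.
rewrite !star_opp !star_scale !star_col Gstar Qstar cjN cj_wi opprK.
rewrite !mul_scalar_mx -!scalemxAr.
apply: block3_eq => //.
- by rewrite -rowE scaleN1r subrr.
- rewrite -mulmxA -[ek k *m _]rowE QG.
  by apply/matrixP => i m; rewrite !(addE, oppE, scaleE) ![row _ _ _ _]mxE !(addE, oppE, scaleE) [LHS]mxE; ring: (@wi2 R n A).
- apply/matrixP => i m; rewrite !ord1 scaleE ![_%:M _ _]mxE !mulr1n ca0E wiE; ring.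
Qed.
Lemma aa_gH : star (aa *m gH) = aa *m gH.
Proof.
have hQ : wi *: (csm *m G) = Q + (4 * q) *: G by rewrite [X in X + _]QG subrK.
have hb : cb *m G = - star dq by rewrite cbE mulNmx -mulmxA (GiG GGi) mulmx1.
rewrite /aa /gH block3_mul star_block3.
rewrite !(mul0mx, mulmx0, mul1mx, mulmx1, add0r, addr0).
rewrite -!scalemxAr hQ hb !mul_mx_scalar.
rewrite !(star0, star_add, star_scale, star_opp, star_scalar, star1, Qstar, Gstar, starK, cj_wi, qreal, cjM, cjN, cj1, cj_nat).
have cdr : cj cd = wi * q by rewrite cdE cjM cjN cj_wi qreal opprK.
have cas : star ca = wi *: star dq by rewrite caE star_scale cjN cj_wi opprK.
apply: block3_eq => //.
- by rewrite cdr.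
- by rewrite caE scalerN scaleN1r.
- by rewrite cdE.
- by rewrite cas scaleN1r scalerN.
- by rewrite scale_scalar_mx !scale_scalar_mx creal cdr cdE; congr (_%:M + _%:M); ring.
Qed.

End Flatness.

(** * The matrix exponential *)

Section ComplexLimits.
Context {R : realType}.
Local Notation C := (Cplx R).
Implicit Types (u v : nat -> C) (l : C).
Definition clim u l := forall e : R, 0 < e -> exists K : nat, forall m, (K <= m)%N -> cn (u m - l) < e.
Lemma clim_bound u l (c : R) : clim u l -> (forall m, cn (u m) <= c) -> cn l <= c.
Proof.
move=> h b; apply/ler_addgt0Pl => e e0; have [K hK] := h e e0.
have -> : l = u K - (u K - l) by rewrite opprB addrC subrK.
apply: le_trans (cnD _ _) _; rewrite cnN addrC lerD //; exact/ltW/hK.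
Qed.
Lemma climD u v l l' : clim u l -> clim v l' -> clim (fun m => u m + v m) (l + l').
Proof.
move=> h1 h2 e e0; have e2 : 0 < e / 2 by rewrite divr_gt0.
have [K1 H1] := h1 _ e2; have [K2 H2] := h2 _ e2; exists (maxn K1 K2) => m.
rewrite geq_max => /andP[m1 m2]; rewrite opprD addrACA [e]splitr.
by apply: le_lt_trans (cnD _ _) _; rewrite ltrD ?H1 ?H2.
Qed.
Lemma climZ (c : C) u l : clim u l -> clim (fun m => c * u m) (c * l).
Proof.
move=> h e e0; have c0 : 0 < cn c + 1 by rewrite ltr_wpDl ?cn_ge0.
have [K H] := h (e / (cn c + 1)) (divr_gt0 e0 c0); exists K => m /H.
rewrite ltr_pdivlMr // -mulrBr cnM => h1; apply: le_lt_trans h1.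
by rewrite mulrC ler_wpM2l ?cn_ge0 // lerDl.
Qed.
Lemma climN u l : clim u l -> clim (fun m => - u m) (- l).
Proof.
by move=> h e /h[K H]; exists K => m /H; rewrite -opprD cnN.
Qed.
Lemma clim_cst l : clim (fun=> l) l.
Proof. by move=> e e0; exists 0%N => m _; rewrite subrr cn0. Qed.
Lemma clim_sum (I : finType) (u : I -> nat -> C) (l : I -> C) : (forall i, clim (u i) (l i)) ->
  clim (fun m => \sum_i u i m) (\sum_i l i).
Proof.
move=> h; rewrite /index_enum; elim: (locked_with _ _) => [|i s IH].
  by move=> e e0; exists 0%N => m _; rewrite !big_nil subrr cn0.
by rewrite big_cons; under eq_fun do rewrite big_cons; apply: climD.
Qed.
Lemma clim_conj u l : clim u l -> clim (fun m => Num.conj (u m)) (Num.conj l).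
Proof.
by move=> h e /h[K H]; exists K => m /H; rewrite -rmorphB /= cn_conj.
Qed.
Lemma clim_shift u l : clim u l -> clim (fun m => u m.+1) l.
Proof. by move=> h e /h[K H]; exists K => m Km; apply: H; apply: leqW. Qed.
Lemma clim_uniq u l l' : clim u l -> clim u l' -> l = l'.
Proof.
move=> h1 h2; apply/eqP; rewrite -subr_eq0 -cn_eq0 eq_le cn_ge0 andbT.
apply: (@clim_bound (fun=> 0) _ 0); last by move=> m; rewrite cn0.
have := climD h1 (climN h2); under eq_fun do rewrite subrr; exact.
Qed.
Lemma clim_eq u v l : clim u l -> (forall m, u m = v m) -> clim v l.
Proof. by move=> h e; rewrite -(_ : u = v) //; apply/funext. Qed.
Lemma real_clim (u : R^nat) : cvgn u -> clim (fun m => toC (u m)) (toC (limn u)).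
Proof.
move=> /cvgrPdist_lt h e e0; have [K _ H] := h e e0; exists K => m Km.
by rewrite -toCB cn_toC distrC; apply: (H m Km).
Qed.
Lemma series_clim (u : nat -> C) (v : R^nat) : (forall k, cn (u k) <= v k) ->
  cvgn (series v) -> exists l, clim (series u) l.
Proof.
move=> h cv.
have aux (w : R^nat) : (forall k, `|w k| <= v k) -> cvgn (series w).
  move=> hw; apply: normed_cvg; apply: (series_le_cvg _ _ _ cv) => k //=.
  exact: le_trans (hw k).
have h1 : cvgn (series (fun k => rp (u k))) by apply: aux => k; apply: le_trans (h k); exact: rp_le.
have h2 : cvgn (series (fun k => ip (u k))) by apply: aux => k; apply: le_trans (h k); exact: ip_le.
exists (toC (limn (series (fun k => rp (u k)))) + 'i * toC (limn (series (fun k => ip (u k))))).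
apply: (@clim_eq (fun m => toC (series (fun k => rp (u k)) m) + 'i * toC (series (fun k => ip (u k)) m))).
  by apply: climD; [|apply: climZ]; apply: real_clim.
move=> m; rewrite /series /= !toC_sum mulr_sumr -big_split /=.
by apply: eq_bigr => k _; rewrite -cplxE.
Qed.
End ComplexLimits.

Section MatrixNorm.
Context {R : realType}.
Local Notation C := (Cplx R).
Definition mn (a b : nat) (M : 'M[C]_(a, b)) : R := \sum_i \sum_j cn (M i j).
Variables (N : nat).
Implicit Types (A B : 'M[C]_N).
Lemma mn_ge0 A : 0 <= mn A.
Proof. by apply: sumr_ge0 => i _; apply: sumr_ge0 => j _; exact: cn_ge0. Qed.
Lemma cn_mn A i j : cn (A i j) <= mn A.
Proof.
rewrite /mn (bigD1 i) //= (bigD1 j) //= -addrA lerDl addr_ge0 //.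
  by apply: sumr_ge0 => l _; exact: cn_ge0.
by apply: sumr_ge0 => k _; apply: sumr_ge0 => l _; exact: cn_ge0.
Qed.
Lemma mnM A B : mn (A *m B) <= mn A * mn B.
Proof.
have h i : \sum_j cn ((A *m B) i j) <= (\sum_l cn (A i l)) * mn B.
  apply: (@le_trans _ _ (\sum_j \sum_l cn (A i l) * cn (B l j))).
    apply: ler_sum => j _; rewrite mxE; apply: le_trans (cn_sum _ _ _) _.
    by apply: ler_sum => l _; rewrite cnM.
  rewrite exchange_big /= mulr_suml; apply: ler_sum => l _; rewrite -mulr_sumr.
  apply: ler_wpM2l; first exact: cn_ge0.
  rewrite /mn [leRHS](bigD1 l) //= lerDl; apply: sumr_ge0 => k _.
  by apply: sumr_ge0 => j _; exact: cn_ge0.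
by rewrite {1}/mn mulr_suml; apply: ler_sum => i _; exact: h.
Qed.
End MatrixNorm.
(** A locked copy of [expmx], to keep unification from unfolding the limit. *)
HB.lock Definition emx (R : realType) (m : nat) (B : 'M[Cplx R]_m) : 'M[Cplx R]_m := expmx B.
Lemma emxE (R : realType) (m : nat) (B : 'M[Cplx R]_m) : expmx B = emx B.
Proof. by rewrite unlock. Qed.

Section Exponential.
Context {R : realType}.
Local Notation C := (Cplx R).
Variables (N : nat).
Implicit Types (A B P : 'M[C]_N.+1).
Definition expterm B (k : nat) : 'M[C]_N.+1 := (k`!%:R)^-1 *: B ^+ k.
Lemma mn_exp B k : mn (B ^+ k) <= mn (1 : 'M[C]_N.+1) * mn B ^+ k.
Proof.
elim: k => [|k IH]; first by rewrite !expr0 mulr1.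
rewrite exprSr; apply: le_trans (mnM _ _) _; rewrite exprSr mulrA.
by rewrite ler_wpM2r ?mn_ge0.
Qed.
Lemma fact_cn k : cn ((k`!%:R : C)^-1) = (k`!%:R)^-1.
Proof. by rewrite cnV -(rmorph_nat (@toC R)) cn_toC normr_nat. Qed.
Lemma expterm_le B k i j : cn (expterm B k i j) <= mn (1 : 'M[C]_N.+1) * exp_coeff (mn B) k.
Proof.
rewrite /expterm mxE cnM fact_cn exp_coeffE mulrCA ler_wpM2l ?invr_ge0 //.
by apply: le_trans (mn_exp B k); exact: cn_mn.
Qed.
Lemma exp_cvg (c x : R) : cvgn (series (fun k => c * exp_coeff x k)).
Proof. exact: (is_cvg_seriesZ (k := c) (is_cvg_series_exp_coeff x)). Qed.
(** The entries are dominated by the real exponential series of [mn B]. As [expmx] is a limit in the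
    matrix topology, the entrywise limits are assembled into a matrix L, which is then shown to be
    that limit. *)
Lemma expmxP B i j : clim (fun m => series (expterm B) m i j) (expmx B i j).
Proof.
have [L hL] : exists L : 'M[C]_N.+1, forall i j, clim (fun m => series (expterm B) m i j) (L i j).
  have h i' j' : exists l, clim (fun m => series (expterm B) m i' j') l.
    have [l hl] := series_clim (fun k => expterm_le B k i' j') (@exp_cvg _ _).
    by exists l; apply: clim_eq hl _ => m; rewrite /series /= summxE.
  pose L i' j' := proj1_sig (cid (h i' j')).
  by exists (\matrix_(i', j') L i' j') => i' j'; rewrite mxE; exact: (proj2_sig (cid (h i' j'))).
suff -> : expmx B = L by exact: hL.
apply: cvg_lim; first exact: norm_hausdorff.
apply/cvg_ballP => e e0; have e0' : 0 < rp e by move: e0; rewrite ltCE => /andP[].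
have [K hK] : exists K : nat, forall m, (K <= m)%N -> forall i j, cn (series (expterm B) m i j - L i j) < rp e.
  have h i' j' : exists K : nat, forall m, (K <= m)%N -> cn (series (expterm B) m i' j' - L i' j') < rp e.
    exact: hL.
  pose K i' j' := proj1_sig (cid (h i' j')).
  exists (\max_i' \max_j' K i' j') => m hm i' j'; apply: (proj2_sig (cid (h i' j'))).
  apply: leq_trans hm; apply: leq_trans (leq_bigmax i'); exact: (leq_bigmax j').
exists K => // m /= Km; split=> // i' j'; rewrite /ball /= -normrN opprB normE.
by rewrite (posC_toC e0) ltr_toC; apply: hK.
Qed.
Lemma exptermE B k i j : expterm B k i j = (k`!%:R)^-1 * (B ^+ k) i j.
Proof. by rewrite /expterm mxE. Qed.
Definition psum B i j m : C := \sum_(0 <= k < m) (k`!%:R)^-1 * (B ^+ k) i j.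
Lemma emxP B i j : clim (psum B i j) (emx B i j).
Proof.
rewrite -emxE; apply: clim_eq (expmxP _ _ _) _ => m.
by rewrite /series /= summxE; apply: eq_bigr => k _; rewrite exptermE.
Qed.
(** The relation holds for powers, hence for partial sums and limits. It covers commutation as well
    as moving J across the exponential. *)
Lemma emx_intertwine P B B' : P *m B = B' *m P -> P *m emx B = emx B' *m P.
Proof.
move=> h; have hk k : P *m B ^+ k = B' ^+ k *m P.
  elim: k => [|k IH]; first by rewrite !expr0 mulmx1 mul1mx.
  by rewrite exprSr mulmxA IH exprSr -!mulmxA h.
apply/matrixP => i j; rewrite !mxE.
apply: (@clim_uniq _ (fun m => \sum_l P i l * psum B l j m)).
  by apply: clim_sum => l; apply: climZ; exact: emxP.
apply: (@clim_eq _ (fun m => \sum_l P l j * psum B' i l m)).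
  rewrite (eq_bigr (fun l => P l j * emx B' i l)); last by move=> l _; rewrite mulrC.
  by apply: clim_sum => l; apply: climZ; exact: emxP.
move=> m; under eq_bigr => l _ do rewrite mulr_sumr.
under [RHS]eq_bigr => l _ do rewrite mulr_sumr.
rewrite exchange_big /= [RHS]exchange_big /=; apply: eq_bigr => k _.
have := congr1 (fun M : 'M[C]_N.+1 => (k`!%:R)^-1 * M i j) (hk k); rewrite /= !mxE !mulr_sumr => e.
rewrite (eq_bigr (fun l => (k`!%:R)^-1 * ((B' ^+ k) i l * P l j))); last by move=> l _; rewrite mulrC mulrA.
by rewrite -e; apply: eq_bigr => l _; rewrite mulrCA.
Qed.
Lemma conjTE (a b : nat) (M : 'M[C]_(a, b)) i j : conjT M i j = Num.conj (M j i).
Proof. by rewrite /conjT !mxE. Qed.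
Lemma emx_conjT B : conjT (emx B) = emx (conjT B).
Proof.
have hX k : conjT B ^+ k = conjT (B ^+ k).
  elim: k => [|k IH].
    by rewrite !expr0; apply/matrixP => x y; rewrite conjTE !mxE eq_sym rmorph_nat.
  rewrite exprSr exprS IH; apply/matrixP => x y; rewrite conjTE !mxE rmorph_sum.
  by apply: eq_bigr => l _; rewrite conjTE conjTE rmorphM mulrC.
apply/matrixP => i j; rewrite conjTE.
apply: (@clim_uniq _ (fun m => Num.conj (psum B j i m))).
  exact/clim_conj/emxP.
apply: (clim_eq (emxP (conjT B) i j)) => m; rewrite /psum rmorph_sum.
by apply: eq_bigr => k _; rewrite hX conjTE rmorphM /= fmorphV /= conjC_nat.
Qed.
Lemma trE (a b : nat) (M : 'M[C]_(a, b)) i j : M^T i j = M j i.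
Proof. by rewrite mxE. Qed.
Lemma emx_tr B : (emx B)^T = emx B^T.
Proof.
have hX k : B^T ^+ k = (B ^+ k)^T.
  elim: k => [|k IH]; first by rewrite !expr0 trmx1.
  by rewrite exprSr exprS IH; symmetry; exact: trmx_mul.
apply/matrixP => i j; rewrite trE.
apply: (@clim_uniq _ (psum B j i)); first exact: emxP.
apply: (clim_eq (emxP B^T i j)) => m.
by apply: eq_bigr => k _; rewrite hX trE.
Qed.
Lemma emx0 : emx (0 : 'M[C]_N.+1) = 1%:M.
Proof.
apply/matrixP => i j; apply: (clim_uniq (emxP _ _ _)).
apply: (@clim_eq _ (fun m => if m is 0 then 0 else (1%:M : 'M[C]_N.+1) i j)).
  by move=> e e0; exists 1%N => -[|m] // _; rewrite subrr cn0.
case=> [|m]; first by rewrite /psum big_nil.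
rewrite /psum big_nat_recl // big1 ?addr0; last by move=> k _; rewrite expr0n mxE mulr0.
by rewrite expr0 fact0 invr1 mul1r.
Qed.
Lemma natp_le4 (k : nat) (r : R) : 1 <= r -> k%:R * r ^+ k.-1 <= (4 * r) ^+ k.
Proof.
move=> r1; rewrite exprMn; apply: ler_pM => //.
- by rewrite exprn_ge0 // (le_trans _ r1).
- rewrite -natrX ler_nat; elim: k => // k IH; rewrite expnS.
  by apply: leq_ltn_trans IH _; rewrite ltn_Pmull // expn_gt0.
- by case: k => [|k] //=; rewrite exprSr ler_peMr // exprn_ge0 // (le_trans _ r1).
Qed.
(** The second-order Taylor remainder of a power, by induction on k. The constant 4 is generous: the
    induction needs r + 1 <= 4 r and the bound of [natp_le4]. *)
Lemma pow_diff (c h : C) (r : R) k : 1 <= r -> cn c + cn h <= r ->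
  cn ((c + h) ^+ k - c ^+ k - k%:R * h * c ^+ k.-1) <= (4 * r) ^+ k * cn h ^+ 2.
Proof.
move=> r1 hr; have r0 : 0 <= r by rewrite (le_trans _ r1).
elim: k => [|k IH].
  by rewrite !expr0 subrr mul0r mul0r subr0 cn0 mul1r exprn_ge0 ?cn_ge0.
have -> : (c + h) ^+ k.+1 - c ^+ k.+1 - k.+1%:R * h * c ^+ k.+1.-1 =
  (c + h) * ((c + h) ^+ k - c ^+ k - k%:R * h * c ^+ k.-1) + k%:R * h ^+ 2 * c ^+ k.-1.
  by case: k {IH} => [|k] /=; rewrite -?natr1 !exprS ?expr0; ring.
apply: le_trans (cnD _ _) _.
rewrite [cn (_ * c ^+ _)]cnM cnX [cn (_ * h ^+ 2)]cnM cnX [cn ((c + h) * _)]cnM.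
have h1 : cn (c + h) <= r by apply: le_trans (cnD _ _) hr.
have h2 : cn (c + h) * cn ((c + h) ^+ k - c ^+ k - k%:R * h * c ^+ k.-1) <= r * ((4 * r) ^+ k * cn h ^+ 2).
  by apply: ler_pM => //; exact: cn_ge0.
have h3 : cn (k%:R : C) * cn h ^+ 2 * cn c ^+ k.-1 <= (4 * r) ^+ k * cn h ^+ 2.
  rewrite mulrAC ler_wpM2r ?exprn_ge0 ?cn_ge0 //; apply: le_trans (natp_le4 k r1).
  rewrite -(rmorph_nat (@toC R)) cn_toC normr_nat ler_wpM2l // lerXn2r ?nnegrE ?cn_ge0 //.
  by apply: le_trans hr; rewrite lerDl cn_ge0.
apply: le_trans (lerD h2 h3) _; rewrite [(4 * r) ^+ k.+1]exprS.
have -> : r * ((4 * r) ^+ k * cn h ^+ 2) + (4 * r) ^+ k * cn h ^+ 2 = (r + 1) * ((4 * r) ^+ k * cn h ^+ 2) by ring.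
rewrite -[4 * r * _ * _]mulrA; apply: ler_wpM2r; first by rewrite mulr_ge0 ?exprn_ge0 ?cn_ge0 // mulr_ge0.
by lra.
Qed.
Lemma exprZ (c : C) A k : (c *: A) ^+ k = c ^+ k *: A ^+ k.
Proof.
by elim: k => [|k IH]; rewrite ?expr0 ?scale1r // !exprS IH -scalerAl -scalerAr scalerA.
Qed.
(** Termwise [pow_diff], majorized by the exponential series at 4 r [mn A]; hence K is uniform over
    all c and h with |c| + |h| <= r. *)
Lemma emx_quad A (r : R) : 1 <= r -> exists2 K : R, 0 <= K & forall (c h : C) i j, cn c + cn h <= r ->
  cn (emx ((c + h) *: A) i j - emx (c *: A) i j - h * (A *m emx (c *: A)) i j) <= K * cn h ^+ 2.
Proof.
move=> r1; have r0 : 0 <= r by rewrite (le_trans _ r1).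
pose x := 4 * r * mn A; pose K := limn (series (fun k => mn (1 : 'M[C]_N.+1) * exp_coeff x k)).
have x0 : 0 <= x by rewrite !mulr_ge0 ?mn_ge0.
have cK := @exp_cvg (mn (1 : 'M[C]_N.+1)) x.
have t0 k : 0 <= mn (1 : 'M[C]_N.+1) * exp_coeff x k by rewrite mulr_ge0 ?mn_ge0 ?exp_coeff_ge0.
have sK m : series (fun k => mn (1 : 'M[C]_N.+1) * exp_coeff x k) m <= K.
  apply: nondecreasing_cvgn_le => //; apply: nondecreasing_series => k _ _; exact: t0.
have K0 : 0 <= K by apply: le_trans (sK 0%N); rewrite /series /= big_nil.
exists K => // c h i j hr.
(* The derivative of the partial sum with m+1 terms is A times the partial sum with m terms, whence
   the shifted index. *)
have lim : clim (fun m => psum ((c + h) *: A) i j m.+1 - psum (c *: A) i j m.+1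
     - h * \sum_l A i l * psum (c *: A) l j m)
   (emx ((c + h) *: A) i j - emx (c *: A) i j - h * (A *m emx (c *: A)) i j).
  apply: climD; [apply: climD|apply: climN; apply: climZ].
  - exact: (clim_shift (emxP _ _ _)).
  - by apply: climN; exact: (clim_shift (emxP _ _ _)).
  - by rewrite mxE; apply: clim_sum => l; apply: climZ; exact: emxP.
apply: (clim_bound lim) => m.
have -> : psum ((c + h) *: A) i j m.+1 - psum (c *: A) i j m.+1
     - h * (\sum_l A i l * psum (c *: A) l j m) =
   \sum_(0 <= k < m.+1) ((k`!%:R)^-1 * ((c + h) ^+ k - c ^+ k - k%:R * h * c ^+ k.-1)) * (A ^+ k) i j.
  have e : h * (\sum_l A i l * psum (c *: A) l j m) =
    \sum_(0 <= k < m.+1) ((k`!%:R)^-1 * (k%:R * h * c ^+ k.-1)) * (A ^+ k) i j.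
    rewrite big_nat_recl // mul0r mul0r mulr0 mul0r add0r /psum.
    rewrite [X in h * X](eq_bigr (fun l => \sum_(0 <= k < m) A i l * ((k`!%:R)^-1 * ((c *: A) ^+ k) l j))); last by move=> l _; rewrite mulr_sumr.
    rewrite exchange_big /= mulr_sumr; apply: eq_bigr => k _.
    have k0 : k.+1%:R != 0 :> C by rewrite pnatr_eq0.
    have f0 : k`!%:R != 0 :> C by rewrite pnatr_eq0 -lt0n fact_gt0.
    have -> : (A ^+ k.+1) i j = \sum_l A i l * (A ^+ k) l j by rewrite exprS -[LHS]/((A *m A ^+ k) i j) mxE.
    have -> : \sum_l A i l * ((k`!%:R)^-1 * ((c *: A) ^+ k) l j) =
      (k`!%:R)^-1 * c ^+ k * \sum_l A i l * (A ^+ k) l j.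
      by rewrite mulr_sumr; apply: eq_bigr => l _; rewrite exprZ mxE; ring.
    move: (\sum_l _) => S; rewrite factS natrM invfM /=.
    move: k0 f0; move: (k.+1%:R) (k`!%:R) => a b a0 b0.
    by field; rewrite a0 b0.
  rewrite e /psum -!sumrB; apply: eq_bigr => k _.
  by rewrite !exprZ !mxE; ring.
apply: le_trans (cn_sum _ _ _) _.
apply: (@le_trans _ _ (\sum_(0 <= k < m.+1) (mn (1 : 'M[C]_N.+1) * exp_coeff x k) * cn h ^+ 2)).
  apply: ler_sum => k _; rewrite !cnM fact_cn exp_coeffE.
  have p1 := pow_diff k r1 hr; have p2 := le_trans (cn_mn (A ^+ k) i j) (mn_exp A k).
  have -> : mn (1 : 'M[C]_N.+1) * ((fun n0 : nat => (n0`!%:R)^-1) k * x ^+ k) * cn h ^+ 2 =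
     (k`!%:R)^-1 * ((4 * r) ^+ k * cn h ^+ 2) * (mn (1 : 'M[C]_N.+1) * mn A ^+ k).
    by rewrite /= /x exprMn; ring.
  apply: ler_pM => //; rewrite ?mulr_ge0 ?cn_ge0 ?invr_ge0 //.
  by rewrite ler_wpM2l ?invr_ge0.
by rewrite -mulr_suml ler_wpM2r ?exprn_ge0 ?cn_ge0 //; exact: sK.
Qed.
Lemma cder_emx A (g : R -> C) (t0 : R) (d : C) i j : cder g t0 d ->
  cder (fun t => emx (g t *: A) i j) t0 (d * (A *m emx (g t0 *: A)) i j).
Proof.
rewrite cder_shift [X in _ -> X]cder_shift !cder0P !add0r; set c := g t0 => hg e e0.
pose E' := cn ((A *m emx (c *: A)) i j).
pose r := cn c + 1.
have r1 : 1 <= r by rewrite lerDr cn_ge0.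
have [K K0 hK] := emx_quad A r1.
pose D := cn d + 1; have D1 : 1 <= D by rewrite lerDr cn_ge0.
have D0 : 0 < D by apply: lt_le_trans D1.
have [b1 b10 H1] := hg 1 ltr01.
have E0 : 0 < E' + 1 by rewrite ltr_wpDl ?cn_ge0.
have e2 : 0 < e / (2 * (E' + 1)) by rewrite divr_gt0 // mulr_gt0.
have [b2 b20 H2] := hg _ e2.
have K1 : 0 < K + 1 by rewrite ltr_wpDl.
(* [b1] bounds the increment h of g by D |t|, 1/D then makes |h| at most 1, the last bound controls
   the quadratic remainder and [b2] the remainder of g. *)
exists (Num.min (Num.min b1 b2) (Num.min D^-1 (e / (2 * (K + 1) * D ^+ 2)))).
  by rewrite !lt_min b10 b20 invr_gt0 D0 divr_gt0 // !mulr_gt0 // exprn_gt0.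
move=> t; rewrite !lt_min => /andP[/andP[tb1 tb2] /andP[tD tK]].
set h := g (t + t0) - c.
have hh : cn h <= D * `|t|.
  have -> : h = (g (t + t0) - c - toC t * d) + toC t * d by rewrite subrK.
  apply: le_trans (cnD _ _) _; rewrite cnM cn_toC.
  by rewrite /D mulrDl mul1r addrC (mulrC (cn d)) lerD2l; have := H1 t tb1; rewrite mul1r.
have h1 : cn h <= 1.
  apply: le_trans hh _; rewrite mulrC -ler_pdivlMr // mul1r; exact/ltW.
have q := hK c h i j; rewrite /r lerD2l in q; have {}q := q h1.
have -> : g (t + t0) = c + h by rewrite /h addrCA subrr addr0.
move: q hh h1; set w1 := emx ((c + h) *: A) i j; set w2 := emx (c *: A) i j.
set w3 := (A *m emx (c *: A)) i j => q hh h1.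
have -> : w1 - w2 - toC t * (d * w3) = (w1 - w2 - h * w3) + (h - toC t * d) * w3 by ring.
apply: le_trans (cnD _ _) _; rewrite [e]splitr [leRHS]mulrDl; apply: lerD.
  apply: le_trans q _.
  apply: (@le_trans _ _ ((K + 1) * (D * `|t|) ^+ 2)).
    by apply: ler_pM; rewrite ?exprn_ge0 ?cn_ge0 // ?lerDl // lerXn2r ?nnegrE ?cn_ge0 // mulr_ge0 // ltW.
  have -> : (K + 1) * (D * `|t|) ^+ 2 = ((K + 1) * D ^+ 2 * `|t|) * `|t| by ring.
  rewrite ler_wpM2r //; move: tK; rewrite ltr_pdivlMr ?mulr_gt0 ?exprn_gt0 // => /ltW tK.
  rewrite ler_pdivlMr //; apply: le_trans tK; rewrite le_eqVlt; apply/orP; left; apply/eqP; ring.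
rewrite cnM -/E'; have := H2 t tb2; rewrite -/c -/h => hq.
apply: (@le_trans _ _ (e / (2 * (E' + 1)) * `|t| * (E' + 1))).
  by apply: ler_pM; rewrite ?cn_ge0 // lerDl.
rewrite le_eqVlt; apply/orP; left; apply/eqP; field; by rewrite gt_eqF.
Qed.
Lemma cder_cst1 (g : R -> C) (c : C) : (forall t : R, 0 <= t <= 1 -> cder g t 0) -> g 1 = g 0.
Proof.
move=> h; apply/eqP; rewrite -subr_eq0 -cn_eq0 eq_le cn_ge0 andbT -[X in cn X]subr0.
have := @cmvt R g (fun=> 0) 0 0 h; rewrite mulr0; apply => t _.
by rewrite subr0 cn0.
Qed.
Lemma emx_comm (c : C) A : A *m emx (c *: A) = emx (c *: A) *m A.
Proof. by apply: emx_intertwine; rewrite -scalemxAl -scalemxAr. Qed.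
(** The curve t -> exp ((t a + b) A) exp (- t a A) has derivative zero, so its values at 1 and at 0
    agree. *)
Lemma emxB (a b : C) A : emx ((a + b) *: A) *m emx (- a *: A) = emx (b *: A).
Proof.
apply/matrixP => i j.
pose g (t : R) := (emx ((toC t * a + b) *: A) *m emx ((- (toC t * a)) *: A)) i j.
have h : g 1 = g 0.
  apply: cder_cst1 => // t _; rewrite /g.
  have d1 l : cder (fun t : R => emx ((toC t * a + b) *: A) i l) t
      (a * (A *m emx ((toC t * a + b) *: A)) i l).
    apply: (@cder_emx A (fun t : R => toC t * a + b) t a i l).
    apply: cder_eq (cderD (cderM (cder_toC t) (cder_cst a t)) (cder_cst b t)) _; ring.
  have d2 l : cder (fun t : R => emx ((- (toC t * a)) *: A) l j) t
      (- a * (A *m emx ((- (toC t * a)) *: A)) l j).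
    apply: (@cder_emx A (fun t : R => - (toC t * a)) t (- a) l j).
    apply: cder_eq (cderN (cderM (cder_toC t) (cder_cst a t))) _; ring.
  have := cder_sum (fun l => cderM (d1 l) (d2 l)).
  move=> H; under eq_fun => s do rewrite mxE.
  apply: cder_eq H _.
  set E := emx ((toC t * a + b) *: A); set E' := emx (_ *: A).
  have -> : \sum_i0 (a * (A *m E) i i0 * E' i0 j + E i i0 * (- a * (A *m E') i0 j)) =
    a * ((A *m E *m E') i j - (E *m (A *m E')) i j).
    by rewrite !mxE -sumrB mulr_sumr; apply: eq_bigr => l _; ring.
  by rewrite mulmxA /E -emx_comm subrr mulr0.
have g1 : g 1 = (emx ((a + b) *: A) *m emx (- a *: A)) i j by rewrite /g toC1 mul1r.
by rewrite -g1 h /g toC0 mul0r add0r oppr0 scale0r emx0 mulmx1.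
Qed.
Lemma emxVl (a : C) A : emx (a *: A) *m emx (- a *: A) = 1%:M.
Proof. by have := emxB a 0 A; rewrite addr0 scale0r emx0. Qed.
Lemma emxD (a b : C) A : emx ((a + b) *: A) = emx (b *: A) *m emx (a *: A).
Proof. by rewrite -(emxB a b) -mulmxA [X in _ *m X]mulmx1C ?mulmx1 // emxVl. Qed.

Section SmoothExp.
Variable n : nat.
Lemma isd_emx A (f : 'cV[C]_n -> C) v z d i j : isd f v z d ->
  isd (fun w => emx (f w *: A) i j) v z (d * (A *m emx (f z *: A)) i j).
Proof.
by move=> h; have := cder_emx A i j h; rewrite toC0 scale0r addr0.
Qed.
Lemma cont_emx A (f : 'cV[C]_n -> C) z i j : {for z, continuous f} ->
  {for z, continuous (fun w => emx (f w *: A) i j)}.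
Proof.
move=> /contP h; apply/contP => e e0.
pose r := cn (f z) + 1; have r1 : 1 <= r by rewrite lerDr cn_ge0.
have [K K0 hK] := emx_quad A r1.
pose L := K + cn ((A *m emx (f z *: A)) i j) + 1.
have L0 : 0 < L by rewrite ltr_wpDl // addr_ge0 ?cn_ge0.
have m0 : 0 < Num.min 1 (e / L) by rewrite lt_min ltr01 divr_gt0.
apply: filterS (h _ m0) => w; rewrite lt_min => /andP[w1 w2].
set h' := f w - f z in w1 w2 *.
have := hK (f z) h' i j; rewrite /r lerD2l => /(_ (ltW w1)).
have -> : f z + h' = f w by rewrite /h' addrCA subrr addr0.
set x := emx _ i j; set y := emx _ i j; set D := (_ *m _) i j => q.
have -> : x - y = (x - y - h' * D) + h' * D by rewrite subrK.
apply: le_lt_trans (cnD _ _) _; rewrite cnM.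
move: w2; rewrite ltr_pdivlMr //; apply: le_lt_trans.
have -> : cn h' * L = cn h' * K + (cn h' * cn D + cn h') by rewrite /L -/D; ring.
apply: lerD; last by rewrite lerDl cn_ge0.
by apply: le_trans q _; rewrite mulrC ler_wpM2r // expr2 ler_piMl ?cn_ge0 // ltW.
Qed.
(** The derivative is a combination of entries of the same exponential, so the induction runs over
    all entries at once. *)
Lemma Ck_emx A k U (f : 'cV[C]_n -> C) i j : open U -> Ck k U f -> Ck k U (fun w => emx (f w *: A) i j).
Proof.
move=> oU; elim: k f i j => [|k IH] f i j hf.
  by split=> // z Uz; apply: cont_emx; apply: (Ck_cont hf Uz).
apply: CkS => // [z Uz|v]; first by apply: cont_emx; apply: (Ck_cont hf Uz).
exists (fun z => rderive f v z * \sum_l A i l * emx (f z *: A) l j); split.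
  by move=> z Uz; have := isd_emx A i j (Ck_isd v hf Uz); rewrite mxE.
apply: Ck_mul => //; first exact: Ck_rderive.
apply: Ck_sum => // l _; apply: Ck_mul => //; first exact: Ck_cst.
by apply: IH; apply: Ck_pred.
Qed.
End SmoothExp.
End Exponential.

(** * Parallel frames of flat connections *)

Section LinearODE.
Context {R : realType}.
Local Notation C := (Cplx R).
Implicit Types (g h : R -> C) (t s : R).
Definition ccont g t := forall e : R, 0 < e ->
  exists2 d : R, 0 < d & forall s, `|s - t| < d -> cn (g s - g t) < e.
(** The retraction onto [0, 1]; composing with it extends functions on [0, 1] continuously to the
    line, where [primitive] applies. *)
Definition clamp t : R := Num.max 0 (Num.min 1 t).
Lemma clamp01 t : 0 <= clamp t <= 1.
Proof. by rewrite /clamp le_max lexx /= ge_max ler01 ge_min lexx. Qed.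
Lemma clamp_id t : 0 <= t <= 1 -> clamp t = t.
Proof. by move=> /andP[t0 t1]; rewrite /clamp (min_idPr t1) (max_idPr t0). Qed.
Lemma clamp_lip s t : `|clamp s - clamp t| <= `|s - t|.
Proof.
have cs u : [\/ u <= 0 /\ clamp u = 0, 0 <= u <= 1 /\ clamp u = u | 1 <= u /\ clamp u = 1].
  have [u0|u0] := lerP u 0.
    by constructor 1; split=> //; rewrite /clamp (max_idPl _) // ge_min u0 orbT.
  have [u1|u1] := lerP u 1; first by constructor 2; rewrite clamp_id ltW.
  by constructor 3; split; [exact: ltW|rewrite /clamp (min_idPl _) ?(max_idPr _) // ltW].
case: (cs s) => [] [hs ->]; case: (cs t) => [] [ht ->]; rewrite ?subrr ?normr0 ?normr_ge0 //;
  try move/andP: hs => [? ?]; try move/andP: ht => [? ?];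
  rewrite ler_norml; case: (ger0P (s - t)) => ?; lra.
Qed.
Lemma ccont_clamp g : (forall t, 0 <= t <= 1 -> ccont g t) -> forall t, ccont (g \o clamp) t.
Proof.
move=> h t e e0; have [d d0 H] := h _ (clamp01 t) e e0; exists d => // s st.
by apply: H; apply: le_lt_trans st; exact: clamp_lip.
Qed.
Lemma ccontD g h t : ccont g t -> ccont h t -> ccont (fun t => g t + h t) t.
Proof.
move=> hg hh e e0; have e2 : 0 < e / 2 by rewrite divr_gt0.
have [d1 d10 H1] := hg _ e2; have [d2 d20 H2] := hh _ e2.
exists (Num.min d1 d2); first by rewrite lt_min d10.
move=> s; rewrite lt_min => /andP[s1 s2]; rewrite opprD addrACA [e]splitr.
by apply: le_lt_trans (cnD _ _) _; rewrite ltrD ?H1 ?H2.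
Qed.
Lemma ccont_cst (c : C) t : ccont (fun=> c) t.
Proof. by move=> e e0; exists 1 => // s _; rewrite subrr cn0. Qed.
Lemma ccontM g h t : ccont g t -> ccont h t -> ccont (fun t => g t * h t) t.
Proof.
move=> hg hh e e0; pose a := cn (g t) + 1; pose b := cn (h t) + 1.
have a0 : 0 < a by rewrite ltr_wpDl ?cn_ge0. 
have b0 : 0 < b by rewrite ltr_wpDl ?cn_ge0.
have [d1 d10 H1] := hg (e / 2 / b) (divr_gt0 (divr_gt0 e0 (ltr0Sn _ 1)) b0).
have [d2 d20 H2] := hh (Num.min 1 (e / 2 / a)) ltac:(by rewrite lt_min ltr01 !divr_gt0).
exists (Num.min d1 d2); first by rewrite lt_min d10.
move=> s; rewrite lt_min => /andP[/H1 s1 /H2]; rewrite lt_min => /andP[s2 s3].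
have -> : g s * h s - g t * h t = (g s - g t) * h s + g t * (h s - h t) by ring.
rewrite [e]splitr; apply: le_lt_trans (cnD _ _) _; rewrite !cnM; apply: ler_ltD.
  have hb : cn (h s) <= b.
    have -> : h s = h t + (h s - h t) by rewrite addrCA subrr addr0.
    by apply: le_trans (cnD _ _) _; rewrite lerD2l ltW.
  by rewrite -[leRHS](divfK (lt0r_neq0 b0)); apply: ler_pM => //; rewrite ?cn_ge0 // ltW.
apply: (@le_lt_trans _ _ (a * cn (h s - h t))).
  by rewrite ler_wpM2r ?cn_ge0 // lerDl.
by rewrite mulrC -ltr_pdivlMr.
Qed.
Lemma ccont_sum (I : finType) (g : I -> R -> C) t : (forall i, ccont (g i) t) ->
  ccont (fun t => \sum_i g i t) t.
Proof.
move=> h; rewrite /index_enum; elim: (locked_with _ _) => [|i s IH].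
  by under eq_fun do rewrite big_nil; exact: ccont_cst.
by under eq_fun do rewrite big_cons; apply: ccontD.
Qed.
Lemma cder_ccont g t d : cder g t d -> ccont g t.
Proof.
rewrite cder_shift cder0P add0r => h e e0.
pose D := cn d + 1; have D0 : 0 < D by rewrite ltr_wpDl ?cn_ge0.
have [b b0 H] := h 1 ltr01; exists (Num.min b (e / D)); first by rewrite lt_min b0 divr_gt0.
move=> s; rewrite lt_min => /andP[sb]; rewrite ltr_pdivlMr // => sD.
apply: le_lt_trans sD; have := H (s - t) sb; rewrite subrK mul1r => hh.
have -> : g s - g t = (g s - g t - toC (s - t) * d) + toC (s - t) * d by rewrite subrK.
apply: le_trans (cnD _ _) _; rewrite cnM cn_toC /D mulrDr mulr1 addrC.
by rewrite lerD2l.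
Qed.
Lemma ccont_rp g t : ccont g t -> {for t, continuous (fun t => rp (g t))}.
Proof.
move=> h; apply/cvgrPdist_lt => e e0; have [d d0 H] := h e e0.
apply/nbhs_ballP; exists d => // s; rewrite /ball /= distrC => st; rewrite distrC -raddfB /=.
by apply: le_lt_trans (rp_le _) _; apply: H.
Qed.
Lemma ccont_ip g t : ccont g t -> {for t, continuous (fun t => ip (g t))}.
Proof.
move=> h; apply/cvgrPdist_lt => e e0; have [d d0 H] := h e e0.
apply/nbhs_ballP; exists d => // s; rewrite /ball /= distrC => st; rewrite distrC -raddfB /=.
by apply: le_lt_trans (ip_le _) _; apply: H.
Qed.
Lemma real_primitive (f : R -> R) : continuous f ->
  exists G : R -> R, G 0 = 0 /\ forall t, 0 <= t <= 1 -> isder t G (f t).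
Proof.
move=> cf.
(* The interval [-1, 2] contains [0, 1] in its interior, so two-sided derivatives exist at 0 and 1
   too. *)
have int : lebesgue_measure.-integrable `[(-1) : R, 2] (EFin \o f).
  apply: continuous_compact_integrable; first exact: segment_compact.
  by apply: continuous_subspaceT.
pose F (x : R) := \int[lebesgue_measure]_(t in `[(-1) : R, x]) f t.
exists (fun x => F x - F 0); rewrite subrr; split=> // t /andP[t0 t1].
have [d1 d2] : derivable F t 1 /\ (F^`()%classic : R -> R) t = f t.
  have t2 : t < 2 by lra.
  have t3 : -1 < t by lra.
  exact: (@continuous_FTC1_closed _ f (-1) t 2 t2 int t3 (cf t)).
have hF : isder t F (f t).
  by apply: DeriveDef; [exact: d1|rewrite -derive1E; exact: d2].
have -> : (fun x => F x - F 0) = F - cst (F 0) by apply/funext.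
by apply: (is_derive_eq (is_deriveB hF (is_derive_cst (F 0) t 1))); rewrite subr0.
Qed.
Lemma primitive g : (forall t, ccont g t) ->
  exists G : R -> C, G 0 = 0 /\ forall t, 0 <= t <= 1 -> cder G t (g t).
Proof.
move=> cg.
have [G1 [G10 G1d]] := @real_primitive (fun t => rp (g t)) (fun t => ccont_rp (cg t)).
have [G2 [G20 G2d]] := @real_primitive (fun t => ip (g t)) (fun t => ccont_ip (cg t)).
exists (fun t => toC (G1 t) + 'i * toC (G2 t)); split.
  by rewrite G10 G20 !toC0 mulr0 addr0.
move=> t ht; have e1 : (fun t => rp (toC (G1 t) + 'i * toC (G2 t))) = G1.
  by apply/funext => s; rewrite rpD rpM rp_i ip_i !rp_toC !ip_toC; ring.
have e2 : (fun t => ip (toC (G1 t) + 'i * toC (G2 t))) = G2.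
  by apply/funext => s; rewrite ipD ipM rp_i ip_i !rp_toC !ip_toC; ring.
by split; rewrite ?e1 ?e2; [exact: G1d|exact: G2d].
Qed.
Lemma cmvt_le g (dg : R -> C) (M : R) : (forall t, 0 <= t <= 1 -> cder g t (dg t)) ->
  (forall t, 0 <= t <= 1 -> cn (dg t) <= M) -> forall t, 0 <= t <= 1 -> cn (g t - g 0) <= 2 * M.
Proof.
move=> h1 h2 t /andP[t0 t1].
have := @cmvt R (fun s => g (t * s)) (fun s => toC t * dg (t * s)) 0 M.
rewrite mulr1 mulr0 subr0; apply => s /andP[s0 s1].
  apply: cder_scale; apply: h1; rewrite mulr_ge0 //=; apply: le_trans t1.
  by rewrite ler_piMr.
rewrite subr0 cnM cn_toC ger0_norm //.
have hs : 0 <= t * s <= 1 by rewrite mulr_ge0 //=; apply: le_trans t1; rewrite ler_piMr.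
apply: le_trans (h2 _ hs); rewrite ler_piMl ?cn_ge0 //.
Qed.
Variable (N : nat).
Implicit Types (y : 'cV[C]_N) (B : R -> 'M[C]_N).
(** A bound of the operator norm for the maximum norm on columns. *)
Definition rowbound (a b : nat) (M : 'M[C]_(a, b)) (be : R) := forall i, \sum_j cn (M i j) <= be.
Lemma rowbound_mul (a b : nat) (M : 'M[C]_(a, b)) (x : 'cV[C]_b) (be m : R) i : 0 <= m -> rowbound M be ->
  (forall j, cn (x j 0) <= m) -> cn ((M *m x) i 0) <= be * m.
Proof.
move=> m0 hM hx; rewrite mxE; apply: le_trans (cn_sum _ _ _) _.
apply: (@le_trans _ _ (\sum_j cn (M i j) * m)).
  by apply: ler_sum => j _; rewrite cnM; apply: ler_wpM2l; rewrite ?cn_ge0.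
by rewrite -mulr_suml ler_wpM2r.
Qed.
Lemma geom_small (S x : R) : 0 < x -> 0 <= S -> exists k : nat, S / 2 ^+ k <= x.
Proof.
move=> x0 S0; exists (Num.bound (S / x)).
rewrite ler_pdivrMr ?exprn_gt0 // mulrC -ler_pdivrMr //.
apply: ltW; apply: lt_le_trans (archi_boundP _) _; first by rewrite divr_ge0 // ltW.
by rewrite -natrX ler_nat ltnW // ltn_expl.
Qed.

(* Since the coefficient is small, the mean value inequality replaces Gronwall's lemma. *)
Lemma small_ode_bound B (y : R -> 'cV[C]_N) (d : R -> 'cV[C]_N) (e S0 : R) : 0 <= e ->
  (forall t, 0 <= t <= 1 -> rowbound (B t) (1 / 4)) ->
  (forall i, y 0 i 0 = 0) ->
  (forall t i, 0 <= t <= 1 -> cn (y t i 0) <= S0) ->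
  (forall t i, 0 <= t <= 1 -> cder (fun t => y t i 0) t ((B t *m y t) i 0 + d t i 0)) ->
  (forall t i, 0 <= t <= 1 -> cn (d t i 0) <= e) ->
  forall t i, 0 <= t <= 1 -> cn (y t i 0) <= 4 * e.
Proof.
move=> e0 hB y0 hS hy hd.
(* An a priori bound S improves to S/2 + 2e; iteration from S0 converges to the fixed point 4e. *)
have step S : 0 <= S -> (forall t i, 0 <= t <= 1 -> cn (y t i 0) <= S) ->
    forall t i, 0 <= t <= 1 -> cn (y t i 0) <= S / 2 + 2 * e.
  move=> S0' h t i ht; rewrite -[y t i 0]subr0 -[X in _ - X](y0 i).
  have := @cmvt_le (fun t => y t i 0) (fun t => (B t *m y t) i 0 + d t i 0) (1 / 4 * S + e).
  have -> : 2 * (1 / 4 * S + e) = S / 2 + 2 * e by field.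
  apply=> // s hs; first exact: hy.
  apply: le_trans (cnD _ _) _; apply: lerD; last exact: hd.
  by apply: rowbound_mul; [done|exact: hB|move=> j; exact: h].
move=> t i ht; have S00 : 0 <= S0 by apply: le_trans (hS t i ht); exact: cn_ge0.
have hk k : forall t i, 0 <= t <= 1 -> cn (y t i 0) <= 4 * e + S0 / 2 ^+ k.
  elim: k => [|k IH] s j hs; first by rewrite expr0 divr1 ler_wpDl ?hS // mulr_ge0.
  have := step _ _ IH s j hs; rewrite exprS invfM.
  have -> : (4 * e + S0 / 2 ^+ k) / 2 + 2 * e = 4 * e + S0 * (2^-1 / 2 ^+ k) by field; rewrite expf_neq0.
  by apply; rewrite addr_ge0 ?mulr_ge0 ?invr_ge0 ?exprn_ge0.
apply/ler_addgt0Pr => x x0.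
have [k hk2] := geom_small x0 S00.
by apply: le_trans (hk k t i ht) _; rewrite lerD2l.
Qed.
Lemma unif_ccont (q : nat -> R -> C) (l : R -> C) (S : R) (D : R -> Prop) : 0 <= S ->
  (forall k t, D t -> cn (q k t - l t) <= S / 2 ^+ k) ->
  (forall k t, ccont (q k) t) -> (forall t, D t) -> forall t, ccont l t.
Proof.
move=> S0 h cq hD t e e0; have e4 : 0 < e / 4 by rewrite divr_gt0.
have [k hk] := geom_small e4 S0.
have [d d0 H] := cq k t _ (e4); exists d => // s st.
have -> : l s - l t = - (q k s - l s) + (q k s - q k t) + (q k t - l t) by ring.
have h1 := le_trans (h k s (hD s)) hk; have h2 := le_trans (h k t (hD t)) hk; have h3 := H s st.
apply: le_lt_trans (cnD _ _) _; apply: le_lt_trans (lerD (cnD _ _) (lexx _)) _; rewrite cnN.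
by lra.
Qed.
(** Picard iteration. The row bound 1/4 and the factor 2 of the mean value inequality make every
    step contract by 1/2, so no weighted norm or subdivision of the interval is needed. The limit
    differs from y0 by at most 2M, whence the bound 3M. *)
Lemma linear_ode B (y0 : 'cV[C]_N) (M : R) : (forall t i j, ccont (fun t => B t i j) t) ->
  (forall t, rowbound (B t) (1 / 4)) -> (forall i, cn (y0 i 0) <= M) -> 0 <= M ->
  exists y : R -> 'cV[C]_N, [/\ y 0 = y0,
    (forall t i, 0 <= t <= 1 -> cder (fun t => y t i 0) t ((B t *m y t) i 0)) &
    (forall t i, 0 <= t <= 1 -> cn (y t i 0) <= 3 * M)].
Proof.
move=> cB hB hM M0; pose cc (q : R -> 'cV[C]_N) := forall j t, ccont (fun t => q t j 0) t.
pose P (g : R -> C) : R -> C := if pselect (forall t, ccont g t) is left h then proj1_sig (cid (primitive h)) else 0.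
have P0 g : (forall t, ccont g t) -> P g 0 = 0.
  by rewrite /P; case: pselect => // h _; have [] := proj2_sig (cid (primitive h)).
have Pd g : (forall t, ccont g t) -> forall t, 0 <= t <= 1 -> cder (P g) t (g t).
  by rewrite /P; case: pselect => // h _; have [] := proj2_sig (cid (primitive h)).
pose rhs (q : R -> 'cV[C]_N) i (t : R) : C := (B t *m q t) i 0.
have crhs (q : R -> 'cV[C]_N) i : cc q -> forall t, ccont (rhs q i) t.
  move=> cq t; rewrite /rhs; under eq_fun do rewrite mxE.
  by apply: ccont_sum => j; apply: ccontM.
pose nxt (q : R -> 'cV[C]_N) (t : R) : 'cV[C]_N := \col_i (y0 i 0 + P (rhs q i) t).
(* The iterates are clamped so that they are continuous on the whole line; [nxt l] without the clamp
   is the differentiable solution. *)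
pose q k : R -> 'cV[C]_N := iter k (fun q => nxt q \o clamp) (fun=> y0).
have nxt_d (q' : R -> 'cV[C]_N) : cc q' -> forall i t, 0 <= t <= 1 ->
    cder (fun t => nxt q' t i 0) t ((B t *m q' t) i 0).
  move=> cq i t ht; under eq_fun do rewrite mxE.
  by apply: cder_eq (cderD (cder_cst _ _) (Pd _ (crhs _ _ cq) t ht)) _; rewrite add0r.
have nxt0 (q' : R -> 'cV[C]_N) : cc q' -> nxt q' 0 = y0.
  by move=> cq; apply/matrixP => i j; rewrite ord1 mxE P0 ?addr0 //; exact: crhs.
have nxt_c (q' : R -> 'cV[C]_N) : cc q' ->
    forall j t, ccont (fun t => (nxt q' \o clamp) t j 0) t.
  move=> cq j; apply: (@ccont_clamp (fun t => nxt q' t j 0)) => t ht.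
  exact: cder_ccont (nxt_d _ cq j t ht).
have cq k : cc (q k).
  elim: k => [|k IH]; first by move=> j t; exact: ccont_cst.
  exact: nxt_c.
have nxt_lip (q1 q2 : R -> 'cV[C]_N) (e : R) : 0 <= e -> cc q1 -> cc q2 -> (forall t j, cn (q1 t j 0 - q2 t j 0) <= e) ->
   forall t j, 0 <= t <= 1 -> cn (nxt q1 t j 0 - nxt q2 t j 0) <= e / 2.
  move=> e0 c1 c2 h t j ht.
  have hd s : 0 <= s <= 1 -> cder (fun t => nxt q1 t j 0 - nxt q2 t j 0) s ((B s *m (q1 s - q2 s)) j 0).
    move=> hs; apply: cder_eq (cderD (nxt_d _ c1 j s hs) (cderN (nxt_d _ c2 j s hs))) _.
    by rewrite mulmxBr !mxE.
  have hb s : 0 <= s <= 1 -> cn ((B s *m (q1 s - q2 s)) j 0) <= 1 / 4 * e.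
    by move=> hs; apply: rowbound_mul => // i; rewrite !mxE; exact: h.
  have := cmvt_le hd hb ht; rewrite !nxt0 // subrr subr0.
  by have -> : 2 * (1 / 4 * e) = e / 2 by field.
have q1 t j : cn (q 1%N t j 0 - q 0%N t j 0) <= M.
  have c0 i s : ccont (fun t : R => (fun=> y0) t i 0) s by exact: ccont_cst.
  have hd s : 0 <= s <= 1 -> cder (fun t => nxt (fun=> y0) t j 0) s ((B s *m y0) j 0).
    by move=> hs; exact: (nxt_d (fun=> y0)).
  have hb s : 0 <= s <= 1 -> cn ((B s *m y0) j 0) <= 1 / 4 * M.
    by move=> hs; apply: rowbound_mul.
  by have := cmvt_le hd hb (clamp01 t); rewrite nxt0 // /q /=; move: M0; lra.
have qd k : forall t j, cn (q k.+1 t j 0 - q k t j 0) <= M / 2 ^+ k.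
  elim: k => [|k IH] t j; first by rewrite expr0 divr1.
  have -> : M / 2 ^+ k.+1 = M / 2 ^+ k / 2 by rewrite exprS invfM; ring.
  apply: (nxt_lip (q k.+1) (q k)) => //; last exact: clamp01.
  by rewrite divr_ge0 ?exprn_ge0.
have cgeo : cvgn (series (geometric M (1 / 2))).
  by apply: is_cvg_geometric_series; rewrite ger0_norm; lra.
have [l hl] : exists l : R -> 'cV[C]_N, forall k t j, cn (q k t j 0 - l t j 0) <= 2 * M / 2 ^+ k.
  have hlim t j : exists l : C, forall k, cn (q k t j 0 - l) <= 2 * M / 2 ^+ k.
    have [l0 hl0] := @series_clim R (fun k => q k.+1 t j 0 - q k t j 0) (geometric M (1 / 2)) (fun k => ltac:(rewrite /geometric /= expr_div_n expr1n mulrA mulr1; exact: qd)) cgeo.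
    exists (y0 j 0 + l0) => k.
    have tel m : series (fun k => q k.+1 t j 0 - q k t j 0) m = q m t j 0 - y0 j 0.
      by rewrite /series /= telescope_sumr // .
    have tail m : cn (q (k + m)%N t j 0 - q k t j 0) <= 2 * M / 2 ^+ k - M / 2 ^+ k * (2 / 2 ^+ m).
      elim: m => [|m IH]; first by rewrite addn0 subrr cn0 expr0 divr1; lra.
      rewrite addnS.
      have -> : q (k + m).+1 t j 0 - q k t j 0 = (q (k + m).+1 t j 0 - q (k + m)%N t j 0) + (q (k + m)%N t j 0 - q k t j 0) by ring.
      apply: le_trans (cnD _ _) _; apply: le_trans (lerD (qd _ _ _) IH) _.
      rewrite exprD exprS le_eqVlt; apply/orP; left; apply/eqP; field.
      by rewrite !expf_neq0.
    have -> : q k t j 0 - (y0 j 0 + l0) = - (l0 - (q k t j 0 - y0 j 0)) by ring.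
    rewrite cnN.
    have lim2 : clim (fun m => q (k + m)%N t j 0 - q k t j 0) (l0 - (q k t j 0 - y0 j 0)).
      move=> e e0; have [K HK] := hl0 e e0; exists K => m Km.
      have := HK (k + m)%N (leq_trans Km (leq_addl _ _)); rewrite tel.
      congr (cn _ < _); ring.
    apply: clim_bound lim2 _ => m; apply: le_trans (tail m) _.
    by rewrite gerBl mulr_ge0 ?divr_ge0 ?exprn_ge0.
  pose L t j := proj1_sig (cid (hlim t j)).
  by exists (fun t => \col_j L t j) => k t j; rewrite mxE; exact: (proj2_sig (cid (hlim t j))).
have cl j t : ccont (fun t => l t j 0) t.
  by apply: (@unif_ccont (fun k t => q k t j 0) _ (2 * M) (fun=> True)) => // [|k s]; [rewrite mulr_ge0|exact: cq].
have yl t j : 0 <= t <= 1 -> nxt l t j 0 = l t j 0.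
  move=> ht; apply/eqP; rewrite -subr_eq0 -cn_eq0 eq_le cn_ge0 andbT.
  apply/ler_addgt0Pl => e e0; rewrite addr0.
  have e2 : 0 < e / 2 by rewrite divr_gt0.
  have M2 : 0 <= 2 * M by rewrite mulr_ge0.
  have [k hk] := geom_small e2 M2.
  have -> : nxt l t j 0 - l t j 0 = (nxt l t j 0 - nxt (q k) t j 0) + (q k.+1 t j 0 - l t j 0).
    by rewrite /q /= clamp_id // -/(q k); ring.
  have h1 := nxt_lip l (q k) (2 * M / 2 ^+ k) _ cl (cq k) _ t j ht.
  have h2 := hl k.+1 t j; apply: le_trans (cnD _ _) _.
  have h3 : 2 * M / 2 ^+ k.+1 <= e / 2.
    apply: le_trans hk; rewrite exprS invfM ler_wpM2l ?mulr_ge0 // ler_piMl ?invr_ge0 ?exprn_ge0 //.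
    lra.
  have {}h1 : cn (nxt l t j 0 - nxt (q k) t j 0) <= 2 * M / 2 ^+ k / 2.
    apply: h1; first by rewrite divr_ge0 ?mulr_ge0 ?exprn_ge0.
    by move=> s i; rewrite -cnN opprB.
  have h5 : 0 <= 2 * M / 2 ^+ k by rewrite divr_ge0 ?mulr_ge0 ?exprn_ge0.
  move: (le_trans h2 h3) h1 hk h5; set w := 2 * M / 2 ^+ k; lra.
exists (nxt l); split.
- exact: nxt0.
- move=> t i ht; apply: cder_eq (nxt_d _ cl i t ht) _.
  by congr ((_ *m _) i 0); apply/matrixP => a b; rewrite ord1 yl.
- move=> t i ht; rewrite yl //.
  have -> : l t i 0 = y0 i 0 - (y0 i 0 - l t i 0) by rewrite opprB addrC subrK.
  have := hl 0%N t i; rewrite expr0 divr1 /q /= => h.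
  apply: le_trans (cnD _ _) _; rewrite cnN.
  have := hM i; move: h; lra.
Qed.
End LinearODE.
(** With B and B' the coefficients along two neighbouring rays, S the connection in the direction u
    of their difference and P its derivative: the deviation of y' from its first-order prediction
    obeys the equation of B' up to the second-order terms on the right. *)
Lemma frame_algebra (A : comNzRingType) (N : nat) (B B' S P : 'M[A]_N) (y y' : 'cV[A]_N) (t : A) :
  B' *m y' - B *m y - (S + t *: (P + B *m S)) *m y =
  B' *m (y' - y - t *: (S *m y)) + ((B' - B - S - t *: P) *m y + (B' - B) *m (t *: (S *m y))).
Proof.
rewrite !(mulmxBr, mulmxBl, mulmxDl, scalerDr) -!scalemxAl -!scalemxAr !mulmxA.
have E (M M' : 'cV[A]_N) i j : (M + M') i j = M i j + M' i j by rewrite mxE.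
have Eo (M : 'cV[A]_N) i j : (- M) i j = - M i j by rewrite mxE.
have Es (c : A) (M : 'cV[A]_N) i j : (c *: M) i j = c * M i j by rewrite mxE.
by apply/matrixP => i j; rewrite !(E, Eo, Es); ring.
Qed.

(** * Parallel sections of a flat connection on a ball *)

Section Frame.
Context {R : realType} {n N : nat}.
Local Notation C := (Cplx R).
Implicit Types (x u v w : 'cV[C]_n).
Lemma addmxE (a b : nat) (M M' : 'M[C]_(a, b)) i j : (M + M') i j = M i j + M' i j. Proof. by rewrite mxE. Qed.
Lemma oppmxE (a b : nat) (M : 'M[C]_(a, b)) i j : (- M) i j = - M i j. Proof. by rewrite mxE. Qed.
Lemma scalemxE (a b : nat) (c : C) (M : 'M[C]_(a, b)) i j : (c *: M) i j = c * M i j. Proof. by rewrite mxE. Qed.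
Lemma rowbound_add (a b : nat) (A B : 'M[C]_(a, b)) (c d : R) :
  rowbound A c -> rowbound B d -> rowbound (A + B) (c + d).
Proof.
move=> hA hB i; apply: le_trans (lerD (hA i) (hB i)); rewrite -big_split /=.
by apply: ler_sum => j _; rewrite mxE cnD.
Qed.
Lemma rowbound_le (a b : nat) (A : 'M[C]_(a, b)) (c d : R) : c <= d -> rowbound A c -> rowbound A d.
Proof. by move=> cd h i; apply: le_trans (h i) cd. Qed.
Variables (p : 'cV[C]_n) (T : 'cV[C]_n -> 'cV[C]_n -> 'M[C]_N)
  (dT : 'cV[C]_n -> 'cV[C]_n -> 'cV[C]_n -> 'M[C]_N) (r K : R).
Hypothesis r0 : 0 < r.
Hypothesis K1 : 1 <= K.
Hypothesis TD : forall u w x, T (u + w) x = T u x + T w x.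
Hypothesis TZ : forall (a : R) u x, T (toC a *: u) x = toC a *: T u x.
Hypothesis dTZ : forall (a : R) u w x, dT (toC a *: u) w x = toC a *: dT u w x.
Hypothesis b1 : forall u x, vn (x - p) < r -> rowbound (T u x) (K * vn u).
Hypothesis b2 : forall u w x, vn (x - p) < r -> vn (x + u - p) < r ->
  rowbound (T w (x + u) - T w x) (K * vn u * vn w).
Hypothesis b3 : forall u w x, vn (x - p) < r -> vn (x + u - p) < r ->
  rowbound (T w (x + u) - T w x - dT u w x) (K * vn u ^+ 2 * vn w).
Hypothesis hd : forall v w x i j, vn (x - p) < r -> isd (fun y => T w y i j) v x (dT v w x i j).
Hypothesis flat : forall v w x, vn (x - p) < r ->
  dT v w x + T w x *m T v x = dT w v x + T v x *m T w x.
(** Within this radius K |v| is at most 1/4, as the differential equations require, and |v| is at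
    most 1, which absorbs surplus powers of |v|. *)
Let rho := Num.min (Num.min r 1) (1 / (4 * K)).
Let K0 : 0 < K. Proof. exact: lt_le_trans K1. Qed.
Let rho0 : 0 < rho.
Proof. by rewrite !lt_min r0 ltr01 divr_gt0 // mulr_gt0. Qed.
Let rho_r : rho <= r. Proof. by rewrite !ge_min lexx. Qed.
Let rho_1 : rho <= 1. Proof. by rewrite !ge_min lexx orbT. Qed.
Let rho_K : K * rho <= 1 / 4.
Proof.
rewrite mulrC -ler_pdivlMr // ge_min; apply/orP; right.
by rewrite invfM mulrA.
Qed.
Lemma seg_vn v (t : R) : 0 <= t <= 1 -> vn (p + toC t *: v - p) <= vn v.
Proof.
move=> /andP[t0 t1]; rewrite addrAC subrr add0r vnZ cn_toC ger0_norm //.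
by rewrite ler_piMl ?vn_ge0.
Qed.
(** The section is defined at x by solving the equation along the ray from p to x. To differentiate
    it in a transverse direction u, the rays to x and to x + u are compared; flatness makes the
    difference from the predicted first-order change satisfy an equation with inhomogeneity of order
    |u|^2, and [small_ode_bound] applies. *)
Lemma frame_col (y0 : 'cV[C]_N) : exists (Phi : 'cV[C]_n -> 'cV[C]_N) (L : R),
  Phi p = y0 /\ forall x u, vn (x - p) < rho -> vn (x + u - p) < rho -> forall i,
    cn (Phi (x + u) i 0 - Phi x i 0 - (T u x *m Phi x) i 0) <= L * vn u ^+ 2.
Proof.
pose M := vn y0; have M0 : 0 <= M by exact: vn_ge0.
pose B v (t : R) := T v (p + toC (clamp t) *: v).
have ode v : vn v < rho -> exists y : R -> 'cV[C]_N, [/\ y 0 = y0,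
    (forall t i, 0 <= t <= 1 -> cder (fun t => y t i 0) t ((B v t *m y t) i 0)) &
    (forall t i, 0 <= t <= 1 -> cn (y t i 0) <= 3 * M)].
  move=> hv; have hx t : vn (p + toC (clamp t) *: v - p) < r.
    by apply: le_lt_trans (seg_vn v (clamp01 t)) _; apply: lt_le_trans hv _.
  apply: linear_ode => //.
  - move=> t i j; apply: (@ccont_clamp _ (fun t => T v (p + toC t *: v) i j)) => s hs.
    have hxs := hx s; rewrite clamp_id // in hxs.
    exact: (cder_ccont (@isd_line _ _ (fun y => T v y i j) v p s _ (hd v v i j hxs))).
  - move=> t; apply: rowbound_le (@b1 v _ (hx t)); apply: le_trans rho_K.
    by rewrite ler_wpM2l ?(ltW K0) // ltW.
  - by move=> i; exact: cn_vn.
pose Y v := if pselect (vn v < rho) is left h then proj1_sig (cid (ode v h)) else fun=> 0.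
have YP v : vn v < rho -> [/\ Y v 0 = y0,
    (forall t i, 0 <= t <= 1 -> cder (fun t => Y v t i 0) t ((B v t *m Y v t) i 0)) &
    (forall t i, 0 <= t <= 1 -> cn (Y v t i 0) <= 3 * M)].
  by move=> h; rewrite /Y; case: pselect => // h'; exact: (proj2_sig (cid (ode v h'))).
have h01 : 0 <= (1 : R) <= 1 by rewrite ler01 lexx.
exists (fun x => Y (x - p) 1), (4 * (6 * K * M + 6 * K ^+ 2 * M)); split.
  rewrite subrr; have v0 : vn (0 : 'cV[C]_n) < rho by rewrite vn0.
  have [e1 e2 e3] := YP _ v0; apply/matrixP => i j; rewrite ord1.
  rewrite -[in RHS]e1; apply: (@cder_cst1 _ (fun t => Y 0 t i 0) 0) => t ht.
  apply: cder_eq (e2 t i ht) _; rewrite /B scaler0 addr0.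
  apply/eqP; rewrite -cn_eq0 eq_le cn_ge0 andbT.
  have := @rowbound_mul _ N N (T 0 p) (Y 0 t) 0 (3 * M) i; rewrite mul0r; apply.
  - by rewrite mulr_ge0.
  - by have := @b1 0 p; rewrite subrr !vn0 mulr0; apply.
  - by move=> j'; exact: e3.
move=> x u; set v := x - p => hv hvu i.
have xE : x = p + v by rewrite /v addrC subrK.
have hvu' : vn (v + u) < rho by move: hvu; rewrite /v addrAC.
have -> : x + u - p = v + u by rewrite /v addrAC.
have [Y0 Yd Yb] := YP _ hv; have [Y0' Yd' Yb'] := YP _ hvu'.
pose X t := p + toC t *: v; pose X' t := p + toC t *: (v + u).
have XX t : X' t = X t + toC t *: u by rewrite /X' /X scalerDr addrA.
have hX t : 0 <= t <= 1 -> vn (X t - p) < r.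
  by move=> ht; apply: le_lt_trans (seg_vn v ht) _; apply: lt_le_trans hv _.
have hX' t : 0 <= t <= 1 -> vn (X t + toC t *: u - p) < r.
  by move=> ht; rewrite -XX; apply: le_lt_trans (seg_vn _ ht) _; apply: lt_le_trans hvu' _.
have vn_tu t : 0 <= t <= 1 -> vn (toC t *: u) <= vn u.
  by move=> /andP[t0 t1]; rewrite vnZ cn_toC ger0_norm // ler_piMl ?vn_ge0.
(* The first-order change expected at time t: the connection in the direction t u applied to the
   solution on the old ray. *)
pose Z t := toC t *: (T u (X t) *m Y v t).
pose E t := B (v + u) t - B v t - T u (X t) - toC t *: dT u v (X t).
pose d t := E t *m Y v t + (B (v + u) t - B v t) *m Z t.
have v1 : vn v <= 1 by apply: le_trans (ltW hv) _.
have Zb t j : 0 <= t <= 1 -> cn (Z t j 0) <= K * vn u * (3 * M).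
  move=> ht; rewrite /Z mxE cnM cn_toC; move/andP: (ht) => [t0 t1]; rewrite ger0_norm //.
  apply: (@le_trans _ _ (1 * (K * vn u * (3 * M)))); last by rewrite mul1r.
  apply: ler_pM => //; first exact: cn_ge0.
  by apply: rowbound_mul; [rewrite mulr_ge0|exact/b1/hX|move=> k; exact: Yb].
have Bv t : 0 <= t <= 1 -> B v t = T v (X t) by move=> ht; rewrite /B clamp_id.
have Bvu t : 0 <= t <= 1 -> B (v + u) t = T v (X t + toC t *: u) + T u (X t + toC t *: u).
  by move=> ht; rewrite /B clamp_id // -TD -XX.
have Eb t : 0 <= t <= 1 -> rowbound (E t) (2 * K * vn u ^+ 2).
  move=> ht; have -> : E t = (T v (X t + toC t *: u) - T v (X t) - dT (toC t *: u) v (X t)) +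
       (T u (X t + toC t *: u) - T u (X t)).
    rewrite /E Bv // Bvu // dTZ.
    set q1 := T v _; set q2 := T u _; set q3 := T v _; set q4 := T u _; set q5 := _ *: _.
    by apply/matrixP => a b; rewrite !mxE; ring.
  have -> : 2 * K * vn u ^+ 2 = K * vn u ^+ 2 + K * vn u * vn u by ring.
  apply: rowbound_add; last first.
    apply: rowbound_le (@b2 (toC t *: u) u _ (hX t ht) (hX' t ht)).
    by rewrite ler_wpM2r ?vn_ge0 // ler_wpM2l ?(ltW K0) // vn_tu.
  apply: rowbound_le (@b3 (toC t *: u) v _ (hX t ht) (hX' t ht)).
  rewrite -[leRHS]mulr1; apply: ler_pM => //; rewrite ?mulr_ge0 ?exprn_ge0 ?vn_ge0 ?(ltW K0) //.
  by rewrite ler_pM2l // lerXn2r ?nnegrE ?vn_ge0 ?vn_tu.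
have dBb t : 0 <= t <= 1 -> rowbound (B (v + u) t - B v t) (2 * K * vn u).
  move=> ht; rewrite Bv // Bvu // addrAC.
  have -> : 2 * K * vn u = K * vn u + K * vn u by ring.
  apply: rowbound_add; last exact/b1/hX'.
  apply: rowbound_le (@b2 (toC t *: u) v _ (hX t ht) (hX' t ht)).
  rewrite -[leRHS]mulr1; apply: ler_pM => //; rewrite ?mulr_ge0 ?vn_ge0 ?(ltW K0) //.
  by rewrite ler_wpM2l ?(ltW K0) // vn_tu.
have u0 := vn_ge0 u.
have db t j : 0 <= t <= 1 -> cn (d t j 0) <= 6 * K * M * vn u ^+ 2 + 6 * K ^+ 2 * M * vn u ^+ 2.
  move=> ht; rewrite /d mxE; apply: le_trans (cnD _ _) _.
  have -> : 6 * K * M * vn u ^+ 2 = 2 * K * vn u ^+ 2 * (3 * M) by ring.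
  have -> : 6 * K ^+ 2 * M * vn u ^+ 2 = 2 * K * vn u * (K * vn u * (3 * M)) by ring.
  apply: lerD; apply: rowbound_mul.
  - by rewrite mulr_ge0.
  - exact: Eb.
  - by move=> k; exact: Yb.
  - by rewrite !mulr_ge0 // (ltW K0).
  - exact: dBb.
  - by move=> k; exact: Zb.
pose D t := Y (v + u) t - Y v t - Z t.
have subE (a b : 'cV[C]_N) k : (a - b) k 0 = a k 0 - b k 0 by rewrite !mxE.
have := @small_ode_bound _ N (B (v + u)) D d (6 * K * M * vn u ^+ 2 + 6 * K ^+ 2 * M * vn u ^+ 2)
   (3 * M + 3 * M + K * vn u * (3 * M)).
have -> : (4 * (6 * K * M + 6 * K ^+ 2 * M)) * vn u ^+ 2 =
   4 * (6 * K * M * vn u ^+ 2 + 6 * K ^+ 2 * M * vn u ^+ 2) by ring.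
have -> : Y (v + u) 1 i 0 - Y v 1 i 0 - (T u x *m Y v 1) i 0 = D 1 i 0.
  by rewrite /D /Z /X toC1 !scale1r -xE !mxE.
apply=> //.
- by rewrite addr_ge0 // !mulr_ge0 ?exprn_ge0 // (ltW K0).
- move=> t ht; rewrite /B clamp_id //.
  have hh : vn (X' t - p) < r by rewrite XX; exact: hX'.
  apply: rowbound_le (@b1 (v + u) _ hh); apply: le_trans rho_K.
  by rewrite ler_wpM2l ?(ltW K0) // ltW.
- by move=> j; rewrite /D /Z toC0 scale0r subr0 Y0 Y0' subrr mxE.
- move=> t j ht; rewrite /D subE subE; apply: le_trans (cnD _ _) _; rewrite cnN.
  apply: lerD; last exact: Zb.
  by apply: le_trans (cnD _ _) _; rewrite cnN; apply: lerD; [exact: Yb'|exact: Yb].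
- move=> t j ht.
  have dTu k : cder (fun t => T u (X t) j k) t (dT v u (X t) j k).
    exact: (@isd_line _ _ (fun y => T u y j k) v p t _ (hd v u j k (hX t ht))).
  have dZ := cder_sum (fun k => cderM (cderM (cder_toC t) (dTu k)) (Yd t k ht)).
  have := cderD (cderD (Yd' t j ht) (cderN (Yd t j ht))) (cderN dZ).
  move=> H; have eD : (fun t => D t j 0) = (fun t0 => Y (v + u) t0 j 0 + - Y v t0 j 0 +
     - (\sum_i0 toC t0 * T u (X t0) j i0 * Y v t0 i0 0)).
    apply/funext => s; rewrite /D /Z !mxE; congr (_ - _); rewrite mulr_sumr.
    by apply: eq_bigr => k _; rewrite mulrA.
  rewrite eD; apply: cder_eq H _.
  have -> : \sum_i0 ((1 * T u (X t) j i0 + toC t * dT v u (X t) j i0) * Y v t i0 0 +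
      toC t * T u (X t) j i0 * (B v t *m Y v t) i0 0) =
    ((T u (X t) + toC t *: (dT v u (X t) + T u (X t) *m T v (X t))) *m Y v t) j 0.
    rewrite scalerDr addrA mulmxDl [RHS]mxE big_split /=; congr (_ + _).
      by rewrite mxE; apply: eq_bigr => k _; rewrite !mxE; ring.
    rewrite -scalemxAl -mulmxA -Bv // [RHS]mxE [X in _ * X]mxE mulr_sumr.
    by apply: eq_bigr => k _; rewrite mulrA.
  (* The derivative of Z contains dT v u + T u T v; flatness exchanges it for dT u v + T v T u,
     which is what the expansion of the new coefficient produces. *)
  rewrite (flat _ _ (hX t ht)).
  have -> : (B (v + u) t *m Y (v + u) t) j 0 + - (B v t *m Y v t) j 0 +
     - (((T u (X t) + toC t *: (dT u v (X t) + T v (X t) *m T u (X t))) *m Y v t) j 0) =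
     (B (v + u) t *m Y (v + u) t - B v t *m Y v t -
       (T u (X t) + toC t *: (dT u v (X t) + T v (X t) *m T u (X t))) *m Y v t) j 0.
    by rewrite !mxE.
  have -> : (B (v + u) t *m D t) j 0 + d t j 0 = (B (v + u) t *m D t + d t) j 0 by rewrite [RHS]addmxE.
  congr (fun_of_matrix _ j 0).
  by rewrite /d /D /E /Z (Bv t ht); exact: frame_algebra.
Qed.
Lemma frame_cont (Phi : 'cV[C]_n -> 'cV[C]_N) (L : R) :
  (forall x u, vn (x - p) < rho -> vn (x + u - p) < rho -> forall i,
    cn (Phi (x + u) i 0 - Phi x i 0 - (T u x *m Phi x) i 0) <= L * vn u ^+ 2) ->
  forall x i, vn (x - p) < rho -> {for x, continuous (fun y => Phi y i 0)} /\
     forall v, isd (fun y => Phi y i 0) v x ((T v x *m Phi x) i 0).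
Proof.
move=> h x i hx; pose M := vn (Phi x).
have hxr : vn (x - p) < r by apply: lt_le_trans hx _.
have L0 : 0 <= `|L| by [].
have near_x u : vn u < rho - vn (x - p) -> vn (x + u - p) < rho.
  move=> hu; rewrite addrAC; apply: le_lt_trans (vnD _ _) _.
  by rewrite -ltrBrDl.
have d0 : 0 < rho - vn (x - p) by rewrite subr_gt0.
split.
  apply/contP => e e0; apply/nearvP.
  pose c := `|L| + K * M + 1; have c0 : 0 < c by rewrite ltr_wpDl // addr_ge0 // mulr_ge0 ?vn_ge0 ?(ltW K0).
  exists (Num.min (rho - vn (x - p)) (Num.min 1 (e / c))); first by rewrite !lt_min d0 ltr01 divr_gt0.
  move=> w; rewrite !lt_min => /andP[/near_x hw /andP[w1]]; rewrite ltr_pdivlMr // => we.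
  apply: le_lt_trans we; set u := w - x in hw w1 *.
  have -> : w = x + u by rewrite /u addrC subrK.
  have -> : Phi (x + u) i 0 - Phi x i 0 = (Phi (x + u) i 0 - Phi x i 0 - (T u x *m Phi x) i 0) + (T u x *m Phi x) i 0 by rewrite subrK.
  apply: le_trans (cnD _ _) _; apply: (@le_trans _ _ (`|L| * vn u + K * vn u * M)).
    apply: lerD.
      apply: le_trans (h x u hx hw i) _; rewrite expr2 mulrA.
      apply: (@le_trans _ _ (`|L| * vn u * vn u)); first by rewrite !ler_wpM2r ?vn_ge0 // ler_norm.
      by rewrite ler_piMr ?mulr_ge0 ?vn_ge0 // ltW.
    by apply: rowbound_mul; [exact: vn_ge0|exact: b1|move=> j; exact: cn_vn].
  have u0 := vn_ge0 u; rewrite /c !mulrDr mulr1.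
  have -> : `|L| * vn u + K * vn u * M = vn u * `|L| + vn u * (K * M) by ring.
  by rewrite lerDl.
move=> v; apply/cder0P => e e0; rewrite line0.
pose c := `|L| * vn v ^+ 2 + 1; have c0 : 0 < c by rewrite ltr_wpDl // mulr_ge0 ?exprn_ge0 ?vn_ge0.
have v1 : 0 < vn v + 1 by rewrite ltr_wpDl ?vn_ge0.
exists (Num.min ((rho - vn (x - p)) / (vn v + 1)) (e / c)); first by rewrite lt_min !divr_gt0.
move=> t; rewrite lt_min => /andP[]; rewrite ltr_pdivlMr // => t1; rewrite ltr_pdivlMr // => t2.
have hu : vn (x + toC t *: v - p) < rho.
  apply: near_x; apply: le_lt_trans t1; rewrite vnZ cn_toC ler_wpM2l // lerDl //.
have := h x (toC t *: v) hx hu i.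
have -> : (T (toC t *: v) x *m Phi x) i 0 = toC t * (T v x *m Phi x) i 0.
  by rewrite TZ -scalemxAl scalemxE.
move=> hh; apply: le_trans hh _; rewrite vnZ cn_toC exprMn.
have v2 : 0 <= vn v ^+ 2 by rewrite exprn_ge0 ?vn_ge0.
apply: (@le_trans _ _ (`|L| * (`|t| ^+ 2 * vn v ^+ 2))).
  apply: ler_wpM2r; last exact: ler_norm.
  by apply: mulr_ge0 => //; exact: exprn_ge0.
have -> : `|L| * (`|t| ^+ 2 * vn v ^+ 2) = `|t| * (`|L| * vn v ^+ 2) * `|t| by ring.
rewrite ler_wpM2r //; apply: le_trans (ltW t2); rewrite ler_wpM2l // lerDl //.
Qed.
(** Bootstrapping: the derivative T v Phi is as regular as Phi itself. *)
Lemma frame_Ck (Phi : 'cV[C]_n -> 'cV[C]_N) (U : set 'cV[C]_n) : open U ->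
  (forall x i, U x -> {for x, continuous (fun y => Phi y i 0)} /\
     forall v, isd (fun y => Phi y i 0) v x ((T v x *m Phi x) i 0)) ->
  (forall v i j, smooth_on U (fun y => T v y i j)) ->
  forall i, smooth_on U (fun y => Phi y i 0).
Proof.
move=> oU hP hT i k; elim: k i => [|k IH] i.
  by split=> // x Ux; have [] := hP x i Ux.
apply: CkS => // [x Ux|v]; first by have [] := hP x i Ux.
exists (fun x => \sum_j T v x i j * Phi x j 0); split.
  by move=> x Ux; have [_ /(_ v)] := hP x i Ux; rewrite mxE.
by apply: Ck_sum => // j _; apply: Ck_mul => //; exact: hT.
Qed.
End Frame.

Section SmoothBounds.
Context {R : realType} {n : nat}.
Local Notation C := (Cplx R).
Implicit Types (x u v w p : 'cV[C]_n) (f : 'cV[C]_n -> C).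
Lemma near_forall (I : finType) p (P : I -> 'cV[C]_n -> Prop) :
  (forall i, \forall z \near p, P i z) -> \forall z \near p, forall i, P i z.
Proof.
move=> h; have : \forall z \near p, forall i, i \in enum I -> P i z.
  elim: (enum I) => [|i s IH]; first by apply: (nearS (P := fun=> True)) => //; apply/nearvP; exists 1.
  apply: nearS (nearI (h i) IH) => z [h1 h2] j; rewrite inE => /orP[/eqP -> //|]; exact: h2.
by apply: nearS => z hz i; apply: hz; rewrite mem_enum.
Qed.
Lemma cont_bound f p : {for p, continuous f} -> exists K : R, \forall z \near p, cn (f z) <= K.
Proof.
move=> /contP /(_ 1 ltr01) h; exists (cn (f p) + 1); apply: nearS h => z hz.
have -> : f z = f p + (f z - f p) by rewrite addrC subrK.
by apply: le_trans (cnD _ _) _; rewrite lerD2l ltW.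
Qed.
Definition in_ball p (r : R) x := vn (x - p) < r.
Lemma ball_conv p (r : R) x u (t : R) : in_ball p r x -> in_ball p r (x + u) -> 0 <= t <= 1 ->
  in_ball p r (x + toC t *: u).
Proof.
rewrite /in_ball => h1 h2 /andP[t0 t1].
have -> : x + toC t *: u - p = toC (1 - t) *: (x - p) + toC t *: (x + u - p).
  by apply/matrixP => i j; rewrite !mxE toCB toC1; ring.
apply: le_lt_trans (vnD _ _) _; rewrite !vnZ !cn_toC !ger0_norm ?subr_ge0 //.
have [->|tn] := eqVneq t 0; first by rewrite subr0 mul1r mul0r addr0.
have tp : 0 < t by rewrite lt_neqAle eq_sym tn.
have h3 : (1 - t) * vn (x - p) <= (1 - t) * r by rewrite ler_wpM2l ?subr_ge0 // ltW.
have h4 : t * vn (x + u - p) < t * r by rewrite ltr_pM2l.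
by apply: lt_le_trans (ler_ltD h3 h4) _; rewrite -mulrDl subrK mul1r.
Qed.
Lemma Ck1_bounds U f p : open_nbhs p U -> Ck 1 U f -> exists (r K : R), [/\ 0 < r, 0 <= K &
  (forall x, in_ball p r x -> U x) /\
  (forall x, in_ball p r x -> cn (f x) <= K) /\
  (forall x v, in_ball p r x -> cn (rderive f v x) <= K * vn v) /\
  (forall x u, in_ball p r x -> in_ball p r (x + u) -> cn (f (x + u) - f x) <= K * vn u)].
Proof.
move=> [oU Up] hf.
have [K1 hK1] := cont_bound (Ck_cont hf Up).
have [Kf /near_forall hKf] := boolp.choice (fun k => cont_bound (Ck_cont (Ck_rderive (rb k) hf) Up)).
have /nearvP[r r0 hr] := nearI (open_near oU Up) (nearI hK1 hKf).
pose K := 2 * (`|K1| + \sum_k `|Kf k|).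
have sK0 : 0 <= \sum_k `|Kf k| by apply: sumr_ge0.
have K0 : 0 <= K by rewrite mulr_ge0 // addr_ge0.
have hU x : in_ball p r x -> U x by move=> /hr[].
have hd x v : in_ball p r x -> cn (rderive f v x) <= (`|K1| + \sum_k `|Kf k|) * vn v.
  move=> hx; have [_ [_ h]] := hr x hx; rewrite (rderive_rc v oU hf (hU _ hx)).
  apply: le_trans (cn_sum _ _ _) _.
  apply: (@le_trans _ _ (\sum_k `|Kf k| * vn v)).
    apply: ler_sum => k _; rewrite cnM cn_toC mulrC; apply: ler_pM => //; rewrite ?cn_ge0 ?rc_le //.
    by apply: le_trans (h k) (ler_norm _).
  by rewrite -mulr_suml ler_wpM2r ?vn_ge0 // lerDr.
have leK : `|K1| + \sum_k `|Kf k| <= K by rewrite /K ler_peMl // ?addr_ge0 // ler1n.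
exists r, K; split=> //; split=> //; split; [|split].
- move=> x hx; have [_ [h _]] := hr x hx; apply: le_trans h _; apply: le_trans (ler_norm _) _.
  by apply: le_trans leK; rewrite lerDl.
- by move=> x v hx; apply: le_trans (hd x v hx) _; rewrite ler_wpM2r ?vn_ge0.
- move=> x u hx hxu.
  have := @cmvt R (fun t => f (x + toC t *: u)) (fun t => rderive f u (x + toC t *: u)) 0 ((`|K1| + \sum_k `|Kf k|) * vn u).
  rewrite toC0 toC1 scale0r scale1r addr0 subr0 mulrA; apply=> t ht.
    exact: (@isd_line _ _ f u x t _ (Ck_isd u hf (hU _ (ball_conv hx hxu ht)))).
  by rewrite subr0; apply: hd; exact: ball_conv.
Qed.
Definition quad_bound U f p (r K : R) : Prop := [/\ 0 < r, 0 <= K &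
  (forall x, in_ball p r x -> U x) /\
  (forall x, in_ball p r x -> cn (f x) <= K) /\
  (forall x v, in_ball p r x -> cn (rderive f v x) <= K * vn v) /\
  (forall x u, in_ball p r x -> in_ball p r (x + u) -> cn (f (x + u) - f x) <= K * vn u) /\
  (forall x u, in_ball p r x -> in_ball p r (x + u) ->
     cn (f (x + u) - f x - rderive f u x) <= K * vn u ^+ 2)].
(** The derivatives in the 2n real basis directions are Lipschitz near p, and the mean value
    inequality with the linear part subtracted turns this into a quadratic remainder. *)
Lemma Ck2_bounds U f p : open_nbhs p U -> Ck 2 U f -> exists (r K : R), quad_bound U f p r K.
Proof.
move=> [oU Up] hf; have hf1 := Ck_pred hf.
have [r1 [K1 [r10 K10 [hU [h1 [h2 h3]]]]]] := Ck1_bounds (conj oU Up) hf1.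
have hk k : exists rK : R * R, [/\ 0 < rK.1, 0 <= rK.2 &
    forall x u, in_ball p rK.1 x -> in_ball p rK.1 (x + u) ->
     cn (rderive f (rb k) (x + u) - rderive f (rb k) x) <= rK.2 * vn u].
  have [r [K [a b [_ [_ [_ h]]]]]] := Ck1_bounds (conj oU Up) (Ck_rderive (rb k) hf).
  by exists (r, K).
have [rK hrK] := boolp.choice hk.
have /near_forall/nearvP[r2 r20 hr2] : forall k, \forall z \near p, in_ball p (rK k).1 z.
  by move=> k; apply/nearvP; have [a _ _] := hrK k; exists (rK k).1.
pose K2 := \sum_k (rK k).2.
have K20 : 0 <= K2 by apply: sumr_ge0 => k _; have [] := hrK k.
exists (Num.min r1 r2), (K1 + 2 * K2); split.
- by rewrite lt_min r10.
- by rewrite addr_ge0 // mulr_ge0.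
have b1 x : in_ball p (Num.min r1 r2) x -> in_ball p r1 x by rewrite /in_ball lt_min => /andP[].
have b2 x : in_ball p (Num.min r1 r2) x -> in_ball p r2 x by rewrite /in_ball lt_min => /andP[].
have leK : K1 <= K1 + 2 * K2 by rewrite lerDl mulr_ge0.
split; [by move=> x /b1/hU|split; [|split; [|split]]].
- by move=> x /b1 hx; apply: le_trans (h1 x hx) leK.
- by move=> x v /b1 hx; apply: le_trans (h2 x v hx) _; rewrite ler_wpM2r ?vn_ge0.
- by move=> x u /b1 hx /b1 hxu; apply: le_trans (h3 x u hx hxu) _; rewrite ler_wpM2r ?vn_ge0.
- move=> x u hx hxu.
  have := @cmvt R (fun t => f (x + toC t *: u)) (fun t => rderive f u (x + toC t *: u)) (rderive f u x) (K2 * vn u ^+ 2).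
  rewrite toC0 toC1 scale0r scale1r addr0 => H; apply: le_trans (H _ _) _.
  - move=> t ht; apply: (@isd_line _ _ f u x t _ (Ck_isd u hf1 _)).
    by apply: hU; apply: ball_conv => //; exact: b1.
  - move=> t ht; have hxt : in_ball p (Num.min r1 r2) (x + toC t *: u) by exact: ball_conv.
    rewrite !(rderive_rc u oU hf1) -?sumrB; [|exact/hU/b1|exact/hU/b1].
    apply: le_trans (cn_sum _ _ _) _; rewrite /K2 mulr_suml; apply: ler_sum => k _.
    rewrite -mulrBr cnM cn_toC; have [_ kk hh] := hrK k.
    have := hh x (toC t *: u) (hr2 _ (b2 _ hx) k) (hr2 _ (b2 _ hxt) k).
    rewrite vnZ cn_toC; move/andP: ht => [t0 t1]; rewrite ger0_norm // => h.
    have h' : cn (rderive f (rb k) (x + toC t *: u) - rderive f (rb k) x) <= (rK k).2 * vn u.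
      apply: le_trans h _; rewrite ler_wpM2l //; by rewrite ler_piMl ?vn_ge0.
    have -> : (rK k).2 * vn u ^+ 2 = vn u * ((rK k).2 * vn u) by ring.
    by apply: ler_pM => //; rewrite ?cn_ge0 ?rc_le.
  - rewrite mulrA ler_wpM2r ?exprn_ge0 ?vn_ge0 // lerDr //.
Qed.
End SmoothBounds.

(** * Parallel frames over the ring of germs *)

Section GermFrame.
Context {R : realType} {n : nat} {p : 'cV[Cplx R]_n}.
Local Notation C := (Cplx R).
Local Notation A := (germ_dring p).
Local Notation J := ('I_n * bool)%type.
Implicit Types (x u v w : 'cV[C]_n) (a b : J).
(** The coordinates z_k and, when the flag is [true], conj z_k, as forms that are linear over the
    reals; [dd] and [gdd] are the matching derivatives. One index set thus treats both types
    together. *)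
Definition zeta a v : C := if a.2 then Num.conj (v a.1 0) else v a.1 0.
Definition dd a (f : 'cV[C]_n -> C) x : C := if a.2 then dzbar a.1 f x else dz a.1 f x.
Definition gdd a (x : germ p) : germ p := if a.2 then gdelb a.1 x else gdel a.1 x.
Lemma zetaD a u v : zeta a (u + v) = zeta a u + zeta a v.
Proof. by rewrite /zeta; case: a.2; rewrite mxE // rmorphD. Qed.
Lemma zetaZ a (c : R) u : zeta a (toC c *: u) = toC c * zeta a u.
Proof. by rewrite /zeta; case: a.2; rewrite mxE // rmorphM /= conj_toC. Qed.
Lemma zeta_le a u : cn (zeta a u) <= vn u.
Proof. by rewrite /zeta; case: a.2; rewrite ?cn_conj cn_vn. Qed.
Lemma gddE a (x : germ p) : neq p (gdd a x) (dd a x).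
Proof. by rewrite /gdd /dd; case: a.2; [exact: gdelbE|exact: gdelE]. Qed.
Lemma rderive_dd U f v x : open U -> Ck 1 U f -> U x -> rderive f v x = \sum_a zeta a v * dd a f x.
Proof.
move=> oU hf Ux; rewrite (rderive_dz v oU hf Ux).
rewrite -(pair_bigA _ (fun i c => zeta (i, c) v * dd (i, c) f x)) /=.
by apply: eq_bigr => j _; rewrite big_bool /zeta /dd /= addrC.
Qed.
Lemma gsumE (I : finType) (g : I -> germ p) : neq p (\sum_i g i) (fun x => \sum_i g i x).
Proof.
rewrite /index_enum; elim: (locked_with _ _) => [|i s IH].
  have h : neq p (0 : germ p) (fun=> 0) := @gcstE R n p 0.
  by rewrite big_nil; apply: nearS h => z ->; rewrite big_nil.
rewrite big_cons; apply: (neq_trans (gaddE _ _)).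
by apply: nearS IH => z h; rewrite big_cons h.
Qed.
Lemma gmulmxE (m N q : nat) (X : 'M[germ p]_(m, N)) (Y : 'M[germ p]_(N, q)) i j :
  neq p ((X *m Y) i j) (fun x => \sum_c X i c x * Y c j x).
Proof.
rewrite mxE; apply: (neq_trans (gsumE _)).
have := near_forall (fun c => gmulE (X i c) (Y c j)).
by apply: nearS => z h; apply: eq_bigr => c _; exact: h.
Qed.
Variables (N : nat) (Th : J -> 'M[germ p]_N).
Hypothesis flat : forall a b i j,
  gdd a (Th b i j) + (Th b *m Th a) i j = gdd b (Th a i j) + (Th a *m Th b) i j.
(** The connection form, the sum of zeta_a Th_a, evaluated on the vector v; [dTm v w] is the
    derivative in direction v of its value on w. *)
Definition Tm v x : 'M[C]_N := \matrix_(i, j) \sum_a zeta a v * Th a i j x.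
Definition dTm v w x : 'M[C]_N := \matrix_(i, j) \sum_a \sum_b zeta a v * zeta b w * dd a (Th b i j) x.
Lemma flat_near : \forall x \near p, forall a b i j,
  dd a (Th b i j) x + \sum_c Th b i c x * Th a c j x = dd b (Th a i j) x + \sum_c Th a i c x * Th b c j x.
Proof.
have h a b i j : neq p (gdd a (Th b i j) + (Th b *m Th a) i j) (fun x => dd a (Th b i j) x + \sum_c Th b i c x * Th a c j x).
  apply: (neq_trans (gaddE _ _)).
  by apply: nearS (nearI (gddE a (Th b i j)) (gmulmxE (Th b) (Th a) i j)) => z [-> ->].
apply: near_forall => a; apply: near_forall => b; apply: near_forall => i; apply: near_forall => j.
have := h b a i j; rewrite -flat => h2.
by apply: nearS (nearI (h a b i j) h2) => z [<- <-].
Qed.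
Lemma Tm_rowbound (M : 'M[C]_N) w (e : J -> 'I_N -> 'I_N -> C) (K : J -> 'I_N -> 'I_N -> R) (c : R) :
  0 <= c -> (forall a i j, 0 <= K a i j) ->
  (forall i j, M i j = \sum_a zeta a w * e a i j) -> (forall a i j, cn (e a i j) <= K a i j * c) ->
  rowbound M ((1 + \sum_i \sum_j \sum_a K a i j) * c * vn w).
Proof.
move=> c0 K0 hM he i.
have sK0 i' : 0 <= \sum_j \sum_a K a i' j by apply: sumr_ge0 => j _; apply: sumr_ge0.
apply: (@le_trans _ _ (\sum_j \sum_a K a i j * c * vn w)).
  apply: ler_sum => j _; rewrite hM; apply: le_trans (cn_sum _ _ _) _; apply: ler_sum => a _.
  by rewrite cnM mulrC; apply: ler_pM; rewrite ?cn_ge0 ?zeta_le.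
have -> : \sum_j \sum_a K a i j * c * vn w = (\sum_j \sum_a K a i j) * c * vn w.
  by rewrite !mulr_suml; apply: eq_bigr => j _; rewrite !mulr_suml.
apply: ler_wpM2r; first exact: vn_ge0.
apply: ler_wpM2r => //; rewrite [in leRHS](bigD1 i) //= addrCA lerDl addr_ge0 //.
by apply: sumr_ge0 => i' _.
Qed.
Lemma germ_frame_data : exists (r K : R) (U : set 'cV[C]_n), [/\ 0 < r, 1 <= K, open U,
  (forall x, vn (x - p) < r -> U x) /\ (forall a i j, smooth_on U (Th a i j)) &
  [/\ (forall x, U x -> forall a b i j,
  dd a (Th b i j) x + \sum_c Th b i c x * Th a c j x = dd b (Th a i j) x + \sum_c Th a i c x * Th b c j x),
  (forall u x, vn (x - p) < r -> rowbound (Tm u x) (K * vn u)),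
  (forall u w x, vn (x - p) < r -> vn (x + u - p) < r ->
  rowbound (Tm w (x + u) - Tm w x) (K * vn u * vn w)) &
  (forall u w x, vn (x - p) < r -> vn (x + u - p) < r ->
  rowbound (Tm w (x + u) - Tm w x - dTm u w x) (K * vn u ^+ 2 * vn w))]].
Proof.
pose I := (J * ('I_N * 'I_N))%type.
have hU (k : I) : exists U, open_nbhs p U /\ smooth_on U (Th k.1 k.2.1 k.2.2).
  by have [U h1 h2] := germ_sm (Th k.1 k.2.1 k.2.2); exists U.
have [Uf hUf] := boolp.choice hU.
have nU : \forall x \near p, forall k, Uf k x.
  by apply: near_forall => k; have [[op Ukp] _] := hUf k; exact: open_near.
have [U [oU Up] hUU] := near_open (nearI nU flat_near).
have sU a i j : smooth_on U (Th a i j).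
  move=> k; apply: Ck_sub (_ : Ck k (Uf (a, (i, j))) _).
    by move=> x /hUU[h _]; exact: h.
  by have [_ h] := hUf (a, (i, j)); exact: h.
have [rf /boolp.choice[Kf hf]] := boolp.choice (fun k : I => Ck2_bounds (conj oU Up) (sU k.1 k.2.1 k.2.2 2%N)).
have : \forall x \near p, U x /\ forall k, in_ball p (rf k) x.
  apply: nearI; first exact: open_near.
  by apply: near_forall => k; apply/nearvP; have [a _ _] := hf k; exists (rf k).
move=> /nearvP[r r0 hr].
pose K a i j := Kf (a, (i, j)); pose KK := 1 + \sum_i \sum_j \sum_a K a i j.
have K0 a i j : 0 <= K a i j by have [] := hf (a, (i, j)).
exists r, KK, U; split=> //.
- rewrite lerDl; apply: sumr_ge0 => i _; apply: sumr_ge0 => j _; exact: sumr_ge0.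
- by split=> // x /hr[].
split.
- by move=> x /hUU[].
- move=> u x hx; have [_ hx'] := hr x hx; rewrite -[KK]mulr1.
  apply: (@Tm_rowbound _ u (fun a i j => Th a i j x)) => //.
    by move=> i j; rewrite mxE.
  by move=> a i j; rewrite mulr1; have [_ _ [_ [h _]]] := hf (a, (i, j)); apply: h; exact: hx'.
- move=> u w x hx hxu; have [_ hx'] := hr x hx; have [_ hxu'] := hr _ hxu.
  apply: (@Tm_rowbound _ w (fun a i j => Th a i j (x + u) - Th a i j x)) => //.
  + exact: vn_ge0.
  + by move=> i j; rewrite !mxE -sumrB; apply: eq_bigr => a _; rewrite mulrBr.
  + by move=> a i j; have [_ _ [_ [_ [_ [h _]]]]] := hf (a, (i, j)); apply: h; [exact: hx'|exact: hxu'].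
- move=> u w x hx hxu; have [Ux hx'] := hr x hx; have [_ hxu'] := hr _ hxu.
  apply: (@Tm_rowbound _ w (fun a i j => Th a i j (x + u) - Th a i j x - rderive (Th a i j) u x)) => //.
  + by rewrite exprn_ge0 ?vn_ge0.
  + move=> i j; rewrite !mxE exchange_big /= -!sumrB; apply: eq_bigr => a _.
    rewrite (rderive_dd u oU (sU a i j 1%N) Ux) !mulrBr; congr (_ - _).
    by rewrite mulr_sumr; apply: eq_bigr => b _; rewrite mulrAC [RHS]mulrA mulrC mulrA.
  + by move=> a i j; have [_ _ [_ [_ [_ [_ h]]]]] := hf (a, (i, j)); apply: h; [exact: hx'|exact: hxu'].
Qed.
Lemma open_ball (r : R) : exists2 W : set 'cV[C]_n, open W & (forall x, W x -> vn (x - p) < r) /\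
   (0 < r -> W p).
Proof.
have [r0|r0] := ltP 0 r; last by exists set0; [exact: open0|split=> // /lt_geF; rewrite r0].
have h : \forall x \near p, vn (x - p) < r by apply/nearvP; exists r.
by have [W [oW Wp] hW] := near_open h; exists W.
Qed.
Lemma zeta_cb (g : J -> C) (c : C) k :
  \sum_b zeta b (c *: cbasis R k) * g b = c * g (k, false) + Num.conj c * g (k, true).
Proof.
rewrite (bigD1 (k, false)) // (bigD1 (k, true)); last by rewrite /= xpair_eqE andbF.
rewrite /= [X in _ + (_ + X)]big1 => [|[l s] /andP[lk1 lk2]].
  by rewrite addr0 /zeta /= !mxE !eqxx mulr1.
have /negPf lk : l != k by apply/eqP => lk; move: lk1 lk2; rewrite lk; case: s; rewrite eqxx.
by rewrite /zeta /= !mxE lk /= mulr0 conjC0; case: s {lk1 lk2}; rewrite mul0r.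
Qed.
(** A real-linear form determines its coefficients on z and conj z; the directions e_k and i e_k
    suffice to find them. *)
Lemma dd_zeta (f : 'cV[C]_n -> C) x (g : J -> C) :
  (forall v, rderive f v x = \sum_b zeta b v * g b) -> forall a, dd a f x = g a.
Proof.
move=> h [k s].
have e1 : rderive f (cbasis R k) x = g (k, false) + g (k, true).
  by rewrite h -[cbasis R k]scale1r (zeta_cb g 1 k) conjC1 !mul1r.
have e2 : rderive f ('i *: cbasis R k) x = 'i * g (k, false) - 'i * g (k, true).
  by rewrite h (zeta_cb g 'i k) conjCi mulNr.
case: s; rewrite /dd /= /dz /dzbar e1 e2; move: (g (k, false)) (g (k, true)) => g1 g2.
  have -> : g1 + g2 + 'i * ('i * g1 - 'i * g2) = g1 + g2 + ('i * 'i) * (g1 - g2) by ring.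
  by rewrite sqrCi1; field.
have -> : g1 + g2 - 'i * ('i * g1 - 'i * g2) = g1 + g2 - ('i * 'i) * (g1 - g2) by ring.
by rewrite sqrCi1; field.
Qed.

(** The Frobenius theorem for linear systems: each column is solved by [frame_col], and the smooth
    solutions are then read as germs. *)
Theorem germ_frame (E0 : 'M[C]_N) : exists E : 'M[germ p]_N,
  (forall i j, gev (E i j) = E0 i j) /\ forall a i j, gdd a (E i j) = (Th a *m E) i j.
Proof.
have [r [K [U [r0 K1 oU [hU sU] [fl h1 h2 h3]]]]] := germ_frame_data.
have TD u w x : Tm (u + w) x = Tm u x + Tm w x.
  apply/matrixP => i j; rewrite !mxE -big_split /=; apply: eq_bigr => a _.
  by rewrite zetaD mulrDl.
have TZ (c : R) u x : Tm (toC c *: u) x = toC c *: Tm u x.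
  apply/matrixP => i j; rewrite !mxE mulr_sumr; apply: eq_bigr => a _.
  by rewrite zetaZ mulrA.
have dTZ (c : R) u w x : dTm (toC c *: u) w x = toC c *: dTm u w x.
  apply/matrixP => i j; rewrite !mxE mulr_sumr; apply: eq_bigr => a _.
  rewrite mulr_sumr; apply: eq_bigr => b _; by rewrite zetaZ !mulrA.
have hd v w x i j : vn (x - p) < r -> isd (fun y => Tm w y i j) v x (dTm v w x i j).
  move=> /hU Ux; rewrite !mxE exchange_big /=; under eq_fun do rewrite mxE.
  apply: isd_sum => b.
  have -> : \sum_a zeta a v * zeta b w * dd a (Th b i j) x = zeta b w * rderive (Th b i j) v x.
    rewrite (rderive_dd v oU (sU b i j 1%N) Ux) mulr_sumr; apply: eq_bigr => a _.
    by rewrite mulrAC mulrC mulrA [_ * zeta a v]mulrC.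
  have := isdM (isd_cst (zeta b w) v x) (Ck_isd v (sU b i j 1%N) Ux).
  by rewrite mul0r add0r.
have flat' v w x : vn (x - p) < r ->
    dTm v w x + Tm w x *m Tm v x = dTm w v x + Tm v x *m Tm w x.
  move=> /hU Ux.
  have S v' w' i j : (dTm v' w' x + Tm w' x *m Tm v' x) i j = \sum_a \sum_b zeta a v' * zeta b w' *
      (dd a (Th b i j) x + \sum_c Th b i c x * Th a c j x).
    rewrite !mxE.
    have -> : \sum_j0 Tm w' x i j0 * Tm v' x j0 j =
      \sum_a \sum_b zeta a v' * zeta b w' * (\sum_c Th b i c x * Th a c j x).
      transitivity (\sum_c \sum_a \sum_b zeta a v' * zeta b w' * (Th b i c x * Th a c j x)).
        apply: eq_bigr => c _; rewrite !mxE mulr_sumr; apply: eq_bigr => a _.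
        by rewrite mulr_suml; apply: eq_bigr => b _; ring.
      rewrite exchange_big /=; apply: eq_bigr => a _; rewrite exchange_big /=.
      by apply: eq_bigr => b _; rewrite mulr_sumr.
    rewrite -big_split /=; apply: eq_bigr => a _; rewrite -big_split /=.
    by apply: eq_bigr => b _; rewrite mulrDr.
  apply/matrixP => i j; rewrite !S exchange_big /=.
  apply: eq_bigr => b _; apply: eq_bigr => a _.
  by rewrite (fl x Ux a b i j) [zeta a v * _]mulrC.
pose rho := Num.min (Num.min r 1) (1 / (4 * K)).
have rho0 : 0 < rho by rewrite !lt_min r0 ltr01 divr_gt0 // mulr_gt0 // (lt_le_trans _ K1).
have col_ex j : exists Phi : 'cV[C]_n -> 'cV[C]_N, Phi p = col j E0 /\
    forall x i, vn (x - p) < rho -> {for x, continuous (fun y => Phi y i 0)} /\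
     forall v, isd (fun y => Phi y i 0) v x ((Tm v x *m Phi x) i 0).
  have [Phi [L [e1 e2]]] := frame_col r0 K1 TD dTZ h1 h2 h3 hd flat' (col j E0).
  by exists Phi; split; [exact: e1|exact: (frame_cont K1 TZ h1 e2)].
have [Phi hPhi] := boolp.choice col_ex.
have [W oW [hW /(_ rho0) Wp]] := open_ball rho.
have oUW : open (U `&` W) by exact: openI.
have Up : U p by apply: hU; rewrite subrr vn0.
have sT v i j : smooth_on (U `&` W) (fun y => Tm v y i j).
  move=> k; apply: (@Ck_ext _ _ _ _ (fun y => \sum_a zeta a v * Th a i j y)) => //.
    by move=> z _; rewrite mxE.
  apply: Ck_sum => // a _; apply: Ck_mul => //; first exact: Ck_cst.
  by apply: Ck_sub (sU a i j k) => z [].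
have hP j x i : (U `&` W) x -> {for x, continuous (fun y => Phi j y i 0)} /\
     forall v, isd (fun y => Phi j y i 0) v x ((Tm v x *m Phi j x) i 0).
  by move=> [_ /hW hx]; have [_ h] := hPhi j; exact: h.
have sP i j : smooth_on (U `&` W) (fun y => Phi j y i 0) := frame_Ck oUW (hP j) sT i.
have mP i j : smn p (fun y => Phi j y i 0) by exists (U `&` W).
have nP i j := gm_near (mP i j).
pose E : 'M[germ p]_N := \matrix_(i, j) gm p (fun y => Phi j y i 0).
have EE i j : E i j = gm p (fun y => Phi j y i 0) by rewrite mxE.
exists E; split.
  by move=> i j; rewrite EE /gev (neq_p (nP i j)); have [-> _] := hPhi j; rewrite mxE.
move=> a i j; apply: germP; apply: (neq_trans (gddE a _)).
have h4 : neq p (dd a (E i j)) (dd a (fun y => Phi j y i 0)).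
  by rewrite EE /dd; case: a.2; [apply: neq_dzbar|apply: neq_dz] => //; exact: germ_sm.
apply: (neq_trans h4); apply: neq_sym; apply: (neq_trans (gmulmxE _ _ i j)).
have h5 : \forall x \near p, forall c, E c j x = Phi j x c 0.
  by apply: near_forall => c; rewrite EE; exact: nP.
apply: nearS (nearI h5 (open_near oUW (conj Up Wp))) => x [h6 Ux].
have hr v : rderive (fun y => Phi j y i 0) v x = \sum_c Tm v x i c * Phi j x c 0.
  by have [_ /(_ v) /isd_rderive ->] := hP j x i Ux; rewrite mxE.
have [g hg] : exists g : J -> C, forall b, g b = \sum_c Th b i c x * Phi j x c 0 by eexists.
have hz v : rderive (fun y => Phi j y i 0) v x = \sum_b zeta b v * g b.
  rewrite hr; transitivity (\sum_c \sum_b zeta b v * (Th b i c x * Phi j x c 0)).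
    by apply: eq_bigr => c _; rewrite mxE mulr_suml; apply: eq_bigr => b _; rewrite mulrA.
  by rewrite exchange_big /=; apply: eq_bigr => b _; rewrite hg mulr_sumr.
transitivity (g a); first by rewrite hg; apply: eq_bigr => c _; rewrite h6.
by symmetry; exact: dd_zeta hz a.
Qed.
End GermFrame.

(** * The inverse function theorem *)

Section InverseFunction.
Local Notation jacobian := Pilot.Defs.jacobian.
Context {R : realType} {m : nat}.
Local Notation C := (Cplx R).
Local Notation V := 'cV[C]_m.
Implicit Types (x y u v w : V) (f g : V -> V).
Lemma vn_mul (N k : nat) (B : 'M[C]_(k, N)) (u : 'cV[C]_N) : vn (B *m u) <= mn B * vn u.
Proof.
rewrite /vn /mn mulr_suml; apply: ler_sum => i _; rewrite mxE; apply: le_trans (cn_sum _ _ _) _.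
rewrite mulr_suml; apply: ler_sum => j _; rewrite cnM; apply: ler_wpM2l; first exact: cn_ge0.
exact: cn_vn.
Qed.
Lemma mnr_ge0 (N k : nat) (B : 'M[C]_(k, N)) : 0 <= mn B.
Proof. by apply: sumr_ge0 => i _; apply: sumr_ge0 => j _; exact: cn_ge0. Qed.
Lemma vn_dist x y (c : R) : vn x <= vn y + vn (x - y).
Proof. by have := vnD y (x - y); rewrite addrC subrK. Qed.
Lemma open_vn (B : 'M[C]_m) c (r : R) : open [set x | vn (B *m (x - c)) < r].
Proof.
have d0 : 0 < mn B + 1 by rewrite ltr_wpDl ?mnr_ge0.
have key x w : vn (w - x) < (r - vn (B *m (x - c))) / (mn B + 1) -> vn (B *m (w - c)) < r.
  rewrite ltr_pdivlMr // => hw.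
  have -> : B *m (w - c) = B *m (x - c) + B *m (w - x) by rewrite -mulmxDr [x - c + _]addrC addrA subrK.
  apply: le_lt_trans (vnD _ _) _; rewrite -ltrBrDl; apply: le_lt_trans hw.
  by apply: le_trans (vn_mul _ _) _; rewrite mulrC ler_wpM2l ?vn_ge0 // lerDl.
rewrite openE => x hx; apply/nearvP; exists ((r - vn (B *m (x - c))) / (mn B + 1)).
  by rewrite divr_gt0 // subr_gt0; exact: hx.
by move=> w; exact: key.
Qed.
Lemma holo_rderive U f x v i : open U -> holomorphic_on U f -> U x ->
  rderive (fun w => f w i 0) v x = (jacobian f x *m v) i 0.
Proof.
move=> oU hf Ux; have [sf df] := hf i; rewrite (rderive_dz v oU (sf 1%N) Ux) mxE.
by apply: eq_bigr => k _; rewrite mxE df // mulr0 addr0 mulrC.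
Qed.
Lemma Ck_det (k : nat) (U : set V) (N : nat) (B : V -> 'M[C]_N) : open U ->
  (forall i j, Ck k U (fun x => B x i j)) -> Ck k U (fun x => \det (B x)).
Proof.
move=> oU hB; apply: Ck_sum => // s _; apply: Ck_mul => //; first exact: Ck_cst.
by apply: Ck_prod.
Qed.
Lemma Ck_invmx (k : nat) (U : set V) (N : nat) (B : V -> 'M[C]_N) i j : open U ->
  (forall x, U x -> B x \in unitmx) ->
  (forall i j, Ck k U (fun x => B x i j)) -> Ck k U (fun x => invmx (B x) i j).
Proof.
move=> oU uB hB; apply: (@Ck_ext _ _ _ _ (fun x => (\det (B x))^-1 * cofactor (B x) j i)) => //.
  by move=> x Ux; rewrite /invmx uB // !mxE.
have n0 x : U x -> \det (B x) != 0 by move=> Ux; have := uB x Ux; rewrite unitmxE unitfE.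
have h1 : Ck k U (fun x => (\det (B x))^-1) by apply: Ck_inv n0 _ => //; exact: Ck_det.
apply: (Ck_mul oU h1); apply: Ck_mul => //; first exact: Ck_cst.
apply: Ck_det => // a b; apply: (Ck_ext oU _ (hB (lift j a) (lift i b))) => x _.
by rewrite !mxE.
Qed.
Lemma cont_contP f x : (forall i, {for x, continuous (fun w => f w i 0)}) ->
  forall e : R, 0 < e -> \forall w \near x, vn (f w - f x) < e.
Proof.
move=> h e e0; have d0 : 0 < e / m.+1%:R by rewrite divr_gt0.
have H : \forall w \near x, forall i, cn (f w i 0 - f x i 0) < e / m.+1%:R.
  by apply: near_forall => i; have /contP := h i; apply.
apply: nearS H => w hw; apply: (@le_lt_trans _ _ (\sum_(i < m) e / m.+1%:R)).
  by apply: ler_sum => i _; rewrite !mxE; exact/ltW.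
exact: sum_cst_lt.
Qed.
Variables (U : set V) (f : V -> V) (a : V).
Hypothesis oU : open U.
Hypothesis Ua : U a.
Hypothesis hf : holomorphic_on U f.
Hypothesis unitJ : jacobian f a \in unitmx.
Variables (Ji : 'M[C]_m) (phi : V -> V).
Hypothesis JiE : Ji = invmx (jacobian f a).
Hypothesis phi_def : forall x, phi x = x - Ji *m f x.
Lemma newtonE x i : phi x i 0 = x i 0 - \sum_j Ji i j * f x j 0.
Proof. by rewrite phi_def addmxE oppmxE mxE. Qed.
Lemma phi_smooth i : smooth_on U (fun x => phi x i 0).
Proof.
move=> k; apply: (@Ck_ext _ _ _ _ (fun x => x i 0 + - \sum_j Ji i j * f x j 0)) => //.
  by move=> x _; rewrite newtonE.
apply: Ck_add => //; first exact: Ck_coord.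
apply: Ck_opp => //; apply: Ck_sum => // j _; apply: Ck_mul => //; first exact: Ck_cst.
by have [sf _] := hf j; exact: sf.
Qed.
Lemma phi_rderive i v x : U x -> rderive (fun x => phi x i 0) v x = (v - Ji *m (jacobian f x *m v)) i 0.
Proof.
move=> Ux; apply: isd_rderive.
have e : (fun x => phi x i 0) = (fun x => x i 0 + - \sum_j Ji i j * f x j 0).
  by apply/funext => w; rewrite newtonE.
rewrite e; have h j : isd (fun x => Ji i j * f x j 0) v x (Ji i j * (jacobian f x *m v) j 0).
  have [sf _] := hf j.
  have := isdM (isd_cst (Ji i j) v x) (Ck_isd v (sf 1%N) Ux).
  by rewrite mul0r add0r (holo_rderive v j oU hf Ux).
have := isdD (isd_coord i v x) (isdN (isd_sum h)).
by rewrite [in X in _ -> isd _ _ _ X]addmxE oppmxE [in X in _ -> isd _ _ _ (_ - X)]mxE.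
Qed.
(** The Newton map [phi] has derivative zero at a, so by continuity its derivative is small nearby
    and [phi] contracts. *)
Lemma phi_contract : exists2 r : R, 0 < r & (forall x, vn (x - a) < r -> U x) /\
  (forall x v, vn (x - a) < r -> vn (v - Ji *m (jacobian f x *m v)) <= 1 / 2 * vn v) /\
  (forall x u, vn (x - a) < r -> vn (x + u - a) < r -> vn (phi (x + u) - phi x) <= 1 / 2 * vn u).
Proof.
pose M := (m * #|{: 'I_m * bool}|).+1%:R : R.
have M0 : 0 < M by rewrite ltr0n.
pose e := 1 / 4 / M; have e0 : 0 < e by rewrite !divr_gt0.
have : \forall x \near a, forall ik : 'I_m * ('I_m * bool), cn (rderive (fun x => phi x ik.1 0) (rb ik.2) x) < e.
  apply: near_forall => -[i k] /=.
  have /contP /(_ e e0) : {for a, continuous (rderive (fun x => phi x i 0) (rb k))}.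
    exact: (Ck_cont (Ck_rderive (rb k) (phi_smooth i 1%N)) Ua).
  apply: nearS => x; rewrite [in X in _ - X]phi_rderive // JiE mulmxA mulVmx // mul1mx subrr.
  by rewrite [in X in _ - X]mxE subr0.
move=> h; have /nearvP[r r0 hr] := nearI (open_near oU Ua) h.
have hU x : vn (x - a) < r -> U x by move=> /hr[].
have hd x v i : vn (x - a) < r -> cn (rderive (fun x => phi x i 0) v x) <= #|{: 'I_m * bool}|%:R * e * vn v.
  move=> hx; have [Ux hh] := hr x hx; rewrite (rderive_rc v oU (phi_smooth i 1%N) Ux).
  apply: le_trans (cn_sum _ _ _) _.
  apply: (@le_trans _ _ (\sum_(k : 'I_m * bool) e * vn v)).
    apply: ler_sum => k _; rewrite cnM cn_toC mulrC; apply: ler_pM => //; rewrite ?cn_ge0 ?rc_le //.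
    exact: ltW (hh (i, k)).
  by rewrite sumr_const -[X in X <= _]mulr_natl mulrA.
have sM (c : R) : 0 <= c -> \sum_(i < m) #|{: 'I_m * bool}|%:R * e * c <= 1 / 4 * c.
  move=> c0; rewrite sumr_const card_ord -[X in X <= _]mulr_natl !mulrA -natrM ler_wpM2r //.
  have hM : (m * #|{: 'I_m * bool}|)%:R <= M by rewrite ler_nat leqnSn.
  by rewrite ler_pdivrMr //; move: hM; lra.
exists r => //; split=> //; split.
  move=> x v hx; apply: (@le_trans _ _ (1 / 4 * vn v)); last by have := vn_ge0 v; lra.
  apply: le_trans (sM _ (vn_ge0 v)); apply: ler_sum => i _.
  by rewrite -(phi_rderive i v (hU x hx)); exact: hd.
move=> x u hx hxu.
apply: (@le_trans _ _ (\sum_(i < m) 2 * (#|{: 'I_m * bool}|%:R * e * vn u))).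
  apply: ler_sum => i _.
  have -> : (phi (x + u) - phi x) i 0 = phi (x + u) i 0 - phi x i 0 - 0 by rewrite addmxE oppmxE subr0.
  have := @cmvt R (fun t => phi (x + toC t *: u) i 0) (fun t => rderive (fun x => phi x i 0) u (x + toC t *: u)) 0 (#|{: 'I_m * bool}|%:R * e * vn u).
  rewrite toC0 toC1 scale0r scale1r addr0; apply=> t ht; have hxt := ball_conv hx hxu ht.
    exact: (@isd_line _ _ (fun x => phi x i 0) u x t _ (Ck_isd u (phi_smooth i 1%N) (hU _ hxt))).
  by rewrite subr0; apply: hd.
rewrite -mulr_sumr; have := sM _ (vn_ge0 u); have := vn_ge0 u; lra.
Qed.
Lemma phi_eq x y : f x = f y -> phi x - phi y = x - y.
Proof. by move=> h; apply/matrixP => i j; rewrite !phi_def h !(addmxE, oppmxE); ring. Qed.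
(** A vector v in the kernel satisfies |v| <= |v| / 2. *)
Lemma small_kernel (B : 'M[C]_m) : (forall v, vn (v - Ji *m (B *m v)) <= 1 / 2 * vn v) -> B \in unitmx.
Proof.
move=> h; rewrite -unitmx_tr -row_free_unit -kermx_eq0; apply/rowV0P => v /sub_kermxP hv.
have h0 : B *m v^T = 0 by apply: trmx_inj; rewrite trmx_mul trmxK hv trmx0.
have := h v^T; rewrite h0 mulmx0 subr0 => h1.
have : vn v^T = 0 by have := vn_ge0 v^T; lra.
by move=> /vn_eq0 /(congr1 trmx); rewrite trmxK trmx0.
Qed.
Lemma inverse_function_aux : exists (V0 W : set V) (g : V -> V), [/\ open V0, open W, V0 a /\ V0 `<=` U &
  [/\ (forall x, V0 x -> W (f x) /\ g (f x) = x), (forall y, W y -> V0 (g y) /\ f (g y) = y),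
   (forall x, V0 x -> jacobian f x \in unitmx) & holomorphic_on W g]].
Proof.
have [r r0 [hU [hJ hphi]]] := phi_contract.
have [T T_def] : exists T : V -> V -> V, forall y x, T y x = phi x + Ji *m y by exists (fun y x => phi x + Ji *m y).
have TE y x : T y x = x + Ji *m (y - f x).
  by rewrite T_def phi_def mulmxBr; apply/matrixP => i j; rewrite !(addmxE, oppmxE); ring.
have Tfix y x : T y x = x -> f x = y.
  rewrite TE => /eqP; rewrite -subr_eq0 addrAC subrr add0r => /eqP /(congr1 (mulmx (jacobian f a))).
  by rewrite JiE mulmxA mulmxV // mul1mx mulmx0 => /eqP; rewrite subr_eq0 => /eqP ->.
have T_lip y x u : vn (x - a) < r -> vn (x + u - a) < r -> vn (T y (x + u) - T y x) <= 1 / 2 * vn u.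
  by move=> h1 h2; rewrite !T_def opprD addrACA subrr addr0; exact: hphi.
have T_lip' y x x' : vn (x - a) < r -> vn (x' - a) < r -> vn (T y x' - T y x) <= 1 / 2 * vn (x' - x).
  by move=> h1 h2; have := T_lip y x (x' - x) h1; rewrite [x + _]addrC subrK; apply.
(* For y in W the first Newton step from a has length d < r/2, and the steps halve, so the iterates
   stay within 2 d < r of a. *)
pose W : set V := [set y | vn (Ji *m (y - f a)) < r / 2].
have solve y : W y -> exists x, vn (x - a) < r /\ f x = y.
  move=> Wy; set d := vn (Ji *m (y - f a)) in Wy.
  have {}Wy : d < r / 2 by exact: Wy.
  have d0 : 0 <= d by exact: vn_ge0.
  pose q k := iter k (T y) a.
  have q1 : vn (q 1%N - q 0%N) = d by rewrite /q /= TE addrAC subrr add0r.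
  have lt_r j : vn (q j - a) <= 2 * d * (1 - (1 / 2) ^+ j) -> vn (q j - a) < r.
    move=> h; apply: le_lt_trans h _.
    have z0 : 0 <= (1 / 2 : R) ^+ j by rewrite exprn_ge0.
    have : 0 <= d * (1 / 2) ^+ j by rewrite mulr_ge0.
    by move: Wy; lra.
  have hq k : vn (q k - a) <= 2 * d * (1 - (1 / 2) ^+ k) /\ vn (q k.+1 - q k) <= d * (1 / 2) ^+ k.
    elim: k => [|k [IH1 IH2]]; first by rewrite /q /= subrr vn0 expr0 subrr mulr0 mulr1 -q1.
    have e0 : 0 <= (1 / 2 : R) ^+ k.+1 by rewrite exprn_ge0.
    have h3 : vn (q k.+1 - a) <= 2 * d * (1 - (1 / 2) ^+ k.+1).
      have -> : q k.+1 - a = (q k.+1 - q k) + (q k - a) by rewrite addrA subrK.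
      apply: le_trans (vnD _ _) _; apply: le_trans (lerD IH2 IH1) _.
      by rewrite exprS; set z := (1 / 2) ^+ k; lra.
    split=> //; have := T_lip' y _ _ (lt_r k IH1) (lt_r k.+1 h3).
    by move=> h; apply: le_trans h _; rewrite exprS; move: IH2; lra.
  have q_lt k : vn (q k - a) < r by have [h _] := hq k; exact: lt_r.
  have cgeo : cvgn (series (geometric d (1 / 2))).
    by apply: is_cvg_geometric_series; rewrite ger0_norm; lra.
  have hlim i : exists l : C, clim (fun k => q k i 0) l.
    have [l hl] := @series_clim R (fun k => q k.+1 i 0 - q k i 0) (geometric d (1 / 2))
      (fun k => ltac:(by have [_ h] := hq k; apply: le_trans h; have := cn_vn (q k.+1 - q k) i; rewrite addmxE oppmxE)) cgeo.
    exists (l + a i 0); apply: (clim_eq (climD hl (clim_cst (a i 0)))) => k.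
    by rewrite /series /= telescope_sumr // subrK.
  pose x : V := \col_i proj1_sig (cid (hlim i)).
  have hx i : clim (fun k => q k i 0) (x i 0) by rewrite mxE; exact: (proj2_sig (cid (hlim i))).
  have hxn e : 0 < e -> exists K : nat, forall k, (K <= k)%N -> vn (q k - x) < e.
    move=> e0; have e1 : 0 < e / m.+1%:R by rewrite divr_gt0.
    pose K i := proj1_sig (cid (hx i _ e1)).
    have hK i : forall k, (K i <= k)%N -> cn (q k i 0 - x i 0) < e / m.+1%:R := proj2_sig (cid (hx i _ e1)).
    exists (\max_i K i) => k hk; apply: (@le_lt_trans _ _ (\sum_(i < m) e / m.+1%:R)).
      apply: ler_sum => i _; rewrite addmxE oppmxE; apply: ltW; apply: hK.
      by apply: leq_trans hk; exact: leq_bigmax.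
    exact: sum_cst_lt.
  have xr : vn (x - a) < r.
    have e0 : 0 < r - 2 * d by lra.
    have [K hK] := hxn _ e0; have h1 := hK K (leqnn K); have [h2 _] := hq K.
    have -> : x - a = - (q K - x) + (q K - a) by rewrite opprB addrA subrK.
    apply: le_lt_trans (vnD _ _) _; rewrite vnN.
    have : 0 <= d * (1 / 2) ^+ K by rewrite mulr_ge0 // exprn_ge0.
    by move: h1 h2; lra.
  exists x; split=> //; apply: Tfix; apply/eqP; rewrite -subr_eq0; apply/eqP/vn_eq0.
  apply/eqP; rewrite eq_le vn_ge0 andbT; apply/ler_addgt0Pl => e e0; rewrite addr0.
  have e2 : 0 < e / 2 by rewrite divr_gt0.
  have [K hK] := hxn _ e2; have h1 := hK K (leqnn K); have h2 := hK K.+1 (leqnSn K).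
  have -> : T y x - x = (T y x - T y (q K)) + (q K.+1 - x) by rewrite addrA subrK.
  have h3 := T_lip' y _ _ (q_lt K) xr; rewrite vnB in h3.
  apply: le_trans (vnD _ _) _; rewrite [vn (T y x - _)]vnB; have := vn_ge0 (q K - x).
  by move: h1 h2 h3; rewrite [vn (x - q K)]vnB; lra.
have inj x x' : vn (x - a) < r -> vn (x' - a) < r -> f x = f x' -> x = x'.
  move=> h1 h2 h; have := hphi x (x' - x) h1; rewrite [x + _]addrC subrK => /(_ h2).
  rewrite (phi_eq (esym h)) => h3; have h4 := vn_ge0 (x' - x).
  have /vn_eq0 /eqP : vn (x' - x) = 0 by lra.
  by rewrite subr_eq0 => /eqP.
have [g hg] : exists g : V -> V, forall y, W y -> vn (g y - a) < r /\ f (g y) = y.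
  exists (fun y => if pselect (W y) is left h then proj1_sig (cid (solve y h)) else a) => y Wy.
  by case: pselect => // h; exact: (proj2_sig (cid (solve y h))).
have oW : open W by exact: open_vn.
have oB : open [set x | vn (x - a) < r].
  have -> : [set x | vn (x - a) < r] = [set x | vn (1%:M *m (x - a)) < r].
    by apply/seteqP; split=> x /=; rewrite mul1mx.
  exact: open_vn.
pose V0 : set V := [set x | vn (x - a) < r /\ W (f x)].
have fcont x : U x -> forall e : R, 0 < e -> \forall w \near x, vn (f w - f x) < e.
  by move=> Ux; apply: cont_contP => i; have [sf _] := hf i; apply: (Ck_cont (sf 0%N) Ux).
have oV0 : open V0.
  rewrite openE => x [hx Wx].
  have /nearvP[e e0 he] := open_near oW Wx.
  apply: nearS (nearI (open_near oB hx) (fcont x (hU x hx) e e0)) => w [h1 h2].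
  by split; [exact: h1|exact: (he _ h2)].
have Wfa : W (f a) by rewrite /W /= subrr mulmx0 vn0 divr_gt0.
have hgf x : V0 x -> g (f x) = x.
  by move=> [hx Wx]; have [h1 h2] := hg _ Wx; apply: inj.
have g_lip y y' : W y -> W y' -> vn (g y' - g y) <= 2 * mn Ji * vn (y' - y).
  move=> Wy Wy'; have [h1 e1] := hg _ Wy; have [h2 e2] := hg _ Wy'.
  have := hphi (g y) (g y' - g y) h1; rewrite [g y + _]addrC subrK => /(_ h2).
  have -> : phi (g y') - phi (g y) = (g y' - g y) - Ji *m (y' - y).
    rewrite !phi_def e1 e2 mulmxBr; apply/matrixP => i j; rewrite !(addmxE, oppmxE); ring.
  move=> h3; have := vn_dist (g y' - g y) (Ji *m (y' - y)) 0.
  have := vn_mul Ji (y' - y); move: h3; lra.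
have uJ x : vn (x - a) < r -> jacobian f x \in unitmx.
  by move=> hx; apply: small_kernel => v; exact: hJ.
(* The quadratic remainder of f at g y, combined with the Lipschitz bound of g, yields the
   derivative of g. *)
have g_isd y v i : W y -> isd (fun y => g y i 0) v y ((invmx (jacobian f (g y)) *m v) i 0).
  move=> Wy; have [hx fx] := hg y Wy; set x := g y in hx fx *.
  have Ux := hU x hx; set B := invmx (jacobian f x).
  have hb j : exists rj Kj : R, [/\ 0 < rj, 0 <= Kj &
     forall u, in_ball x rj (x + u) -> cn (f (x + u) j 0 - f x j 0 - (jacobian f x *m u) j 0) <= Kj * vn u ^+ 2].
    have [r' [K' [a1 a2 [_ [_ [_ [_ a3]]]]]]] := Ck2_bounds (conj oU Ux) ((hf j).1 2%N).
    exists r', K'; split=> // u hu; rewrite -(holo_rderive u j oU hf Ux); apply: a3 => //.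
    by rewrite /in_ball subrr vn0.
  have [rj /boolp.choice[Kj hrj]] := boolp.choice hb.
  have : \forall w \near x, forall j, in_ball x (rj j) w.
    by apply: near_forall => j; apply/nearvP; have [h1 _ _] := hrj j; exists (rj j).
  move=> /nearvP[r1 r10 hr1].
  pose K := \sum_j Kj j; have K0 : 0 <= K by apply: sumr_ge0 => j _; have [] := hrj j.
  have quad u : vn u < r1 -> vn (f (x + u) - f x - jacobian f x *m u) <= K * vn u ^+ 2.
    move=> hu; rewrite /vn /K mulr_suml -/(vn u); apply: ler_sum => j _.
    rewrite !(addmxE, oppmxE); have [_ _ h] := hrj j; apply: h.
    by apply: hr1; rewrite addrAC subrr add0r.
  have /nearvP[r2 r20 hr2] := open_near oW Wy.
  apply/cder0P => e e0; rewrite line0.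
  pose L := 2 * mn Ji * vn v; have L0 : 0 <= L by rewrite !mulr_ge0 ?mnr_ge0 ?vn_ge0.
  pose c := mn B * K * L ^+ 2 + 1; have c0 : 0 < c.
    by rewrite ltr_wpDl //; apply: mulr_ge0 (exprn_ge0 _ L0); exact: mulr_ge0 (mnr_ge0 _) K0.
  have v1 : 0 < vn v + 1 by rewrite ltr_wpDl ?vn_ge0.
  have L1 : 0 < L + 1 by rewrite ltr_wpDl.
  exists (Num.min (r2 / (vn v + 1)) (Num.min (r1 / (L + 1)) (e / c))).
    by rewrite !lt_min !divr_gt0.
  move=> t; rewrite !lt_min !ltr_pdivlMr // => /andP[t2 /andP[t1 te]].
  have Wt : W (y + toC t *: v).
    apply: hr2; rewrite addrAC subrr add0r vnZ cn_toC; apply: le_lt_trans t2.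
    by rewrite ler_wpM2l // lerDl.
  have [hxt fxt] := hg _ Wt; set u := g (y + toC t *: v) - x.
  have hu : vn u <= `|t| * L.
    have := g_lip _ _ Wy Wt; rewrite addrAC subrr add0r vnZ cn_toC -/x -/u /L => h.
    by apply: le_trans h _; rewrite le_eqVlt; apply/orP; left; apply/eqP; ring.
  have hu1 : vn u < r1.
    by apply: le_lt_trans hu _; apply: le_lt_trans t1; rewrite ler_wpM2l // lerDl.
  have xu : x + u = g (y + toC t *: v) by rewrite /u addrC subrK.
  have hq := quad u hu1; rewrite xu fxt fx [y + _]addrC addrK in hq.
  change (cn (g (y + toC t *: v) i 0 - x i 0 - toC t * (B *m v) i 0) <= e * `|t|).
  have -> : g (y + toC t *: v) i 0 - x i 0 - toC t * (B *m v) i 0 =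
     (- (B *m (toC t *: v - jacobian f x *m u))) i 0.
    rewrite mulmxBr mulmxA /B mulVmx ?uJ // mul1mx -scalemxAr /u.
    by rewrite !(addmxE, oppmxE, scalemxE); ring.
  rewrite oppmxE cnN; apply: le_trans (cn_vn _ _) _; apply: le_trans (vn_mul _ _) _.
  apply: (@le_trans _ _ (mn B * (K * (`|t| * L) ^+ 2))).
    rewrite ler_wpM2l ?mnr_ge0 //; apply: le_trans hq _; rewrite ler_wpM2l //.
    by rewrite ler_pXn2r ?nnegrE ?vn_ge0 //; apply: mulr_ge0.
  have -> : mn B * (K * (`|t| * L) ^+ 2) = (`|t| * (mn B * K * L ^+ 2)) * `|t| by ring.
  rewrite ler_wpM2r //; apply: le_trans (ltW te); rewrite ler_wpM2l // /c lerDl //.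
have g_cont y i : W y -> {for y, continuous (fun y => g y i 0)}.
  move=> Wy; apply/contP => e e0; apply/nearvP.
  have /nearvP[r2 r20 hr2] := open_near oW Wy.
  pose c := 2 * mn Ji + 1; have c0 : 0 < c by rewrite ltr_wpDl // mulr_ge0 ?mnr_ge0.
  exists (Num.min r2 (e / c)); first by rewrite lt_min r20 divr_gt0.
  move=> w; rewrite lt_min ltr_pdivlMr // => /andP[/hr2 Ww we].
  apply: le_lt_trans we; have := g_lip _ _ Wy Ww => h.
  have := cn_vn (g w - g y) i; rewrite addmxE oppmxE => h2.
  apply: le_trans h2 _; apply: le_trans h _; rewrite /c mulrDr mulr1 mulrC lerDl vn_ge0 //.
(* Bootstrapping: the derivative of g is the inverse Jacobian of f composed with g, hence as regular
   as g. *)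
have g_smooth i : smooth_on W (fun y => g y i 0).
  move=> k; elim: k i => [|k IH] i; first by split=> // y Wy; exact: g_cont.
  apply: CkS => // [y Wy|v]; first exact: g_cont.
  exists (fun y => \sum_j invmx (jacobian f (g y)) i j * v j 0); split.
    by move=> y Wy; have := g_isd y v i Wy; rewrite mxE.
  apply: Ck_sum => // j _; apply: Ck_mul => //; last exact: Ck_cst.
  apply: (@Ck_comp _ _ _ k W [set x | vn (x - a) < r] (fun x => invmx (jacobian f x) i j) g) => //.
    by move=> y Wy; have [h _] := hg y Wy.
  apply: Ck_invmx => // i' j'.
  apply: (@Ck_ext _ _ _ _ (dz j' (fun w => f w i' 0))) => //; first by move=> z _; rewrite mxE.
  have sf := (hf i').1.
  have h := Ck_sub (fun x h => hU x h) (Ck_rderive _ (sf k.+1)).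
  apply: Ck_mul => //; first exact: Ck_cst.
  apply: (Ck_add oB (h _)); apply: Ck_opp => //; apply: (Ck_mul oB _ (h _)); exact: Ck_cst.
have V0a : V0 a by split; [rewrite subrr vn0|exact: Wfa].
have V0U : V0 `<=` U by move=> x [hx _]; exact: hU hx.
have c1 x : V0 x -> W (f x) /\ g (f x) = x by move=> h; split; [exact: h.2|exact: hgf h].
have c2 y : W y -> V0 (g y) /\ f (g y) = y.
  move=> Wy; have [h1 h2] := hg y Wy; split; last exact: h2.
  by split; [exact: h1|rewrite h2].
have c3 x : V0 x -> jacobian f x \in unitmx by move=> [hx _]; exact: uJ hx.
have c4 : holomorphic_on W g.
  move=> i; split; first exact: g_smooth.
  move=> k y Wy; rewrite /dzbar !(isd_rderive (g_isd _ _ _ Wy)) -scalemxAr scalemxE.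
  by rewrite mulrA -expr2 sqrCi mulN1r subrr mulr0.
exists V0, W, g; exact: (And4 oV0 oW (conj V0a V0U) (And4 c1 c2 c3 c4)).
Qed.
End InverseFunction.

Theorem inverse_function (R : realType) (m : nat) (U : set 'cV[Cplx R]_m) (f : 'cV[Cplx R]_m -> 'cV[Cplx R]_m) a :
  open U -> U a -> holomorphic_on U f -> Pilot.Defs.jacobian f a \in unitmx ->
  exists (V0 W : set 'cV[Cplx R]_m) (g : 'cV[Cplx R]_m -> 'cV[Cplx R]_m), [/\ open V0, open W, V0 a /\ V0 `<=` U &
  [/\ (forall x, V0 x -> W (f x) /\ g (f x) = x), (forall y, W y -> V0 (g y) /\ f (g y) = y),
   (forall x, V0 x -> Pilot.Defs.jacobian f x \in unitmx) & holomorphic_on W g]].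
Proof. by move=> oU Ua hf uJ; exact: (inverse_function_aux oU Ua hf uJ erefl (fun=> erefl)). Qed.

(** * The Bochner tensor over the ring of germs *)

Section BochnerTensor.
Context {R : realType} {n : nat} {A : dring R n}.
Implicit Types (i j k l : 'I_n).
Local Notation del := (@del R n A).
Local Notation delb := (@delb R n A).
Variables (G Gi : 'M[A]_n).
(** This and the next three definitions are [riemann], [ricci], [scalar_curvature] and [bochner]
    over an abstract ring, where numerical denominators enter as scalars. *)
Definition Rm i j k l : A :=
  - del k (delb l (G i j)) + \sum_p \sum_q Gi q p * del k (G i q) * delb l (G p j).
Definition Ric k l : A := \sum_i \sum_j Gi j i * Rm i j k l.
Definition Sc : A := \sum_k \sum_l Gi l k * Ric k l.
Definition Bo i j k l : A := Rm i j k l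
  - (G i j * Ric k l + G k j * Ric i l + G i l * Ric k j + G k l * Ric i j) * cs n.+2%:R^-1
  + Sc * (G i j * G k l + G i l * G k j) * cs (n.+1%:R * n.+2%:R)^-1.
Definition Ricm : 'M[A]_n := \matrix_(k, l) Ric k l.
Hypothesis GGi : G *m Gi = 1%:M.
Hypothesis Gstar : star G = G.
Hypothesis Gsym : forall k i l, del k (G i l) = del i (G k l).
Lemma trace_mulE (a : nat) (M N : 'M[A]_a) : \tr (M *m N) = \sum_i \sum_j N j i * M i j.
Proof. by apply: eq_bigr => i _; rewrite mxE; apply: eq_bigr => j _; rewrite mulrC. Qed.
Lemma Rm_Om i j k l : Rm i j k l = (Om G Gi k l *m G) i j.
Proof.
rewrite /Om GamE Db_mul (Db_inv l GGi) mulmxN opprB mulmxBl !mulmxA.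
rewrite -(mulmxA _ Gi G) (GiG GGi) mulmx1 -(mulmxA _ Gi G) (GiG GGi) mulmx1.
rewrite addE oppE DbE DE -del_delb addrC /Rm; congr (_ + _).
rewrite exchange_big /= -mulmxA [RHS]mxE; apply: eq_bigr => q _; rewrite [X in _ = _ * X]mxE mulr_sumr.
by apply: eq_bigr => p _; rewrite DE DbE mulrA [Gi q p * _]mulrC.
Qed.
Lemma Ric_tr k l : Ric k l = \tr (Om G Gi k l).
Proof.
transitivity (\tr (Om G Gi k l *m G *m Gi)); last by rewrite -mulmxA GGi mulmx1.
by rewrite trace_mulE; apply: eq_bigr => i _; apply: eq_bigr => j _; rewrite Rm_Om.
Qed.
Lemma Sc_tr : Sc = \tr (Ricm *m Gi).
Proof. by rewrite trace_mulE; apply: eq_bigr => i _; apply: eq_bigr => j _; rewrite mxE. Qed.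
Lemma Ric_star : star Ricm = Ricm.
Proof.
apply/matrixP => k l; rewrite starE !mxE !Ric_tr.
have e a b : \tr (Om G Gi a b) = - delb b (\tr (Gam G Gi a)) by rewrite /Om raddfN /= Db_tr.
rewrite !e cjN -del_cj; congr (- _).
have -> : cj (\tr (Gam G Gi l)) = \tr (Gi *m Db l G).
  rewrite (DbG GGi Gstar) mulmxA (GiG GGi) mul1mx /mxtrace cj_sum.
  by apply: eq_bigr => i _; rewrite starE.
rewrite D_tr GamE Db_tr D_mul Db_mul (D_inv k GGi) (Db_inv l GGi) !raddfD /= mulNmx mulmxN !raddfN /=.
rewrite addrC; congr (_ - _); first by rewrite mxtrace_mulC D_Db.
by rewrite -!mulmxA mxtrace_mulC -!mulmxA.
Qed.
Lemma Sc_real : cj Sc = Sc.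
Proof.
have h : cj (\tr (Ricm *m Gi)) = \tr (star (Ricm *m Gi)).
  by rewrite /mxtrace cj_sum; apply: eq_bigr => i _; rewrite starE.
by rewrite Sc_tr h star_mul Ric_star (Gistar GGi Gstar) mxtrace_mulC.
Qed.
Lemma cs_inv (m : nat) : cs m.+1%:R^-1 * m.+1%:R = 1 :> A.
Proof. by rewrite -cs_nat -csM mulVf ?cs1 // pnatr_eq0. Qed.
Lemma cs_invM : cs (n.+1%:R * n.+2%:R)^-1 = cs n.+1%:R^-1 * cs n.+2%:R^-1 :> A.
Proof. by rewrite -csM invfM. Qed.

Section Flat.
Variable y : Cplx R.
Hypothesis flat : forall i j k l, Bo i j k l = 0.
(** A vanishing Bochner tensor gives the curvature the Bochner form with Q = Ric / (n+2) and q = -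
    Sc / (4 (n+1) (n+2)). The number y moves the constant multiple 2y of the metric out of Q, which
    adds y to q; it will be chosen to make q vanish at p. *)
Definition bQ : 'M[A]_n := cs n.+2%:R^-1 *: Ricm - (2 * cs y) *: G.
Definition bq : A := cs y - Sc * (cs 4%:R^-1 * cs n.+1%:R^-1 * cs n.+2%:R^-1).
Lemma four_inv : 4 * cs 4%:R^-1 = 1 :> A.
Proof. by rewrite mulrC (cs_inv 3). Qed.
Lemma flat_Om k l i m : Om G Gi k l i m = bochner_form G bQ (bQ *m Gi) bq k l i m.
Proof.
have hR j : (Om G Gi k l *m G) i j = bQ k l * G i j + bQ i l * G k j + G i l * bQ k j + G k l * bQ i j
    + 4 * bq * (G k l * G i j + G i l * G k j).
  rewrite -Rm_Om; have := flat i j k l; rewrite /Bo => /eqP; rewrite -addrA addr_eq0 opprD opprK => /eqP ->.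
  rewrite /bQ /bq !(addE, oppE, scaleE) ![Ricm _ _]mxE cs_invM.
  transitivity ((G i j * Ric k l + G k j * Ric i l + G i l * Ric k j + G k l * Ric i j) * cs n.+2%:R^-1 -
    (4 * cs 4%:R^-1) * (Sc * (G i j * G k l + G i l * G k j) * (cs n.+1%:R^-1 * cs n.+2%:R^-1))).
    by rewrite four_inv mul1r.
  ring.
have -> : Om G Gi k l i m = (Om G Gi k l *m G *m Gi) i m by rewrite -mulmxA GGi mulmx1.
rewrite mxE.
have dl a : \sum_j G a j * Gi j m = (a == m)%:R by have := congr1 (fun M : 'M[A]_n => M a m) GGi; rewrite !mxE.
transitivity (bQ k l * (\sum_j G i j * Gi j m) + bQ i l * (\sum_j G k j * Gi j m) + G i l * (bQ *m Gi) k m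
   + G k l * (bQ *m Gi) i m + 4 * bq * (G k l * (\sum_j G i j * Gi j m) + G i l * (\sum_j G k j * Gi j m))).
  rewrite ![(bQ *m Gi) _ _]mxE !mulr_sumr -!big_split /= mulr_sumr -!big_split /=.
  by apply: eq_bigr => j _; rewrite hR; ring.
by rewrite !dl /bochner_form [m == k]eq_sym.
Qed.
Lemma bQ_star : cs y = cj (cs y) :> A -> star bQ = bQ.
Proof.
move=> hy; rewrite /bQ star_add star_opp !star_scale Ric_star Gstar cjM cj_nat -hy cj_cs.
by rewrite fmorphV rmorph_nat.
Qed.
Lemma bq_real : cs y = cj (cs y) :> A -> cj bq = bq.
Proof. by move=> hy; rewrite /bq cjB !cjM !cj_cs Sc_real !fmorphV !rmorph_nat -cj_cs -hy. Qed.
Lemma bQ_tr : \tr (bQ *m Gi) + 4 * (n%:R + 1) * bq = cs (2 * n.+2%:R * y).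
Proof.
rewrite /bQ mulmxBl -!scalemxAl GGi raddfB /= !mxtraceZ mxtrace1 -Sc_tr /bq.
have h1 : cs n.+1%:R^-1 * (n%:R + 1) = 1 :> A by rewrite -(natrD _ n 1) addn1 cs_inv.
have -> : cs n.+2%:R^-1 * Sc - 2 * cs y * n%:R +
  4 * (n%:R + 1) * (cs y - Sc * (cs 4^-1 * cs n.+1%:R^-1 * cs n.+2%:R^-1)) =
  cs n.+2%:R^-1 * Sc - 2 * cs y * n%:R + 4 * (n%:R + 1) * cs y
   - (4 * cs 4^-1) * (cs n.+1%:R^-1 * (n%:R + 1)) * (cs n.+2%:R^-1 * Sc) by ring.
rewrite four_inv h1 !mul1r -addn2 !csM !cs_nat natrD; ring.
Qed.
End Flat.
(** The Ricci tensor and the scalar curvature are traces of the Bochner form; inserted into the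
    Bochner tensor, they cancel it after clearing n+1 and n+2. *)
Lemma Om_flat (Q : 'M[A]_n) (q : A) :
  (forall k l i m, Om G Gi k l i m = bochner_form G Q (Q *m Gi) q k l i m) ->
  forall i j k l, Bo i j k l = 0.
Proof.
move=> H i j k l.
set t := \tr (Q *m Gi) + 4 * (n%:R + 1) * q.
have hRic a b : Ric a b = (n%:R + 2) * Q a b + t * G a b by rewrite Ric_tr (trOm GGi erefl H).
have hSc : Sc = (n%:R + 2) * (t - 4 * (n%:R + 1) * q) + t * n%:R.
  rewrite Sc_tr; have -> : Ricm = (n%:R + 2) *: Q + t *: G.
    by apply/matrixP => a b; rewrite addE !scaleE mxE hRic.
  by rewrite mulmxDl -!scalemxAl GGi mxtraceD !mxtraceZ mxtrace1 /t addrK.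
have u1 : cs n.+1%:R^-1 * (n%:R + 1) = 1 :> A by rewrite -(natrD _ n 1) addn1 cs_inv.
have u2 : cs n.+2%:R^-1 * (n%:R + 2) = 1 :> A by rewrite -(natrD _ n 2) addn2 cs_inv.
have hRm : Rm i j k l = Q k l * G i j + Q i l * G k j + G i l * Q k j + G k l * Q i j
    + 4 * q * (G k l * G i j + G i l * G k j).
  by rewrite Rm_Om (OmMr H) !(SG GGi erefl).
rewrite /Bo hRm !hRic hSc cs_invM.
set c1 := cs n.+1%:R^-1 in u1 *; set c2 := cs n.+2%:R^-1 in u2 *; set N := n%:R in u1 u2 *.
move: (Q k l) (Q i l) (Q k j) (Q i j) (G k l) (G i j) (G i l) (G k j) => Qkl Qil Qkj Qij Gkl Gij Gil Gkj.
have -> : Qkl * Gij + Qil * Gkj + Gil * Qkj + Gkl * Qij + 4 * q * (Gkl * Gij + Gil * Gkj)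
  - (Gij * ((N + 2) * Qkl + t * Gkl) + Gkj * ((N + 2) * Qil + t * Gil) + Gil * ((N + 2) * Qkj + t * Gkj) +
   Gkl * ((N + 2) * Qij + t * Gij)) * c2
  + ((N + 2) * (t - 4 * (N + 1) * q) + t * N) * (Gij * Gkl + Gil * Gkj) * (c1 * c2) =
  Qkl * Gij + Qil * Gkj + Gil * Qkj + Gkl * Qij + 4 * q * (Gkl * Gij + Gil * Gkj)
  - (c2 * (N + 2)) * (Gij * Qkl + Gkj * Qil + Gil * Qkj + Gkl * Qij)
  - 2 * t * c2 * (Gij * Gkl + Gil * Gkj)
  + (2 * t * c2 * (c1 * (N + 1)) - 4 * q * (c2 * (N + 2)) * (c1 * (N + 1))) * (Gij * Gkl + Gil * Gkj) by ring.
by rewrite u1 u2; ring.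
Qed.
End BochnerTensor.

(** * Functions representing germs *)

Section Represent.
Context {R : realType} {n : nat} {p : 'cV[Cplx R]_n}.
Local Notation C := (Cplx R).
Local Notation V := 'cV[C]_n.
Implicit Types (f g : V -> C) (x y : germ p) (i j k l : 'I_n).
Definition rep f x := neq p x f.
Lemma rep_gm f : smn p f -> rep f (gm p f). Proof. exact: gm_near. Qed.
Lemma rep_smn f x : rep f x -> smn p f.
Proof. by move=> h; apply: smn_neq h (germ_sm x). Qed.
Lemma rep_eq f x y : rep f x -> rep f y -> x = y.
Proof. by move=> h1 h2; apply: germP; apply: neq_trans h1 _; exact: neq_sym. Qed.
Lemma rep_ext f g x : neq p f g -> rep f x -> rep g x.
Proof. by move=> h1 h2; apply: neq_trans h2 h1. Qed.
Lemma rep_eqf f g x : (forall z, f z = g z) -> rep f x -> rep g x.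
Proof. by move=> h; apply: rep_ext; apply/nearvP; exists 1. Qed.
Lemma rep0 f : (\forall z \near p, f z = 0) -> rep f 0.
Proof. by move=> h; rewrite -(rmorph0 (gcst p)); apply: neq_trans (gcstE 0) _; apply: nearS h => z ->. Qed.
Lemma rep_p f x : rep f x -> gev x = f p. Proof. exact: neq_p. Qed.
Lemma rep_cst (c : C) : rep (fun=> c) (gcst p c). Proof. exact: gcstE. Qed.
Lemma rep_add f g x y : rep f x -> rep g y -> rep (fun z => f z + g z) (x + y).
Proof. by move=> h1 h2; apply: nearS (nearI (gaddE x y) (nearI h1 h2)) => z [-> [-> ->]]. Qed.
Lemma rep_opp f x : rep f x -> rep (fun z => - f z) (- x).
Proof. by move=> h; apply: nearS (nearI (goppE x) h) => z [-> ->]. Qed.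
Lemma rep_mul f g x y : rep f x -> rep g y -> rep (fun z => f z * g z) (x * y).
Proof. by move=> h1 h2; apply: nearS (nearI (gmulE x y) (nearI h1 h2)) => z [-> [-> ->]]. Qed.
Lemma rep_conj f x : rep f x -> rep (fun z => Num.conj (f z)) (gconj x).
Proof. by move=> h; apply: nearS (nearI (gconjE x) h) => z [-> ->]. Qed.
Lemma rep_dz k f x : rep f x -> rep (dz k f) (gdel k x).
Proof. by move=> h; apply: neq_trans (gdelE k x) _; apply: neq_dz h; exact: germ_sm. Qed.
Lemma rep_dzbar k f x : rep f x -> rep (dzbar k f) (gdelb k x).
Proof. by move=> h; apply: neq_trans (gdelbE k x) _; apply: neq_dzbar h; exact: germ_sm. Qed.
Lemma rep_sum (I : finType) (f : I -> V -> C) (x : I -> germ p) :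
  (forall i : I, rep (f i) (x i)) -> rep (fun z => \sum_i f i z) (\sum_i x i).
Proof.
move=> h; apply: neq_trans (gsumE x) _; apply: nearS (near_forall h) => z hz.
by apply: eq_bigr => i _; exact: hz.
Qed.
Variables (g : V -> 'M[C]_n) (G Gi : 'M[germ p]_n).
Hypothesis gG : forall i j, rep (fun z => g z i j) (G i j).
Hypothesis GGi : G *m Gi = 1%:M.
Lemma rep_inv i j : rep (fun z => invmx (g z) i j) (Gi i j).
Proof.
have h : \forall z \near p, forall ij : 'I_n * 'I_n, (g z *m (\matrix_(a, b) Gi a b z)) ij.1 ij.2 = (ij.1 == ij.2)%:R.
  apply: near_forall => -[a b] /=.
  have e : rep (fun z => \sum_c g z a c * Gi c b z) ((G *m Gi) a b).
    by rewrite mxE; apply: rep_sum => c; apply: rep_mul => //; exact: neq_refl.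
  rewrite GGi mxE in e; have e2 : rep (fun=> (a == b)%:R : C) ((a == b)%:R).
    by rewrite -(rmorph_nat (gcst p)); exact: rep_cst.
  apply: nearS (nearI (neq_sym e) e2) => z [h1 h2]; rewrite mxE -h2 -h1.
  by apply: eq_bigr => c _; rewrite mxE.
apply: nearS h => z hz; have e : g z *m (\matrix_(a, b) Gi a b z) = 1%:M.
  by apply/matrixP => a b; rewrite (hz (a, b)) mxE.
have [_ u] := mulmx1_unit e.
have := congr1 (fun M => invmx (g z) *m M) e; rewrite mulmxA mulVmx ?mul1mx ?mulmx1.
  by move=> <-; rewrite mxE.
by case: (mulmx1_unit e).
Qed.
Lemma rep_bochner i j k l : rep (fun z => bochner g z i j k l) (@Bo R n (germ_dring p) G Gi i j k l).
Proof.
have dbE b x : @delb R n (germ_dring p) b x = gdelb b x by rewrite /delb /cj /del /= -gdelb_conj.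
have hR a b c d : rep (fun z => riemann g z a b c d) (@Rm R n (germ_dring p) G Gi a b c d).
  apply: rep_add; first by apply: rep_opp; rewrite dbE; apply/rep_dz/rep_dzbar/gG.
  apply: rep_sum => q; apply: rep_sum => r; apply: rep_mul; last by rewrite dbE; apply/rep_dzbar/gG.
  apply: rep_mul; [exact: rep_inv | exact/rep_dz/gG].
have hRic a b : rep (fun z => ricci g z a b) (@Ric R n (germ_dring p) G Gi a b).
  by apply: rep_sum => q; apply: rep_sum => r; apply: rep_mul; [exact: rep_inv|exact: hR].
have hS : rep (fun z => scalar_curvature g z) (@Sc R n (germ_dring p) G Gi).
  by apply: rep_sum => q; apply: rep_sum => r; apply: rep_mul; [exact: rep_inv|exact: hRic].
apply: rep_add; [apply: rep_add; first exact: hR|].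
  apply: rep_opp; apply: rep_mul; last exact: rep_cst.
  by apply: rep_add; [apply: rep_add; [apply: rep_add|]|]; apply: rep_mul.
apply: rep_mul; last exact: rep_cst.
by apply: rep_mul => //; apply: rep_add; apply: rep_mul.
Qed.
End Represent.

(** * Normal form of a Hermitian matrix and a vector *)

Definition posdef (R : realType) (n : nat) (G : 'M[Cplx R]_n) : Prop :=
  forall v : 'cV[Cplx R]_n, v != 0 -> 0 < (v^T *m G *m map_mx Num.conj v) 0 0.

Section ConjTranspose.
Context {R : realType}.
Local Notation C := (Cplx R).
Lemma conjTM (a b c : nat) (M : 'M[C]_(a, b)) (N : 'M[C]_(b, c)) : conjT (M *m N) = conjT N *m conjT M.
Proof. by rewrite /conjT trmx_mul map_mxM. Qed.
Lemma conjTK (a b : nat) (M : 'M[C]_(a, b)) : conjT (conjT M) = M.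
Proof. by apply/matrixP => i j; rewrite !conjTE Num.Theory.conjCK. Qed.
Lemma conjTD (a b : nat) (M N : 'M[C]_(a, b)) : conjT (M + N) = conjT M + conjT N.
Proof. by rewrite /conjT !raddfD. Qed.
Lemma conjTN (a b : nat) (M : 'M[C]_(a, b)) : conjT (- M) = - conjT M.
Proof. by rewrite /conjT !raddfN. Qed.
Lemma conjTZ (a b : nat) (c : C) (M : 'M[C]_(a, b)) : conjT (c *: M) = Num.conj c *: conjT M.
Proof. by apply/matrixP => i j; rewrite conjTE !mxE rmorphM. Qed.
Lemma conjT1 (a : nat) : conjT (1%:M : 'M[C]_a) = 1%:M.
Proof. by rewrite /conjT trmx1 map_mx1. Qed.
Lemma conjT0 (a b : nat) : conjT (0 : 'M[C]_(a, b)) = 0.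
Proof. by rewrite /conjT trmx0 map_mx0. Qed.
Lemma real_toC (c : C) : Num.conj c = c -> c = toC (rp c).
Proof.
move=> h; apply: cplxP => //; rewrite ip_toC.
have := congr1 ip h; rewrite ip_conj; lra.
Qed.
Lemma conj_toCV (r : R) : Num.conj ((toC r)^-1) = (toC r)^-1.
Proof. by rewrite -[(toC r)^-1](fmorphV (@toC R)) conj_toC. Qed.
Lemma mx1E (M : 'M[C]_1) : M = (M 0 0)%:M.
Proof. by apply/matrixP => i j; rewrite !ord1 mxE eqxx. Qed.
Lemma conjT_delta (m : nat) (i : 'I_m) (v : 'cV[C]_m) : conjT (delta_mx i 0) *m v = (v i 0)%:M.
Proof.
rewrite [LHS]mx1E mxE (bigD1 i) //= big1 => [|k /negPf hk]; last by rewrite conjTE !mxE hk conjC0 mul0r.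
by rewrite addr0 conjTE !mxE !eqxx rmorph1 mul1r.
Qed.
Lemma normsqE (m : nat) (w : 'cV[C]_m) : (conjT w *m w) 0 0 = toC (\sum_i cn (w i 0) ^+ 2).
Proof.
rewrite mxE toC_sum; apply: eq_bigr => i _; rewrite conjTE mulrC -normCK normE.
by rewrite expr2 -toCM.
Qed.
Lemma normsq_gt0 (m : nat) (w : 'cV[C]_m) : w != 0 -> 0 < \sum_i cn (w i 0) ^+ 2.
Proof.
move=> w0; rewrite lt_neqAle sumr_ge0 ?andbT => [|i _]; last exact: exprn_ge0 (cn_ge0 _).
apply: contra_neq w0 => /esym /psumr_eq0P h.
apply/matrixP => i j; rewrite ord1 mxE; apply/eqP; rewrite -cn_eq0 -sqrf_eq0; apply/eqP.
by apply: h => // k _; exact: exprn_ge0 (cn_ge0 _).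
Qed.
Definition rdiag (m : nat) (x : 'I_m -> R) : 'M[C]_m := diag_mx (\row_i toC (x i)).
Definition rcol (m : nat) (a : 'I_m -> R) : 'cV[C]_m := \col_i toC (a i).
Lemma rdiag_mul (m k : nat) (x : 'I_m -> R) (N : 'M[C]_(m, k)) i j : (rdiag x *m N) i j = toC (x i) * N i j.
Proof. by rewrite mul_diag_mx !mxE. Qed.
Lemma mul_rdiag (m k : nat) (x : 'I_m -> R) (N : 'M[C]_(k, m)) i j : (N *m rdiag x) i j = N i j * toC (x j).
Proof. by rewrite mul_mx_diag !mxE. Qed.
Lemma hermitian_diag (m : nat) (B : 'M[C]_m) : conjT B = B ->
  exists (P : 'M[C]_m) (d : 'I_m -> R), [/\ P *m conjT P = 1%:M, conjT P *m P = 1%:M & P *m B = rdiag d *m P].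
Proof.
move=> hB; have hs : B \is hermsymmx.
  by apply/is_hermitianmxP; rewrite expr0 scale1r -[LHS]hB.
have /orthomx_spectralP e := hermitian_normalmx hs.
have hr := hermitian_spectral_diag_real hs.
set P := spectralmx B in e; have uP : P \is unitarymx := spectral_unitarymx B.
have e1 : P *m conjT P = 1%:M by apply/eqP; move: uP; rewrite qualifE.
have iP : invmx P = conjT P := invmx_unitary uP.
move: hr e; rewrite iP; set sd := spectral_diag B => hr e.
exists P, (fun i => rp (sd 0 i)); split=> //; first exact: mulmx1C.
rewrite e !mulmxA e1 mul1mx; congr (_ *m _); congr diag_mx; apply/matrixP => i j; rewrite ord1 mxE.
by apply: real_toC; have /mxOverP /(_ 0 j) /CrealP := hr.
Qed.
(** A Householder reflection. If the first entry of e is r om with |om| = 1, the reflection H along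
    e + om d, with d the first basis vector, sends e to - om d, so - om H is unitary and sends d to
    e. The phase om makes the squared length 2 (1 + r) of the axis nonzero. *)
Lemma unitary_first (m : nat) (e : 'cV[C]_m.+1) : conjT e *m e = 1%:M ->
  exists U : 'M[C]_m.+1, [/\ U *m conjT U = 1%:M, conjT U *m U = 1%:M & U *m delta_mx 0 0 = e].
Proof.
move=> he; pose c : C := e 0 0.
have [r [om [r0 c_om om1]]] : exists (r : R) (om : C), [/\ 0 <= r, c = toC r * om & om * Num.conj om = 1].
  move: c => c; have [->|c0] := eqVneq c 0; first by exists 0, 1; rewrite toC0 mul0r rmorph1 mulr1.
  have rn : toC (cn c) != 0 by rewrite -toC0 (inj_eq (@toC_inj R)) cn_eq0.
  exists (cn c), (c / toC (cn c)); split; first exact: cn_ge0.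
    by rewrite mulrCA divff ?mulr1.
  have -> : Num.conj (c / toC (cn c)) = Num.conj c / toC (cn c).
    by rewrite rmorphM; congr (_ * _); exact: conj_toCV.
  rewrite mulrACA -normCK normE -invfM -expr2 divff //.
  by rewrite sqrf_eq0.
pose d : 'cV[C]_m.+1 := delta_mx 0 0; pose v := e + om *: d.
have hd : conjT d *m d = 1%:M by rewrite conjT_delta mxE !eqxx.
have de : conjT d *m e = c%:M by exact: conjT_delta.
have ed : conjT e *m d = (Num.conj c)%:M.
  by rewrite -[LHS]conjTK conjTM conjTK de [LHS]mx1E conjTE !mxE eqxx.
have s1 : 1 + toC r != 0 by apply: lt0r_neq0; rewrite -toC1 -toCD -toC0 ltr_toC; apply: ltr_pwDl.
pose s : C := (1 + toC r)^-1.
have cc : Num.conj c = toC r * Num.conj om by rewrite c_om rmorphM; congr (_ * _); exact: conj_toC.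
have rom : om * Num.conj c = toC r by rewrite cc mulrCA om1 mulr1.
have rom' : Num.conj om * c = toC r by rewrite c_om mulrCA [_ * om]mulrC om1 mulr1.
have vv : conjT v *m v = (2 * (1 + toC r))%:M.
  rewrite /v conjTD conjTZ mulmxDl !mulmxDr -!scalemxAl -!scalemxAr he hd de ed scalerA [_ * om]mulrC om1.
  by rewrite [LHS]mx1E !mxE eqxx /= rom rom'; congr _%:M; ring.
have ve : conjT v *m e = (1 + toC r)%:M.
  by rewrite /v conjTD conjTZ mulmxDl -!scalemxAl he de [LHS]mx1E !mxE eqxx /= rom'.
pose H := 1%:M - s *: (v *m conjT v).
have sr : Num.conj s = s.
  have -> : s = (toC (1 + r))^-1 by rewrite /s toCD toC1.
  exact: conj_toCV.
have Hs : conjT H = H by rewrite /H conjTD conjTN conjTZ conjTM conjTK conjT1 sr.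
have HH : H *m H = 1%:M.
  rewrite {1}/H mulmxBl mul1mx /H mulmxBr mulmx1 -!scalemxAl -scalemxAr.
  rewrite mulmxA -[v *m _ *m v]mulmxA vv mul_mx_scalar -scalemxAl !scalerA.
  have -> : s * (s * (2 * (1 + toC r))) = s + s.
    by rewrite [2 * _]mulrC mulrA mulrA -(mulrA s) mulVf // mulr1 mulr_natr mulr2n.
  rewrite scalerDl; set Y := s *: _.
  have -> : Y - (Y + Y) = - Y by rewrite opprD addrA subrr add0r.
  by rewrite opprK subrK.
have He : H *m e = - om *: d.
  rewrite /H mulmxBl mul1mx -scalemxAl -mulmxA ve mul_mx_scalar scalerA mulVf // scale1r.
  by rewrite /v opprD addrA subrr add0r scaleNr.
have om1' : Num.conj (- om) * - om = 1 by rewrite rmorphN mulrNN mulrC.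
have eqU : (- om *: H) *m conjT (- om *: H) = 1%:M.
  by rewrite conjTZ Hs -scalemxAl -scalemxAr scalerA HH mulrC om1' scale1r.
exists (- om *: H); split=> //; first exact: mulmx1C.
rewrite -scalemxAl scalemxAr -He mulmxA HH mul1mx //.
Qed.
(** In the eigenspace of the largest eigenvalue lam, e is the normalized projection of b, or any
    unit vector if that projection is zero. All eigenvectors for lam orthogonal to e are then
    orthogonal to b, and the component of b along e is nonnegative. *)
Lemma top_eigen (m : nat) (B : 'M[C]_m.+1) (b : 'cV[C]_m.+1) : conjT B = B ->
  exists (lam be : R) (e : 'cV[C]_m.+1), [/\ conjT e *m e = 1%:M, B *m e = toC lam *: e, 0 <= be,
    conjT e *m b = (toC be)%:M &
    forall (w : 'cV[C]_m.+1) (t : R), conjT w *m w = 1%:M -> B *m w = toC t *: w -> conjT e *m w = 0 ->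
      t <= lam /\ (t = lam -> conjT w *m b = 0)].
Proof.
move=> hB; have [P [d [PP PP' hP]]] := hermitian_diag hB.
have [i0 hi0] : exists i0, forall i, d i <= d i0.
  by case: (@Order.TotalTheory.arg_maxP _ _ _ ord0 xpredT d isT) => i _ h; exists i => j; exact: h.
(* In the coordinates given by P, [sel] is the projection onto the eigenspace of [lam]. *)
pose lam := d i0; pose sel := rdiag (fun i => (d i == lam)%:R).
have eB : B = conjT P *m rdiag d *m P by rewrite -mulmxA -hP mulmxA PP' mul1mx.
have PB (v : 'cV[C]_m.+1) : B *m (conjT P *m v) = conjT P *m (rdiag d *m v).
  by rewrite eB -!mulmxA (mulmxA P) PP mul1mx.
have selE (v : 'cV[C]_m.+1) i : (sel *m v) i 0 = (d i == lam)%:R * v i 0.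
  by rewrite rdiag_mul; case: (d i == lam); rewrite ?toC1 ?toC0.
pose y := sel *m (P *m b).
have hy : conjT y *m (P *m b) = conjT y *m y.
  apply/matrixP => i j; rewrite !ord1 !mxE; apply: eq_bigr => k _; rewrite conjTE /y selE.
  by case: (d k == lam); rewrite ?mul0r ?conjC0 ?mul0r ?mul1r.
have hw (w : 'cV[C]_m.+1) (t : R) : conjT w *m w = 1%:M -> B *m w = toC t *: w ->
    t <= lam /\ (t = lam -> conjT w *m b = conjT (P *m w) *m y).
  move=> w1 Bw; have hPw i : d i = t \/ (P *m w) i 0 = 0.
    have := congr1 (fun M : 'cV[C]_m.+1 => M i 0) (congr1 (mulmx P) Bw).
    rewrite /= mulmxA hP -mulmxA rdiag_mul -scalemxAr [RHS]mxE => /eqP.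
    by rewrite -subr_eq0 -mulrBl mulf_eq0 -toCB => /orP[|/eqP]; [rewrite -toC0 (inj_eq (@toC_inj R)) subr_eq0 => /eqP; left|right].
  have Pw0 : P *m w != 0.
    apply/eqP => h; have := w1; rewrite -[w]mul1mx -PP' -mulmxA h mulmx0 conjT0 mul0mx => /matrixP /(_ 0 0).
    by rewrite !mxE eqxx => /esym/eqP; rewrite oner_eq0.
  split.
    have [i hi] : exists i, (P *m w) i 0 != 0.
      apply/existsP; apply: contraNT Pw0 => /existsPn h; apply/eqP/matrixP => i j; rewrite ord1 [RHS]mxE.
      by have := h i; rewrite negbK => /eqP.
    by case: (hPw i) => [<-|h]; [exact: hi0|rewrite h eqxx in hi].
  move=> tl; have -> : conjT w *m b = conjT (P *m w) *m (P *m b) by rewrite conjTM -mulmxA (mulmxA _ P) PP' mul1mx.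
  apply/matrixP => i j; rewrite !ord1 !mxE; apply: eq_bigr => k _; rewrite conjTE /y selE.
  case: (hPw k) => [->|->]; last by rewrite conjC0 !mul0r.
  by rewrite tl eqxx mul1r.
have selD (v : 'cV[C]_m.+1) : rdiag d *m (sel *m v) = toC lam *: (sel *m v).
  apply/matrixP => i j; rewrite ord1 rdiag_mul [RHS]mxE selE.
  by case: eqP => [->|]; rewrite ?mul0r ?mulr0.
have [y0|y0] := eqVneq y 0.
  pose dl : 'cV[C]_m.+1 := delta_mx i0 0.
  have sdl : sel *m dl = dl.
    apply/matrixP => i j; rewrite ord1 selE !mxE; case: (eqVneq i i0) => [->|]; rewrite ?eqxx ?mulr0 ?mul1r //.
  exists lam, 0, (conjT P *m dl); split=> //.
  - by rewrite conjTM conjTK mulmxA -(mulmxA _ P) PP mulmx1 conjT_delta !mxE !eqxx.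
  - have -> : B *m (conjT P *m dl) = conjT P *m (toC lam *: dl) by rewrite PB -{1}sdl selD sdl.
    by rewrite -scalemxAr.
  - rewrite conjTM conjTK -mulmxA conjT_delta toC0; congr _%:M.
    by have := selE (P *m b) i0; rewrite eqxx mul1r => <-; rewrite -/y y0 mxE.
  - by move=> w t h1 h2 _; have [h3 h4] := hw w t h1 h2; split=> // /h4 ->; rewrite y0 mulmx0.
have N0 := normsq_gt0 y0; set N := \sum_i _ in N0; pose be : R := Num.sqrt N.
have be0 : 0 < be by rewrite sqrtr_gt0.
have bn : toC be != 0 by rewrite -toC0 (inj_eq (@toC_inj R)) gt_eqF.
have yy : conjT y *m y = (toC be * toC be)%:M.
  by rewrite [LHS]mx1E normsqE -toCM -expr2 sqr_sqrtr // ltW.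
have ei (v : 'cV[C]_m.+1) : conjT ((toC be)^-1 *: (conjT P *m y)) *m v = (toC be)^-1 *: (conjT y *m (P *m v)).
  by rewrite conjTZ conj_toCV conjTM conjTK -scalemxAl mulmxA.
exists lam, be, ((toC be)^-1 *: (conjT P *m y)); split; last 1 first.
- move=> w t h1 h2; rewrite ei => h3; have [h4 h5] := hw w t h1 h2; split=> // /h5 ->.
  have h6 : conjT y *m (P *m w) = 0.
    by move/eqP: h3; rewrite scaler_eq0 invr_eq0 (negPf bn) => /eqP.
  by rewrite -[LHS]conjTK conjTM conjTK h6 conjT0.
- by rewrite ei -!scalemxAr (mulmxA P) PP mul1mx yy !scale_scalar_mx mulKf // mulVf.
- by rewrite -scalemxAr PB selD -scalemxAr !scalerA mulrC.
- exact: ltW.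
- by rewrite ei hy yy scale_scalar_mx mulrA mulVf // mul1r.
Qed.
Definition normalized (m : nat) (x a : 'I_m -> R) : Prop :=
  [/\ forall j k : 'I_m, k = j.+1 :> nat -> x k <= x j, forall j, 0 <= a j &
      forall j k : 'I_m, k = j.+1 :> nat -> x j = x k -> a k = 0].
(** Induction on the size: the vector of [top_eigen] is split off and the induction hypothesis is
    applied to the orthogonal complement. The last clause of [top_eigen] gives the ordering and the
    vanishing of later entries in the same eigenspace. *)
Lemma unitary_normal (m : nat) (B : 'M[C]_m) (b : 'cV[C]_m) : conjT B = B ->
  exists (U : 'M[C]_m) (x a : 'I_m -> R), [/\ U *m conjT U = 1%:M, conjT U *m U = 1%:M,
    B *m U = U *m rdiag x, conjT U *m b = rcol a & normalized x a].
Proof.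
elim: m B b => [B b hB|m IH].
  exists 1%:M, (fun=> 0), (fun=> 0); split; [by rewrite conjT1 mul1mx|by rewrite conjT1 mul1mx| | |].
  - by apply/matrixP => -[].
  - by apply/matrixP => -[].
  - by split; case.
change (forall (B : 'M[C]_(1 + m)) (b : 'cV[C]_(1 + m)), conjT B = B ->
  exists (U : 'M[C]_(1 + m)) (x a : 'I_(1 + m) -> R), [/\ U *m conjT U = 1%:M, conjT U *m U = 1%:M,
    B *m U = U *m rdiag x, conjT U *m b = rcol a & normalized x a]) => B b hB.
have [lam [be [e [ee Be be0 eb top]]]] : exists (lam be : R) (e : 'cV[C]_(1 + m)),
    [/\ conjT e *m e = 1%:M, B *m e = toC lam *: e, 0 <= be, conjT e *m b = (toC be)%:M &
    forall (w : 'cV[C]_(1 + m)) (t : R), conjT w *m w = 1%:M -> B *m w = toC t *: w -> conjT e *m w = 0 ->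
      t <= lam /\ (t = lam -> conjT w *m b = 0)] := top_eigen b hB.
have [U1 [U1a U1b U1e]] : exists U1 : 'M[C]_(1 + m), [/\ U1 *m conjT U1 = 1%:M, conjT U1 *m U1 = 1%:M &
    U1 *m delta_mx ord0 0 = e] := unitary_first ee.
pose B1 : 'M[C]_(1 + m) := conjT U1 *m B *m U1.
have hB1 : conjT B1 = B1 by rewrite /B1 !conjTM conjTK hB mulmxA.
have e0 : (delta_mx ord0 0 : 'cV[C]_(1 + m)) = col_mx 1%:M 0.
  apply/matrixP => i j; rewrite ord1 !mxE; case: (splitP i) => k.
    rewrite [k]ord1 => ik; have -> : i = ord0 by apply: val_inj; exact: ik.
    by rewrite !mxE !eqxx.
  by move=> hk; rewrite !mxE; case: eqP => // ik; rewrite ik in hk.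
have B1e : B1 *m col_mx 1%:M 0 = toC lam *: (col_mx 1%:M 0 : 'cV[C]_(1 + m)).
  by rewrite -e0 /B1 -!mulmxA U1e Be -scalemxAr -U1e mulmxA U1b mul1mx.
pose B' : 'M[C]_m := drsubmx B1.
have B1E : B1 = block_mx (toC lam)%:M 0 0 B'.
  have := B1e; rewrite -[B1]submxK mul_block_col !mulmx1 !mulmx0 !addr0 scale_col_mx scaler0.
  move=> /eq_col_mx[h1 h2]; have h3 : ursubmx B1 = 0.
    apply: (can_inj (@conjTK _ _)); rewrite conjT0 -h2 -[in RHS]hB1.
    by apply/matrixP => i j; rewrite !mxE.
  by rewrite h1 h2 h3 scale_scalar_mx mulr1.
have hB' : conjT B' = B' by rewrite /B' -{2}hB1; apply/matrixP => i j; rewrite !mxE.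
pose b1 : 'cV[C]_(1 + m) := conjT U1 *m b.
have [U' [x' [a' [Ua Ub UB Ub' [n1 n2 n3]]]]] := IH B' (dsubmx b1) hB'.
pose U2 : 'M[C]_(1 + m) := block_mx 1%:M 0 0 U'.
have cU2 : conjT U2 = block_mx 1%:M 0 0 (conjT U').
  by rewrite /conjT tr_block_mx map_block_mx trmx1 !trmx0 !map_mx0 map_mx1.
pose x (i : 'I_(1 + m)) := match fintype.split i with inl _ => lam | inr k => x' k end.
pose a (i : 'I_(1 + m)) := match fintype.split i with inl _ => be | inr k => a' k end.
have xl k : x (lshift m k) = lam by rewrite /x (unsplitK (inl k)).
have xr k : x (rshift 1 k) = x' k by rewrite /x (unsplitK (inr k)).
have al k : a (lshift m k) = be by rewrite /a (unsplitK (inl k)).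
have ar k : a (rshift 1 k) = a' k by rewrite /a (unsplitK (inr k)).
have rx : rdiag x = block_mx (toC lam)%:M 0 0 (rdiag x').
  rewrite /rdiag -[\row_i _]hsubmxK diag_mx_row; congr block_mx.
    by apply/matrixP => i j; rewrite !ord1 !mxE /= xl.
  by congr diag_mx; apply/matrixP => i j; rewrite !mxE xr.
pose U := U1 *m U2.
have UU : U *m conjT U = 1%:M.
  rewrite /U conjTM mulmxA -(mulmxA U1) cU2 /U2 mulmx_block !mulmx0 !mul0mx !mulmx1 !addr0 !add0r Ua.
  by rewrite -scalar_mx_block mulmx1.
have UU' : conjT U *m U = 1%:M by exact: mulmx1C.
have BU : B *m U = U *m rdiag x.
  rewrite /U mulmxA; have -> : B *m U1 = U1 *m B1 by rewrite /B1 !mulmxA U1a mul1mx.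
  rewrite -(mulmxA U1 B1 U2) -(mulmxA U1 U2) B1E rx /U2 !mulmx_block !mulmx0 !mul0mx !mulmx1 !mul1mx !addr0 !add0r.
  by rewrite UB.
have e_first : col ord0 U = e.
  have h : U2 *m delta_mx ord0 0 = delta_mx ord0 0 :> 'cV[C]_(1 + m).
    by rewrite e0 /U2 mul_block_col !mulmx1 !mulmx0 !addr0.
  by rewrite colE /U -(mulmxA U1) h.
have Ub1 : conjT U *m b = rcol a.
  rewrite /U conjTM -mulmxA -/b1 cU2 -[b1]vsubmxK mul_block_col !mul0mx mul1mx addr0 add0r Ub'.
  have -> : usubmx b1 = (toC be)%:M.
    rewrite -eb -U1e conjTM -mulmxA -/b1 e0; have -> : conjT (col_mx 1%:M (0 : 'cV[C]_m)) = row_mx 1%:M 0.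
      by rewrite /conjT tr_col_mx map_row_mx trmx1 trmx0 map_mx1 map_mx0.
    by rewrite -{2}[b1]vsubmxK mul_row_col mul1mx mul0mx addr0.
  apply/matrixP => i j; rewrite ord1 [RHS]mxE; case: (split_ordP i) => k ->.
    by rewrite col_mxEu al ord1 mxE eqxx.
  by rewrite col_mxEd ar mxE.
have cond (k : 'I_m) : x' k <= lam /\ (x' k = lam -> a' k = 0).
  pose w := col (rshift 1 k) U.
  have wE : w = U *m delta_mx (rshift 1 k) 0 by rewrite /w colE.
  have h1 : conjT w *m w = 1%:M.
    by rewrite wE conjTM mulmxA -(mulmxA _ (conjT U)) UU' mulmx1 conjT_delta mxE !eqxx.
  have h2 : B *m w = toC (x' k) *: w.
    rewrite wE mulmxA BU -mulmxA; have -> : rdiag x *m delta_mx (rshift 1 k) 0 = toC (x' k) *: (delta_mx (rshift 1 k) 0 : 'cV[C]_(1 + m)).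
      apply/matrixP => i j; rewrite rdiag_mul !mxE; case: (eqVneq i (rshift 1 k)) => [->|_]; first by rewrite xr.
      by rewrite !mulr0.
    by rewrite -scalemxAr.
  have h3 : conjT e *m w = 0.
    have := congr1 (fun M : 'M[C]_(1 + m) => M ord0 (rshift 1 k)) UU'; rewrite /= [RHS]mxE /= => h.
    apply/matrixP => i j; rewrite !ord1 [RHS]mxE -[RHS]h [LHS]mxE [RHS]mxE; apply: eq_bigr => i' _.
    by rewrite -e_first !conjTE /w ![col _ _ _ _]mxE.
  have [h4 h5] := top w (x' k) h1 h2 h3; split=> // /h5 h6.
  have : (conjT U *m b) (rshift 1 k) 0 = (conjT w *m b) 0 0.
    by rewrite !mxE; apply: eq_bigr => i _; rewrite !conjTE /w [col _ _ _ _]mxE.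
  by rewrite h6 Ub1 !mxE ar -toC0 => /toC_inj.
exists U, x, a; split=> //; split.
- move=> j k; case: (split_ordP k) => k' ->; first by rewrite [k']ord1.
  case: (split_ordP j) => j' ->.
    by rewrite xl xr; case: (cond k').
  by rewrite !xr /= !add1n => -[] /n1.
- move=> j; case: (split_ordP j) => j' ->.
    by rewrite al.
  by rewrite ar.
- move=> j k; case: (split_ordP k) => k' ->; first by rewrite [k']ord1.
  case: (split_ordP j) => j' ->.
    by rewrite xl xr ar => _ /esym; case: (cond k').
  by rewrite !xr ar /= !add1n => -[] /n3.
Qed.
Lemma sorted_mono (m : nat) (x : 'I_m -> R) : (forall j k : 'I_m, k = j.+1 :> nat -> x k <= x j) ->
  forall j k : 'I_m, (j <= k)%N -> x k <= x j.
Proof.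
move=> h j k; case: k => k hk /=; elim: k hk => [|k IH] hk.
  by rewrite leqn0 => /eqP j0; have -> : j = Ordinal hk by exact: val_inj.
rewrite leq_eqVlt => /orP[/eqP jk|]; first by have -> : j = Ordinal hk by exact: val_inj.
rewrite ltnS => jk; have hk' := ltnW hk.
by apply: le_trans (IH hk' jk); exact: h.
Qed.
(** Similar matrices have the same characteristic polynomial, so the diagonals agree as multisets
    and, being sorted, as sequences. *)
Lemma sorted_similar (m : nat) (W : 'M[C]_m) (x1 x2 : 'I_m -> R) : W \in unitmx ->
  rdiag x1 *m W = W *m rdiag x2 ->
  (forall j k : 'I_m, k = j.+1 :> nat -> x1 k <= x1 j) ->
  (forall j k : 'I_m, k = j.+1 :> nat -> x2 k <= x2 j) -> x1 =1 x2.
Proof.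
move=> uW hW s1 s2.
have hc : char_poly (rdiag x1) = char_poly (rdiag x2).
  have h : char_poly_mx (rdiag x1) *m map_mx polyC W = map_mx polyC W *m char_poly_mx (rdiag x2).
    by rewrite /char_poly_mx mulmxBl mulmxBr -!map_mxM hW mul_scalar_mx mul_mx_scalar.
  have := congr1 determinant h; rewrite !det_mulmx mulrC; apply: mulfI.
  by rewrite det_map_mx polyC_eq0 -unitfE -unitmxE.
have cp x : char_poly (rdiag x) = \prod_(c <- [seq toC (x i) | i <- enum 'I_m]) ('X - c%:P).
  rewrite char_poly_trig; last exact/is_diag_mx_is_trig/diag_mx_is_diag.
  rewrite big_map big_enum /=.
  by apply: eq_bigr => i _; rewrite !mxE eqxx.
rewrite !cp in hc.
have {}hp : perm_eq [seq x1 i | i <- enum 'I_m] [seq x2 i | i <- enum 'I_m].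
  have mp (y : 'I_m -> R) : [seq toC (y i) | i <- enum 'I_m] = map (@toC R) [seq y i | i <- enum 'I_m].
    by rewrite -map_comp.
  by have := prod_XsubC_eq hc; rewrite !mp; exact: (perm_map_inj (@toC_inj R)).
have srt (x : 'I_m -> R) : (forall j k : 'I_m, k = j.+1 :> nat -> x k <= x j) -> sorted >=%R [seq x i | i <- enum 'I_m].
  move=> h; apply/(sortedP 0) => i; rewrite size_map size_enum_ord => hi.
  change (nth 0 [seq x i0 | i0 <- enum 'I_m] i.+1 <= nth 0 [seq x i0 | i0 <- enum 'I_m] i).
  have h2 : (i < size (enum 'I_m))%N by rewrite size_enum_ord ltnW.
  rewrite (nth_map (Ordinal hi) 0 x h2) (nth_map (Ordinal hi)) ?size_enum_ord //.
  by apply: h; rewrite !nth_enum_ord // ltnW.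
have e : [seq x1 i | i <- enum 'I_m] = [seq x2 i | i <- enum 'I_m].
  apply: (sorted_eq _ _ (srt _ s1) (srt _ s2) hp) => [u v w|u v] /=; first by move=> h1 h2; exact: le_trans h2 h1.
  by move=> /andP[h1 h2]; apply/eqP; rewrite eq_le h1 h2.
by move/eq_in_map: e => e i; apply: e; rewrite mem_enum.
Qed.
(** W preserves eigenspaces and lengths. In each eigenspace only the first entry of a normalized
    vector can be nonzero, so this entry is the length of the component there, taken with the sign
    +. *)
Lemma normal_unique (m : nat) (W : 'M[C]_m) (x1 x2 a1 a2 : 'I_m -> R) : conjT W *m W = 1%:M ->
  rdiag x1 *m W = W *m rdiag x2 -> rcol a1 = W *m rcol a2 ->
  normalized x1 a1 -> normalized x2 a2 -> x1 =1 x2 /\ a1 =1 a2.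
Proof.
move=> WW hW ha [s1 p1 z1] [s2 p2 z2].
have uW : W \in unitmx by case: (mulmx1_unit WW).
have ex := sorted_similar uW hW s1 s2; split=> // j.
have W0 i k : x1 i != x1 k -> W i k = 0.
  move=> hik; have := congr1 (fun M : 'M[C]_m => M i k) hW; rewrite /= rdiag_mul mul_rdiag -ex mulrC => /eqP.
  rewrite -subr_eq0 -mulrBr mulf_eq0 -toCB -toC0 (inj_eq (@toC_inj R)) subr_eq0 (negPf hik) orbF => /eqP ->.
  by rewrite toC0.
(* The component of the vector in the eigenspace to which the index j belongs. *)
pose cut a (i : 'I_m) : R := (x1 i == x1 j)%:R * a i.
have hcut : rcol (cut a1) = W *m rcol (cut a2).
  apply/matrixP => i k; rewrite ord1 [LHS]mxE /cut toCM.
  have -> : toC (a1 i) = (W *m rcol a2) i 0 by rewrite -ha mxE.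
  rewrite !mxE mulr_sumr; apply: eq_bigr => l _; rewrite !mxE toCM mulrCA.
  have [e|/W0 ->] := eqVneq (x1 i) (x1 l); last by rewrite !mul0r.
  by rewrite e.
have nrm : \sum_i cn (rcol (cut a1) i 0) ^+ 2 = \sum_i cn (rcol (cut a2) i 0) ^+ 2.
  apply: toC_inj; rewrite -!normsqE hcut conjTM mulmxA -(mulmxA _ (conjT W)) WW mulmx1 //.
(* Either j is not the first index of its eigenspace, and both entries are zero, or it is, and then
   the entry is the length of the component. *)
have [[i hi exi]|first] := pselect (exists2 i : 'I_m, j = i.+1 :> nat & x1 i = x1 j).
  by rewrite (z1 i j) // (z2 i j) // -!ex.
have other (a x : 'I_m -> R) i : x =1 x1 -> (forall j k : 'I_m, k = j.+1 :> nat -> x j = x k -> a k = 0) ->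
    i != j -> x1 i = x1 j -> a i = 0.
  move=> exx za ij eij; have mono := sorted_mono s1.
  have [lt|] := ltnP i j.
    have hj : (j.-1 < m)%N by apply: leq_ltn_trans (leq_pred j) _.
    case: first; exists (Ordinal hj) => /=; first by rewrite prednK // (leq_ltn_trans _ lt).
    apply/eqP; rewrite eq_le -{1}eij !mono //= ?leq_pred //.
    by rewrite -ltnS prednK // (leq_ltn_trans _ lt).
  rewrite leq_eqVlt => /orP[/eqP/val_inj h|lt]; first by rewrite h eqxx in ij.
  have hi : (i.-1 < m)%N by apply: leq_ltn_trans (leq_pred i) _.
  have ip : (0 < i)%N by apply: leq_ltn_trans lt.
  apply: (za (Ordinal hi)) => /=; first by rewrite prednK.
  have m1 : x1 i <= x1 (Ordinal hi) by apply: mono; exact: leq_pred.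
  have m2 : x1 (Ordinal hi) <= x1 j by apply: mono => /=; rewrite -ltnS prednK.
  by rewrite !exx; apply/eqP; rewrite eq_le m1 andbT eij.
have one (a x : 'I_m -> R) : x =1 x1 -> (forall j k : 'I_m, k = j.+1 :> nat -> x j = x k -> a k = 0) ->
    \sum_i cn (rcol (cut a) i 0) ^+ 2 = a j ^+ 2.
  move=> exx za; rewrite (bigD1 j) //= big1 => [|i ij].
    by rewrite addr0 mxE /cut eqxx mul1r cn_toC real_normK ?num_real.
  rewrite mxE /cut; case: eqP => [e|_]; last by rewrite mul0r toC0 cn0 expr0n.
  by rewrite (other a x i) // mulr0 toC0 cn0 expr0n.
have ex' : x2 =1 x1 by move=> i; rewrite ex.
move: nrm; rewrite (one a1 x1) // (one a2 x2) // => /eqP.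
by rewrite eqrXn2 // => /eqP.
Qed.
Lemma hermitian_sqrt (m : nat) (G : 'M[C]_m) : conjT G = G ->
  posdef G ->
  exists P : 'M[C]_m, P \in unitmx /\ P *m conjT P = G.
Proof.
move=> hG pos; have [P [d [PP PP' hP]]] := hermitian_diag hG.
have d0 i : 0 < d i.
  pose v : 'cV[C]_m := (row i P)^T.
  have v0 : v != 0.
    apply/eqP => /(congr1 trmx); rewrite trmxK trmx0 => h.
    have := congr1 (fun M : 'M[C]_m => M i i) PP.
    rewrite /= [LHS](_ : _ = (row i P *m conjT P) 0 i); last by rewrite -row_mul [RHS]mxE.
    by rewrite h mul0mx !mxE eqxx => /esym/eqP; rewrite oner_eq0.
  have := pos v v0; have -> : (v^T *m G *m map_mx Num.conj v) 0 0 = (P *m G *m conjT P) i i.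
    rewrite /v trmxK -row_mul [LHS]mxE [RHS]mxE; apply: eq_bigr => j _.
    by rewrite conjTE !mxE.
  by rewrite hP -mulmxA PP mulmx1 !mxE eqxx mulr1n -toC0 ltr_toC.
have dd : rdiag (fun i => Num.sqrt (d i)) *m conjT (rdiag (fun i => Num.sqrt (d i))) = rdiag d.
  apply/matrixP => i j; rewrite rdiag_mul conjTE !mxE eq_sym.
  case: eqP => [->|_]; last by rewrite !mulr0n conjC0 mulr0.
  by rewrite !mulr1n conj_toC -toCM -expr2 sqr_sqrtr // ltW.
pose P1 := conjT P *m rdiag (fun i => Num.sqrt (d i)).
have hP1 : P1 *m conjT P1 = G.
  by rewrite /P1 conjTM conjTK mulmxA -(mulmxA (conjT P)) dd -mulmxA -hP mulmxA PP' mul1mx.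
exists P1; split=> //; rewrite unitmxE unitfE det_mulmx mulf_neq0 //.
  by have /mulmx1_unit[_] := PP; rewrite unitmxE unitfE.
rewrite det_diag; apply/prodf_neq0 => i _.
by rewrite mxE -toC0 (inj_eq (@toC_inj R)) gt_eqF // sqrtr_gt0.
Qed.
(** Simultaneous reduction of the form Q relative to the metric and of a covector. The factor 2 and
    the sign are those which turn the values of [csm] and [ca] at a point where q vanishes into i X
    and -2i a. *)
Lemma normal_frame (m : nat) (G Q : 'M[C]_m) (w : 'cV[C]_m) : conjT G = G -> conjT Q = Q ->
  posdef G ->
  exists (P : 'M[C]_m) (x a : 'I_m -> R), [/\ P \in unitmx, P *m conjT P = G,
    Q = 2 *: (P *m rdiag x *m conjT P), w = - (P *m rcol a) & normalized x a].
Proof.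
move=> hG hQ pos; have [P1 [u1 hP1]] := hermitian_sqrt hG pos.
pose Pi := invmx P1; have e1 : P1 *m Pi = 1%:M by exact: mulmxV.
pose B := 2^-1 *: (Pi *m Q *m conjT Pi).
have hB : conjT B = B by rewrite /B conjTZ !conjTM conjTK hQ fmorphV rmorph_nat mulmxA.
have [U [x [a [UU UU' BU hb nxa]]]] := unitary_normal (- (Pi *m w)) hB.
have e2 : conjT Pi *m conjT P1 = 1%:M by rewrite -conjTM e1 conjT1.
exists (P1 *m U), x, a; split=> //.
- by rewrite unitmx_mul u1; case: (mulmx1_unit UU).
- by rewrite conjTM mulmxA -(mulmxA P1) UU mulmx1.
- rewrite -(mulmxA P1) -BU conjTM !mulmxA -(mulmxA _ U) UU mulmx1 /B.
  rewrite -scalemxAr -!scalemxAl scalerA divff ?pnatr_eq0 // scale1r.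
  by rewrite !mulmxA e1 mul1mx -mulmxA e2 mulmx1.
- by rewrite -hb -mulmxA (mulmxA U) UU mul1mx mulmxN opprK mulmxA e1 mul1mx.
Qed.
End ConjTranspose.
Lemma posdef_unit (R : realType) (n : nat) (G : 'M[Cplx R]_n) :
  posdef G -> G \in unitmx.
Proof.
move=> Gpos; rewrite -unitmx_tr -row_free_unit -kermx_eq0; apply/rowV0P => v /sub_kermxP hv.
apply/eqP; apply: contraT => v0; pose w : 'cV[Cplx R]_n := map_mx Num.conj v^T.
have w0 : w != 0.
  apply: contra_neq v0 => /(congr1 (map_mx Num.conj)); rewrite /w map_mx0 => h.
  apply: trmx_inj; rewrite trmx0 -h; apply/matrixP => i j; rewrite !mxE.
  by rewrite Num.Theory.conjCK.
have := Gpos w w0; have -> : map_mx Num.conj w = v^T.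
  by apply/matrixP => i j; rewrite !mxE Num.Theory.conjCK.
have h : G *m v^T = 0 by apply: trmx_inj; rewrite trmx_mul trmxK hv trmx0.
by rewrite -mulmxA h mulmx0 mxE ltxx.
Qed.

(** * From Bochner-flat germs to the normal form *)

Section StructureEquations.
Context {R : realType} {n : nat} {A : dring R n}.
Local Notation wi := (@wi R n A).
Variables (F : A) (M K : 'M[A]_(1 + (n + 1))) (G Gi : 'M[A]_n) (phi : 'rV[A]_(1 + (n + 1))).

(** The structure equations of a solution, with the auxiliary tensors as parameters and all frame
    vectors written out in terms of phi. The last group of fields allows evaluation at p. *)
Record structure_data (ga : 'I_n -> A) (Q : 'M[A]_n) (q : A) (s : 'M[A]_n) (al : 'I_n -> A) (c : A) : Prop :=
  StructureData {
  sl_ga : forall k, del k (bf K (phi *m M) phi) = ga k * bf K (phi *m M) phi;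
  sl_star : star Q = Q;
  sl_real : cj q = q;
  sl_om : forall k l i m, Om G Gi k l i m = bochner_form G Q (Q *m Gi) q k l i m;
  sl_tr : forall k, del k (\tr (Q *m Gi)) + 4 * (n%:R + 1) * del k q = 0;
  sl_Q : forall k l, Q k l = wi * (s *m G) k l - 4 * q * G k l;
  sl_al : forall k l, delb l (al k) = \sum_m s k m * Q m l - wi * G k l * c;
  sl_q : forall k, wi * del k q = - al k;
  sl_phi : forall k, bf K (Tw F M k phi - ga k *: phi) phi = 0;
  sl_be : forall k, bf K (Tw F M k phi - ga k *: phi) (phi *m M) = 0;
  sl_EE : forall k m, bf K (Tw F M k phi - ga k *: phi) (Tw F M m phi - ga m *: phi) = wi * bf K (phi *m M) phi * G k m;
  sl_bebe : bf K (phi *m M) (phi *m M) = wi * bf K (phi *m M) phi * q;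
  sl_EM : forall k m, bf K ((Tw F M k phi - ga k *: phi) *m M) (Tw F M m phi - ga m *: phi) =
     wi * bf K (phi *m M) phi * (s *m G) k m;
  sl_Ebe : forall k, bf K ((Tw F M k phi - ga k *: phi) *m M) (phi *m M) = - al k * bf K (phi *m M) phi;
  sl_c : bf K (phi *m M *m M) (phi *m M) = - c * bf K (phi *m M) phi - wi * q * (wi * bf K (phi *m M) phi * q) }.
Hypothesis Freal : cj F = F.
Hypothesis DM : forall k, D k M = 0.
Hypothesis DbM : forall k, Db k M = 0.
Hypothesis DK : forall k, D k K = (- wi * del k F) *: (M *m K).
Hypothesis Kstar : star K = K.
Hypothesis KM : K *m star M = - (M *m K).
Hypothesis GE : forall k l, G k l = del k (delb l F).
Hypothesis GGi : G *m Gi = 1%:M.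
Hypothesis Dbphi : forall l, Db l phi = 0.
Hypothesis null : bf K phi phi = 0.
Hypothesis u_unit : bf K (phi *m M) phi \is a GRing.unit.
(** The auxiliary quantities are defined by division: u is a unit and the metric is invertible, so
    each defining equation can be solved for its unknown. *)
Lemma structure_equations : exists ga Q q s al c, structure_data ga Q q s al c.
Proof.
have [be defbe] : exists be, be = phi *m M by exists (phi *m M).
have [u defu] : exists u, u = bf K be phi by exists (bf K be phi).
have uu : u \is a GRing.unit by rewrite defu defbe.
have wu_unit : wi * u \is a GRing.unit by rewrite unitrM wi_unit.
have [ga gaE] : exists ga : 'I_n -> A, forall k, del k u = ga k * u.
  by exists (fun k => del k u * u^-1) => k; rewrite mulrVK.
have [E EE'] : exists E : 'I_n -> 'rV[A]_(1 + (n + 1)), forall k, E k = Tw F M k phi - ga k *: phi.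
  by exists (fun k => Tw F M k phi - ga k *: phi).
have TwE k : Tw F M k phi = E k + ga k *: phi by rewrite EE' subrK.
have [Q QE] : exists Q : 'M[A]_n, forall k l, Q k l = delb l (ga k).
  by exists (\matrix_(k, l) delb l (ga k)) => k l; rewrite mxE.
have [q bebe] : exists q, bf K be be = wi * u * q.
  by exists ((wi * u)^-1 * bf K be be); rewrite mulVKr.
have solve (a : nat) (X : 'M[A]_(a, n)) : exists s : 'M[A]_(a, n), forall k m, X k m = wi * u * (s *m G) k m.
  exists (((wi * u)^-1 *: X) *m Gi) => k m.
  by rewrite -mulmxA (GiG GGi) mulmx1 scaleE mulVKr.
have [s hs] : exists s : 'M[A]_n, forall k m, bf K (E k *m M) (E m) = wi * u * (s *m G) k m.
  by have [s hs] := solve n (\matrix_(k, m) bf K (E k *m M) (E m)); exists s => k m; rewrite -hs mxE.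
have [al hal] : exists al : 'I_n -> A, forall k, bf K (E k *m M) be = - al k * u.
  by exists (fun k => - (bf K (E k *m M) be * u^-1)) => k; rewrite opprK mulrVK.
have [bv hb] : exists bv : 'I_n -> A, forall m, bf K (be *m M) (E m) = wi * u * \sum_p bv p * G p m.
  have [b hb] := solve 1%N (\row_m bf K (be *m M) (E m)); exists (b 0) => m.
  by have := hb 0 m; rewrite !mxE.
have [c hc] : exists c, bf K (be *m M) be = - c * u - wi * q * (wi * u * q).
  exists (- ((bf K (be *m M) be + wi * q * (wi * u * q)) * u^-1)).
  by rewrite opprK mulrVK // addrK.
exists ga, Q, q, s, al, c; split; rewrite -?defbe -?defu -?EE' //.
- exact: (Qstar Kstar KM defbe defu uu gaE QE).
- exact: (qreal Kstar KM defbe defu uu bebe).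
- exact: (Om_form DM DbM DK Kstar KM GE GGi Dbphi null defbe defu uu gaE TwE QE bebe hs hal hb hc).
- exact: (trQ DM DbM DK Kstar KM GE GGi Dbphi null defbe defu uu gaE TwE QE bebe hs hal hb hc).
- exact: (Q_form DM DbM DK Kstar KM GE GGi Dbphi null defbe defu uu gaE TwE QE bebe hs hal hb hc).
- exact: (delb_al DM DbM DK Kstar KM GE GGi Dbphi null defbe defu uu gaE TwE QE bebe hs hal hb hc).
- exact: (del_q DM DbM DK Dbphi defbe uu gaE TwE bebe hal).
- by move=> k; rewrite -EE'; exact: (Ephi DK Dbphi null TwE).
- by move=> k; rewrite -EE'; exact: (Ebe DM DK KM Dbphi defbe defu gaE TwE).
- by move=> k m; rewrite -!EE'; exact: (EE DbM DK Kstar GE Dbphi null defbe defu TwE).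
- by move=> k m; rewrite -!EE'; exact: hs.
- by move=> k; rewrite -!EE'; exact: hal.
Qed.
End StructureEquations.

(** * Constant germs and exponentials of germs *)

Section GermExp.
Context {R : realType} {n : nat} {p : 'cV[Cplx R]_n}.
Local Notation C := (Cplx R).
Local Notation V := 'cV[C]_n.
Local Notation A := (germ_dring p).
Implicit Types (x y : germ p).
Definition ev (a b : nat) (M : 'M[A]_(a, b)) : 'M[C]_(a, b) := map_mx (@gev R n p) M.
Definition csm_ (a b : nat) (M : 'M[C]_(a, b)) : 'M[A]_(a, b) := map_mx (@cs R n A) M.
Lemma gevM (x y : A) : gev (x * y) = gev x * gev y. Proof. exact: rmorphM. Qed.
Lemma gevD (x y : A) : gev (x + y) = gev x + gev y. Proof. exact: rmorphD. Qed.
Lemma gevN (x : A) : gev (- x) = - gev x. Proof. exact: rmorphN. Qed.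
Lemma gev0 : gev (0 : A) = 0. Proof. exact: rmorph0. Qed.
Lemma evE (a b : nat) (M : 'M[A]_(a, b)) i j : ev M i j = gev (M i j). Proof. by rewrite mxE. Qed.
Lemma evM (a b c : nat) (M : 'M[A]_(a, b)) (N : 'M[A]_(b, c)) : ev (M *m N) = ev M *m ev N.
Proof. exact: map_mxM. Qed.
Lemma evD (a b : nat) (M N : 'M[A]_(a, b)) : ev (M + N) = ev M + ev N.
Proof. exact: map_mxD. Qed.
Lemma evN (a b : nat) (M : 'M[A]_(a, b)) : ev (- M) = - ev M.
Proof. exact: map_mxN. Qed.
Lemma evZ (a b : nat) (x : A) (M : 'M[A]_(a, b)) : ev (x *: M) = gev x *: ev M.
Proof. exact: map_mxZ. Qed.
Lemma ev_star (a b : nat) (M : 'M[A]_(a, b)) : ev (star M) = conjT (ev M).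
Proof. by apply/matrixP => i j; rewrite conjTE !evE starE -gev_conj. Qed.
Lemma ev_csm (a b : nat) (M : 'M[C]_(a, b)) : ev (csm_ M) = M.
Proof. by apply/matrixP => i j; rewrite evE mxE; exact: gev_cst. Qed.
Lemma ev_bf (K : 'M[A]_(1 + (n + 1))) (y z : 'rV[A]_(1 + (n + 1))) :
  gev (bf K y z) = (ev y *m ev K *m conjT (ev z)) 0 0.
Proof. by rewrite /bf -evE !evM ev_star. Qed.
(** On a ball the derivatives along the segments from p vanish, so the mean value inequality applies
    on each segment. *)
Lemma const_germ x : (forall k, gdel k x = 0) -> (forall k, gdelb k x = 0) -> x = gcst p (gev x).
Proof.
move=> h1 h2; have [U [oU Up] sx] := germ_sm x.
have z0 : neq p (0 : germ p) (fun=> 0) by rewrite -(rmorph0 (gcst p)); exact: gcstE.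
have h : \forall z \near p, forall k : 'I_n, dz k x z = 0 /\ dzbar k x z = 0.
  apply: near_forall => k; have e1 := gdelE k x; have e2 := gdelbE k x; rewrite h1 in e1; rewrite h2 in e2.
  by apply: nearS (nearI z0 (nearI e1 e2)) => z [<- [<- <-]].
have /nearvP[r r0 hr] := nearI (open_near oU Up) h.
apply: germP; apply: neq_trans (neq_sym (gcstE (gev x))).
apply/nearvP; exists r => // z hz; rewrite /gev.
have key (t : R) : 0 <= t <= 1 -> isd x (z - p) (p + toC t *: (z - p)) 0.
  move=> /andP[t0 t1]; have hb : vn (p + toC t *: (z - p) - p) < r.
    rewrite addrAC subrr add0r vnZ cn_toC ger0_norm //; apply: le_lt_trans hz.
    by rewrite -[leRHS]mul1r ler_wpM2r ?vn_ge0.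
  have [Uz hd] := hr _ hb; have := Ck_isd (z - p) (sx 1%N) Uz.
  rewrite (rderive_dz _ oU (sx 1%N) Uz) big1 // => k _.
  by have [-> ->] := hd k; rewrite mulr0 mulr0 addr0.
have := @cder_cst1 R (fun t : R => x (p + toC t *: (z - p))) .
rewrite toC0 toC1 scale0r scale1r addr0 [p + _]addrC subrK; apply.
  exact: 0.
move=> t ht; apply: isd_line; exact: key.
Qed.

Section Exp.
Variable N : nat.
Implicit Types B : 'M[C]_N.+1.
Definition gexp B x : 'M[A]_N.+1 := \matrix_(i, j) gm p (fun z => emx (x z *: B) i j).
Lemma smn_emx B f i j : smn p f -> smn p (fun z => emx (f z *: B) i j).
Proof. by move=> [U [oU Up] sx]; exists U => // k; apply: Ck_emx => //; exact: sx. Qed.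
Lemma rep_gexp B f x i j : rep f x -> rep (fun z => emx (f z *: B) i j) (gexp B x i j).
Proof.
move=> h; rewrite mxE; apply: neq_trans (gm_near (smn_emx B i j (germ_sm x))) _.
by apply: nearS h => z ->.
Qed.
Lemma rep_cs (c : C) : rep (fun=> c) (@cs R n A c). Proof. exact: rep_cst. Qed.
Lemma rep_mulmx (a b c : nat) (f : V -> 'M[C]_(a, b)) (g : V -> 'M[C]_(b, c)) (X : 'M[A]_(a, b)) (Y : 'M[A]_(b, c)) :
  (forall i j, rep (fun z => f z i j) (X i j)) -> (forall i j, rep (fun z => g z i j) (Y i j)) ->
  forall i j, rep (fun z => (f z *m g z) i j) ((X *m Y) i j).
Proof.
move=> h1 h2 i j; rewrite mxE; have h : rep (fun z => \sum_l f z i l * g z l j) (\sum_l X i l * Y l j).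
  by apply: rep_sum => l; apply: rep_mul.
by apply: rep_eqf h => z; rewrite mxE.
Qed.
Lemma rep_csm (a b : nat) (M : 'M[C]_(a, b)) i j : rep (fun=> M i j) (csm_ M i j).
Proof. by rewrite mxE; exact: rep_cs. Qed.
Lemma dd_emx B x : \forall z \near p, forall i j (v : V),
  rderive (fun w => emx (x w *: B) i j) v z = rderive x v z * (B *m emx (x z *: B)) i j.
Proof.
have [U [oU Up] sx] := germ_sm x; apply: nearS (open_near oU Up) => z Uz i j v.
by apply: isd_rderive; apply: isd_emx; exact: (Ck_isd v (sx 1%N) Uz).
Qed.
Lemma D_gexp k B x : D k (gexp B x) = del k (x : A) *: (csm_ B *m gexp B x).
Proof.
apply/matrixP => i j; rewrite DE scaleE.
apply: rep_eq (rep_dz k (rep_gexp B i j (neq_refl p x))) _.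
have h := rep_mul (rep_dz k (neq_refl p x)) (rep_mulmx (rep_csm B) (fun a b => rep_gexp B a b (neq_refl p x)) i j).
apply: rep_ext h; apply: nearS (dd_emx B x) => z hz.
rewrite /dz !hz.
by move: (rderive x (cbasis R k) z) (rderive x ('i *: cbasis R k) z) ((B *m emx _) i j) => a b c; ring.
Qed.
Lemma Db_gexp k B x : Db k (gexp B x) = delb k (x : A) *: (csm_ B *m gexp B x).
Proof.
have dbE (y : germ p) : @delb R n A k y = gdelb k y by rewrite /delb /cj /del /= -gdelb_conj.
apply/matrixP => i j; rewrite DbE scaleE !dbE.
apply: rep_eq (rep_dzbar k (rep_gexp B i j (neq_refl p x))) _.
have h := rep_mul (rep_dzbar k (neq_refl p x)) (rep_mulmx (rep_csm B) (fun a b => rep_gexp B a b (neq_refl p x)) i j).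
apply: rep_ext h; apply: nearS (dd_emx B x) => z hz.
rewrite /dzbar !hz.
by move: (rderive x (cbasis R k) z) (rderive x ('i *: cbasis R k) z) ((B *m emx _) i j) => a b c; ring.
Qed.
Lemma gexpV B x : gexp B x *m gexp B (- x) = 1%:M.
Proof.
apply/matrixP => i j; apply: rep_eq (rep_mulmx (fun a b => rep_gexp B a b (neq_refl p x))
   (fun a b => rep_gexp B a b (rep_opp (neq_refl p x))) i j) _.
have h := rep_csm (1%:M : 'M[C]_N.+1) i j; rewrite [csm_ _]map_mx1 in h.
by apply: rep_eqf h => z; rewrite emxVl.
Qed.
Lemma gexp_intertwine (P B B' : 'M[C]_N.+1) x : P *m B = B' *m P -> csm_ P *m gexp B x = gexp B' x *m csm_ P.
Proof.
move=> h; apply/matrixP => i j.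
apply: rep_eq (rep_mulmx (rep_csm P) (fun a b => rep_gexp B a b (neq_refl p x)) i j) _.
apply: rep_eqf (rep_mulmx (fun a b => rep_gexp B' a b (neq_refl p x)) (rep_csm P) i j) => z; rewrite (@emx_intertwine _ _ P (x z *: B) (x z *: B')) //.
by rewrite -scalemxAr -scalemxAl h.
Qed.
Lemma gexp_comm B x : csm_ B *m gexp B x = gexp B x *m csm_ B.
Proof. exact: gexp_intertwine. Qed.
Lemma gexpNN B x : gexp (- B) (- x) = gexp B x.
Proof.
apply/matrixP => i j; apply: rep_eq (rep_gexp _ i j (rep_opp (neq_refl p x))) _.
apply: rep_eqf (rep_gexp B i j (neq_refl p x)) => z.
by rewrite scalerN scaleNr opprK.
Qed.
Lemma star_gexp B x : star (gexp B x) = gexp (conjT B) (gconj x).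
Proof.
apply/matrixP => i j; rewrite starE.
apply: rep_eq (rep_conj (rep_gexp B j i (neq_refl p x))) _.
apply: rep_eqf (rep_gexp (conjT B) i j (rep_conj (neq_refl p x))) => z.
by rewrite -conjTE emx_conjT conjTZ.
Qed.
Lemma ev_gexp B x : ev (gexp B x) = emx (gev x *: B).
Proof. by apply/matrixP => i j; rewrite evE (rep_p (rep_gexp B i j (neq_refl p x))). Qed.
End Exp.
End GermExp.

(** * A Bochner-flat potential germ solves the equation for a normal matrix *)

Section NormalFormGerm.
Context {R : realType} {n : nat} {p : 'cV[Cplx R]_n}.
Local Notation C := (Cplx R).
Local Notation A := (germ_dring p).
Local Notation wi := (@wi R n A).
Local Notation N := (1 + (n + 1))%N.
Lemma gdd_del k (x : germ p) : gdd (k, false) x = @del R n A k x. Proof. by []. Qed.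
Lemma gdd_delb k (x : germ p) : gdd (k, true) x = @delb R n A k x.
Proof. by rewrite /gdd /= gdelb_conj. Qed.
Lemma frame_exists (N' : nat) (T Tb : 'I_n -> 'M[A]_N') (E0 : 'M[C]_N') :
  (forall j k, D j (T k) + T k *m T j = D k (T j) + T j *m T k) ->
  (forall k l, Db l (T k) + T k *m Tb l = D k (Tb l) + Tb l *m T k) ->
  (forall j k, Db j (Tb k) + Tb k *m Tb j = Db k (Tb j) + Tb j *m Tb k) ->
  exists E : 'M[A]_N', [/\ ev E = E0, forall k, D k E = T k *m E & forall k, Db k E = Tb k *m E].
Proof.
move=> h1 h2 h3; pose Th (a : 'I_n * bool) : 'M[A]_N' := if a.2 then Tb a.1 else T a.1.
have flat a b i j : gdd a (Th b i j) + (Th b *m Th a) i j = gdd b (Th a i j) + (Th a *m Th b) i j.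
  case: a b => [a []] [b []]; rewrite /Th /= ?gdd_del ?gdd_delb.
  - by have /matrixP/(_ i j) := h3 a b; rewrite !addE !DbE.
  - by have /matrixP/(_ i j) := h2 b a; rewrite !addE DbE DE.
  - by have /matrixP/(_ i j) := h2 a b; rewrite !addE DbE DE.
  - by have /matrixP/(_ i j) := h1 a b; rewrite !addE !DE.
have [E [e1 e2]] := germ_frame flat E0; exists E; split.
- by apply/matrixP => i j; rewrite evE.
- by move=> k; apply/matrixP => i j; rewrite DE -gdd_del e2.
- by move=> k; apply/matrixP => i j; rewrite DbE -gdd_delb e2.
Qed.
Lemma const_mx_germ (a b : nat) (M : 'M[A]_(a, b)) : (forall k, D k M = 0) -> (forall k, Db k M = 0) ->
  M = csm_ (ev M).
Proof.
move=> h1 h2; apply/matrixP => i j; rewrite !mxE; apply: const_germ => k.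
  by have /matrixP/(_ i j) := h1 k; rewrite !mxE.
have /matrixP/(_ i j) := h2 k; rewrite !mxE.
by rewrite /delb /cj /del /= -gdelb_conj.
Qed.
Lemma unitmx_ev (a : nat) (M : 'M[A]_a) : (M \in unitmx) = (ev M \in unitmx).
Proof. by rewrite !unitmxE unitfE /ev det_map_mx gunitE. Qed.
(** Applied to the conjugate transpose of (1, z, 0), it gives the transpose of the row (0, z^*, i/2)
    of the equation. *)
Definition Jmx : 'M[C]_N := block3 0 0 (- ('i / 2))%:M 0 1%:M 0 ('i / 2)%:M 0 0.
Lemma conj_i2 : Num.conj ('i / 2 : C) = - ('i / 2).
Proof.
have h : Num.conj (2^-1 : C) = 2^-1 by have := conj_toCV (2 : R); rewrite rmorph_nat.
have -> : Num.conj ('i / 2 : C) = Num.conj 'i * Num.conj 2^-1 by exact: rmorphM.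
by rewrite h conjCi mulNr.
Qed.
Lemma conjT_block3 (a : 'M[C]_1) b (c : 'M[C]_1) (d : 'cV[C]_n) e f (g : 'M[C]_1) h i :
  conjT (block3 a b c d e f g h i) = block3 (conjT a) (conjT d) (conjT g) (conjT b) (conjT e) (conjT h) (conjT c) (conjT f) (conjT i).
Proof. rewrite /conjT block3_tr; exact: block3_map. Qed.
Lemma conjT_scalar (a : nat) (x : C) : conjT (x%:M : 'M[C]_a) = (Num.conj x)%:M.
Proof. by rewrite /conjT tr_scalar_mx map_scalar_mx. Qed.
Lemma ev_block3 (a : 'M[A]_1) b (c : 'M[A]_1) (d : 'cV[A]_n) e f (g : 'M[A]_1) h i : ev (block3 a b c d e f g h i) =
  block3 (ev a) (ev b) (ev c) (ev d) (ev e) (ev f) (ev g) (ev h) (ev i).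
Proof. exact: block3_map. Qed.
Lemma ev_scalar (a : nat) (x : A) : ev (x%:M : 'M[A]_a) = (gev x)%:M.
Proof. exact: map_scalar_mx. Qed.
Lemma ev0 (a b : nat) : ev (0 : 'M[A]_(a, b)) = 0. Proof. exact: map_mx0. Qed.
Lemma ev1 (a : nat) : ev (1%:M : 'M[A]_a) = 1%:M. Proof. exact: map_mx1. Qed.
Lemma diag_block3 (P P' : 'M[C]_n) (a b : 'M[C]_1) :
  block3 1%:M 0 0 0 P 0 0 0 1%:M *m block3 0 0 a 0 1%:M 0 b 0 0 *m block3 1%:M 0 0 0 P' 0 0 0 1%:M =
  block3 0 0 a 0 (P *m P') 0 b 0 0.
Proof.
have -> : block3 1%:M 0 0 0 P 0 0 0 1%:M *m block3 0 0 a 0 1%:M 0 b 0 0 = block3 0 0 a 0 P 0 b 0 0.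
  by rewrite block3_mul !(mul0mx, mulmx0, mul1mx, mulmx1, add0r, addr0).
by rewrite block3_mul !(mul0mx, mulmx0, mul1mx, mulmx1, add0r, addr0).
Qed.
Lemma Jmx_herm : conjT Jmx = Jmx.
Proof.
rewrite /Jmx conjT_block3; apply: block3_eq; rewrite ?conjT0 ?conjT_scalar ?rmorph1 //.
  by rewrite conj_i2.
by rewrite rmorphN /= conj_i2 opprK.
Qed.
Variables (F : A) (G : 'M[A]_n).
Hypothesis n2 : (2 <= n)%N.
Hypothesis Freal : cj F = F.
Hypothesis F0 : gev F = 0.
Hypothesis GE : forall k l, G k l = del k (delb l F).
Hypothesis Gpos : posdef (ev G).
Hypothesis flat : forall i j k l, Bo G (invmx G) i j k l = 0.
(** The transpose of [normal_mx], so that it acts on rows from the right; see [normal_mx_Mmx]. *)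
Definition Mmx (x a : 'I_n -> R) (r : R) : 'M[C]_N :=
  block3 0 0 1%:M (- (2 * 'i) *: rcol a) ('i *: rdiag x) 0 (toC r)%:M (rcol a)^T 0.

(** In a parallel frame EE the matrix [aa] becomes the constant M and the transported Gram matrix
    becomes K. The value of EE at p is chosen so that M has normal form, and the first row of EE is
    phi. The values of its derivatives at p serve to build coordinates. *)
Theorem germ_normal_form : exists (x a : 'I_n -> R) (r : R) (phi : 'rV[A]_N) (P : 'M[C]_n) (al be : 'I_n -> C),
  [/\ normalized x a, P \in unitmx, forall k, Db k phi = 0, ev phi = row_mx 1%:M (row_mx 0 0) &
     (forall k, ev (D k phi) = row_mx (al k)%:M (row_mx (row k P) (be k)%:M)) /\
     phi *m (gexp (Mmx x a r) (- wi * F) *m csm_ Jmx) *m star phi = 0].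
Proof.
have Gu : G \in unitmx by rewrite unitmx_ev; exact: posdef_unit.
have GGi : G *m invmx G = 1%:M by exact: mulmxV.
move: flat GGi; move: (invmx G) => Gi fl GGi.
have Gstar : star G = G := hess_star Freal GE.
have Gsym : forall k i l, del k (G i l) = del i (G k l) := hess_sym GE.
have [t0 t0E] : exists t : A, t = Sc G Gi * (cs 4%:R^-1 * cs n.+1%:R^-1 * cs n.+2%:R^-1) by eexists.
have t0r : cj t0 = t0 by rewrite t0E !cjM !cj_cs (Sc_real GGi Gstar) !fmorphV !rmorph_nat.
(* This constant makes q vanish at p, which turns the last diagonal entry of [aa] at p into the zero
   of [Mmx]. *)
pose y : C := gev t0.
have yr : cs y = cj (cs y) :> A by rewrite cj_cs /y -gev_conj -[X in _ = cs (gev X)]/(cj t0) t0r.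
have [Q [q [y' [Qs qr om tr q0]]]] : exists (Q : 'M[A]_n) (q : A) (y' : C), [/\ star Q = Q, cj q = q,
   forall k l i m, Om G Gi k l i m = bochner_form G Q (Q *m Gi) q k l i m,
   \tr (Q *m Gi) + 4 * (n%:R + 1) * q = cs y' & gev q = 0].
  exists (bQ G Gi y), (bq G Gi y), (2 * n.+2%:R * y); split.
  - exact: bQ_star.
  - exact: bq_real.
  - exact: (flat_Om GGi y fl).
  - exact: (bQ_tr GGi).
  - rewrite /bq -t0E; rewrite gevD gevN.
    by rewrite /cs /= gev_cst subrr.
have H1' := H1 tr.
have [c [cr hc]] := scalar_c GGi Gstar Gsym n2 Qs qr erefl (DQ_N G Gi Q) om H1'.
have evH (M : 'M[A]_n) : star M = M -> conjT (ev M) = ev M by move=> h; rewrite -ev_star h.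
have [P [x [a [Pu PP QP wP nxa]]]] := normal_frame (ev (dq q)) (evH _ Gstar) (evH _ Qs) Gpos.
pose r := rp (gev c).
have cE : gev c = toC r by apply: real_toC; rewrite -gev_conj -[X in gev X]/(cj c) cr.
have [T TE] : exists T, forall k, T k = th G Gi Q q k + (gam F G Gi y' k)%:M + (wi * del k F) *: aa Gi Q q c.
  by exists (Th F G Gi Q q c y').
(* The initial frame: P reduces Q and dq at p relative to the metric, so that conjugation by E0
   takes [aa] at p to normal form. *)
pose E0 : 'M[C]_N := block3 1%:M 0 0 0 P 0 0 0 1%:M.
have [EE [evEE DEE DbEE]] : exists E : 'M[A]_N, [/\ ev E = E0, forall k, D k E = T k *m E &
    forall k, Db k E = thb G Q k *m E].
  apply: frame_exists => [j k|k l|j k]; rewrite ?TE.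
  - exact: (Th_flat' n2 GE GGi qr om tr hc).
  - exact: (Th_thb_flat' n2 Freal GE GGi Qs qr cr om tr hc).
  - exact: (thb_flat Freal GE GGi Qs om tr).
have gsym := @del_gam_sym R n A F G Gi y' GGi.
have gQ := delb_gam GE GGi om tr.
have cjgam k l : del k (cj (gam F G Gi y' l)) = Q k l by rewrite del_cj gQ -starE Qs.
(* A flat line bundle: the mixed derivatives agree because both equal Q. The value i/2 at p makes wi
   u equal to 1 there, so that u [gH] at p becomes J in the initial frame. *)
have [u [u0 Du Dbu]] : exists u : A, [/\ gev u = 'i / 2, forall k, del k u = gam F G Gi y' k * u &
    forall k, delb k u = cj (gam F G Gi y' k) * u].
  have [U [U0 DU DbU]] : exists E : 'M[A]_1, [/\ ev E = ('i / 2)%:M,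
      forall k, D k E = (gam F G Gi y' k)%:M *m E & forall k, Db k E = (cj (gam F G Gi y' k))%:M *m E].
    apply: frame_exists => [j k|k l|j k]; rewrite ?D_scalar ?Db_scalar -!scalar_mxM.
    - by rewrite gsym [_ * gam _ _ _ _ k]mulrC.
    - by rewrite gQ cjgam [_ * gam _ _ _ _ k]mulrC.
    - by rewrite !delb_cj gsym [_ * cj (gam _ _ _ _ k)]mulrC.
  exists (U 0 0); split.
  - by rewrite -evE U0 mxE eqxx.
  - by move=> k; rewrite -DE DU mul_scalar_mx scaleE.
  - by move=> k; rewrite -DbE DbU mul_scalar_mx scaleE.
have i2 : ('i / 2 : C) != 0 by rewrite mulf_neq0 ?neq0Ci // invr_eq0 pnatr_eq0.
have uu : u \is a GRing.unit by rewrite gunitE u0.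
(* The quotient of [cj u] by u has vanishing derivatives, hence is constant, and its value at p is
   -1. *)
have cju : cj u = - u.
  have ui : cj u * u^-1 = gcst p (gev (cj u * u^-1 : A)).
    have dV (d g : A) : g * u * u^-1 + u * d = 0 -> d = - g * u^-1.
      by rewrite mulrK // => /eqP; rewrite addrC addr_eq0 => /eqP h; apply: (mulrI uu); rewrite h mulNr mulrN mulrCA mulrV ?mulr1.
    have dui k : del k u^-1 = - gam F G Gi y' k * u^-1 by apply: dV; rewrite -Du -delM mulrV // del1.
    have dbui k : delb k u^-1 = - cj (gam F G Gi y' k) * u^-1.
      by apply: dV; rewrite -Dbu -delbM mulrV // -cs1 delb_cs.
    apply: const_germ => k.
      change (@del R n A k (cj u * u^-1) = 0).
      by rewrite delM del_cj Dbu cjM cjK dui; ring.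
    rewrite (_ : gdelb k _ = @delb R n A k (cj u * u^-1)); last by rewrite -gdd_delb.
    by rewrite delbM delb_cj Du cjM dbui; ring.
  have h : gev (cj u * u^-1 : A) = -1.
    have e1 : gev (u * u^-1 : A) = 1 by rewrite mulrV // rmorph1.
    have e2 : gev (cj u : A) = - gev u by rewrite (gev_conj u) u0 conj_i2.
    by rewrite rmorphM /= e2 mulNr -e1 rmorphM.
  have := congr1 (fun t : A => t * u) ui; rewrite h mulrVK // => ->.
  by rewrite rmorphN rmorph1 mulN1r.
have E0u : E0 *m block3 1%:M 0 0 0 (invmx P) 0 0 0 1%:M = 1%:M.
  rewrite /E0 block3_mul !(mul0mx, mulmx0, mul1mx, mulmx1, add0r, addr0) mulmxV //.
  by rewrite [RHS]block3_scalar.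
have E0unit : E0 \in unitmx by case: (mulmx1_unit E0u).
have EEi : EE *m invmx EE = 1%:M by apply: mulmxV; rewrite unitmx_ev evEE.
have [Ei EiE] : exists Ei, EE *m Ei = 1%:M by exists (invmx EE).
have [MM MME] : exists MM, MM = Ei *m aa Gi Q q c *m EE by eexists.
have [XX XXE] : exists XX, XX = Ei *m (u *: gH G q) *m star Ei by eexists.
have Daa := D_aa n2 GE GGi qr om tr hc.
have Dbaa := Db_aa n2 Freal GE GGi Qs qr cr om tr hc.
have DMM := D_MM Daa TE DEE EiE MME.
have DbMM := Db_MM Dbaa DbEE EiE MME.
have sH := star_gH Freal GE qr.
have aH := aa_gH Freal GE GGi Qs qr cr.
have DH := D_gH q Freal GE GGi Qs.
have sXX : star XX = XX := star_XX sH cju XXE.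
have DXX := D_XX TE DH Du DEE DbEE EiE MME XXE.
have XM : XX *m star MM = - (MM *m XX) := XX_MM sH aH EiE MME XXE.
have g_wi : gev (wi : A) = - (2 * 'i) by exact: gev_cst.
have g_hq : gev (@hq R n A) = 'i / 2 by exact: gev_cst.
have evGi : conjT P *m ev Gi *m P = 1%:M.
  by apply: mulmx1C; rewrite mulmxA PP -evM GGi ev1.
have ev_ca : ev (ca q) = - (2 * 'i) *: (P *m rcol a).
  rewrite caE evZ wP; have -> : gev (- wi : A) = 2 * 'i by rewrite rmorphN /= g_wi opprK.
  by rewrite scalerN scaleNr.
have ev_csmP : ev (csm Gi Q q) *m P = P *m ('i *: rdiag x).
  rewrite csmE evZ evD evM g_hq ev_scalar rmorphM /= q0 mulr0 -scalemxAl mulmxDl.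
  rewrite [in X in _ + X](_ : (0%:M : 'M[C]_n) = 0); last by apply/matrixP => i j; rewrite !mxE mul0rn.
  rewrite mul0mx addr0 QP -!scalemxAl -!mulmxA (mulmxA (conjT P)) evGi mulmx1 scalerA.
  by rewrite mulfVK ?pnatr_eq0 // scalemxAr.
have rcolT : conjT (rcol a) = (rcol a)^T by apply/matrixP => i j; rewrite conjTE !mxE conj_toC.
have ev_cbP : ev (cb Gi q) *m P = (rcol a)^T.
  rewrite cbE evN evM ev_star wP conjTN conjTM !mulNmx opprK rcolT -!mulmxA (mulmxA (conjT P)) evGi mulmx1 //.
have ev_aa : E0 *m Mmx x a r = ev (aa Gi Q q c) *m E0.
  rewrite /aa ev_block3 !ev0 ev1 !ev_scalar cE ev_ca cdE gevM gevN q0 mulr0 /E0 /Mmx !block3_mul.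
  rewrite !(mul0mx, mulmx0, mul1mx, mulmx1, add0r, addr0) ev_csmP ev_cbP.
  apply: block3_eq => //; first by rewrite -scalemxAr.
  by apply/matrixP => i j; rewrite !mxE mul0rn.
have EEinj (m : nat) (X Y : 'M[C]_(N, m)) : E0 *m X = E0 *m Y -> X = Y.
  by move=> h; rewrite -(mulKmx E0unit X) h mulKmx.
(* A constant germ matrix equals its value at p, where the frame is E0. *)
have MMc : MM = csm_ (Mmx x a r).
  rewrite (const_mx_germ DMM DbMM); congr csm_; apply: EEinj.
  rewrite ev_aa -evEE -!evM; congr ev; rewrite MME !mulmxA EiE mul1mx //.
have starE' : star Ei *m star EE = 1%:M by rewrite -star_mul EiE star1.
have evXX : ev XX = Jmx.
  apply: EEinj; have h : E0 *m ev XX *m conjT E0 = E0 *m Jmx *m conjT E0.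
    have -> : E0 *m ev XX *m conjT E0 = ev (u *: gH G q).
      rewrite -evEE -ev_star -!evM; congr ev; rewrite XXE !mulmxA EiE mul1mx -mulmxA starE' mulmx1 //.
    rewrite evZ /gH ev_block3 !ev0 evZ !ev_scalar block3_scale u0.
    rewrite /E0 conjT_block3 !conjT0 !conjT1 /Jmx diag_block3 !scaler0.
    have hw : 'i / 2 * - (2 * 'i) = 1 :> C.
      rewrite mulrN mulrA mulfVK ?pnatr_eq0 //; have := sqrCi C; rewrite expr2 => ->.
      by rewrite opprK.
    apply: block3_eq => //; rewrite ?scale_scalar_mx ?scalerA ?g_wi ?PP ?hw ?scale1r //.
    - by rewrite rmorphN rmorph1 mulrN1.
    - by rewrite rmorph1 mulr1.
    - by rewrite gevM q0 !mulr0; apply/matrixP => i j; rewrite !mxE mul0rn.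
  have cu : conjT E0 \in unitmx.
    by apply: (proj1 (mulmx1_unit (_ : conjT E0 *m conjT (invmx E0) = 1%:M))); rewrite -conjTM mulVmx // conjT1.
  by rewrite -(mulmxK cu (E0 *m ev XX)) h mulmxK.
have DbXX := DbK Freal DXX sXX XM.
pose wF : germ p := wi * F.
have DwF k : @del R n A k wF = wi * del k F by rewrite delM del_wi mul0r add0r.
have DbwF k : @delb R n A k wF = wi * delb k F by rewrite delbM delb_wi mul0r add0r.
(* Both factors solve opposite differential equations, so the product is constant; at p it is J
   because F vanishes there. *)
have Yc : gexp (Mmx x a r) wF *m XX = csm_ Jmx.
  have -> : Jmx = ev (gexp (Mmx x a r) wF *m XX).
    have wF0 : gev wF = 0 by rewrite rmorphM /= F0 mulr0.
    by rewrite evM ev_gexp evXX wF0 scale0r emx0 mul1mx.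
  apply: const_mx_germ => k.
    rewrite D_mul D_gexp DXX DwF MMc -scalemxAl -scalemxAr mulNr scaleNr !mulmxA gexp_comm.
    by rewrite subrr.
  rewrite Db_mul Db_gexp DbXX DbwF MMc -scalemxAl -scalemxAr mulNr scaleNr !mulmxA gexp_comm.
  by rewrite subrr.
have XXK : XX = gexp (Mmx x a r) (- wi * F) *m csm_ Jmx.
  have := gexpV (Mmx x a r) (- wF); rewrite opprK => h.
  by rewrite -Yc mulmxA mulNr h mul1mx.
have uT k : usubmx (T k) = row_mx (gam F G Gi y' k)%:M (row_mx (ek k : 'rV[A]_n) (wi * del k F)%:M).
  rewrite TE /th /aa block3_scalar block3_scale !block3_add [LHS]col_mxKu.
  rewrite !scaler0 !add0r !addr0; congr row_mx; congr row_mx.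
  by rewrite scale_scalar_mx mulr1.
exists x, a, r, (usubmx EE), P, (fun k => gev (gam F G Gi y' k)), (fun k => gev (wi * del k F)).
split=> //.
- move=> k; rewrite /Db map_usubmx -/(Db k EE) DbEE -mul_usub_mx /thb [usubmx _]col_mxKu !row_mx0 mul0mx //.
- by rewrite /ev map_usubmx -/(ev EE) evEE [LHS]col_mxKu.
split=> [k|].
  rewrite /D map_usubmx -/(D k EE) DEE -mul_usub_mx uT evM evEE /ev !map_row_mx -!/(ev _) !ev_scalar.
  rewrite /E0 /block3 !mul_row_col !mul_mx_row !(mul0mx, mulmx0, mul1mx, mulmx1).
  rewrite !add_row_mx !(add0r, addr0) /ev map_delta_mx -rowE //.
(* phi is the first row of EE, so phi K phi^* is the upper left entry of EE XX EE^* = u [gH], which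
   is zero. *)
rewrite -XXK mul_usub_mx; have -> : star (usubmx EE) = lsubmx (star EE).
  by apply/matrixP => i j; rewrite !mxE.
rewrite mulmx_lsub mul_usub_mx.
have -> : EE *m XX *m star EE = u *: gH G q.
  by rewrite XXE !mulmxA EiE mul1mx -mulmxA starE' mulmx1.
rewrite /gH block3_scale [usubmx _]col_mxKu row_mxKl scaler0 //.
Qed.
End NormalFormGerm.

(** * Holomorphic functions and the implicit function theorem *)

Section Holo.
Context {R : realType}.
Local Notation C := (Cplx R).

(* The Cauchy-Riemann equations in coordinate-free form. *)
Definition holo (n : nat) (U : set 'cV[C]_n) (f : 'cV[C]_n -> C) : Prop :=
  smooth_on U f /\ forall z v, U z -> rderive f ('i *: v) z = 'i * rderive f v z.
Lemma isd_chain (n m : nat) (W : set 'cV[C]_m) (f : 'cV[C]_m -> C) (psi : 'cV[C]_n -> 'cV[C]_m)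
    (v z : 'cV[C]_n) (d : 'cV[C]_m) : open W -> W (psi z) -> Ck 1 W f ->
  (forall j, isd (fun w => psi w j 0) v z (d j 0)) -> isd (fun w => f (psi w)) v z (rderive f d (psi z)).
Proof. by move=> oW Wz hf hd; rewrite (rderive_rc d oW hf Wz); exact: (isd_comp oW Wz hf hd). Qed.
Lemma rderive_eqf (n : nat) (f g : 'cV[C]_n -> C) v z : f =1 g -> rderive f v z = rderive g v z.
Proof. by move=> /funext ->. Qed.
Lemma rderive_eqv (n : nat) (f : 'cV[C]_n -> C) v w z : v = w -> rderive f v z = rderive f w z.
Proof. by move=> ->. Qed.

Section Fixed.
Context {n : nat}.
Implicit Types (U : set 'cV[C]_n) (f g : 'cV[C]_n -> C).
Lemma holo_dzbar U f k z : holo U f -> U z -> dzbar k f z = 0.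
Proof. by move=> [_ h] Uz; rewrite /dzbar h // mulrA sqrCi1 mulN1r subrr mulr0. Qed.
Lemma holoP U f : open U -> smooth_on U f -> (forall k z, U z -> dzbar k f z = 0) -> holo U f.
Proof.
move=> oU sf h; split=> // z v Uz; rewrite !(rderive_dz _ oU (sf 1%N) Uz) mulr_sumr.
by apply: eq_bigr => j _; rewrite h // !mulr0 !addr0 mxE mulrA.
Qed.
Lemma holomorphic_holo U (f : 'cV[C]_n -> 'cV[C]_n) : open U ->
  holomorphic_on U f <-> forall j, holo U (fun z => f z j 0).
Proof.
move=> oU; split=> h j; first by have [sf df] := h j; exact: holoP.
by split; [case: (h j)|move=> k z; apply: holo_dzbar; exact: h].
Qed.
Lemma holo_isd U f v z : holo U f -> U z -> isd f v z (rderive f v z).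
Proof. by move=> [sf _] Uz; exact: Ck_isd (sf 1%N) Uz. Qed.
Lemma holo_sub U U' f : U' `<=` U -> holo U f -> holo U' f.
Proof. by move=> h [sf cr]; split=> [k|z v Uz]; [exact: Ck_sub (sf k)|apply: cr; exact: h]. Qed.
Lemma holo_ext U f g : open U -> (forall z, U z -> f z = g z) -> holo U f -> holo U g.
Proof.
move=> oU fg [sf cr]; split=> [k|z v Uz]; first exact: Ck_ext (sf k).
have e w : rderive f w z = rderive g w z.
  by apply: (rderive_open_eq oU Uz fg); apply: isd_rderivable; exact: Ck_isd (sf 1%N) Uz.
by rewrite -!e cr.
Qed.
Lemma holo_cst U (c : C) : open U -> holo U (fun=> c).
Proof.
by move=> oU; split=> [k|z v _]; [exact: Ck_cst|rewrite !(isd_rderive (isd_cst _ _ _)) mulr0].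
Qed.
Lemma holo_coord U j : open U -> holo U (fun w => w j 0).
Proof.
by move=> oU; split=> [k|z v _]; [exact: Ck_coord|rewrite !(isd_rderive (isd_coord _ _ _)) mxE].
Qed.
Lemma holo_mul U f g : open U -> holo U f -> holo U g -> holo U (fun w => f w * g w).
Proof.
move=> oU hf hg; split=> [k|z v Uz]; first by apply: Ck_mul => //; [exact: hf.1|exact: hg.1].
have h w := isdM (holo_isd w hf Uz) (holo_isd w hg Uz).
by rewrite !(isd_rderive (h _)) hf.2 // hg.2 //; ring.
Qed.
Lemma holo_sum U (I : finType) (f : I -> 'cV[C]_n -> C) : open U ->
  (forall i, holo U (f i)) -> holo U (fun w => \sum_i f i w).
Proof.
move=> oU hf; split=> [k|z v Uz]; first by apply: Ck_sum => // i _; exact: (hf i).1.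
have h w := isd_sum (fun i => holo_isd w (hf i) Uz).
rewrite !(isd_rderive (h _)) mulr_sumr; apply: eq_bigr => i _; exact: (hf i).2.
Qed.
Lemma holo_inv U f : open U -> (forall z, U z -> f z != 0) -> holo U f -> holo U (fun w => (f w)^-1).
Proof.
move=> oU f0 hf; split=> [k|z v Uz]; first by apply: Ck_inv => //; exact: hf.1.
have h w := isdV (holo_isd w hf Uz) (f0 z Uz).
by rewrite !(isd_rderive (h _)) hf.2 //; ring.
Qed.
Lemma holo_emx U (N : nat) (B : 'M[C]_N.+1) f i j : open U -> holo U f -> holo U (fun w => emx (f w *: B) i j).
Proof.
move=> oU hf; split=> [k|z v Uz]; first by apply: Ck_emx => //; exact: hf.1.
by rewrite !(isd_rderive (isd_emx B i j (holo_isd _ hf Uz))) hf.2 // mulrA.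
Qed.
Lemma holo_mulmx U (a b c : nat) (f : 'cV[C]_n -> 'M[C]_(a, b)) (g : 'cV[C]_n -> 'M[C]_(b, c)) i j : open U ->
  (forall i j, holo U (fun w => f w i j)) -> (forall i j, holo U (fun w => g w i j)) ->
  holo U (fun w => (f w *m g w) i j).
Proof.
move=> oU hf hg; apply: (holo_ext (f := fun w => \sum_l f w i l * g w l j)) => //.
  by move=> z _; rewrite mxE.
by apply: holo_sum => // l; exact: holo_mul.
Qed.
Lemma holo_rd0 U f z : holo U f -> U z -> rderive f 0 z = 0.
Proof.
move=> hf Uz; have := hf.2 z 0 Uz; rewrite scaler0 => /eqP.
rewrite -subr_eq0 -{1}[rderive f 0 z]mul1r -mulrBl mulf_eq0 => /orP[|/eqP //].
by rewrite subr_eq0 => /eqP h; have := congr1 ip h; rewrite ip1 ip_i => /esym/eqP; rewrite oner_eq0.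
Qed.
End Fixed.
Lemma holo_comp (n m : nat) (U : set 'cV[C]_n) (W : set 'cV[C]_m) f (psi : 'cV[C]_n -> 'cV[C]_m) :
  open U -> open W -> (forall z, U z -> W (psi z)) -> (forall j, holo U (fun w => psi w j 0)) ->
  holo W f -> holo U (fun w => f (psi w)).
Proof.
move=> oU oW UW hp hf; split=> [k|z v Uz].
  by apply: (Ck_comp oU oW UW) => [j|]; [exact: (hp j).1|exact: hf.1].
have h w : isd (fun w => f (psi w)) w z (rderive f (\col_j rderive (fun y => psi y j 0) w z) (psi z)).
  by apply: (isd_chain oW (UW z Uz) (hf.1 1%N)) => j; rewrite mxE; exact: holo_isd Uz.
rewrite !(isd_rderive (h _)) -hf.2; last exact: UW.
apply: rderive_eqv; apply/matrixP => j l; rewrite ord1 scalemxE ![(\col__ _) _ _]mxE; exact: (hp j).2.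
Qed.
Lemma jacobian_unit (n : nat) (U : set 'cV[C]_n) (f : 'cV[C]_n -> 'cV[C]_n) z : open U -> holomorphic_on U f -> U z ->
  (forall v, (forall i, rderive (fun w => f w i 0) v z = 0) -> v = 0) -> Pilot.Defs.jacobian f z \in unitmx.
Proof.
move=> oU hf Uz h; rewrite -unitmx_tr -row_free_unit -kermx_eq0; apply/rowV0P => v /sub_kermxP hv.
have h0 : Pilot.Defs.jacobian f z *m v^T = 0 by apply: trmx_inj; rewrite trmx_mul trmxK hv trmx0.
have /(congr1 trmx) : v^T = 0 by apply: h => i; rewrite (holo_rderive _ _ oU hf Uz) h0 mxE.
by rewrite trmxK trmx0.
Qed.
(** The inverse function theorem for (z, w) -> (z, f (z, w)), whose Jacobian is invertible because f
    has nonzero derivative in w; g is the last component of the inverse at (z, 0). *)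
Lemma implicit_function (n : nat) (U : set 'cV[C]_(n + 1)) (f : 'cV[C]_(n + 1) -> C) (a : 'cV[C]_n) (b : C) :
  open U -> U (col_mx a b%:M) -> holo U f -> f (col_mx a b%:M) = 0 ->
  rderive f (col_mx 0 1%:M) (col_mx a b%:M) != 0 ->
  exists (V : set 'cV[C]_n) (g : 'cV[C]_n -> C), [/\ open V, V a, holo V g, g a = b &
    forall z, V z -> f (col_mx z (g z)%:M) = 0].
Proof.
move=> oU Ua hf f0 df; pose x0 : 'cV[C]_(n + 1) := col_mx a b%:M.
have [Phi PhiE] : exists Phi : 'cV[C]_(n + 1) -> 'cV[C]_(n + 1), forall x, Phi x = col_mx (usubmx x) (f x)%:M by eexists.
have Phil x (i : 'I_n) : Phi x (lshift 1 i) 0 = x (lshift 1 i) 0 by rewrite PhiE col_mxEu mxE.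
have Phir x (i : 'I_1) : Phi x (rshift n i) 0 = f x by rewrite PhiE col_mxEd ord1 mxE eqxx.
have hPhi : holomorphic_on U Phi.
  apply/(holomorphic_holo _ oU) => j; case: (split_ordP j) => i ->.
    by apply: holo_ext (holo_coord (lshift 1 i) oU) => // z _; rewrite Phil.
  by apply: holo_ext hf => // z _; rewrite Phir.
have uJ : Pilot.Defs.jacobian Phi x0 \in unitmx.
  apply: (jacobian_unit oU hPhi Ua) => v hv.
  have vu : usubmx v = 0.
    apply/matrixP => i j; rewrite ord1 mxE [RHS]mxE -(hv (lshift 1 i)).
    rewrite -(isd_rderive (isd_coord (lshift 1 i) v x0)); apply: rderive_eqf => x; exact/esym/Phil.
  have hr : rderive f v x0 = 0.
    by rewrite -(hv (rshift n 0)); apply: rderive_eqf => x; exact/esym/Phir.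
  have vE : v = v (rshift n 0) 0 *: col_mx 0 1%:M.
    rewrite -{1}[v]vsubmxK vu scale_col_mx scaler0; congr col_mx.
    by apply/matrixP => i j; rewrite !ord1 !mxE eqxx mulr1.
  have hlin c : rderive f (c *: col_mx 0 1%:M) x0 = c * rderive f (col_mx 0 1%:M) x0.
    have e w : rderive f w x0 = (Pilot.Defs.jacobian Phi x0 *m w) (rshift n 0) 0.
      rewrite -(holo_rderive _ _ oU hPhi Ua); apply: rderive_eqf => x; exact/esym/Phir.
    by rewrite !e -scalemxAr mxE.
  rewrite vE hlin in hr; move/eqP: hr; rewrite mulf_eq0 (negPf df) orbF => /eqP hr.
  by rewrite vE hr scale0r.
have [V0 [W [G [oV oW [Va VU] [c1 c2 _ hG]]]]] := inverse_function oU Ua hPhi uJ.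
pose inc (z : 'cV[C]_n) : 'cV[C]_(n + 1) := col_mx z 0.
have Phix0 : Phi x0 = inc a.
  rewrite PhiE f0 col_mxKu /inc; congr col_mx; apply/matrixP => i j; rewrite !mxE mul0rn //.
have hinc (S : set 'cV[C]_n) : open S -> forall j, holo S (fun z => inc z j 0).
  move=> oS j; case: (split_ordP j) => i ->.
    by apply: holo_ext (holo_coord i oS) => // z _; rewrite col_mxEu.
  by apply: holo_ext (holo_cst 0 oS) => // z _; rewrite col_mxEd mxE.
pose V : set 'cV[C]_n := [set z | W (inc z)].
have oVV : open V.
  rewrite openE => z Wz; have /nearvP[r r0 hr] := open_near oW Wz.
  apply/nearvP; exists r => // w hw; apply: hr.
  have -> : inc w - inc z = inc (w - z) by rewrite /inc opp_col_mx add_col_mx subr0.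
  apply: le_lt_trans hw; rewrite /vn big_split_ord /= [X in _ + X]big1 => [|i _].
    by rewrite addr0; apply: ler_sum => i _; rewrite col_mxEu.
  by rewrite col_mxEd mxE cn0.
have Va' : V a by rewrite /V /= -Phix0; exact: (c1 x0 Va).1.
exists V, (fun z => G (inc z) (rshift n 0) 0); split=> //.
- have hG' := (holomorphic_holo G oW).1 hG (rshift n 0).
  exact: (holo_comp oVV oW (fun z h => h) (hinc V oVV) hG').
- by rewrite -Phix0 (c1 x0 Va).2 col_mxEd mxE eqxx.
- move=> z Vz; have [_ h] := c2 _ Vz.
  have hu : usubmx (G (inc z)) = z by have := congr1 usubmx h; rewrite PhiE /inc !col_mxKu.
  have hd : f (G (inc z)) = 0.
    have := congr1 (fun x : 'cV[C]_(n + 1) => x (rshift n 0) 0) h; rewrite Phir => ->.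
    by rewrite col_mxEd mxE.
  rewrite -[RHS]hd; congr f; rewrite -[RHS]vsubmxK hu; congr col_mx.
  by apply/matrixP => i j; rewrite !ord1 !mxE eqxx.
Qed.
End Holo.

(** * The effect of multiplying phi by a one-parameter group *)

Section Gauge.
Context {R : realType} {n : nat}.
Local Notation C := (Cplx R).
Local Notation N := (1 + (n + 1))%N.
Definition nrow (w : 'cV[C]_n) : 'rV[C]_N := row_mx 1%:M (row_mx w^T 0).
Lemma J_left (u w c : 'M[C]_1) b e f :
  block3 0 0 u 0 1%:M 0 w 0 0 *m block3 0 b c 0 e f 1%:M 0 0 = block3 u 0 0 0 e f 0 (w *m b) (w *m c) :> 'M[C]_N.
Proof. by rewrite block3_mul !(mul0mx, mulmx0, mul1mx, mulmx1, add0r, addr0). Qed.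
Lemma J_right (u w g : 'M[C]_1) d e h :
  block3 0 0 1%:M d e 0 g h 0 *m block3 0 0 u 0 1%:M 0 w 0 0 = block3 w 0 0 0 e (d *m u) 0 h (g *m u) :> 'M[C]_N.
Proof. by rewrite block3_mul !(mul0mx, mulmx0, mul1mx, mulmx1, add0r, addr0). Qed.
(** [Mmx] is skew for the Hermitian form J. Hence J carries the conjugate transpose of an
    exponential of M into an exponential of M again. *)
Lemma Mmx_J (x a : 'I_n -> R) (r : R) : Jmx *m conjT (Mmx x a r) = - (Mmx x a r *m Jmx).
Proof.
have rT : conjT (rcol a) = (rcol a)^T by apply/matrixP => i j; rewrite conjTE !mxE conj_toC.
have rT' : conjT (rcol a)^T = rcol a by rewrite -rT conjTK.
have dT : conjT (rdiag x) = rdiag x.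
  apply/matrixP => i j; rewrite conjTE !mxE eq_sym; case: eqP => [->|_]; last by rewrite !mulr0n conjC0.
  by rewrite !mulr1n conj_toC.
have ci : Num.conj (- (2 * 'i) : C) = 2 * 'i.
  rewrite rmorphN /= rmorphM /= conjCi rmorph_nat mulrN opprK //.
have h : 'i / 2 * (2 * 'i) = -1 :> C.
  by rewrite mulrA mulfVK ?pnatr_eq0 //; have := sqrCi C; rewrite expr2.
rewrite /Mmx conjT_block3 !conjTZ ci conjCi !conjT0 conjT1 conjT_scalar conj_toC rT rT' dT /Jmx J_left J_right block3_opp.
apply: block3_eq; rewrite ?oppr0 //.
- by rewrite raddfN.
- by rewrite scaleNr.
- by rewrite mul_mx_scalar scalerA mulrNN h scaleN1r opprK.
- by rewrite mul_scalar_mx scalerA h scaleN1r.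
- by rewrite -!scalar_mxM mulrN raddfN opprK mulrC.
Qed.
Lemma mulmx_swap (phi : 'rV[C]_N) (Eg Em Ec En Et J : 'M[C]_N) (v : 'cV[C]_N) : J *m Ec = En *m J ->
  Eg *m (Em *m En) = Et -> phi *m Eg *m (Em *m J) *m (Ec *m v) = phi *m (Et *m J) *m v.
Proof. by move=> e <-; rewrite !mulmxA -(mulmxA _ J) e !mulmxA. Qed.
(** By the skewness all three exponentials are powers of one group and their exponents add up. For t
    = 2iF the new exponent is 2i (F - Im g). *)
Lemma gauge (M : 'M[C]_N) (phi : 'rV[C]_N) (g t : C) : Jmx *m conjT M = - (M *m Jmx) ->
  phi *m emx (g *: M) *m (emx ((t - g + Num.conj g) *: M) *m Jmx) *m conjT (phi *m emx (g *: M)) =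
  phi *m (emx (t *: M) *m Jmx) *m conjT phi.
Proof.
move=> hJ; rewrite conjTM emx_conjT conjTZ.
have e : Jmx *m emx (Num.conj g *: conjT M) = emx (- Num.conj g *: M) *m Jmx :> 'M[C]_N.
  by apply: emx_intertwine; rewrite -scalemxAr hJ -scalemxAl scalerN scaleNr.
apply: (mulmx_swap _ _ e); rewrite -!emxD.
by have -> : - Num.conj g + (t - g + Num.conj g) + g = t by ring.
Qed.
End Gauge.

(** * Normalizing phi to (1, zeta, 0) *)

Section NormalCoordinates.
Context {R : realType} {n : nat} {p : 'cV[Cplx R]_n}.
Local Notation C := (Cplx R).
Local Notation A := (germ_dring p).
Local Notation wi := (@wi R n A).
Local Notation N := (1 + (n + 1))%N.
Lemma holo_germ (x : germ p) : (forall k, gdelb k x = 0) -> exists2 U, open_nbhs p U & holo U x.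
Proof.
move=> h; have [U [oU Up] sx] := germ_sm x.
have z0 : neq p (0 : germ p) (fun=> 0) by rewrite -(rmorph0 (gcst p)); exact: gcstE.
have h' : \forall z \near p, forall k : 'I_n, dzbar k x z = 0.
  apply: near_forall => k; have e := gdelbE k x; rewrite h in e.
  by apply: nearS (nearI z0 e) => z [<- <-].
have [W [oW Wp] hW] := near_open h'.
exists (U `&` W); first by split; [exact: openI|split].
apply: holoP; [exact: openI| |by move=> k z [_ /hW]; exact].
by move=> k; apply: Ck_sub (sx k) => z [].
Qed.
Lemma holo_finite (I : finType) (f : I -> 'cV[C]_n -> C) : (forall i, exists2 U, open_nbhs p U & holo U (f i)) ->
  exists2 U, open_nbhs p U & forall i, holo U (f i).
Proof.
move=> h; have h' i : exists S, open_nbhs p S /\ holo S (f i) by have [U h1 h2] := h i; exists U.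
have [S hS] := boolp.choice h'.
have hn : \forall z \near p, forall i, S i z by apply: near_forall => i; exact: open_nbhs_nbhs (hS i).1.
have [W oW hW] := near_open hn; exists W => // i; apply: holo_sub (hS i).2 => z /hW; exact.
Qed.
Variables (x a : 'I_n -> R) (r : R) (F : germ p) (phi : 'rV[A]_N) (P : 'M[C]_n) (al be : 'I_n -> C).
Let M := Mmx x a r.
Hypothesis Pu : P \in unitmx.
Hypothesis Dbphi : forall k, Db k phi = 0.
Hypothesis ephi : ev phi = row_mx 1%:M (row_mx 0 0).
Hypothesis Dphi : forall k, ev (D k phi) = row_mx (al k)%:M (row_mx (row k P) (be k)%:M).
Hypothesis null : phi *m (gexp (Mmx x a r) (- wi * F : A) *m csm_ Jmx) *m star phi = 0.
(** The implicit function theorem provides a holomorphic g for which the last entry of phi exp (g M)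
    vanishes; dividing by the first entry, which is 1 at p, gives (1, zeta, 0). By [gauge] the
    potential changes by Im g. *)
Lemma normal_coordinates : exists (U : set 'cV[C]_n) (zeta : 'cV[C]_n -> 'cV[C]_n) (g : 'cV[C]_n -> C),
  [/\ open_nbhs p U, holomorphic_on U zeta /\ zeta p = 0, Pilot.Defs.jacobian zeta p \in unitmx,
      holo U g /\ g p = 0 &
      forall z, U z -> nrow (zeta z) *m (emx ((2 * 'i * (F z - toC (ip (g z)))) *: M) *m Jmx) *m conjT (nrow (zeta z)) = 0].
Proof.
pose ph (z : 'cV[C]_n) : 'rV[C]_N := \row_j (phi 0 j : germ p) z.
have [U1 [oU1 U1p] hU1] : exists2 U, open_nbhs p U & forall j : 'I_N, holo U (phi 0 j : germ p).
  apply: holo_finite => j; apply: holo_germ => k.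
  have /matrixP/(_ 0 j) := Dbphi k; rewrite !mxE.
  by rewrite /delb /cj /del /= -gdelb_conj.
have hph i j : holo U1 (fun z => ph z i j).
  by rewrite ord1; apply: holo_ext (hU1 j) => // z _; rewrite mxE.
have php : ph p = row_mx 1%:M (row_mx 0 0).
  by rewrite -ephi; apply/matrixP => i j; rewrite ord1 [LHS]mxE evE.
(* At p the row phi M is the last basis vector, so the derivative of the last entry with respect to
   g is 1. *)
have phM : ph p *m M = row_mx 0 (row_mx 0 1%:M).
  by rewrite php /M /Mmx /block3 mul_row_col row_mx0 mul0mx addr0 mul1mx.
pose last : 'I_N := rshift 1 (rshift n 0); pose mid (i : 'I_n) : 'I_N := rshift 1 (lshift 1 i).
have rlast (u : 'M[C]_1) (v : 'rV[C]_n) (w : 'M[C]_1) : row_mx u (row_mx v w) 0 last = w 0 0.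
  by rewrite /last !row_mxEr.
have rmid (u : 'M[C]_1) (v : 'rV[C]_n) (w : 'M[C]_1) i : row_mx u (row_mx v w) 0 (mid i) = v 0 i.
  by rewrite /mid row_mxEr row_mxEl.
have oO : open [set y : 'cV[C]_(n + 1) | U1 (usubmx y)].
  rewrite openE => y Uy; have /nearvP[e e0 he] := open_near oU1 Uy.
  apply/nearvP; exists e => // w hw; apply: he; apply: le_lt_trans hw.
  rewrite /vn [leRHS]big_split_ord /=; apply: (@le_trans _ _ (\sum_(i < n) cn ((w - y) (lshift 1 i) 0))).
    by apply: ler_sum => i _; rewrite !addmxE !oppmxE ![usubmx _ _ _]mxE.
  by rewrite lerDl; apply: sumr_ge0 => i _; exact: cn_ge0.
have hus (S : set 'cV[C]_(n + 1)) j : open S -> holo S (fun y => usubmx y j 0).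
  by move=> oS; apply: holo_ext (holo_coord (lshift 1 j) oS) => // z _; rewrite mxE.
have hds (S : set 'cV[C]_(n + 1)) : open S -> holo S (fun y => dsubmx y 0 0).
  by move=> oS; apply: holo_ext (holo_coord (rshift n 0) oS) => // z _; rewrite mxE.
(* The last entry of phi exp (g M) as a function of z and the unknown value of g. *)
pose f (y : 'cV[C]_(n + 1)) : C := (ph (usubmx y) *m emx (dsubmx y 0 0 *: M)) 0 last.
have hphu i j : holo [set y : 'cV[C]_(n + 1) | U1 (usubmx y)] (fun y => ph (usubmx y) i j).
  exact: (holo_comp oO oU1 (fun z h => h) (fun k => hus _ k oO) (hph i j)).
have hf : holo [set y : 'cV[C]_(n + 1) | U1 (usubmx y)] f.
  by apply: holo_mulmx => // i j; apply: holo_emx => //; exact: hds.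
pose y0 : 'cV[C]_(n + 1) := col_mx p (0 : C)%:M.
have Uy0 : [set y : 'cV[C]_(n + 1) | U1 (usubmx y)] y0 by rewrite /= /y0 col_mxKu.
have dy0 : dsubmx y0 0 0 = 0 by rewrite /y0 col_mxKd mxE mul0rn.
have uy0 : usubmx y0 = p by rewrite /y0 col_mxKu.
have f0 : f y0 = 0 by rewrite /f dy0 uy0 scale0r emx0 mulmx1 php rlast mxE.
have df : rderive f (col_mx 0 1%:M) y0 != 0.
  have e : isd f (col_mx 0 1%:M) y0 (\sum_l (0 * emx (dsubmx y0 0 0 *: M) l last +
      ph (usubmx y0) 0 l * (1 * (M *m emx (dsubmx y0 0 0 *: M)) l last))).
    have e0 : f = fun y => \sum_l ph (usubmx y) 0 l * emx (dsubmx y 0 0 *: M) l last.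
      by apply/funext => y; rewrite /f mxE.
    rewrite e0; apply: isd_sum => l; apply: isdM.
      have Up : U1 (usubmx y0) by rewrite uy0.
      have -> : 0 = rderive (fun z => ph z 0 l) 0 (usubmx y0) :> C by rewrite (holo_rd0 (hph 0 l) Up).
      apply: (isd_chain oU1 Up ((hph 0 l).1 1%N)) => j.
      have := isd_coord (lshift 1 j) (col_mx 0 1%:M) y0.
      rewrite col_mxEu; apply: isd_near; apply/nearvP; exists 1 => // w _; by rewrite mxE.
    apply: isd_emx; have := isd_coord (rshift n 0) (col_mx 0 1%:M) y0.
    rewrite col_mxEd [X in isd _ _ _ X]mxE eqxx; apply: isd_near; apply/nearvP; exists 1 => // w _; by rewrite mxE.
  rewrite (isd_rderive e) dy0 uy0 scale0r emx0 mulmx1.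
  have -> : \sum_l (0 * (1%:M : 'M[C]_N) l last + ph p 0 l * (1 * M l last)) = (ph p *m M) 0 last.
    by rewrite mxE; apply: eq_bigr => l _; rewrite mul0r add0r mul1r.
  by rewrite phM rlast mxE eqxx oner_eq0.
have [V [g [oV Vp hg gp hfg]]] := implicit_function oO Uy0 hf f0 df.
pose pt z := ph z *m emx (g z *: M).
have oI := openI oU1 oV.
have hpt i j : holo (U1 `&` V) (fun z => pt z i j).
  apply: holo_mulmx => // [k l|k l]; first by apply: holo_sub (hph k l) => z [].
  by apply: holo_emx => //; apply: holo_sub hg => z [].
have ptl z : V z -> pt z 0 last = 0.
  by move=> /hfg; rewrite /f col_mxKu col_mxKd [(g z)%:M _ _]mxE eqxx mulr1n.
have ptp : pt p = ph p by rewrite /pt gp scale0r emx0 mulmx1.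
have i00 : lshift (n + 1) 0 = 0 :> 'I_N by exact: val_inj.
have pt0 : pt p 0 0 = 1 by rewrite ptp php -i00 row_mxEl mxE eqxx.
have /near_open[W [oW Wp] hW] : \forall z \near p, pt z 0 0 != 0.
  apply: cont_neq0; last by rewrite pt0 oner_eq0.
  by have [s _] := hpt 0 0; exact: (Ck_cont (s 0%N) (conj U1p Vp)).
have nf : \forall z \near p, ph z *m (emx ((2 * 'i * F z) *: M) *m Jmx) *m conjT (ph z) = 0.
  have h1 : rep (fun z => 2 * 'i * (F : germ p) z) (- wi * F : A).
    rewrite /wi -csN opprK; apply: (rep_mul (rep_cs (2 * 'i)) (neq_refl p F)).
  have r1 i j : rep (fun z => ph z i j) (phi i j : germ p).
    by rewrite ord1; apply/nearvP; exists 1 => // z _; rewrite mxE.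
  have r2 i j : rep (fun z => conjT (ph z) i j) (star phi i j).
    rewrite starE; apply: rep_eqf (rep_conj (r1 j i)) => z; by rewrite conjTE.
  have := rep_mulmx (rep_mulmx r1 (rep_mulmx (fun i j => rep_gexp M i j h1) (rep_csm Jmx))) r2 0 0.
  rewrite null mxE; have z0 : neq p (0 : germ p) (fun=> 0) by rewrite -(rmorph0 (gcst p)); exact: gcstE.
  move=> h; apply: nearS (nearI z0 h) => z [e1 e2].
  by apply/matrixP => i j; rewrite !ord1 -e2 e1 mxE.
have [W' [oW' W'p] hW'] := near_open nf.
pose U := (U1 `&` V) `&` (W `&` W').
have oU : open U by apply: openI oI _; exact: openI.
have Up : U p by [].
(* The equation is homogeneous in phi up to a factor of squared modulus, so dividing by the nonzero
   first entry preserves it. *)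
pose zeta z : 'cV[C]_n := \col_i (pt z 0 (mid i) * (pt z 0 0)^-1).
have hptU i j : holo U (fun z => pt z i j) by apply: holo_sub (hpt i j) => z [].
have pz (z : 'cV[C]_n) : U z -> pt z 0 0 != 0 by move=> [_ [/hW]].
have hz : holomorphic_on U zeta.
  apply/(holomorphic_holo _ oU) => j.
  apply: (holo_ext (f := fun z => pt z 0 (mid j) * (pt z 0 0)^-1)) => //; first by move=> z _; rewrite [RHS]mxE.
  by apply: holo_mul => //; exact: holo_inv.
have zp : zeta p = 0.
  by apply/matrixP => i j; rewrite ord1 [LHS]mxE ptp php rmid [(0 : 'rV[C]_n) _ _]mxE mul0r [RHS]mxE.
exists U, zeta, g; split=> //.
(* At p the middle entries of phi and of phi M vanish and the first entry of phi is 1, so the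
   derivative of zeta in direction v is v^T P, and P is invertible. *)
- apply: (jacobian_unit oU hz Up) => v hv.
  have dpt j : rderive (fun z => pt z 0 j) v p = \sum_k v k 0 * ev (D k phi) 0 j + rderive g v p * (ph p *m M) 0 j.
    have e : isd (fun z => pt z 0 j) v p (\sum_l (rderive (fun z => ph z 0 l) v p * emx (g p *: M) l j +
        ph p 0 l * (rderive g v p * (M *m emx (g p *: M)) l j))).
      have e0 : (fun z => pt z 0 j) = fun z => \sum_l ph z 0 l * emx (g z *: M) l j.
        by apply/funext => z; rewrite /pt mxE.
      rewrite e0; apply: isd_sum => l; apply: isdM; first exact: (holo_isd v (hph 0 l) U1p).
      by apply: isd_emx; exact: (holo_isd v hg Vp).
    rewrite (isd_rderive e) gp scale0r emx0 mulmx1 big_split /=; congr (_ + _); last first.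
      by rewrite mxE mulr_sumr; apply: eq_bigr => l _; rewrite mulrCA.
    rewrite (bigD1 j) //= big1 => [|l /negPf lj]; last by rewrite mxE lj mulr0.
    rewrite addr0 mxE eqxx mulr1 (rderive_dz _ oU1 ((hph 0 j).1 1%N) U1p).
    apply: eq_bigr => k _; rewrite (holo_dzbar k (hph 0 j) U1p) mulr0 addr0; congr (_ * _).
    rewrite evE DE; have r1 : rep (fun z => ph z 0 j) (phi 0 j : germ p).
      by apply/nearvP; exists 1 => // z _; rewrite mxE.
    by rewrite -(rep_p (rep_dz k r1)).
  have hm i : \sum_k v k 0 * P k i = 0.
    have := hv i; have e : isd (fun z => zeta z i 0) v p (rderive (fun z => pt z 0 (mid i)) v p * (pt p 0 0)^-1
        + pt p 0 (mid i) * (- rderive (fun z => pt z 0 0) v p / pt p 0 0 ^+ 2)).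
      have e0 : (fun z => zeta z i 0) = fun z => pt z 0 (mid i) * (pt z 0 0)^-1.
        by apply/funext => z; rewrite [LHS]mxE.
      rewrite e0; apply: isdM; first exact: (holo_isd v (hptU 0 (mid i)) Up).
      have := isdV (holo_isd v (hptU 0 0) Up) (pz p Up); exact.
    rewrite (isd_rderive e) pt0 ptp php rmid [(0 : 'rV[C]_n) _ _]mxE mul0r addr0 invr1 mulr1 dpt phM rmid.
    rewrite [(0 : 'rV[C]_n) _ _]mxE mulr0 addr0 => h; rewrite -[RHS]h; apply: eq_bigr => k _.
    by rewrite Dphi rmid [row _ _ _ _]mxE.
  have h0 : v^T *m P = 0 by apply/matrixP => i j; rewrite ord1 [LHS]mxE [RHS]mxE -[RHS](hm j); apply: eq_bigr => k _; rewrite mxE.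
  by apply: trmx_inj; rewrite -[v^T](mulmxK Pu) h0 mul0mx trmx0.
- by split=> //; apply: holo_sub hg => z [[]].
- move=> z Uz; have [[U1z Vz] [_ /hW' hn]] := Uz.
  have ptE : pt z = pt z 0 0 *: nrow (zeta z).
    apply/matrixP => i j; rewrite ord1 [RHS]mxE; case: (split_ordP j) => j' ->.
      by rewrite ord1 row_mxEl [1%:M _ _]mxE eqxx mulr1 i00.
    rewrite row_mxEr; case: (split_ordP j') => k ->.
      by rewrite row_mxEl [(zeta z)^T _ _]mxE [zeta z _ _]mxE mulrC mulfVK // pz.
    by rewrite row_mxEr ord1 [(0 : 'rV[C]_1) _ _]mxE mulr0 -[RHS](ptl z Vz).
  have gz := gauge (ph z) (g z) (2 * 'i * F z) (Mmx_J x a r); rewrite -/M hn -/(pt z) ptE in gz.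
  have e : 2 * 'i * F z - g z + Num.conj (g z) = 2 * 'i * (F z - toC (ip (g z))).
    rewrite [in LHS](cplxE (g z)) rmorphD /= rmorphM /= conjCi !conj_toC; ring.
  rewrite e conjTZ -!scalemxAl -!scalemxAr !scalerA in gz.
  move/eqP: gz; rewrite scaler_eq0 => /orP[|/eqP //].
  by rewrite mulf_eq0 conjC_eq0 orbb (negPf (pz z Uz)).
Qed.
End NormalCoordinates.

(** * Germs satisfying the normal equation and their invariants *)

Section Represented.
Context {R : realType} {n : nat} {p : 'cV[Cplx R]_n}.
Local Notation C := (Cplx R).
Local Notation A := (germ_dring p).
Local Notation wi := (@wi R n A).
Local Notation N := (1 + (n + 1))%N.
Definition Kmx (x a : 'I_n -> R) (r : R) (F : A) : 'M[A]_N := gexp (Mmx x a r) (- wi * F : A) *m csm_ Jmx.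
Definition grow (z : 'I_n -> germ p) : 'rV[A]_N := row_mx 1%:M (row_mx (\row_i (z i : A)) 0).

Section One.
Variables (x a : 'I_n -> R) (r : R) (F : A) (z : 'I_n -> germ p).
Local Notation M := (csm_ (Mmx x a r) : 'M[A]_N).
Local Notation K := (Kmx x a r F).
Local Notation phi := (grow z).
Hypothesis Freal : cj F = F.
Hypothesis Dbz : forall k i, @delb R n A k (z i) = 0.
Lemma D_csm (b c : nat) (B : 'M[C]_(b, c)) k : D k (csm_ B : 'M[A]_(b, c)) = 0.
Proof. by apply/matrixP => i j; rewrite DE !mxE del_cs. Qed.
Lemma Db_csm (b c : nat) (B : 'M[C]_(b, c)) k : Db k (csm_ B : 'M[A]_(b, c)) = 0.
Proof. by apply/matrixP => i j; rewrite DbE !mxE delb_cs. Qed.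
Lemma star_csm (b c : nat) (B : 'M[C]_(b, c)) : star (csm_ B : 'M[A]_(b, c)) = csm_ (conjT B).
Proof. by apply/matrixP => i j; rewrite starE !mxE cj_cs. Qed.
Lemma csm_mul (b c d : nat) (B : 'M[C]_(b, c)) (B' : 'M[C]_(c, d)) : csm_ (B *m B') = csm_ B *m csm_ B' :> 'M[A]_(b, d).
Proof. exact: map_mxM. Qed.
Lemma csm_opp (b c : nat) (B : 'M[C]_(b, c)) : csm_ (- B) = - csm_ B :> 'M[A]_(b, c).
Proof. exact: map_mxN. Qed.
Lemma D_Kmx k : D k K = (- wi * del k F) *: (M *m K).
Proof.
rewrite /Kmx D_mul D_csm mulmx0 addr0 D_gexp -scalemxAl mulmxA; congr (_ *: _).
by rewrite delM delN del_wi oppr0 mul0r add0r.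
Qed.
Lemma JM : csm_ Jmx *m star M = - (M *m csm_ Jmx).
Proof. by rewrite star_csm -!csm_mul Mmx_J csm_opp. Qed.
Lemma Kmx_star : star K = K.
Proof.
rewrite /Kmx star_mul star_gexp star_csm Jmx_herm.
have -> : gconj (- wi * F : A) = - (- wi * F) :> A.
  by change (cj (- wi * F : A) = - (- wi * F)); rewrite cjM cjN cj_wi Freal opprK mulNr opprK.
rewrite (@gexp_intertwine _ _ _ _ Jmx (conjT (Mmx x a r)) (- Mmx x a r)); last by rewrite Mmx_J mulNmx.
by rewrite gexpNN.
Qed.
Lemma Kmx_M : K *m star M = - (M *m K).
Proof. by rewrite /Kmx -mulmxA JM mulmxN !mulmxA gexp_comm. Qed.
Lemma Db_grow k : Db k phi = 0.
Proof.
rewrite /grow /Db !map_row_mx -!/(Db _ _) Db_1 Db_zero.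
have -> : Db k (\row_i (z i : A)) = 0 by apply/matrixP => i j; rewrite DbE !mxE Dbz.
by rewrite !row_mx0.
Qed.
Variables (G : 'M[A]_n).
Hypothesis GE : forall k l, G k l = del k (delb l F).
Hypothesis null : bf K phi phi = 0.
(** The structure equations apply to K and the holomorphic row (1, z, 0); nothing is assumed about
    the values of F and z at p, so the statement can be used at every point near the centre. *)
Lemma represented_flat : G \in unitmx -> bf K (phi *m M) phi \is a GRing.unit ->
  forall i j k l, Bo G (invmx G) i j k l = 0.
Proof.
move=> Gu uu; have GGi : G *m invmx G = 1%:M by exact: mulmxV.
have [ga [Q [q [s [al [c sd]]]]]] := structure_equations (D_csm _) (Db_csm _) D_Kmx Kmx_star Kmx_M GE GGi Db_grow null uu.
exact: (Om_flat GGi (sl_om sd)).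
Qed.
Hypothesis F0 : gev F = 0.
Hypothesis z0 : forall i, gev (z i) = 0.
Definition Zmx : 'M[C]_n := \matrix_(k, i) gev (@del R n A k (z i)).
Lemma ev_Kmx : ev K = Jmx.
Proof.
have h : gev (- wi * F : A) = 0.
  by rewrite gevM F0 mulr0.
by rewrite /Kmx evM ev_gexp h scale0r emx0 mul1mx ev_csm.
Qed.
Lemma ev_grow : ev phi = row_mx 1%:M (row_mx 0 0).
Proof.
rewrite /grow /ev !map_row_mx -!/(ev _) ev1 ev0; congr row_mx; congr row_mx.
by apply/matrixP => i j; rewrite evE !mxE z0.
Qed.
Lemma row3M (b c : 'M[C]_1) (v : 'rV[C]_n) : row_mx b (row_mx v c) *m Mmx x a r =
  row_mx (- (2 * 'i) *: (v *m rcol a) + c *m (toC r)%:M) (row_mx ('i *: (v *m rdiag x) + c *m (rcol a)^T) b).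
Proof.
rewrite /Mmx /block3 !mul_row_col !mul_mx_row !add_row_mx.
by rewrite !(mulmx0, mulmx1, add0r, addr0) -!scalemxAr.
Qed.
Lemma row3J (b c b' c' : 'M[C]_1) (v v' : 'rV[C]_n) :
  row_mx b (row_mx v c) *m Jmx *m conjT (row_mx b' (row_mx v' c')) =
  ('i / 2) *: (c *m conjT b' - b *m conjT c') + v *m conjT v'.
Proof.
rewrite /Jmx /block3 !mul_row_col !mul_mx_row !add_row_mx.
rewrite !(mulmx0, mulmx1, add0r, addr0).
have -> : conjT (row_mx b' (row_mx v' c')) = col_mx (conjT b') (col_mx (conjT v') (conjT c')).
  by rewrite /conjT !tr_row_mx !map_col_mx.
rewrite !mul_row_col !mul_mx_scalar -!scalemxAl scaleNr scalerBr.
by rewrite [RHS]addrAC addrA [_ + - _]addrC addrA.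
Qed.
Lemma ev_be : ev (phi *m M) = row_mx 0 (row_mx 0 1%:M).
Proof. by rewrite evM ev_csm ev_grow row3M !(mul0mx, scaler0, addr0). Qed.
Lemma ev_u : gev (bf K (phi *m M) phi) = 'i / 2.
Proof.
rewrite ev_bf ev_Kmx ev_be ev_grow row3J conjT1 !(conjT0, mul0mx, mulmx0, mul1mx, subr0, addr0).
by rewrite !mxE eqxx mulr1.
Qed.
Lemma ev_D_grow k : ev (D k phi) = row_mx 0 (row_mx (row k Zmx) 0).
Proof.
rewrite /grow /D /ev !map_row_mx -!/(D _ _) -!/(ev _) D_1 D_zero !ev0; congr row_mx; congr row_mx.
by apply/matrixP => i j; rewrite evE DE !mxE.
Qed.
Lemma ev_Tw (k : 'I_n) (g : A) : ev (Tw F M k phi - g *: phi) =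
  row_mx (- gev g)%:M (row_mx (row k Zmx) (- gev (wi * del k F))%:M).
Proof.
rewrite /Tw evD evD evN evN evZ evZ ev_D_grow ev_be ev_grow !scale_row_mx !opp_row_mx !add_row_mx.
congr row_mx; last congr row_mx.
- by rewrite scaler0 subr0 sub0r scale_scalar_mx mulr1 raddfN.
- by rewrite !scaler0 !subr0.
- by rewrite scaler0 subr0 sub0r scale_scalar_mx mulr1 raddfN.
Qed.
Lemma g_wiu : gev (wi * bf K (phi *m M) phi) = 1.
Proof.
rewrite gevM ev_u (_ : gev (wi : A) = - (2 * 'i)); last exact: gev_cst.
rewrite mulrC mulrN mulrA mulfVK ?pnatr_eq0 //; have := sqrCi C; rewrite expr2 => ->.
by rewrite opprK.
Qed.
(** The Gram relation [EE] evaluated at p, where K is J and wi u is 1. It does not involve the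
    logarithmic derivative of u, so zero can be put for [ga]. *)
Lemma ev_metric : ev G = Zmx *m conjT Zmx.
Proof.
apply/matrixP => k m; have [E dE] : exists E, forall k, E k = Tw F M k phi - 0 *: phi by eexists.
have hE i : Tw F M i phi = E i + 0 *: phi by rewrite dE subrK.
have evi i := etrans (congr1 (@ev R n p _ _) (dE i)) (ev_Tw i 0).
have h := @EE R n A F M K (Db_csm _) D_Kmx Kmx_star G GE phi Db_grow null (phi *m M) _ (fun=> 0) E erefl erefl hE k m.
have := congr1 (@gev R n p) h; rewrite ev_bf ev_Kmx !evi.
rewrite [gev (_ * G k m)]gevM g_wiu mul1r evE => <-; have g0 : (- gev (0 : A))%:M = 0 :> 'M[C]_1.
  rewrite gev0.
  by rewrite oppr0; apply/matrixP => i j; rewrite !mxE mul0rn.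
rewrite row3J g0 conjT0 mulmx0 mul0mx subr0 scaler0 add0r [LHS]mxE [RHS]mxE.
by apply: eq_bigr => i _; rewrite !conjTE ![row _ _ _ _]mxE.
Qed.
Lemma metric_unit : Zmx \in unitmx -> G \in unitmx.
Proof.
move=> uZ; rewrite unitmx_ev ev_metric unitmx_mul uZ /=.
have h : Zmx *m invmx Zmx = 1%:M by exact: mulmxV.
by have /mulmx1_unit[] : conjT (invmx Zmx) *m conjT Zmx = 1%:M by rewrite -conjTM h conjT1.
Qed.
Lemma u_unit : bf K (phi *m M) phi \is a GRing.unit.
Proof. by rewrite gunitE ev_u mulf_neq0 ?neq0Ci // invr_eq0 pnatr_eq0. Qed.
(** Everything is evaluated at p, where F vanishes and K is J. The orthogonality relations force the
    vectors E k to be (0, row k of Z, 0), and their products with M can be read off from the blocks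
    of [Mmx]; the zero in its corner gives q = 0. *)
Lemma represented_invariants ga Q q s al c : structure_data F M K G (invmx G) phi ga Q q s al c ->
  [/\ gev q = 0, gev c = toC r, ev s *m ev G = 'i *: (Zmx *m rdiag x *m conjT Zmx) &
      \col_k gev (al k) = - (2 * 'i) *: (Zmx *m rcol a)].
Proof.
move=> sd.
have i2 : ('i / 2 : C) != 0 by rewrite mulf_neq0 ?neq0Ci // invr_eq0 pnatr_eq0.
have ga0 k : gev (ga k) = 0.
  have := congr1 (@gev R n p) (sl_be sd k); rewrite ev_bf ev_Kmx ev_Tw ev_be row3J.
  rewrite conjT1 !conjT0 !mulmx0 mulmx1 sub0r addr0 !mxE eqxx !mulr1n opprK.
  rewrite gev0.
  by move/eqP; rewrite mulf_eq0 (negPf i2) => /eqP.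
have evE' k : ev (Tw F M k phi - ga k *: phi) = row_mx 0 (row_mx (row k Zmx) (- gev (wi * del k F))%:M).
  by rewrite ev_Tw ga0 oppr0; congr row_mx; apply/matrixP => i j; rewrite !mxE mul0rn.
have f0 k : gev (wi * del k F) = 0.
  have := congr1 (@gev R n p) (sl_phi sd k); rewrite ev_bf ev_Kmx evE' ev_grow row3J.
  rewrite conjT1 !conjT0 !mulmx0 mulmx1 subr0 addr0 !mxE eqxx !mulr1n.
  rewrite gev0.
  by rewrite mulrN => /eqP; rewrite oppr_eq0 mulf_eq0 (negPf i2) => /eqP.
have evU k : ev (Tw F M k phi - ga k *: phi) = row_mx 0 (row_mx (row k Zmx) 0).
  by rewrite evE' f0 oppr0; congr row_mx; congr row_mx; apply/matrixP => i j; rewrite !mxE mul0rn.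
have evEM k : ev ((Tw F M k phi - ga k *: phi) *m M) =
    row_mx (- (2 * 'i) *: (row k Zmx *m rcol a)) (row_mx ('i *: (row k Zmx *m rdiag x)) 0).
  by rewrite evM ev_csm evU row3M !(mul0mx, addr0).
have q0 : gev q = 0.
  have := congr1 (@gev R n p) (sl_bebe sd); rewrite ev_bf ev_Kmx ev_be row3J gevM g_wiu mul1r => <-.
  by rewrite !conjT0 !mulmx0 mul0mx subr0 addr0 scaler0 mxE.
split=> //.
- have := congr1 (@gev R n p) (sl_c sd); rewrite ev_bf ev_Kmx evM ev_csm ev_be row3M row3J.
  have -> : gev (- c * bf K (phi *m M) phi - wi * q * (wi * bf K (phi *m M) phi * q)) =
     - gev c * ('i / 2) - gev (wi * q) * (gev (wi * bf K (phi *m M) phi) * gev q).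
    by rewrite -ev_u -!gevM -(rmorphN (@gev R n p)) -(rmorphN (@gev R n p)) -gevM -rmorphD.
  rewrite q0 !mulr0 subr0 conjT1 !conjT0 !mulmx0 mulmx1 !(mul0mx, mul1mx, scaler0, add0r, addr0, sub0r).
  rewrite !mxE eqxx !mulr1n mulrN mulNr => /eqP.
  by rewrite eqr_opp mulrC => /eqP /(mulIf i2) <-.
- apply/matrixP => k m; have := congr1 (@gev R n p) (sl_EM sd k m).
  rewrite ev_bf ev_Kmx evEM evU row3J gevM g_wiu mul1r !conjT0 !mulmx0 subr0 scaler0 add0r => h.
  rewrite -evM evE -h -scalemxAl !mxE; congr (_ * _); apply: eq_bigr => i _.
  by rewrite !conjTE ![row _ _ _ _]mxE -row_mul [row _ _ _ _]mxE.
- apply/matrixP => k j; rewrite ord1 [LHS]mxE; have := congr1 (@gev R n p) (sl_Ebe sd k).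
  rewrite ev_bf ev_Kmx evEM ev_be row3J gevM ev_u conjT1 !conjT0 !mulmx0 mulmx1 sub0r addr0.
  rewrite gevN.
  rewrite scalemxE oppmxE mulrN mulNr => /eqP; rewrite eqr_opp mulrC => /eqP /(mulIf i2) <-.
  by rewrite [LHS]mxE [RHS]mxE -row_mul [row _ _ _ _]mxE.
Qed.
End One.
(** Equal Ricci tensors make Q1 - Q2 a multiple mu of the metric, and comparing the full curvatures
    gives mu = -2 (q1 - q2). The trace conditions make the derivatives of mu zero. *)
Lemma curvature_determines (B : dring R n) (G Gi Q1 Q2 : 'M[B]_n) (q1 q2 : B) : (0 < n)%N -> G *m Gi = 1%:M ->
  (forall k l i m, Om G Gi k l i m = bochner_form G Q1 (Q1 *m Gi) q1 k l i m) ->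
  (forall k l i m, Om G Gi k l i m = bochner_form G Q2 (Q2 *m Gi) q2 k l i m) ->
  (forall k, del k (\tr (Q1 *m Gi)) + 4 * (n%:R + 1) * del k q1 = 0) ->
  (forall k, del k (\tr (Q2 *m Gi)) + 4 * (n%:R + 1) * del k q2 = 0) ->
  Q1 = Q2 - (2 * (q1 - q2)) *: G /\ forall k, del k q1 = del k q2.
Proof.
move=> n0 GGi om1 om2 tr1 tr2.
pose t1 := \tr (Q1 *m Gi) + 4 * (n%:R + 1) * q1; pose t2 := \tr (Q2 *m Gi) + 4 * (n%:R + 1) * q2.
have u2 : cs n.+2%:R^-1 * (n%:R + 2) = 1 :> B by rewrite -(natrD _ n 2) addn2 cs_inv.
pose mu := cs n.+2%:R^-1 * (t2 - t1).
have hQ : Q1 = Q2 + mu *: G.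
  apply/matrixP => k l; rewrite addE scaleE; have := trOm GGi erefl om1 k l; rewrite (trOm GGi erefl om2 k l) => h.
  rewrite -[Q1 k l]mul1r -[Q2 k l]mul1r -u2 /mu -!mulrA -mulrDr; congr (_ * _).
  by move/eqP: h; rewrite -/t1 -/t2 -subr_eq0 => /eqP h; apply/eqP; rewrite -subr_eq0 -[X in _ == X]oppr0 -h; apply/eqP; ring.
have hS : Q1 *m Gi = Q2 *m Gi + mu%:M by rewrite hQ mulmxDl -scalemxAl GGi scalemx1.
have emm k : (mu%:M : 'M[B]_n) k k = mu by rewrite mxE eqxx mulr1n.
have hz k l : (4 * (mu + 2 * (q1 - q2))) * G k l = 0.
  have := om1 k l k k; rewrite om2 /bochner_form hS hQ !(addE, scaleE) emm => h.
  have w1 : (k == k)%:R = 1 :> B by rewrite eqxx.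
  rewrite !w1 in h.
  by move/eqP: h; rewrite -subr_eq0 => /eqP h; rewrite -[RHS]oppr0 -h; ring.
have mu0 : mu = - (2 * (q1 - q2)).
  pose k := Ordinal n0; have h : \sum_l (4 * (mu + 2 * (q1 - q2))) * G k l * Gi l k = 0.
    by apply: big1 => l _; rewrite hz mul0r.
  have e : \sum_l G k l * Gi l k = 1 by have /matrixP/(_ k k) := GGi; rewrite !mxE eqxx.
  have : 4 * (mu + 2 * (q1 - q2)) = 0.
    by move: (4 * _) h => w h; rewrite -[LHS]mulr1 -[X in w * X]e mulr_sumr -[RHS]h; apply: eq_bigr => l _; rewrite mulrA.
  rewrite -[RHS](mulr0 4) => /(@nat_cancel _ _ _ 3) /eqP; rewrite addr_eq0 => /eqP -> //.
split; first by rewrite hQ mu0 scaleNr.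
have dt (q : B) (t : B) k : del k t + 4 * (n%:R + 1) * del k q = 0 -> del k (t + 4 * (n%:R + 1) * q) = 0.
  have e : del k (4 * (n%:R + 1) : B) = 0 by rewrite -(natrD _ n 1) -natrM del_nat.
  by move=> h; rewrite delD [del k (_ * q)]delM e mul0r add0r.
move=> k; have := congr1 (del k) mu0.
rewrite /mu delM del_cs mul0r add0r delB /t1 /t2 dt // dt // subr0 mulr0 delN delM del_nat mul0r add0r delB.
move=> /esym /eqP; rewrite oppr_eq0 -[X in _ == X](mulr0 2) => /eqP /(@nat_cancel _ _ _ 1) /eqP.
by rewrite subr_eq0 => /eqP.
Qed.
(** With the first coordinates as reference, Z2 is unitary because both solutions have the same
    metric at p. As q1 and q2 have the same derivatives and both vanish at p, the values of Q, dq
    and c agree there, so Z2 conjugates one normal form to the other and [normal_unique] applies. *)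
Lemma represented_unique (x1 a1 x2 a2 : 'I_n -> R) (r1 r2 : R) (F1 F2 : A) (z1 z2 : 'I_n -> germ p) (G : 'M[A]_n) :
  (0 < n)%N -> cj F1 = F1 -> cj F2 = F2 ->
  (forall k i, @delb R n A k (z1 i) = 0) -> (forall k i, @delb R n A k (z2 i) = 0) ->
  (forall k l, G k l = del k (delb l F1)) -> (forall k l, G k l = del k (delb l F2)) ->
  bf (Kmx x1 a1 r1 F1) (grow z1) (grow z1) = 0 -> bf (Kmx x2 a2 r2 F2) (grow z2) (grow z2) = 0 ->
  gev F1 = 0 -> gev F2 = 0 -> (forall i, gev (z1 i) = 0) -> (forall i, gev (z2 i) = 0) ->
  Zmx z1 = 1%:M -> normalized x1 a1 -> normalized x2 a2 -> [/\ x1 =1 x2, a1 =1 a2 & r1 = r2].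
Proof.
move=> n0 Fr1 Fr2 Db1 Db2 GE1 GE2 null1 null2 F01 F02 z01 z02 Z1 nx1 nx2.
have Gu : G \in unitmx.
  by apply: (metric_unit Fr1 Db1 GE1 null1 F01 z01); rewrite Z1 unitmx1.
have GGi : G *m invmx G = 1%:M by exact: mulmxV.
have eG1 := ev_metric Fr1 Db1 GE1 null1 F01 z01; have eG2 := ev_metric Fr2 Db2 GE2 null2 F02 z02.
rewrite Z1 conjT1 mulmx1 in eG1; rewrite eG1 in eG2.
have [ga1 [Q1 [q1 [s1 [al1 [c1 d1]]]]]] := structure_equations (D_csm _) (Db_csm _) (D_Kmx x1 a1 r1 F1) (Kmx_star x1 a1 r1 Fr1)
  (Kmx_M x1 a1 r1 F1) GE1 GGi (Db_grow Db1) null1 (u_unit x1 a1 r1 F01 z01).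
have [ga2 [Q2 [q2 [s2 [al2 [c2 d2]]]]]] := structure_equations (D_csm _) (Db_csm _) (D_Kmx x2 a2 r2 F2) (Kmx_star x2 a2 r2 Fr2)
  (Kmx_M x2 a2 r2 F2) GE2 GGi (Db_grow Db2) null2 (u_unit x2 a2 r2 F02 z02).
have [q01 c01 es1 ea1] := represented_invariants F01 z01 d1.
have [q02 c02 es2 ea2] := represented_invariants F02 z02 d2.
have [hQ dq] := curvature_determines n0 GGi (sl_om d1) (sl_om d2) (sl_tr d1) (sl_tr d2).
have al_eq k : al1 k = al2 k by apply: oppr_inj; rewrite -(sl_q d1) -(sl_q d2) dq.
have eQ : ev Q1 = ev Q2.
  rewrite hQ evD evN evZ gevM gevD gevN q01 q02 oppr0 addr0 mulr0 scale0r oppr0 addr0 //.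
have g_wi : gev (wi : A) != 0.
  by rewrite (_ : gev (wi : A) = - (2 * 'i)) ?oppr_eq0 ?mulf_neq0 ?pnatr_eq0 ?neq0Ci //; exact: gev_cst.
have hsQ ga Q q s al c F M K phi : gev q = 0 -> structure_data F M K G (invmx G) phi ga Q q s al c ->
    ev Q = gev (wi : A) *: ev s.
  move=> q0 d; apply/matrixP => k l; have := congr1 (@gev R n p) (sl_Q d k l).
  rewrite gevD gevN !gevM q0 mulr0 mul0r subr0 !evE => ->; rewrite [RHS]mxE; congr (_ * _).
  by rewrite -!evE evM eG1 mulmx1.
have es : ev s1 = ev s2.
  have := eQ; rewrite (hsQ _ _ _ _ _ _ _ _ _ _ q01 d1) (hsQ _ _ _ _ _ _ _ _ _ _ q02 d2) => h.
  by apply: (scalerI g_wi).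
(* c is read off from the zbar-derivative of al, in which all other terms already agree at p. *)
have ec : gev c1 = gev c2.
  pose k := Ordinal n0; have := sl_al d1 k k; rewrite al_eq (sl_al d2) => h.
  have := congr1 (@gev R n p) h; rewrite !gevD !gevN !gevM.
  have hsum (s Q : 'M[A]_n) : gev (\sum_m s k m * Q m k) = (ev s *m ev Q) k k.
    by rewrite -evM evE mxE.
  rewrite !hsum es eQ => /addrI /oppr_inj.
  have -> : gev (G k k) = 1 by rewrite -evE eG1 mxE eqxx.
  by rewrite mulr1 => /(mulfI g_wi).
have i0 : ('i : C) != 0 by exact: neq0Ci.
have hx : rdiag x1 = Zmx z2 *m rdiag x2 *m conjT (Zmx z2).
  have := es1; rewrite es es2 Z1 mul1mx conjT1 mulmx1 => h.
  by apply/esym; apply: (scalerI i0).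
have ha : rcol a1 = Zmx z2 *m rcol a2.
  have i2 : - (2 * 'i) != 0 :> C by rewrite oppr_eq0 mulf_neq0 ?pnatr_eq0.
  apply: (scalerI i2); rewrite -ea2 -[rcol a1]mul1mx -Z1 -ea1.
  by apply/matrixP => i j; rewrite !mxE al_eq.
have ZZ : conjT (Zmx z2) *m Zmx z2 = 1%:M by apply: mulmx1C; rewrite -eG2.
have hx' : rdiag x1 *m Zmx z2 = Zmx z2 *m rdiag x2 by rewrite hx -mulmxA ZZ mulmx1.
have [h1 h2] := normal_unique ZZ hx' ha nx1 nx2; split=> //.
by apply: (@toC_inj R); rewrite -c01 -c02.
Qed.
End Represented.

(** * Changes of charts *)

Section Local.
Context {R : realType} {n : nat}.
Local Notation C := (Cplx R).
Implicit Types (U : set 'cV[C]_n) (f g : 'cV[C]_n -> C).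
Lemma Ck_local k U f : (forall z, U z -> exists2 V, open_nbhs z V & Ck k V f) -> Ck k U f.
Proof.
elim: k f => [|k IH] f h; split=> //; try by move=> z /h[V [oV Vz] [hc _]]; exact: hc.
move=> v; split=> [z /h[V [_ Vz] [_ /(_ v)[hd _]]]|]; first exact: hd.
by apply: IH => z /h[V nV [_ /(_ v)[_ hd]]]; exists V.
Qed.
Lemma smooth_local U f : (forall z, U z -> smn z f) -> smooth_on U f.
Proof. by move=> h k; apply: Ck_local => z /h[V nV sf]; exists V. Qed.
Lemma smooth_sub U U' f : U' `<=` U -> smooth_on U f -> smooth_on U' f.
Proof. by move=> h sf k; exact: Ck_sub (sf k). Qed.
Lemma smooth_smn U f z : open U -> smooth_on U f -> U z -> smn z f.
Proof. by move=> oU sf Uz; exists U. Qed.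
Lemma holo_local U f : (forall z, U z -> exists2 V, open_nbhs z V & holo V f) -> holo U f.
Proof.
move=> h; split; first by apply: smooth_local => z /h[V nV [sf _]]; exists V.
by move=> z v /h[V [_ Vz] [_ cr]]; exact: cr.
Qed.
Lemma smooth_dzbar U f k : open U -> smooth_on U f -> smooth_on U (dzbar k f).
Proof. by move=> oU sf; apply: smooth_local => z Uz; apply: smn_dzbar; exists U. Qed.
Lemma smooth_dz U f k : open U -> smooth_on U f -> smooth_on U (dz k f).
Proof. by move=> oU sf; apply: smooth_local => z Uz; apply: smn_dz; exists U. Qed.
Lemma ddbarE f z j k : ddbar f z j k = dz j (dzbar k f) z.
Proof. by rewrite mxE. Qed.
Lemma ddbar_smooth U f j k : open U -> smooth_on U f -> smooth_on U (fun z => ddbar f z j k).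
Proof.
move=> oU sf l; have h := smooth_dz j oU (smooth_dzbar k oU sf).
by apply: Ck_ext (h l) => // z _; rewrite ddbarE.
Qed.
Lemma ddbar_ext U f g z : open U -> (forall w, U w -> f w = g w) -> smooth_on U f -> U z -> ddbar f z = ddbar g z.
Proof.
move=> oU fg sf Uz; apply/matrixP => j k.
rewrite [LHS]ddbarE [RHS]ddbarE.
apply: (dz_ext j oU Uz _ (smooth_dzbar k oU sf 1%N)) => w Uw.
exact: (dzbar_ext k oU Uw fg (sf 1%N)).
Qed.
Lemma rep_ddbar z f (x : germ z) j k : rep f x -> rep (fun w => ddbar f w j k) (gdel j (gdelb k x)).
Proof.
by move=> h; apply: rep_eqf (rep_dz j (rep_dzbar k h)) => w; rewrite ddbarE.
Qed.
Lemma gdel_conj (z : 'cV[C]_n) k (x : germ z) : gdel k (gconj x) = gconj (gdelb k x).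
Proof. by rewrite gdelb_conj gconjK. Qed.
Lemma rep_holo U f z (x : germ z) k : open U -> holo U f -> U z -> rep f x -> gdelb k x = 0.
Proof.
move=> oU hf Uz h; apply: (rep_eq (rep_dzbar k h)); apply: rep0.
by apply: nearS (open_near oU Uz) => w Uw; rewrite (holo_dzbar _ hf Uw).
Qed.
Lemma rep_self U f z : open U -> smooth_on U f -> U z -> rep f (gm z f).
Proof. by move=> oU sf Uz; apply: rep_gm; exists U. Qed.
Lemma rep_conj_real z f (x : germ z) : (forall w, Num.conj (f w) = f w) -> rep f x -> gconj x = x.
Proof.
by move=> fr h; apply: rep_eq (rep_conj h) _; apply: rep_eqf h => w; rewrite fr.
Qed.
Lemma ddbar_herm U f z : open U -> smooth_on U f -> (forall w, Num.conj (f w) = f w) -> U z ->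
  conjT (ddbar f z) = ddbar f z.
Proof.
move=> oU sf fr Uz; have h := rep_self oU sf Uz; apply/matrixP => j k; rewrite conjTE.
rewrite -(rep_p (rep_ddbar j k h)) -(rep_p (rep_ddbar k j h)) -gev_conj; congr gev.
have hr := rep_conj_real fr h.
have -> : gdelb j (gm z f) = gconj (gdel j (gm z f)) by rewrite gdelb_conj hr.
by rewrite -gdelb_conj gdel_delb.
Qed.
End Local.

Section Chain.
Context {R : realType} {n : nat}.
Local Notation C := (Cplx R).
Local Notation jacobian := Pilot.Defs.jacobian.
Variables (U W : set 'cV[C]_n) (T : 'cV[C]_n -> 'cV[C]_n).
Hypotheses (oU : open U) (oW : open W) (UW : forall z, U z -> W (T z)).
Hypothesis hT : forall j, holo U (fun w => T w j 0).
Implicit Types f : 'cV[C]_n -> C.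
Lemma smooth_comp f : smooth_on W f -> smooth_on U (fun w => f (T w)).
Proof. by move=> sf k; apply: (Ck_comp oU oW UW) => // j; exact: (hT j).1. Qed.
Lemma rderive_chain f v z : smooth_on W f -> U z -> rderive (fun w => f (T w)) v z = rderive f (jacobian T z *m v) (T z).
Proof.
move=> sf Uz; apply: isd_rderive; apply: (isd_chain oW (UW Uz) (sf 1%N)) => j.
rewrite -(holo_rderive _ _ oU) //; first exact: holo_isd Uz.
exact/(holomorphic_holo _ oU).
Qed.
Lemma wirtinger_chain f k z : smooth_on W f -> U z ->
  dz k (fun w => f (T w)) z = \sum_j jacobian T z j k * dz j f (T z) /\
  dzbar k (fun w => f (T w)) z = \sum_j Num.conj (jacobian T z j k) * dzbar j f (T z).
Proof.
move=> sf Uz; have Wz := UW Uz.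
have e v : rderive (fun w => f (T w)) v z = \sum_j ((jacobian T z *m v) j 0 * dz j f (T z) +
    Num.conj ((jacobian T z *m v) j 0) * dzbar j f (T z)).
  by rewrite (rderive_chain _ sf Uz) (rderive_dz _ oW (sf 1%N) Wz).
have c1 j : (jacobian T z *m cbasis R k) j 0 = jacobian T z j k by rewrite /cbasis -colE mxE.
have c2 j : (jacobian T z *m ('i *: cbasis R k)) j 0 = 'i * jacobian T z j k.
  by rewrite -scalemxAr scalemxE c1.
have cJ j : Num.conj ('i * jacobian T z j k) = - 'i * Num.conj (jacobian T z j k) by rewrite rmorphM /= conjCi.
split.
  rewrite [LHS]/dz !e mulr_sumr -sumrB mulr_sumr; apply: eq_bigr => j _; rewrite c1 c2 cJ.
  move: (jacobian T z j k) (Num.conj _) (dz j f _) (dzbar j f _) => a b c d.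
  transitivity (2^-1 * (a * c + b * d - ('i * 'i) * (a * c - b * d))); first by ring.
  by rewrite sqrCi1; field.
rewrite [LHS]/dzbar !e mulr_sumr -big_split mulr_sumr; apply: eq_bigr => j _; rewrite c1 c2 cJ.
move: (jacobian T z j k) (Num.conj _) (dz j f _) (dzbar j f _) => a b c d.
transitivity (2^-1 * (a * c + b * d + ('i * 'i) * (a * c - b * d))); first by rewrite /=; ring.
by rewrite sqrCi1; field.
Qed.
(** In the product rule the derivative of the conjugated Jacobian drops out, since conjugates of
    holomorphic functions are killed by d/dz_j. *)
Lemma ddbar_chain f z : smooth_on W f -> U z -> ddbar (fun w => f (T w)) z =
  (jacobian T z)^T *m ddbar f (T z) *m map_mx Num.conj (jacobian T z).
Proof.
move=> sf Uz; apply/matrixP => j k; rewrite ddbarE.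
pose X m := gm z (fun w => T w m 0).
have hX m : rep (fun w => T w m 0) (X m) by exact: rep_self (hT m).1 Uz.
have dX m : gdelb j (X m) = 0 by exact: rep_holo j oU (hT m) Uz (hX m).
have sB m : smooth_on U (fun w => dzbar m f (T w)).
  move=> l; apply: (Ck_comp oU oW UW) => [i|]; first exact: (hT i).1.
  exact: smooth_dzbar.
have hB m := rep_self oU (sB m) Uz.
have hH := rep_self oU (smooth_comp sf) Uz.
have e : gdelb k (gm z (fun w => f (T w))) = \sum_m gconj (gdel k (X m)) * gm z (fun w => dzbar m f (T w)).
  apply: (rep_eq (rep_dzbar k hH)).
  have h := rep_sum (fun m => rep_mul (rep_conj (rep_dz k (hX m))) (hB m)).
  apply: rep_ext h; apply: nearS (open_near oU Uz) => w Uw.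
  rewrite (wirtinger_chain k sf Uw).2; apply: eq_bigr => m _; by rewrite [jacobian _ _ _ _]mxE.
have gS (h : 'I_n -> germ z) : gev (gdel j (\sum_m h m)) = \sum_m gev (gdel j (h m)).
  have -> : gdel j (\sum_m h m) = \sum_m gdel j (h m) by exact: raddf_sum.
  exact: raddf_sum.
rewrite -(rep_p (rep_dz j (rep_dzbar k hH))) e gS mxE; apply: eq_bigr => m _.
rewrite gdelM gdel_conj -gdel_delb dX raddf0 raddf0 mul0r add0r.
have -> : gev (gconj (gdel k (X m)) * gdel j (gm z (fun w => dzbar m f (T w)))) =
   gev (gconj (gdel k (X m))) * gev (gdel j (gm z (fun w => dzbar m f (T w)))) by exact: rmorphM.
rewrite gev_conj (rep_p (rep_dz k (hX m))) (rep_p (rep_dz j (hB m))).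
have -> : dz j (fun w => dzbar m f (T w)) z = \sum_l jacobian T z l j * dz l (dzbar m f) (T z).
  exact: (wirtinger_chain j (smooth_dzbar m oW sf) Uz).1.
rewrite mulrC; congr (_ * _); last by rewrite mxE [jacobian _ _ _ _]mxE.
rewrite [RHS]mxE; apply: eq_bigr => l _; rewrite -(ddbarE f); congr (_ * _).
by rewrite [RHS]mxE.
Qed.
End Chain.

Section Charts.
Context {R : realType} {n : nat}.
Local Notation C := (Cplx R).
Local Notation jacobian := Pilot.Defs.jacobian.
Lemma open_in_chart (T : topologicalType) (U : set T) (c : chart R n T) : open U -> open (in_chart U c).
Proof.
move=> oU; rewrite openE => z [cz Uz]; rewrite /interior /=; apply: filterI.
  exact: open_near (@cimg_open _ _ _ c) cz.
by apply: (cinv_continuous cz); apply: open_nbhs_nbhs.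
Qed.
(** Near z the entries differ from those of the identity by less than 1/(n+1), so the form differs
    from |v|^2 by at most n/(n+1) |v|^2. Hermitian symmetry makes its value real. *)
Lemma posdef_near (z : 'cV[C]_n) (g : 'cV[C]_n -> 'M[C]_n) :
  (forall i j, {for z, continuous (fun w => g w i j)}) -> g z = 1%:M ->
  (\forall w \near z, conjT (g w) = g w) ->
  \forall w \near z, posdef (g w).
Proof.
move=> gc g1 gh; pose e : R := n.+1%:R^-1; have e0 : 0 < e by rewrite invr_gt0.
have near1 : \forall w \near z, forall i j, cn ((g w - 1%:M) i j) < e.
  apply: near_forall => i; apply: near_forall => j; have /contP/(_ e e0) := gc i j.
  by apply: nearS => w; rewrite g1 addmxE oppmxE.
apply: nearS (nearI near1 gh) => w [hw hh] v v0.
pose E := (v^T *m (g w - 1%:M) *m map_mx Num.conj v) 0 0; pose s : R := \sum_i cn (v i 0) ^+ 2.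
have vE : (v^T *m map_mx Num.conj v) 0 0 = toC s.
  rewrite mxE /s rmorph_sum /=; apply: eq_bigr => j _; rewrite !mxE rmorphXn /=.
  exact: (esym (@Num.Theory.normCK C (v j 0))).
have dec : (v^T *m g w *m map_mx Num.conj v) 0 0 = toC s + E.
  rewrite -[g w](subrK 1%:M) mulmxDr mulmxDl addmxE mulmx1 vE addrC //.
have sE : cn E <= e * n%:R * s.
  rewrite /E mxE; apply: le_trans (cn_sum _ _ _) _.
  apply: (@le_trans _ _ (\sum_j \sum_i e / 2 * (cn (v i 0) ^+ 2 + cn (v j 0) ^+ 2))).
    apply: ler_sum => j _; rewrite cnM [(_ *m _) 0 j]mxE; apply: le_trans (ler_wpM2r (cn_ge0 _) (cn_sum _ _ _)) _.
    rewrite mulr_suml; apply: ler_sum => i _; rewrite cnM mxE [map_mx _ _ _ _]mxE cn_conj.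
    have h1 := cn_ge0 (v i 0); have h2 := cn_ge0 (v j 0); have h3 := ltW (hw i j).
    apply: (@le_trans _ _ (cn (v i 0) * e * cn (v j 0))); first by rewrite ler_wpM2r // ler_wpM2l.
    by move: (cn (v i 0)) (cn (v j 0)) h1 h2 => a b a0 b0; have := sqr_ge0 (a - b); nra.
  have -> : \sum_j \sum_i e / 2 * (cn (v i 0) ^+ 2 + cn (v j 0) ^+ 2) = \sum_(j < n) (e / 2 * s + e / 2 * n%:R * cn (v j 0) ^+ 2).
    apply: eq_bigr => j _; rewrite -mulr_sumr big_split /= sumr_const card_ord -mulr_natl; rewrite /s; ring.
  rewrite big_split /= sumr_const card_ord -mulr_sumr -/s -mulr_natl.
  by rewrite [leLHS](_ : _ = e * n%:R * s) //; field.
have s0 : 0 < s by exact: normsq_gt0.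
have hS : Num.conj ((v^T *m g w *m map_mx Num.conj v) 0 0) = (v^T *m g w *m map_mx Num.conj v) 0 0.
  have cv : conjT v^T = map_mx Num.conj v by rewrite /conjT trmxK.
  have cc : conjT (map_mx Num.conj v) = v^T by rewrite -cv conjTK.
  by rewrite -[LHS]conjTE [conjT _]conjTM [conjT (_ *m g w)]conjTM hh mulmxA cv cc.
rewrite (real_toC hS) -(rmorph0 (@toC R)) ltr_toC dec rpD rp_toC.
have h1 := rp_le E; have h2 : e * n%:R < 1 by rewrite mulrC ltr_pdivrMr // mul1r ltr_nat.
have h3 : e * n%:R * s < s by rewrite -[ltRHS]mul1r ltr_pM2r.
have h4 : `|rp E| < s by apply: le_lt_trans h3; exact: le_trans sE.
by move: h4; rewrite ltr_norml => /andP[h5 h6]; lra.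
Qed.
Variable M : complexManifold R n.
Implicit Types (c d : chart R n M) (U : set M) (F : M -> R).
Lemma atlas_holo c : cm_atlas c -> holo_chart c.
Proof. by move=> hc d; exact: cm_compatible. Qed.
Lemma in_chart_map U c q : cdom c q -> U q -> in_chart U c (cmap c q).
Proof. by move=> cq Uq; split; [exact: cmap_img|rewrite cmapK]. Qed.
(** Charts of the maximal atlas are compared with charts of the atlas by definition; two of them are
    compared near each point through an atlas chart containing it. *)
Lemma holo_transition c d j : holo_chart c -> holo_chart d ->
  holo (in_chart (cdom d) c) (fun z => transition c d z j 0).
Proof.
move=> hc hd; apply: holo_local => z [cz dz].
have [e ae eq] := cm_cover (cinv c z).
have oe := @cdom_open _ _ _ e; have od := @cdom_open _ _ _ d.
have oV : open (in_chart (cdom e `&` cdom d) c) by apply: open_in_chart; exact: openI.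
exists (in_chart (cdom e `&` cdom d) c) => //.
have h1 : forall i, holo (in_chart (cdom e `&` cdom d) c) (fun w => transition c e w i 0).
  move=> i; have /(holomorphic_holo _ (open_in_chart oe))/(_ i) := (hc e ae).1.
  by apply: holo_sub => w [cw [ew _]].
have /(holomorphic_holo _ (open_in_chart od))/(_ j) h2 := (hd e ae).2.
apply: (holo_ext oV _ (holo_comp oV (open_in_chart od) _ h1 h2)) => w [cw [ew dw]].
  by rewrite /transition cmapK.
by apply: in_chart_map.
Qed.
Lemma in_chart_transition c d U z : in_chart (U `&` cdom d) c z -> in_chart U d (transition c d z).
Proof. by move=> [cz [Uz dz]]; exact: in_chart_map. Qed.
Lemma in_coords_transition c d F z : in_chart (cdom d) c z -> in_coords c F z = in_coords d F (transition c d z).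
Proof. by move=> [cz dz]; rewrite /in_coords /transition cmapK. Qed.

Section Pair.
Variables (c d : chart R n M).
Hypotheses (hc : holo_chart c) (hd : holo_chart d).
Variable U : set M.
Hypothesis oU : open U.
Let oc : open (in_chart (U `&` cdom d) c).
Proof. by apply: open_in_chart; apply: openI => //; exact: cdom_open. Qed.
Let hT j : holo (in_chart (U `&` cdom d) c) (fun z => transition c d z j 0).
Proof. by apply: holo_sub (holo_transition j hc hd) => z [cz [_ dz]]. Qed.
Lemma smooth_transition F : smooth_on (in_chart U d) (in_coords d F) ->
  smooth_on (in_chart (U `&` cdom d) c) (in_coords c F).
Proof.
move=> sF k; have h := smooth_comp oc (open_in_chart oU) (@in_chart_transition c d U) hT sF.
by apply: Ck_ext (h k) => // z [cz [_ dz]]; rewrite [RHS](@in_coords_transition c d).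
Qed.
Lemma ddbar_transition F z : smooth_on (in_chart U d) (in_coords d F) -> in_chart (U `&` cdom d) c z ->
  ddbar (in_coords c F) z = (jacobian (transition c d) z)^T *m ddbar (in_coords d F) (transition c d z)
    *m map_mx Num.conj (jacobian (transition c d) z).
Proof.
move=> sF Uz.
rewrite -(ddbar_chain oc (open_in_chart oU) (@in_chart_transition c d U) hT sF Uz).
apply: (ddbar_ext oc _ (smooth_transition sF) Uz) => w [cw [_ dw]].
exact: in_coords_transition.
Qed.
End Pair.
Lemma dz_coord k i (z : 'cV[C]_n) : dz k (fun w => w i 0) z = (i == k)%:R.
Proof.
rewrite /dz !(isd_rderive (isd_coord _ _ _)) !mxE !eqxx !andbT mulrA -expr2 sqrCi mulN1r opprK.
by case: (i == k) => /=; rewrite ?mulr1n ?mulr0n; field.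
Qed.
Lemma jacobian_transitionK c d z : holo_chart c -> holo_chart d -> in_chart (cdom d) c z ->
  jacobian (transition d c) (transition c d z) *m jacobian (transition c d) z = 1%:M.
Proof.
move=> hc hd Uz; have oc : open (in_chart (cdom d) c) by apply: open_in_chart; exact: cdom_open.
have od : open (in_chart (cdom c) d) by apply: open_in_chart; exact: cdom_open.
have UW w : in_chart (cdom d) c w -> in_chart (cdom c) d (transition c d w).
  by move=> [cw dw]; apply: in_chart_map => //; exact: cinv_dom.
apply/matrixP => i k; rewrite mxE.
have [h _] := wirtinger_chain oc od UW (fun j => holo_transition j hc hd) k (holo_transition i hd hc).1 Uz.
have e : dz k (fun w => w i 0) z = \sum_j jacobian (transition c d) z j k * dz j (fun w => transition d c w i 0) (transition c d z).
  rewrite -h; apply: (dz_ext k oc Uz _ (Ck_coord 1 i oc)) => w [cw dw].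
  by rewrite /transition cmapK // cinvK.
transitivity (dz k (fun w : 'cV[C]_n => w i 0) z).
  by rewrite e; apply: eq_bigr => j _; rewrite mulrC; congr (_ * _); rewrite [LHS]mxE.
by rewrite dz_coord mxE.
Qed.
Lemma smooth_function_chart c0 U F : holo_chart c0 -> open U -> U `<=` cdom c0 ->
  smooth_on (in_chart U c0) (in_coords c0 F) -> smooth_function U F.
Proof.
move=> h0 oU Uc sF c hc; apply: smooth_sub (smooth_transition hc h0 oU sF).
by move=> z [cz Uz]; split=> //; split=> //; exact: Uc.
Qed.
Lemma smooth_function_sub U U' F : U' `<=` U -> smooth_function U F -> smooth_function U' F.
Proof. by move=> s sF c hc; apply: smooth_sub (sF c hc) => z [cz /s]. Qed.
Lemma in_coords_real c F z : Num.conj (in_coords c F z) = in_coords c F z.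
Proof. exact: conj_toC. Qed.
End Charts.

(** * The main theorem *)

Section NormalEquation.
Context {R : realType} {n : nat}.
Local Notation C := (Cplx R).
Local Notation N := (1 + (n + 1))%N.
Lemma normal_mx_Mmx (x a : 'I_n -> R) (r : R) :
  normal_mx (diag_mx (\row_i x i)) (\col_i a i) r = (Mmx x a r)^T.
Proof.
rewrite /Mmx block3_tr /normal_mx !(trmx0, trmx1, tr_scalar_mx, trmxK).
have e1 : conjT (map_mx (@toC R) (\col_i a i)) = (rcol a)^T.
  by apply/matrixP => i j; rewrite conjTE !mxE conj_toC.
have e2 : map_mx (@toC R) (\col_i a i) = rcol a by apply/matrixP => i j; rewrite !mxE.
have e3 : map_mx (@toC R) (diag_mx (\row_i x i)) = rdiag x.
  by apply/matrixP => i j; rewrite !mxE; case: (i == j); rewrite ?mulr1n ?mulr0n ?rmorph0.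
rewrite e1 e2 e3 !linearZ /= tr_diag_mx.
by congr (col_mx (row_mx 0 (row_mx _ _)) (col_mx _ (row_mx _ _))).
Qed.
Lemma is_normalP (A : 'M[C]_N) : is_normal A <->
  exists (x a : 'I_n -> R) (r : R), normalized x a /\ A = (Mmx x a r)^T.
Proof.
split=> [[X [a [r [[dX X1] a0 a1 ->]]]]|[x [a [r [[h1 h2 h3] ->]]]]].
  exists (fun i => X i i), (fun i => a i 0), r; split; first by split.
  have eX : diag_mx (\row_i X i i) = X.
    apply/matrixP => i j; rewrite !mxE; have [->|ij] := eqVneq i j; rewrite ?mulr1n // mulr0n.
    by move/is_diag_mxP: dX => ->.
  have ea : \col_i a i 0 = a by apply/matrixP => i j; rewrite ord1 mxE.
  by rewrite -normal_mx_Mmx eX ea.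
exists (diag_mx (\row_i x i)), (\col_i a i), r; rewrite normal_mx_Mmx.
have e j : diag_mx (\row_i x i) j j = x j by rewrite !mxE eqxx mulr1n.
split=> // [|j|j k jk].
- split=> [|j k jk]; last by rewrite !e; exact: h1.
  exact: diag_mx_is_diag.
- by rewrite mxE; exact: h2.
- by rewrite !e mxE; exact: h3.
Qed.
Definition nform (x a : 'I_n -> R) (r : R) (y z : 'rV[C]_N) (t : C) : C :=
  (y *m (emx ((2 * 'i * t) *: Mmx x a r) *m Jmx) *m conjT z) 0 0.
(** The equation is transposed, which reverses the product and replaces A by its transpose. *)
Lemma normal_equationE (x a : 'I_n -> R) (r : R) w (t : R) :
  normal_equation (Mmx x a r)^T w t <-> nform x a r (nrow w) (nrow w) (toC t) = 0.
Proof.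
rewrite /normal_equation /nform emxE.
set u := row_mx 0 _; set v := col_mx 1 _.
have ev : v = (nrow w)^T by rewrite /v /nrow !tr_row_mx trmxK trmx1 trmx0.
have eu : Jmx *m conjT (nrow w) = u^T.
  have -> : conjT (nrow w) = col_mx 1%:M (col_mx (conjT w^T) 0).
    by rewrite /conjT /nrow !tr_row_mx !map_col_mx trmx1 trmx0 map_mx1 map_mx0.
  rewrite /Jmx /block3 !mul_col_mx !mul_row_col !(mul0mx, mulmx0, add0r, addr0, mul1mx, mulmx1).
  rewrite /u !tr_row_mx trmx0 tr_scalar_mx; congr col_mx; congr col_mx.
  by apply/matrixP => i j; rewrite /conjT !mxE.
have e : (u *m emx ((2 * 'i * toC t) *: (Mmx x a r)^T) *m v)^T =
    nrow w *m (emx ((2 * 'i * toC t) *: Mmx x a r) *m Jmx) *m conjT (nrow w).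
  rewrite -!mulmxA eu !trmx_mul ev trmxK emx_tr mulmxA; congr (_ *m emx _ *m _).
  by rewrite linearZ /= trmxK.
split=> [h|h]; first by rewrite -e h !mxE.
by apply: trmx_inj; rewrite e trmx0; apply/matrixP => i j; rewrite !ord1 h mxE.
Qed.
End NormalEquation.

Section RepNormal.
Context {R : realType} {n : nat} {p : 'cV[Cplx R]_n}.
Local Notation C := (Cplx R).
Local Notation V := 'cV[C]_n.
Local Notation A := (germ_dring p).
Local Notation N := (1 + (n + 1))%N.
Implicit Types (T : V -> V) (z : 'I_n -> germ p).
Lemma rep_nform (x a : 'I_n -> R) (r : R) (f : V -> C) (F : germ p) (y1 y2 : V -> 'rV[C]_N) (Y1 Y2 : 'rV[A]_N) :
  rep f F -> (forall i j, rep (fun w => y1 w i j) (Y1 i j)) -> (forall i j, rep (fun w => y2 w i j) (Y2 i j)) ->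
  rep (fun w => nform x a r (y1 w) (y2 w) (f w)) (bf (Kmx x a r F) Y1 Y2).
Proof.
move=> hF h1 h2; apply: (rep_mulmx (f := fun w => y1 w *m (emx ((2 * 'i * f w) *: Mmx x a r) *m Jmx))).
  apply: rep_mulmx => // i j; apply: rep_mulmx; last by move=> i' j'; exact: rep_csm.
  move=> i' j'; apply: (@rep_gexp _ _ _ _ (Mmx x a r) (fun w => 2 * 'i * f w)).
  by apply: rep_mul => //; apply: rep_eqf (rep_opp (rep_cs (- (2 * 'i)))) => w; rewrite opprK.
by move=> i j; rewrite starE; apply: rep_eqf (rep_conj (h2 j i)) => w; rewrite conjTE.
Qed.
Lemma rep_row_mx (a b c : nat) (f1 : V -> 'M[C]_(a, b)) (f2 : V -> 'M[C]_(a, c)) (X1 : 'M[A]_(a, b)) (X2 : 'M[A]_(a, c)) :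
  (forall i j, rep (fun w => f1 w i j) (X1 i j)) -> (forall i j, rep (fun w => f2 w i j) (X2 i j)) ->
  forall i j, rep (fun w => row_mx (f1 w) (f2 w) i j) (row_mx X1 X2 i j).
Proof.
move=> h1 h2 i j; rewrite -(splitK j); case: (fintype.split j) => k /=.
  by rewrite row_mxEl; apply: rep_eqf (h1 i k) => w; rewrite row_mxEl.
by rewrite row_mxEr; apply: rep_eqf (h2 i k) => w; rewrite row_mxEr.
Qed.
Lemma rep_nrow T z : (forall i, rep (fun w => T w i 0) (z i)) ->
  forall i j, rep (fun w => nrow (T w) i j) (grow z i j).
Proof.
move=> h; apply: rep_row_mx => [i j|].
  by have := @rep_csm R n p _ _ 1%:M i j; rewrite [csm_ _]map_mx1.
apply: rep_row_mx => i j.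
  by rewrite mxE; apply: rep_eqf (h j) => w; rewrite mxE ord1.
by have := @rep_csm R n p _ _ 0 i j; rewrite [csm_ _]map_mx0.
Qed.
Variables (x a : 'I_n -> R) (r : R) (f : V -> C) (T : V -> V).
Hypothesis sf : smn p f.
Hypothesis fr : forall w, Num.conj (f w) = f w.
Hypothesis hT : exists2 U, open_nbhs p U & forall i, holo U (fun w => T w i 0).
Hypothesis eqn : \forall w \near p, nform x a r (nrow (T w)) (nrow (T w)) (f w) = 0.
Local Notation F := (gm p f).
Local Notation z := (fun i => gm p (fun w => T w i 0)).
Lemma coords_rep i : rep (fun w => T w i 0) (z i).
Proof. by have [U nU hU] := hT; apply: rep_gm; exists U => //; exact: (hU i).1. Qed.
Lemma delb_gdelb k (y : germ p) : @delb R n A k y = gdelb k y.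
Proof. by rewrite /delb /cj /del /= -gdelb_conj. Qed.
Lemma coords_delb k i : @delb R n A k (z i) = 0.
Proof.
by have [U [oU Up] hU] := hT; rewrite delb_gdelb; exact: rep_holo k oU (hU i) Up (coords_rep i).
Qed.
Lemma potential_real : cj (F : A) = F.
Proof. exact: rep_conj_real fr (rep_gm sf). Qed.
Lemma equation_null : bf (Kmx x a r F) (grow z) (grow z) = 0.
Proof.
have h := rep_nrow coords_rep; apply: (rep_eq (rep_nform x a r (rep_gm sf) h h)).
apply: rep0.
by apply: nearS eqn => w ->.
Qed.
Definition uval (w : V) : C := nform x a r (nrow (T w) *m Mmx x a r) (nrow (T w)) (f w).
Lemma rep_uval : rep uval (bf (Kmx x a r F) (grow z *m csm_ (Mmx x a r)) (grow z)).
Proof.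
have h := rep_nrow coords_rep; apply: rep_nform => //; first exact: rep_gm.
by apply: rep_mulmx => //; exact: rep_csm.
Qed.
Definition pmetric : 'M[A]_n := \matrix_(k, l) @del R n A k (@delb R n A l F).
Lemma pmetricE k l : pmetric k l = @del R n A k (@delb R n A l F). Proof. exact: mxE. Qed.
Lemma rep_pmetric k l : rep (fun w => ddbar f w k l) (pmetric k l).
Proof. by rewrite pmetricE delb_gdelb; apply: rep_ddbar; exact: rep_gm. Qed.
Lemma ev_pmetric : ev pmetric = ddbar f p.
Proof. by apply/matrixP => k l; rewrite evE (rep_p (rep_pmetric k l)). Qed.
(** Here p is any point near the centre of the coordinates T. The conditions which are automatic at
    the centre, an invertible Hessian and a nonzero u, become hypotheses. *)
Lemma bochner_represented (g : V -> 'M[C]_n) : (\forall w \near p, g w = ddbar f w) ->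
  ddbar f p \in unitmx -> uval p != 0 -> forall i j k l, bochner g p i j k l = 0.
Proof.
move=> gE gu u0 i j k l.
have Gu : pmetric \in unitmx by rewrite unitmx_ev ev_pmetric.
have uu : bf (Kmx x a r F) (grow z *m csm_ (Mmx x a r)) (grow z) \is a GRing.unit.
  by rewrite gunitE (rep_p rep_uval).
have flat := represented_flat potential_real coords_delb pmetricE equation_null Gu uu i j k l.
have gG i' j' : rep (fun w => g w i' j') (pmetric i' j').
  by apply: rep_ext (rep_pmetric i' j'); apply: nearS gE => w ->.
rewrite -(rep_p (rep_bochner gG (mulmxV Gu) i j k l)) flat; exact: rmorph0.
Qed.
End RepNormal.

(** * Potentials and normal equations on the manifold *)

Section Potentials.
Context {R : realType} {n : nat}.
Local Notation C := (Cplx R).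
Local Notation jacobian := Pilot.Defs.jacobian.
Lemma posdef_congr (G J K : 'M[C]_n) : K *m J = 1%:M -> posdef G -> posdef (J^T *m G *m map_mx Num.conj J).
Proof.
move=> KJ Gpos v v0; have Jv : J *m v != 0.
  by apply: contra_neq v0 => h; rewrite -[v]mul1mx -KJ -mulmxA h mulmx0.
have := Gpos _ Jv; rewrite trmx_mul map_mxM !mulmxA //.
Qed.
Lemma ddbar_add (U : set 'cV[C]_n) (f g : 'cV[C]_n -> C) z : open U -> smooth_on U f -> smooth_on U g -> U z ->
  ddbar (fun w => f w + g w) z = ddbar f z + ddbar g z.
Proof.
move=> oU sf sg Uz; have hf := rep_self oU sf Uz; have hg := rep_self oU sg Uz.
apply/matrixP => j k; rewrite -(rep_p (rep_ddbar j k (rep_add hf hg))) addmxE.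
transitivity (gev (gdel j (gdelb k (gm z f))) + gev (gdel j (gdelb k (gm z g)))); last first.
  exact: (f_equal2 (fun a b : C => a + b) (rep_p (rep_ddbar j k hf)) (rep_p (rep_ddbar j k hg))).
have -> : gdel j (gdelb k (gm z f + gm z g)) = gdel j (gdelb k (gm z f)) + gdel j (gdelb k (gm z g)).
  have -> : gdelb k (gm z f + gm z g) = gdelb k (gm z f) + gdelb k (gm z g).
    by rewrite !gdelb_conj (raddfD (@gconj R n z)) (raddfD (@gdel R n z k)) (raddfD (@gconj R n z)).
  exact: raddfD.
exact: raddfD.
Qed.
Lemma pluriharmonic_re (A : dring R n) (y : A) (k b : C) : (forall l, delb l y = 0) ->
  forall i j, del i (delb j (cs k + cs b * (y - cj y))) = 0.
Proof.
move=> dy i j; rewrite delbD delb_cs add0r delbM delb_cs mul0r add0r delbB dy delb_cj sub0r.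
by rewrite delM del_cs mul0r add0r delN del_cj -del_delb dy del0 cj0 oppr0 mulr0.
Qed.
(** The imaginary part is (y - conj y) / 2i, a sum of a holomorphic and an antiholomorphic
    function. *)
Lemma ddbar_ip (U : set 'cV[C]_n) (f : 'cV[C]_n -> C) (k : C) z : open U -> holo U f -> U z ->
  ddbar (fun w => k + toC (ip (f w))) z = 0.
Proof.
move=> oU hf Uz; have h := rep_self oU hf.1 Uz; set y := gm z f in h.
have dy l : gdelb l y = 0 by exact: rep_holo l oU hf Uz h.
have e : rep (fun w => k + toC (ip (f w))) (gcst z k + gcst z (2 * 'i)^-1 * (y - gconj y)).
  apply: rep_eqf (rep_add (rep_cst k) (rep_mul (rep_cst (2 * 'i)^-1) (rep_add h (rep_opp (rep_conj h))))) => w.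
  apply: esym; congr (_ + _); rewrite {2}(cplxE (f w)) conj_cplxE; field.
  by rewrite neq0Ci.
have dy' l : @delb R n (germ_dring z) l y = 0 by rewrite delb_gdelb.
apply/matrixP => i j; rewrite -(rep_p (rep_ddbar i j e)) [RHS]mxE.
have := congr1 (@gev R n z) (@pluriharmonic_re (germ_dring z) y k (2 * 'i)^-1 dy' i j).
by rewrite delb_gdelb => ->; exact: rmorph0.
Qed.
Variable M : complexManifold R n.
Implicit Types (c d : chart R n M) (U : set M) (F G : M -> R).
Lemma smooth_functionB U F G : open U -> smooth_function U F -> smooth_function U G ->
  smooth_function U (fun q => F q - G q).
Proof.
move=> oU sF sG c hc k; have o := open_in_chart (c := c) oU.
have h := Ck_add o (sF c hc k) (Ck_opp o (sG c hc k)).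
by apply: Ck_ext h => // z _; rewrite /in_coords -rmorphB.
Qed.
Lemma ddbarB U F G c z : open U -> holo_chart c -> smooth_function U F -> smooth_function U G -> in_chart U c z ->
  ddbar (in_coords c G) z = 0 -> ddbar (in_coords c F) z = ddbar (in_coords c (fun q => F q - G q)) z.
Proof.
move=> oU hc sF sG Uz G0; have o := open_in_chart (c := c) oU.
have := ddbar_add o (smooth_functionB oU sF sG hc) (sG c hc) Uz; rewrite G0 addr0 => <-.
by apply: (ddbar_ext o _ (sF c hc) Uz) => w _; rewrite /in_coords -rmorphD subrK.
Qed.
Lemma open_chart_preimage c (P : set 'cV[C]_n) : open P -> open [set q | cdom c q /\ P (cmap c q)].
Proof.
move=> oP; rewrite openE => q [cq Pq]; rewrite /interior /=; apply: filterI.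
  by apply: open_nbhs_nbhs; split=> //; exact: cdom_open.
by apply: (cmap_continuous cq); apply: open_nbhs_nbhs.
Qed.
(** At the centre the Hessian of F - h is the identity and u is i/2; on a smaller neighbourhood the
    Hessian stays positive and u nonzero, and there [bochner_represented] applies at every point and
    in every chart. F and F - h have the same Hessian. *)
Lemma represents_potential (p : M) F h (A : 'M[C]_(1 + (n + 1))) : smooth_near p F -> pluriharmonic_near p h ->
  is_normal A -> represents p A (fun q => F q - h q) -> bochner_kahler_potential_near p F.
Proof.
move=> [UF [oF Fp] sF] [Uh [[oh hp] sh ddh]] /is_normalP[x [a [r [_ AE]]]] [D0 [c [hc cp c0 eqn]]].
pose D q := F q - h q; rewrite {}AE in eqn.
move: eqn; rewrite /prop_near1 nbhsE => -[Q [oQ Qp] hQ].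
pose O := UF `&` Uh `&` Q `&` cdom c.
have oO : open O by apply: openI; [apply: openI => //; exact: openI|exact: cdom_open].
have Op : O p by [].
have sFO : smooth_function O F by apply: smooth_function_sub sF => q [[[]]].
have shO : smooth_function O h by apply: smooth_function_sub sh => q [[[]]].
have sDO : smooth_function O D by exact: smooth_functionB.
have FD d z : holo_chart d -> in_chart O d z -> ddbar (in_coords d F) z = ddbar (in_coords d D) z.
  move=> hd Oz; apply: (ddbarB oO hd sFO shO Oz); apply: ddh => //.
  by case: Oz => dz [[[_ hz] _] _].
have eqD q : O q -> nform x a r (nrow (cmap c q)) (nrow (cmap c q)) (toC (D q)) = 0.
  by move=> [[_ Qq] _]; apply/normal_equationE; exact: hQ.
pose u q := nform x a r (nrow (cmap c q) *m Mmx x a r) (nrow (cmap c q)) (toC (D q)).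
pose S := in_chart O c; have oS : open S by exact: open_in_chart.
have S0 : S 0 by rewrite -c0; exact: in_chart_map.
have p0 : cinv c 0 = p by rewrite -c0 cmapK.
pose f := in_coords c D.
have sf : smn 0 f by exact: smooth_smn oS (sDO c hc) S0.
have fr w : Num.conj (f w) = f w by exact: in_coords_real.
have hT : exists2 U, open_nbhs (0 : 'cV[C]_n) U & forall i, holo U (fun w : 'cV[C]_n => w i 0).
  by exists S => // i; exact: holo_coord.
have eqS : \forall w \near (0 : 'cV[C]_n), nform x a r (nrow w) (nrow w) (f w) = 0.
  apply: nearS (open_near oS S0) => w [cw Ow].
  by have := eqD _ Ow; rewrite cinvK.
have ef : gev (gm 0 f) = 0.
  by rewrite (rep_p (rep_gm sf)) /f /in_coords p0 /D D0 rmorph0.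
pose zz i := gm (0 : 'cV[C]_n) (fun w => w i 0).
have ez i : gev (zz i) = 0 by rewrite (rep_p (coords_rep hT i)) mxE.
have ddf : ddbar f 0 = 1%:M.
  rewrite -(ev_pmetric sf) (ev_metric (potential_real sf fr) (coords_delb hT) (pmetricE f)
    (equation_null sf hT eqS) ef ez).
  have -> : Zmx zz = 1%:M; last by rewrite conjT1 mulmx1.
  apply/matrixP => k i; rewrite [LHS]mxE [RHS]mxE eq_sym -(dz_coord k i 0).
  exact: rep_p (rep_dz k (coords_rep hT i)).
have pos : \forall w \near (0 : 'cV[C]_n), posdef (ddbar f w).
  apply: posdef_near => // [i j|].
    by apply: smn_cont; apply: (smooth_smn oS _ S0); exact: (ddbar_smooth _ _ oS (sDO c hc)).
  by apply: nearS (open_near oS S0) => w Sw; exact: ddbar_herm oS (sDO c hc) fr Sw.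
have hu := rep_uval x a r sf hT.
have u0 : \forall w \near (0 : 'cV[C]_n), uval x a r f id w != 0.
  apply: cont_neq0; first by apply: smn_cont; exact: rep_smn hu.
  by rewrite -(rep_p hu) (ev_u x a r ef ez) mulf_neq0 ?neq0Ci // invr_eq0 pnatr_eq0.
have [P [oP P0] hP] := near_open (nearI pos u0).
pose U := O `&` [set q | cdom c q /\ P (cmap c q)].
have oU : open U by apply: openI => //; exact: open_chart_preimage.
have UO : U `<=` O by move=> q [].
have Uc : U `<=` cdom c by move=> q [_ []].
have sub d : in_chart U d `<=` in_chart O d by move=> z [dz [Oz _]].
have toc d z : in_chart U d z -> in_chart (O `&` cdom c) d z by move=> [dz [Oz [cz _]]].
have up q : U q -> u q != 0 /\ posdef (ddbar f (cmap c q)).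
  move=> [Oq [cq /hP [h1 h2]]]; split; last exact: h1.
  by move: h2; rewrite /uval /f /in_coords (cmapK cq).
have gpos d z : holo_chart d -> in_chart U d z -> posdef (ddbar (in_coords d F) z).
  move=> hd Uz; rewrite (FD d z hd (sub _ _ Uz)) (ddbar_transition hd hc oO (sDO c hc) (toc _ _ Uz)).
  apply: (@posdef_congr _ _ (jacobian (transition c d) (transition d c z))).
    by apply: jacobian_transitionK => //; case: Uz => dz /Uc.
  by have [_] := up _ Uz.2.
exists U, (fun d z => ddbar (in_coords d F) z); split.
- by split=> //; split=> //; split=> //=; rewrite c0.
- split; last first.
    move=> d hd z Uz i j k l; have oz := open_in_chart (c := d) oO; have Oz := sub _ _ Uz.
    have od := open_in_chart (c := d) oU.
    apply: (@bochner_represented _ _ z x a r (in_coords d D) (transition d c)).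
    + exact: smooth_smn oz (sDO d hd) Oz.
    + by move=> w; exact: in_coords_real.
    + exists (in_chart U d) => // m; apply: holo_sub (holo_transition m hd hc) => w [dw /Uc]; by [].
    + by apply: nearS (open_near oz Oz) => w [dw Ow]; exact: eqD _ Ow.
    + by apply: nearS (open_near oz Oz) => w Ow; exact: FD.
    + by apply: posdef_unit; rewrite -FD //; exact: gpos.
    + by have [h1 _] := up _ Uz.2.
  have sFU d (hd : holo_chart d) : smooth_on (in_chart U d) (in_coords d F).
    by apply: smooth_sub (sFO d hd); exact: sub.
  split.
  + by move=> d hd j k; apply: ddbar_smooth; [exact: open_in_chart|exact: sFU].
  + move=> d hd z Uz; apply: (ddbar_herm (open_in_chart oU) (sFU d hd) _ Uz) => w; exact: in_coords_real.
  + by move=> d hd z Uz; exact: gpos.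
  + move=> d hd z Uz j k l; have o := open_in_chart (c := d) oU.
    have hF := rep_self o (sFU d hd) Uz.
    have e : gev (gdel l (gdel j (gdelb k (gm z (in_coords d F))))) = gev (gdel j (gdel l (gdelb k (gm z (in_coords d F))))).
      by rewrite gdelC.
    exact: etrans (esym (rep_p (rep_dz l (rep_ddbar j k hF)))) (etrans e (rep_p (rep_dz j (rep_ddbar l k hF)))).
  + move=> d e hd he z [dz [Uz ez']]; apply: (ddbar_transition hd he oU (sFU e he)).
    by split.
- split; first exact: smooth_function_sub UO sFO.
  by [].
Qed.
Lemma cont_vec (f : 'cV[C]_n -> 'cV[C]_n) z : (forall i, {for z, continuous (fun w => f w i 0)}) ->
  {for z, continuous f}.
Proof.
move=> h P /nearvP[e e0 hP]; have := cont_contP h e0.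
by apply: nearS => w; exact: hP.
Qed.
(** A local biholomorphic map of the model space turns a chart of the maximal atlas into another
    one; this makes zeta a coordinate system. *)
Lemma chart_compose (c0 : chart R n M) (V W : set 'cV[C]_n) (f g : 'cV[C]_n -> 'cV[C]_n) : holo_chart c0 ->
  open V -> open W -> V `<=` cimg c0 -> (forall x, V x -> W (f x) /\ g (f x) = x) ->
  (forall y, W y -> V (g y) /\ f (g y) = y) -> (forall j, holo V (fun z => f z j 0)) ->
  (forall j, holo W (fun z => g z j 0)) ->
  exists c : chart R n M, [/\ holo_chart c, cdom c = [set q | cdom c0 q /\ V (cmap c0 q)] & forall q, cmap c q = f (cmap c0 q)].
Proof.
move=> h0 oV oW Vc fg gf hf hg.
have o1 : open [set q | cdom c0 q /\ V (cmap c0 q)] by exact: open_chart_preimage.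
have a1 q : [set q | cdom c0 q /\ V (cmap c0 q)] q -> W (f (cmap c0 q)) by move=> [_ /fg[]].
have a2 z : W z -> [set q | cdom c0 q /\ V (cmap c0 q)] (cinv c0 (g z)).
  by move=> /gf[Vg _]; split; [apply: cinv_dom; exact: Vc|rewrite (cinvK (Vc _ Vg))].
have a3 q : [set q | cdom c0 q /\ V (cmap c0 q)] q -> cinv c0 (g (f (cmap c0 q))) = q.
  by move=> [cq /fg[_ ->]]; exact: cmapK.
have a4 z : W z -> f (cmap c0 (cinv c0 (g z))) = z.
  by move=> /gf[Vg e]; rewrite (cinvK (Vc _ Vg)).
have a5 q : [set q | cdom c0 q /\ V (cmap c0 q)] q -> {for q, continuous (fun q => f (cmap c0 q))}.
  move=> [cq Vq]; have hc : {for cmap c0 q, continuous f}.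
    by apply: cont_vec => i; exact: (Ck_cont ((hf i).1 0%N) Vq).
  exact: (continuous_comp (cmap_continuous cq) hc).
have a6 z : W z -> {for z, continuous (fun z => cinv c0 (g z))}.
  move=> Wz; have [Vg _] := gf z Wz; have hc : {for z, continuous g}.
    by apply: cont_vec => i; exact: (Ck_cont ((hg i).1 0%N) Wz).
  exact: (continuous_comp hc (cinv_continuous (Vc _ Vg))).
pose c := Chart o1 oW a1 a2 a3 a4 a5 a6.
exists c; split=> // d ad; have hd := atlas_holo ad.
have od := @cdom_open _ _ _ d.
have oc : open (cdom c) by exact: cdom_open.
split.
  apply/(holomorphic_holo _ (open_in_chart od)) => j.
  have hg' i : holo (in_chart (cdom d) c) (fun w => g w i 0) by apply: holo_sub (hg i) => w [].
  apply: (holo_comp (open_in_chart od) (open_in_chart od) _ hg' (holo_transition j h0 hd)) => w [Ww dw].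
  by have [Vg _] := gf w Ww; split; [exact: Vc|].
apply/(holomorphic_holo _ (open_in_chart oc)) => j.
have ht i : holo (in_chart (cdom c) d) (fun w => transition d c0 w i 0).
  by apply: holo_sub (holo_transition i hd h0) => w [dw [cw _]].
by apply: (holo_comp (open_in_chart oc) oV _ ht (hf j)) => w [dw [cw Vw]].
Qed.
(** The germ theorems are applied in an arbitrary chart around p, and their local coordinates zeta
    are turned into a chart of the manifold. *)
Lemma potential_represents (p : M) F : (2 <= n)%N -> bochner_kahler_potential_near p F ->
  exists (h : M -> R) (A : 'M[C]_(1 + (n + 1))),
    [/\ pluriharmonic_near p h, is_normal A & represents p A (fun q => F q - h q)].
Proof.
move=> n2 [U [g [[oU Up] [kg bo] [sF gF]]]]; have [c0 /atlas_holo h0 c0p] := cm_cover p.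
pose S := in_chart U c0; have oS : open S by exact: open_in_chart.
pose z0 := cmap c0 p; have Sz0 : S z0 by exact: in_chart_map.
(* Subtracting the constant F p, which is pluriharmonic, makes the potential vanish at p, so that
   the exponential there is the identity. *)
pose k0 (q : M) := F p; have sk : smooth_function U k0.
  by move=> c hc k; exact: (Ck_cst k (toC (F p)) (open_in_chart oU)).
pose D q := F q - k0 q; have sD := smooth_functionB oU sF sk.
have k00 (c : chart R n M) z : in_chart U c z -> ddbar (in_coords c k0) z = 0.
  move=> Uz; have o := open_in_chart (c := c) oU.
  apply: etrans (ddbar_ip (toC (F p)) o (holo_cst 0 o) Uz).
  congr (ddbar _ z); apply/funext => w.
  by rewrite /in_coords /k0 (raddf0 (@ip R)) raddf0 addr0.
pose f := in_coords c0 D.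
have gf z : S z -> g c0 z = ddbar f z.
  by move=> Sz; rewrite (gF c0 h0 z Sz); apply: (ddbarB oU h0 sF sk Sz); exact: k00.
have sf : smn z0 f by exact: smooth_smn oS (sD c0 h0) Sz0.
have fr w : Num.conj (f w) = f w by exact: in_coords_real.
have ef : gev (gm z0 f) = 0.
  by rewrite (rep_p (rep_gm sf)) /f /in_coords /z0 cmapK // /D /k0 subrr rmorph0.
have Gpos : posdef (ev (@pmetric R n z0 f)).
  by move=> v; rewrite (ev_pmetric sf) -gf //; exact: (kahler_pos kg h0 Sz0).
have Gu : @pmetric R n z0 f \in unitmx :> bool by rewrite unitmx_ev; exact: posdef_unit.
have gG i j : rep (fun w => g c0 w i j) (@pmetric R n z0 f i j).
  by apply: rep_ext (rep_pmetric sf i j); apply: nearS (open_near oS Sz0) => w /gf ->.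
have flat i j k l : Bo (@pmetric R n z0 f) (invmx (@pmetric R n z0 f)) i j k l = 0.
  apply: (rep_eq (rep_bochner gG (mulmxV Gu) i j k l)).
  apply: rep0.
  by apply: nearS (open_near oS Sz0) => w Sw; rewrite (bo c0 h0 w Sw).
have [x [a [r [phi [P [al [be [nx Pu Dbphi ephi [Dphi null]]]]]]]]] :=
  germ_normal_form n2 (potential_real sf fr) ef (pmetricE f) Gpos flat.
have [U1 [zeta [ga [[oU1 U1p] [hz z00] jz [hga ga0] eqn]]]] := normal_coordinates Pu Dbphi ephi Dphi null.
have [W1 [oW1 W1p] hW1] := near_open (gm_near sf).
pose S' := U1 `&` (S `&` W1).
have oS' : open S' by apply: openI => //; exact: openI.
have S'z0 : S' z0 by [].
have hz' : holomorphic_on S' zeta.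
  by move=> j; have [hs hd] := hz j; split=> [k|k z [Uz _]]; [apply: Ck_sub (hs k) => z []|exact: hd].
have [V [W [gi [oV oW [Vz0 VS] [fg gfi _ hgi]]]]] := inverse_function oS' S'z0 hz' jz.
have Vc : V `<=` cimg c0 by move=> z /VS [_ [[]]].
have hzV j : holo V (fun z => zeta z j 0).
  have /(holomorphic_holo _ oS')/(_ j) := hz'; exact: holo_sub.
have [c [hc cdE cmE]] := chart_compose h0 oV oW Vc fg gfi hzV (fun j => (holomorphic_holo _ oW).1 hgi j).
(* The constant removed above plus the imaginary part of the gauge function, which vanishes at p. *)
pose h q := F p + ip (ga (cmap c0 q)); pose O := [set q | cdom c0 q /\ V (cmap c0 q)].
have oO : open O by exact: open_chart_preimage.
have Op : O p by [].
have inV z : in_chart O c0 z -> V z by move=> [cz [_]]; rewrite cinvK.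
have hgaO : holo (in_chart O c0) ga by apply: holo_sub hga => z /inV /VS [].
have hE z : in_chart O c0 z -> in_coords c0 h z = toC (F p) + toC (ip (ga z)).
  by move=> [cz _]; rewrite /in_coords /h cinvK // rmorphD.
have oc0 := open_in_chart (c := c0) oO.
have sh0 : smooth_on (in_chart O c0) (in_coords c0 h).
  move=> k; apply: Ck_ext (Ck_add oc0 (Ck_cst k (toC (F p)) oc0) (Ck_ip oc0 (hgaO.1 k))) => // z Oz.
  by rewrite hE.
have ddh z : in_chart O c0 z -> ddbar (in_coords c0 h) z = 0.
  move=> Oz; rewrite (ddbar_ext oc0 hE sh0 Oz); exact: (ddbar_ip _ oc0 hgaO Oz).
have Oc0 : O `<=` cdom c0 by move=> q [].
exists h, (Mmx x a r)^T; split.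
- exists O; split=> //; first exact: (smooth_function_chart h0).
  move=> d hd z [dz Oz]; have oz : in_chart (O `&` cdom c0) d z by split=> //; split=> //; exact: Oc0.
  rewrite (ddbar_transition hd h0 oO sh0 oz) ddh ?mulmx0 ?mul0mx //.
  exact: (in_chart_transition oz).
- by apply/is_normalP; exists x, a, r.
- split; first by rewrite /h -/z0 ga0 (raddf0 (@ip R)) addr0 subrr.
  exists c; split=> //; [by rewrite cdE|by rewrite cmE|].
  apply: filterS (open_nbhs_nbhs (conj oO Op)) => q [cq Vq]; apply/normal_equationE; rewrite cmE.
  have [Uq [_ Wq]] := VS _ Vq.
  have e : gm z0 f (cmap c0 q) - toC (ip (ga (cmap c0 q))) = toC (F q - h q).
    rewrite (hW1 _ Wq) /f /in_coords /D /k0 (cmapK cq) -rmorphB /h; by rewrite opprD addrA.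
  by rewrite /nform -e (eqn _ Uq) mxE.
Qed.
(** Both equations are read in the chart c1 of the first one: there its coordinates are the identity
    map, whose Jacobian is 1, and those of the second are the transition map. *)
Lemma represents_unique (p : M) (U1 U2 : set M) (g1 g2 : metric_field M) (F1 F2 : M -> R) (A1 A2 : 'M[C]_(1 + (n + 1))) :
  (0 < n)%N -> open_nbhs p U1 -> kahler_potential U1 g1 F1 -> open_nbhs p U2 -> kahler_potential U2 g2 F2 ->
  is_normal A1 -> represents p A1 F1 -> is_normal A2 -> represents p A2 F2 -> same_germ p g1 g2 -> A1 = A2.
Proof.
move=> n0 [oU1 U1p] [sF1 gF1] [oU2 U2p] [sF2 gF2] /is_normalP[x1 [a1 [r1 [nx1 ->]]]] [F10 [c1 [h1 c1p c10 eqn1]]].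
move=> /is_normalP[x2 [a2 [r2 [nx2 ->]]]] [F20 [c2 [h2 c2p c20 eqn2]]] [V [oV Vp] g12].
move: eqn1 eqn2; rewrite /prop_near1 !nbhsE => -[Q1 [oQ1 Q1p] hQ1] [Q2 [oQ2 Q2p] hQ2].
pose O := U1 `&` U2 `&` V `&` (Q1 `&` Q2 `&` cdom c2).
have oO : open O.
  by apply: openI; [apply: openI => //; exact: openI|apply: openI; [exact: openI|exact: cdom_open]].
have Op : O p by [].
pose S := in_chart O c1; have oS : open S by exact: open_in_chart.
have S0 : S 0 by rewrite -c10; exact: in_chart_map.
have p0 : cinv c1 0 = p by rewrite -c10 cmapK.
pose f1 := in_coords c1 F1; pose f2 := in_coords c1 F2; pose T := transition c1 c2.
have s1 : smooth_on S f1 by apply: (smooth_sub _ (sF1 c1 h1)) => z [cz [[[]]]].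
have s2 : smooth_on S f2 by apply: (smooth_sub _ (sF2 c1 h1)) => z [cz [[[]]]].
have sf1 := smooth_smn oS s1 S0; have sf2 := smooth_smn oS s2 S0.
have fr1 w : Num.conj (f1 w) = f1 w by exact: in_coords_real.
have fr2 w : Num.conj (f2 w) = f2 w by exact: in_coords_real.
have hT1 : exists2 U, open_nbhs (0 : 'cV[C]_n) U & forall i, holo U (fun w : 'cV[C]_n => id w i 0).
  by exists S => // i; exact: holo_coord.
have hT2 : exists2 U, open_nbhs (0 : 'cV[C]_n) U & forall i, holo U (fun w => T w i 0).
  by exists S => // i; apply: holo_sub (holo_transition i h1 h2) => z [cz [_ [_ dz]]].
have e1 : \forall w \near (0 : 'cV[C]_n), nform x1 a1 r1 (nrow (id w)) (nrow (id w)) (f1 w) = 0.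
  apply: nearS (open_near oS S0) => w [cw [_ [[Qw _] _]]].
  by have /normal_equationE := hQ1 _ Qw; rewrite (cinvK cw).
have e2 : \forall w \near (0 : 'cV[C]_n), nform x2 a2 r2 (nrow (T w)) (nrow (T w)) (f2 w) = 0.
  by apply: nearS (open_near oS S0) => w [cw [_ [[_ Qw] _]]]; have /normal_equationE := hQ2 _ Qw.
have ef1 : gev (gm 0 f1) = 0 by rewrite (rep_p (rep_gm sf1)) /f1 /in_coords p0 F10 rmorph0.
have ef2 : gev (gm 0 f2) = 0 by rewrite (rep_p (rep_gm sf2)) /f2 /in_coords p0 F20 rmorph0.
have ez1 i : gev (gm (0 : 'cV[C]_n) (fun w => id w i 0)) = 0.
  by rewrite (rep_p (coords_rep hT1 i)) mxE.
have ez2 i : gev (gm (0 : 'cV[C]_n) (fun w => T w i 0)) = 0.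
  by rewrite (rep_p (coords_rep hT2 i)) /T /transition p0 c20 mxE.
have G12 : @pmetric R n 0 f1 = @pmetric R n 0 f2.
  apply/matrixP => k l; apply: (rep_eq (rep_pmetric sf1 k l)).
  apply: rep_ext (rep_pmetric sf2 k l); apply: nearS (open_near oS S0) => w [cw [[[w1 w2] wV] _]].
  have E : ddbar f1 w = ddbar f2 w.
    exact: etrans (esym (gF1 c1 h1 w (conj cw w1))) (etrans (g12 c1 h1 w (conj cw wV)) (gF2 c1 h1 w (conj cw w2))).
  by rewrite E.
have Z1 : Zmx (fun i => gm (0 : 'cV[C]_n) (fun w => id w i 0)) = 1%:M.
  apply/matrixP => k i; rewrite [LHS]mxE [RHS]mxE eq_sym -(dz_coord k i 0).
  exact: rep_p (rep_dz k (coords_rep hT1 i)).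
have GE2 k l : @pmetric R n 0 f1 k l = @del R n (germ_dring 0) k (@delb R n (germ_dring 0) l (gm 0 f2)).
  by rewrite G12; exact: pmetricE.
have [/funext -> /funext -> ->] := represented_unique n0 (potential_real sf1 fr1) (potential_real sf2 fr2)
  (coords_delb hT1) (coords_delb hT2) (pmetricE f1) GE2 (equation_null sf1 hT1 e1) (equation_null sf2 hT2 e2)
  ef1 ef2 ez1 ez2 Z1 nx1 nx2.
by [].
Qed.
End Potentials.

Theorem theorem1 (R : realType) (n : nat) (hn : (2 <= n)%N)
    (M : complexManifold R n) (p : M) :
  (forall F : M -> R, smooth_near p F ->
     (bochner_kahler_potential_near p F <->
      exists (h : M -> R) (A : 'M[Cplx R]_(1 + (n + 1))),
        [/\ pluriharmonic_near p h, is_normal A &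
            represents p A (fun q => F q - h q)])) /\
  (forall (U1 U2 : set M) (g1 g2 : metric_field M) (F1 F2 : M -> R)
          (A1 A2 : 'M[Cplx R]_(1 + (n + 1))),
     open_nbhs p U1 -> bochner_kahler U1 g1 -> kahler_potential U1 g1 F1 ->
     open_nbhs p U2 -> bochner_kahler U2 g2 -> kahler_potential U2 g2 F2 ->
     is_normal A1 -> represents p A1 F1 ->
     is_normal A2 -> represents p A2 F2 ->
     same_germ p g1 g2 -> A1 = A2).
Proof.
split=> [F sF|U1 U2 g1 g2 F1 F2 A1 A2 oU1 _ k1 oU2 _ k2]; last exact: represents_unique (ltnW hn) oU1 k1 oU2 k2.
split=> [|[h [A [hh hA hr]]]]; first exact: potential_represents.
exact: represents_potential sF hh hA hr.
Qed.
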